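(* Let $0<T\le\infty$ and let $L=(L_t)_{0\le t\le T}$ be a real-valued Lévy process with local characteristics $(b,c,\lambda)$ that satisfies Assumption (EM) with constant $M>1$ and is not a compound Poisson process. Let $\alpha^*(M)=\max\{\overline\alpha(M),\underline\alpha(M)\}$. Then the Laplace transforms of $\overline L_t$ and $\underline L_t$ at a fixed time $t\in[0,T]$ are given by $$E\big[e^{-\beta\overline L_t}\big]=\lim_{A\to\infty}\frac1{2\pi}\int_{-A}^{A}\frac{e^{t(Y+iv)}}{Y+iv}\,\frac{\overline\kappa(Y+iv,0)}{\overline\kappa(Y+iv,\beta)}\,dv$$ and $$E\big[e^{\beta\underline L_t}\big]=\lim_{A\to\infty}\frac1{2\pi}\int_{-A}^{A}\frac{e^{t(\widetilde Y+iv)}}{\widetilde Y+iv}\,\frac{\underline\kappa(\widetilde Y+iv,0)}{\underline\kappa(\widetilde Y+iv,\beta)}\,dv,$$ for $\beta\in\mathbb C$ with $\operatorname{Re}\beta\in(-M,\infty)$ and real $Y,\widetilde Y>\alpha^*(M)$.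
   Context: Lévy process: càdlàg with independent and stationary increments, $L_0=0$ a.s. (if $T=\infty$, the time index $t$ ranges over finite times). Assumption (EM): there is a constant $M>1$ such that $\int_{\{|x|>1\}}e^{ux}\lambda(dx)<\infty$ for all $u\in[-M,M]$, where $\lambda$ is the Lévy measure of $L$. Under (EM) no truncation function is needed, and $(b,c,\lambda)$ is normalized by $E[e^{iuL_t}]=\exp(t\kappa(iu))$ for $u\in\mathbb R$, with $\kappa(u)=ub+\frac{u^2}{2}c+\int_{\mathbb R}(e^{ux}-1-ux)\lambda(dx)$. Define $$\overline\alpha(M)=M|b|+\tfrac12cM^2+\int_{\mathbb R}|e^{Mx}-1-Mx|\lambda(dx),\quad \underline\alpha(M)=M|b|+\tfrac12cM^2+\int_{\mathbb R}|e^{-Mx}-1+Mx|\lambda(dx).$$ $\overline L_t=\sup_{0\le s\le t}L_s$ and $\underline L_t=\inf_{0\le s\le t}L_s$. $P_{L_t}$ denotes the law of $L_t$, i.e. the law with characteristic function $u\mapsto\exp(t\kappa(iu))$; in this sense it is defined for every $t>0$, also when $T<\infty$ and $t>T$. ''Compound Poisson process'' is meant in the usual sense: a pure-jump process of finite activity without drift and without Gaussian part. $\overline\kappa$ and $\underline\kappa$ are the (analytically extended) Laplace exponents of the ascending and descending ladder processes of $L$, given for $\alpha,\beta\in\mathbb C$ with $\operatorname{Re}\alpha>\alpha^*(M)$ and $\operatorname{Re}\beta>-M$ by $$\overline\kappa(\alpha,\beta)=\overline k\exp\Big(\int_0^\infty\int_{(0,\infty)}\big(e^{-t}-e^{-\alpha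 t-\beta x}\big)\frac1t\,P_{L_t}(dx)\,dt\Big),$$ $$\underline\kappa(\alpha,\beta)=\underline k\exp\Big(\int_0^\infty\int_{(-\infty,0)}\big(e^{-t}-e^{-\alpha t+\beta x}\big)\frac1t\,P_{L_t}(dx)\,dt\Big),$$ where $\overline k,\underline k>0$ are constants (which cancel in the ratios above).
   Formalization: The time t = 0 is excluded (0 < t ≤ T, t finite): at t = 0 the printed formulas fail, e.g. for β = 0 the left side is 1 while the limit of the integral is 1/2. *)

(* Defs.v *)
From HB Require Import structures.
From mathcomp Require Import all_boot all_order all_algebra.
From mathcomp Require Import all_classical all_reals all_analysis.
From mathcomp Require Export complex.

Set Implicit Arguments.
Unset Strict Implicit.
Unset Printing Implicit Defensive.

Import Order.TTheory GRing.Theory Num.Theory.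
Import numFieldNormedType.Exports.

Local Open Scope classical_set_scope.
Local Open Scope ring_scope.
Local Open Scope complex_scope.

Section complex_analysis.
Context {R : realType}.

Definition cexp (z : R[i]) : R[i] :=
  (expR (complex.Re z))%:C * (cos (complex.Im z) +i* sin (complex.Im z)).

Context {d : measure_display} {T : measurableType d}.

Definition cintegrable (mu : {measure set T -> \bar R}) (D : set T)
    (f : T -> R[i]) : Prop :=
  mu.-integrable D (fun x => (complex.Re (f x))%:E) /\
  mu.-integrable D (fun x => (complex.Im (f x))%:E).

Definition cintegral (mu : {measure set T -> \bar R}) (D : set T)
    (f : T -> R[i]) : R[i] :=
  (\int[mu]_(x in D) complex.Re (f x)) +i* (\int[mu]_(x in D) complex.Im (f x)).

End complex_analysis.

Section levy_process.
Context {R : realType} {d : measure_display} {Omega : measurableType d}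
  {P : probability Omega R}.
(* The time set is {t : R | 0 <= t <= T}, with T = +oo allowed. The values of
   L outside of the time set play no role. *)
Variables (T : \bar R) (L : R -> {RV P >-> R}).

Definition cadlag_paths : Prop := forall w : Omega,
  (forall t : R, 0 <= t -> (t%:E < T)%E ->
     (L s w : R) @[s --> t^'+] --> (L t w : R)) /\
  (forall t : R, 0 < t -> (t%:E <= T)%E ->
     cvg ((L s w : R) @[s --> t^'-])).

(* As the sets B i may be the whole line, the product rule for the full family
   of increments contains the one for its subfamilies. *)
Definition independent_increments : Prop :=
  forall (n : nat) (t : nat -> R) (B : nat -> set R),
    0 <= t 0%N -> (forall i, (i < n)%N -> t i <= t i.+1) ->
    ((t n)%:E <= T)%E -> (forall i, measurable (B i)) ->
    let E i := [set w | B i (L (t i.+1) w - L (t i) w)] in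
    P (\bigcap_(i in `I_n) E i) = (\prod_(i < n) P (E i))%E.

Definition stationary_increments : Prop :=
  forall (s h : R) (B : set R),
    0 <= s -> 0 <= h -> ((s + h)%:E <= T)%E -> measurable B ->
    P [set w | B (L (s + h) w - L s w)] = P [set w | B (L h w - L 0 w)].

Definition levy_process : Prop :=
  [/\ cadlag_paths, {ae P, forall w, L 0 w = 0},
      independent_increments & stationary_increments].

Definition running_sup (t : R) (w : Omega) : R :=
  sup [set (L s w : R) | s in `[0, t]].

Definition running_inf (t : R) (w : Omega) : R :=
  inf [set (L s w : R) | s in `[0, t]].

End levy_process.

Section characteristics.
Context {R : realType}.
Local Notation RR := (measurableTypeR R).

Definition levy_measure (lam : {measure set RR -> \bar R}) : Prop :=
  lam [set 0 : R] = 0%E /\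
  (\int[lam]_x (Num.min 1 (x ^+ 2))%:E < +oo)%E.

Definition exp_moments (M : R) (lam : {measure set RR -> \bar R}) : Prop :=
  forall u : R, -M <= u <= M ->
    (\int[lam]_(x in [set x : R | (1 < `|x|)%R]) (expR (u * x))%:E < +oo)%E.

Variables (b c : R) (lam : {measure set RR -> \bar R}).

Definition cumulant (z : R[i]) : R[i] :=
  z * b%:C + z ^+ 2 / 2 * c%:C +
  cintegral lam setT (fun x : R => cexp (z * x%:C) - 1 - z * x%:C).

Definition alpha_up (M : R) : R :=
  M * `|b| + 2^-1 * c * M ^+ 2 +
  \int[lam]_x `|expR (M * x) - 1 - M * x|.

Definition alpha_down (M : R) : R :=
  M * `|b| + 2^-1 * c * M ^+ 2 +
  \int[lam]_x `|expR (- (M * x)) - 1 + M * x|.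

Definition alpha_star (M : R) : R := Num.max (alpha_up M) (alpha_down M).

(* Without truncation function, b is the mean of L at time 1, so the drift of a
   process with finite jump activity is b minus the integral of x. *)
Definition compound_poisson : Prop :=
  [/\ c = 0, (lam setT < +oo)%E & b - \int[lam]_x (x : R) = 0].

Definition local_characteristics {d : measure_display} {Omega : measurableType d}
    {P : probability Omega R} (T : \bar R) (L : R -> {RV P >-> R}) : Prop :=
  [/\ 0 <= c, levy_measure lam &
      forall t u : R, 0 <= t -> (t%:E <= T)%E ->
        cintegral P setT (fun w => cexp (0 +i* (u * L t w))) =
        cexp (t%:C * cumulant (0 +i* u))].

Definition levy_laws (PL : R -> probability RR R) : Prop :=
  forall t u : R, 0 < t ->
    cintegral (PL t) setT (fun x : R => cexp (0 +i* (u * x))) =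
    cexp (t%:C * cumulant (0 +i* u)).

End characteristics.

Section ladder.
Context {R : realType}.
Local Notation RR := (measurableTypeR R).
Local Notation mu := (@lebesgue_measure R).
Variables (k : R) (PL : R -> probability RR R).

Definition ladder_up (alpha beta : R[i]) : R[i] :=
  k%:C * cexp (cintegral mu `]0, +oo[ (fun t : R =>
    cintegral (PL t) `]0, +oo[ (fun x : R =>
      (cexp (- t%:C) - cexp (- (alpha * t%:C) - beta * x%:C)) * (t^-1)%:C))).

Definition ladder_down (alpha beta : R[i]) : R[i] :=
  k%:C * cexp (cintegral mu `]0, +oo[ (fun t : R =>
    cintegral (PL t) `]-oo, 0[ (fun x : R =>
      (cexp (- t%:C) - cexp (- (alpha * t%:C) + beta * x%:C)) * (t^-1)%:C))).

End ladder.

Definition inversion_integral {R : realType} (kap : R[i] -> R[i] -> R[i])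
    (t : R) (beta : R[i]) (Y A : R) : R[i] :=
  ((2 * pi)^-1)%:C *
  cintegral (@lebesgue_measure R) `[- A, A] (fun v : R =>
    let z := Y +i* v in
    cexp (t%:C * z) / z * (kap z 0 / kap z beta)).

(* Main.v *)
(** For a step [h = t / n], let [m_n] be [E exp(- beta max(L_0, L_h, ..., L_nh))]
    and [a s = E exp(- beta L_s^+)]. Spitzer's identity
    [n m_n = sum_(1 <= k <= n) a(k h) m_(n - k)] says that
    [sum m_n x^n = (1 - x)^-1 exp(sum_k (a(k h) - 1) x^k / k)], and reading off the
    coefficient [m_n] at [x = exp(- z h)], [Re z = Y], gives an integral over
    [[- pi / h, pi / h]]. As [h -> 0], the sums tend to [int_0^oo e^(- z s) (a s - 1) / s ds],
    the logarithm of the ratio of ladder exponents, and [(1 - x)^-1] to [1 / z] up to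
    the factor [h]; Parseval's identity controls the integral for large [Im z], so
    that the limit is the inversion integral. The maxima over dyadic grids increase to
    the running supremum of a cadlag path, and the infimum is obtained by reflection.

    The bound on [a s - 1] needed for this rests on [E exp(+- M L_s) <= exp(s alpha_star)].
    Instead of continuing the characteristic function analytically, the law is smoothed
    by a Gaussian and its characteristic function approximated by those of compound
    Poisson sums, along which positivity of the density and the bound on the moment persist. *)
Require Import Defs.
From HB Require Import structures.
From mathcomp Require Import all_boot all_order all_algebra.
From mathcomp Require Import all_classical all_reals all_analysis.
From mathcomp Require Import measurable_realfun complex ring lra.

Set Implicit Arguments.
Unset Strict Implicit.
Unset Printing Implicit Defensive.

Import Order.TTheory GRing.Theory Num.Theory.
Import numFieldNormedType.Exports.

Local Open Scope classical_set_scope.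
Local Open Scope ring_scope.
Local Open Scope complex_scope.

(** The transform of the maxima decays only like [1 / |z|], so [m_n] cannot be read off under a
    dominated limit. What is read off is [n m_n], a coefficient of the product of [sum a(k h) x^k]
    and [sum m_k x^k]: the second factor is at most a constant over [|z|], the first is bounded in
    mean square, and the product has uniformly small tails. Its limit is [t K + i K'] for the
    integrand [K] of the inversion formula, so the fundamental theorem of calculus returns the
    integral of [K] up to boundary terms of order [1 / A]. Series are truncated to polynomials, and
    two exponents [Y' < Y] pay for it: majorants are summed at radius [exp(- Y' h)] and used on the
    smaller circle of radius [exp(- Y h)], so that cutting at degree [N] costs
    [exp(- (Y - Y') N h)], which beats even a factor [N]. For small [s] the decisive fact is that
    [a s - 1] is of order [sqrt s], which makes [(a s - 1) / s] integrable. It comes from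
    [E (exp(M L_s) + exp(- M L_s) - 2) = O(s)], where both signs of the exponential moment enter. *)

Notation normc := ComplexField.Normc.normc.
Notation Re := (@complex.Re _).
Notation Im := (@complex.Im _).

(** * The complex exponential *)

Section modulus.
Context {R : realType}.
Implicit Types z w : R[i].

Lemma normrcE z : `|z| = (normc z)%:C.
Proof. by rewrite normc_def; case: z. Qed.

Lemma normc_ge0 z : 0 <= normc z.
Proof. by case: z => a b; exact: sqrtr_ge0. Qed.

Lemma normcE2 z : normc z ^+ 2 = Re z ^+ 2 + Im z ^+ 2.
Proof. by case: z => a b /=; rewrite sqr_sqrtr// addr_ge0// sqr_ge0. Qed.

Lemma ReD z w : Re (z + w) = Re z + Re w. Proof. by case: z; case: w. Qed.
Lemma ImD z w : Im (z + w) = Im z + Im w. Proof. by case: z; case: w. Qed.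
Lemma ReN z : Re (- z) = - Re z. Proof. by case: z. Qed.
Lemma ImN z : Im (- z) = - Im z. Proof. by case: z. Qed.
Lemma ReB z w : Re (z - w) = Re z - Re w. Proof. by rewrite ReD ReN. Qed.
Lemma ImB z w : Im (z - w) = Im z - Im w. Proof. by rewrite ImD ImN. Qed.
Lemma ReM z w : Re (z * w) = Re z * Re w - Im z * Im w.
Proof. by case: z; case: w. Qed.
Lemma ImM z w : Im (z * w) = Re z * Im w + Im z * Re w.
Proof. by case: z; case: w. Qed.
Lemma Re_sum (I : Type) (r : seq I) (Q : pred I) (F : I -> R[i]) :
  Re (\sum_(i <- r | Q i) F i) = \sum_(i <- r | Q i) Re (F i).
Proof. by apply: (big_morph (@complex.Re R)); [exact: ReD|]. Qed.
Lemma complexP z w : Re z = Re w -> Im z = Im w -> z = w.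
Proof. by case: z; case: w => /= ? ? ? ? -> ->. Qed.

Lemma normcX z n : normc (z ^+ n) = normc z ^+ n.
Proof.
elim: n => [|n IH]; first by rewrite !expr0 ComplexField.Normc.normc1.
by rewrite !exprS ComplexField.Normc.normcM IH.
Qed.

Lemma normcR (x : R) : normc x%:C = `|x|.
Proof. by rewrite /= expr0n addr0 sqrtr_sqr. Qed.

Lemma normc_Re z : `|Re z| <= normc z.
Proof.
by rewrite -(@ler_pXn2r _ 2) ?nnegrE ?normc_ge0// normcE2 real_normK ?num_real// lerDl sqr_ge0.
Qed.

Lemma normc_Im z : `|Im z| <= normc z.
Proof.
by rewrite -(@ler_pXn2r _ 2) ?nnegrE ?normc_ge0// normcE2 real_normK ?num_real// lerDr sqr_ge0.
Qed.

Lemma normcD z w : normc (z + w) <= normc z + normc w.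
Proof. exact: (@le_normcD R). Qed.

Lemma normcN z : normc (- z) = normc z.
Proof. exact: (@complex.normcN R). Qed.

Lemma normcB z w : normc (z - w) <= normc z + normc w.
Proof. by rewrite -[in leRHS](normcN w) normcD. Qed.

Lemma normc_distrC z w : normc (z - w) = normc (w - z).
Proof. by rewrite -normcN opprB. Qed.

Lemma normcM z w : normc (z * w) = normc z * normc w.
Proof. exact: ComplexField.Normc.normcM. Qed.

Lemma normcV z : normc z^-1 = (normc z)^-1.
Proof. exact: ComplexField.Normc.normcV. Qed.

Lemma normc0 : normc (0 : R[i]) = 0.
Proof. exact: ComplexField.Normc.normc0. Qed.

Lemma normc1 : normc (1 : R[i]) = 1.
Proof. exact: ComplexField.Normc.normc1. Qed.

Lemma normc_gt0 z : z != 0 -> 0 < normc z.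
Proof.
move=> z0; rewrite lt_neqAle normc_ge0 andbT eq_sym; apply: contra z0.
by move/eqP/ComplexField.Normc.eq0_normc => ->.
Qed.

Lemma normc_sum (I : Type) (r : seq I) (Q : pred I) (F : I -> R[i]) :
  normc (\sum_(i <- r | Q i) F i) <= \sum_(i <- r | Q i) normc (F i).
Proof.
elim/big_ind2 : _ => [|z x w y zx wy|//]; first by rewrite normc0.
by rewrite (le_trans (normcD _ _))// lerD.
Qed.

Lemma normc_le_ReIm z : normc z <= `|Re z| + `|Im z|.
Proof.
rewrite -(@ler_pXn2r _ 2) ?nnegrE ?normc_ge0 ?addr_ge0// normcE2 sqrrD.
rewrite !real_normK ?num_real// addrAC lerDl.
by rewrite mulrn_wge0 ?mulr_ge0.
Qed.

End modulus.

Section cexp.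
Context {R : realType}.
Implicit Types z w : R[i].

Lemma Re_cexp z : Re (cexp z) = expR (Re z) * cos (Im z).
Proof. by rewrite /cexp ReM /= mul0r subr0. Qed.

Lemma Im_cexp z : Im (cexp z) = expR (Re z) * sin (Im z).
Proof. by rewrite /cexp ImM /= mul0r addr0. Qed.

Lemma cexpE_polar z : cexp z = (expR (Re z))%:C * cexp (0 +i* Im z).
Proof. by rewrite /cexp /= expR0 mul1r. Qed.

Lemma cexp0 : cexp (0 : R[i]) = 1.
Proof. by rewrite /cexp /= expR0 cos0 sin0 mul1r. Qed.

Lemma cexpR (x : R) : cexp x%:C = (expR x)%:C.
Proof. by rewrite /cexp /= cos0 sin0 mulr1. Qed.

Lemma cexpD z w : cexp (z + w) = cexp z * cexp w.
Proof.
apply: complexP.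
  rewrite (ReM (cexp z)) !Re_cexp !Im_cexp ReD ImD expRD cosD; ring.
rewrite (ImM (cexp z)) !Re_cexp !Im_cexp ReD ImD expRD sinD; ring.
Qed.

Lemma cexpNR (x : R) : cexp (- x%:C) = (expR (- x))%:C.
Proof. by rewrite -rmorphN cexpR. Qed.

Lemma normc_cexp z : normc (cexp z) = expR (Re z).
Proof.
apply/eqP; rewrite -(@eqrXn2 _ 2) ?expR_ge0 ?normc_ge0//; apply/eqP.
by rewrite normcE2 Re_cexp Im_cexp !exprMn -mulrDr cos2Dsin2 mulr1.
Qed.

Lemma cexpN z : cexp (- z) = (cexp z)^-1.
Proof.
have h : cexp (- z) * cexp z = 1 by rewrite -cexpD addNr cexp0.
have u : cexp z != 0.
  by apply/eqP => e; move: h; rewrite e mulr0 => /eqP; rewrite eq_sym oner_eq0.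
by apply: (mulIf u); rewrite h mulVf.
Qed.

Lemma cexpB z w : cexp (z - w) = cexp z / cexp w.
Proof. by rewrite cexpD cexpN. Qed.

Lemma cexpMn z n : cexp (z *+ n) = cexp z ^+ n.
Proof.
elim: n => [|n IH]; first by rewrite mulr0n cexp0 expr0.
by rewrite mulrS cexpD IH exprS.
Qed.

End cexp.

(** * Elementary inequalities for the real exponential, sine and cosine *)

Section real_estimates.
Context {R : realType}.
Implicit Types x y : R.

(** The mean value theorem in the form used for the Taylor bounds below: the derivative of each
    remainder is controlled by the preceding bound, starting from [cos x <= 1]. *)
Lemma derive_ge0_le (f df : R -> R) (a b : R) : a <= b ->
  (forall x, a <= x <= b -> is_derive x 1 f (df x)) ->
  (forall x, a <= x <= b -> 0 <= df x) -> f a <= f b.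
Proof.
rewrite le_eqVlt => /predU1P[->//|ab] dfx dfge0.
have [c cab e] : exists2 c, c \in `]a, b[%R & f b - f a = df c * (b - a).
  apply: MVT => //.
    by move=> x /[!in_itv]/= /andP[ax xb]; apply: dfx; rewrite !ltW.
  apply: derivable_within_continuous => x /[!in_itv]/= xab.
  by have := dfx _ xab; case.
rewrite -subr_ge0 e mulr_ge0 ?subr_ge0 ?(ltW ab)//.
by apply: dfge0; move: cab; rewrite in_itv/= => /andP[ac cb]; rewrite !ltW.
Qed.

Lemma sin_le x : 0 <= x -> sin x <= x.
Proof.
move=> x0; rewrite -subr_ge0.
have := @derive_ge0_le (fun x => x - sin x) (fun x => 1 - cos x) _ _ x0.
rewrite sin0 subr0; apply.
by move=> y _; rewrite subr_ge0 cos_le1.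
Qed.

Lemma cos_ge x : 1 - x ^+ 2 / 2 <= cos x.
Proof.
wlog x0 : x / 0 <= x.
  move=> H; have [x0|/ltW x0] := leP 0 x; first exact: H.
  by have := H (- x); rewrite oppr_ge0 x0 sqrrN cosN; exact.
have := @derive_ge0_le (fun x => cos x + x ^+ 2 / 2) (fun x => x - sin x) _ _ x0.
rewrite cos0 expr0n/= mul0r addr0 -lerBlDr; apply.
  move=> y _; apply: is_derive_eq; rewrite /GRing.scale/=; lra.
by move=> y /andP[y0 _]; rewrite subr_ge0 sin_le.
Qed.

Lemma sin_ge x : 0 <= x -> x - x ^+ 3 / 6 <= sin x.
Proof.
move=> x0.
have := @derive_ge0_le (fun x => sin x + x ^+ 3 / 6) (fun x => cos x + x ^+ 2 / 2 - 1) _ _ x0.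
rewrite sin0 expr0n/= mul0r addr0 -subr_ge0 => H.
suff : 0 <= sin x + x ^+ 3 / 6 - x by lra.
have := @derive_ge0_le (fun x => sin x + x ^+ 3 / 6 - x) (fun x => cos x + x ^+ 2 / 2 - 1) _ _ x0.
rewrite sin0 expr0n/= mul0r addr0 subr0; apply.
  move=> y _; apply: is_derive_eq; rewrite /GRing.scale/=; lra.
move=> y _; have := cos_ge y; lra.
Qed.

Lemma norm_sin_le x : `|sin x| <= `|x|.
Proof.
wlog x0 : x / 0 <= x.
  move=> H; have [x0|/ltW x0] := leP 0 x; first exact: H.
  by have := H (- x); rewrite oppr_ge0 x0 sinN !normrN; exact.
rewrite (ger0_norm x0) ler_norml sin_le// andbT.
(* Up to [pi] the sine is nonnegative; beyond, [- x] lies below [- 1]. *)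
have [xp|xp] := leP x pi; first by rewrite (le_trans _ (sin_ge0_pi _)) ?oppr_le0 ?x0.
by have := sin_geN1 x; have := pi_ge2 R; lra.
Qed.

Lemma norm_sinB_le x : `|sin x - x| <= x ^+ 2.
Proof.
wlog x0 : x / 0 <= x.
  move=> H; have [x0|/ltW x0] := leP 0 x; first exact: H.
  by have := H (- x); rewrite oppr_ge0 x0 sinN -opprD normrN sqrrN; exact.
have h1 := sin_le x0; have h2 := sin_ge x0.
(* Below 2 the cubic remainder is dominated by [x ^+ 2]; above 2, [x - sin x <= x + 1 <= 2 * x]
   suffices. *)
have [x1|x1] := leP x 2.
  rewrite ler_norml; apply/andP; split; last by have := sqr_ge0 x; lra.
  have : x ^+ 3 <= 2 * x ^+ 2 by rewrite exprS ler_wpM2r ?sqr_ge0.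
  have := sqr_ge0 x; lra.
have h3 := sin_geN1 x; have h4 : 2 * x <= x ^+ 2 by rewrite expr2 ler_wpM2r// ltW.
by rewrite ler_norml; apply/andP; split; lra.
Qed.

Lemma expR_lin x : `|expR x - 1| <= `|x| * Num.max 1 (expR x).
Proof.
have [x0|x0] := leP 0 x.
  rewrite !ger0_norm ?subr_ge0 -?expR0 ?ler_expR//.
  rewrite expR0 max_r -?[X in X <= _]expR0 ?ler_expR//.
  have := expR_ge1Dx (- x); rewrite expRN => h.
  have e0 := expR_gt0 x; move: h; rewrite -(ler_pM2r e0) mulVf ?gt_eqF// mulrDl; lra.
rewrite !ltr0_norm ?subr_lt0 ?expR_lt1//.
have -> : Num.max 1 (expR x) = 1 by apply/max_idPl; rewrite expR_le1 ltW.
by rewrite mulr1; have := expR_ge1Dx x; lra.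
Qed.

Lemma expR_quad x : `|x| <= 1 -> `|expR x - 1 - x| <= 3 * x ^+ 2.
Proof.
move=> x1.
have h1 := expR_ge1Dx x.
rewrite ger0_norm; last by lra.
have e1 : expR (1 : R) <= 3.
  (* The bound [exp 1 <= 3] follows from [exp (- 1/8) >= 7/8], since the eighth power of [8/7] is
     below 3. *)
  have h8 : expR (8^-1 : R) <= 8/7.
    have := expR_ge1Dx (- 8^-1 : R); rewrite expRN => h.
    have e0 := expR_gt0 (8^-1:R); move: h; rewrite -(ler_pM2r e0) mulVf ?gt_eqF//; lra.
  have e : (1 : R) = 8%:R * 8^-1 by rewrite divff.
  rewrite e expRM_natl.
  have h' : expR (8^-1 : R) ^+ 8 <= (8/7) ^+ 8 by rewrite lerXn2r ?nnegrE ?expR_ge0//; lra.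
  apply: (le_trans h'); lra.
have e3 : expR x <= 3.
  by apply: le_trans e1; rewrite ler_expR; exact: le_trans (ler_norm _) x1.
rewrite -subr_ge0.
have [x0'|x0'] := leP 0 x.
  have := @derive_ge0_le (fun x => 3 * x ^+ 2 - (expR x - 1 - x)) (fun x => 6 * x - (expR x - 1)) _ _ x0'.
  rewrite expr0n/= expR0 mulr0 subrr subrr subrr; apply.
    move=> y _; apply: is_derive_eq; rewrite /GRing.scale/=; lra.
  move=> y /andP[y0 yx].
  have y1 : `|y| <= 1 by rewrite ger0_norm// (le_trans yx)// (le_trans (ler_norm _) x1).
  have ey : expR y <= 3 by apply: le_trans e1; rewrite ler_expR; exact: le_trans (ler_norm _) y1.
  have := @expR_lin y; rewrite (ger0_norm y0) ger0_norm; last by rewrite subr_ge0 -expR0 ler_expR.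
  have m3 : Num.max 1 (expR y) <= 3 by rewrite ge_max ey andbT; lra.
  have := ler_wpM2l y0 m3; lra.
have := @derive_ge0_le (fun x => 3 * x ^+ 2 - (expR (- x) - 1 + x)) (fun x => 6 * x + expR (- x) - 1) 0 (- x).
rewrite expr0n/= oppr0 expR0 mulr0 subrr addr0 subr0 sqrrN opprK; apply.
- by rewrite oppr_ge0 ltW.
- move=> y _; apply: is_derive_eq; rewrite /GRing.scale/=; lra.
- move=> y /andP[y0 _]; have := expR_ge1Dx (- y); lra.
Qed.

End real_estimates.

Section cexp_estimates.
Context {R : realType}.
Implicit Types z w : R[i].

Lemma normc_expi_sub1 (y : R) : normc (cexp (0 +i* y) - 1) <= 2 * `|y|.
Proof.
apply: le_trans (normc_le_ReIm _) _.
rewrite ReB ImB Re_cexp Im_cexp /= expR0 !mul1r subr0.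
have h1 := norm_sin_le y.
suff : `|cos y - 1| <= `|y| by lra.
have h2 := cos_le1 y; have h3 := cos_ge y; have h4 := cos_geN1 y.
rewrite ler0_norm ?subr_le0// opprB.
have [y2|y2] := leP `|y| 2; last by lra.
have : `|y| * `|y| <= 2 * `|y| by rewrite ler_wpM2r.
have -> : `|y| * `|y| = y ^+ 2 by rewrite -expr2 real_normK ?num_real.
lra.
Qed.

Lemma normc_expi_quad (y : R) : normc (cexp (0 +i* y) - 1 - 0 +i* y) <= 2 * y ^+ 2.
Proof.
apply: le_trans (normc_le_ReIm _) _.
rewrite !ReB !ImB Re_cexp Im_cexp /= expR0 !mul1r !subr0.
have h1 := norm_sinB_le y.
have h2 := cos_le1 y; have h3 := cos_ge y.
rewrite ler0_norm ?subr_le0// opprB.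
have := sqr_ge0 y; lra.
Qed.

(** The angular deviation from 1 costs a factor 2 and the radial one a factor 1, whence the 3. *)
Lemma normc_cexp_sub1 z : normc (cexp z - 1) <= 3 * normc z * Num.max 1 (expR (Re z)).
Proof.
have -> : cexp z - 1 = (expR (Re z))%:C * (cexp (0 +i* Im z) - 1) + (expR (Re z) - 1)%:C.
  by rewrite cexpE_polar rmorphB/=; ring.
apply: le_trans (normcD _ _) _.
rewrite normcM normcR normcR (ger0_norm (expR_ge0 _)).
have h1 := normc_expi_sub1 (Im z); have h2 := expR_lin (Re z).
have h3 := normc_Re z; have h4 := normc_Im z.
set m := Num.max _ _ in h2 *.
have m0 : 0 <= m by rewrite le_max ler01.
have em : expR (Re z) <= m by rewrite le_max lexx orbT.
have : expR (Re z) * normc (cexp (0 +i* Im z) - 1) <= m * (2 * normc z).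
  by apply: ler_pM; rewrite ?expR_ge0 ?normc_ge0// (le_trans h1)// ler_pM2l.
have : `|Re z| * m <= normc z * m by rewrite ler_wpM2r.
lra.
Qed.

Lemma normc_cexp_quad z : normc z <= 1 -> normc (cexp z - 1 - z) <= 9 * normc z ^+ 2.
Proof.
move=> z1.
have h3 := normc_Re z; have h4 := normc_Im z.
have x1 : `|Re z| <= 1 by apply: le_trans z1.
(* The three terms cost 3, 4 and 1 times [normc z ^+ 2], which is within the 9 of the statement. *)
have -> : cexp z - 1 - z = (expR (Re z) - 1 - Re z)%:C * cexp (0 +i* Im z)
   + (1 + Re z)%:C * (cexp (0 +i* Im z) - 1 - 0 +i* Im z)
   + (0 +i* (Re z * Im z)).
  apply: complexP; rewrite !(ReD, ReM, ReN, ImD, ImM, ImN, Re_cexp, Im_cexp) /= expR0; ring.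
apply: le_trans (normcD _ _) _; apply: le_trans (lerD (normcD _ _) (lexx _)) _.
rewrite (normcM _ (cexp _)) normc_cexp expR0 mulr1 (normcM _ (_ - _)) !normcR.
have q1 := expR_quad x1; have q2 := normc_expi_quad (Im z).
have n0 : Re z ^+ 2 <= normc z ^+ 2 by rewrite normcE2 lerDl sqr_ge0.
have n1 : Im z ^+ 2 <= normc z ^+ 2 by rewrite normcE2 lerDr sqr_ge0.
have : `|1 + Re z| * normc (cexp (0 +i* Im z) - 1 - 0 +i* Im z) <= 2 * (2 * normc z ^+ 2).
  apply: ler_pM; rewrite ?normc_ge0//; last by lra.
  by rewrite (le_trans (ler_normD _ _))// normr1; lra.
have : normc (0 +i* (Re z * Im z)) <= normc z ^+ 2.
  by rewrite /= expr0n/= add0r sqrtr_sqr normrM expr2 ler_pM.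
move=> q3 q4; apply: le_trans (lerD (lerD q1 q4) q3) _.
by have := sqr_ge0 (normc z); move: (normc z ^+ 2) n0 => n n0; lra.
Qed.

End cexp_estimates.

(** * Derivatives of complex-valued functions of a real variable *)

Section cderive.
Context {R : realType}.

(** Only derivatives in a real parameter occur: a vertical line is parametrised by [v], a segment
    from 0 by a factor in [[0, 1]]. Holomorphy never enters. *)
Definition is_cderive (x : R) (f : R -> R[i]) (df : R[i]) : Prop :=
  is_derive x 1 (Re \o f) (Re df) /\ is_derive x 1 (Im \o f) (Im df).

Lemma is_cderive_eq x f df df' : is_cderive x f df -> df = df' -> is_cderive x f df'.
Proof. by move=> ? <-. Qed.

Lemma is_cderive_ext x f g df : f =1 g -> is_cderive x f df -> is_cderive x g df.
Proof. by move=> /funext <-. Qed.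

Lemma is_cderive_cst x z : is_cderive x (fun=> z) 0.
Proof. by split; exact: is_derive_cst. Qed.

Lemma is_cderiveD x f g df dg : is_cderive x f df -> is_cderive x g dg ->
  is_cderive x (fun y => f y + g y) (df + dg).
Proof.
move=> [f1 f2] [g1 g2]; split.
  rewrite ReD (_ : _ \o _ = (Re \o f) + (Re \o g)); first exact: is_deriveD.
  by apply/funext => y /=; rewrite ReD.
rewrite ImD (_ : _ \o _ = (Im \o f) + (Im \o g)); first exact: is_deriveD.
by apply/funext => y /=; rewrite ImD.
Qed.

Lemma is_cderiveM x f g df dg : is_cderive x f df -> is_cderive x g dg ->
  is_cderive x (fun y => f y * g y) (df * g x + f x * dg).
Proof.
move=> [f1 f2] [g1 g2]; split.
  rewrite (_ : _ \o _ = (Re \o f) * (Re \o g) - (Im \o f) * (Im \o g)); last first.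
    by apply/funext => y /=; rewrite ReM.
  apply: is_derive_eq; rewrite /GRing.scale/= ReD !ReM; ring.
rewrite (_ : _ \o _ = (Re \o f) * (Im \o g) + (Im \o f) * (Re \o g)); last first.
  by apply/funext => y /=; rewrite ImM.
apply: is_derive_eq; rewrite /GRing.scale/= ImD (ImM df (g x)) (ImM (f x) dg); ring.
Qed.

Lemma is_cderive_cexp x f df : is_cderive x f df ->
  is_cderive x (fun y => cexp (f y)) (df * cexp (f x)).
Proof.
move=> [f1 f2]; split.
  rewrite (_ : _ \o _ = (expR \o (Re \o f)) * (cos \o (Im \o f))); last first.
    by apply/funext => y; rewrite [LHS]Re_cexp.
  apply: is_derive_eq; rewrite /GRing.scale (ReM df) Re_cexp Im_cexp/=; ring.
rewrite (_ : _ \o _ = (expR \o (Re \o f)) * (sin \o (Im \o f))); last first.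
  by apply/funext => y; rewrite [LHS]Im_cexp.
apply: is_derive_eq; rewrite /GRing.scale (ImM df) Re_cexp Im_cexp/=; ring.
Qed.

Lemma is_cderive_real (x : R) (f : R -> R) (df : R) : is_derive x 1 f df ->
  is_cderive x (fun y => (f y)%:C) df%:C.
Proof.
move=> h; split => //=.
by rewrite (_ : _ \o _ = cst 0); [exact: is_derive_cst|exact/funext].
Qed.

(* The bound holds for the real and the imaginary part separately, whence the factor 2. *)
Lemma cmean_value (f : R -> R[i]) (df : R -> R[i]) (a b K : R) : a <= b ->
  (forall x, a <= x <= b -> is_cderive x f (df x)) ->
  (forall x, a <= x <= b -> normc (df x) <= K) ->
  normc (f b - f a) <= 2 * K * (b - a).
Proof.
move=> ab dfx dfK.
have mv (g dg : R -> R) : (forall x, a <= x <= b -> is_derive x 1 g (dg x)) ->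
    (forall x, a <= x <= b -> `|dg x| <= K) -> `|g b - g a| <= K * (b - a).
  move=> dgx dgK; rewrite ler_norml; apply/andP; split.
    rewrite -subr_ge0 opprK.
    have := @derive_ge0_le R (fun x => g x + K * x) (fun x => dg x + K) a b ab.
    rewrite -subr_ge0 => H.
    suff : 0 <= g b + K * b - (g a + K * a) by lra.
    apply: H => x xab.
      have := dgx _ xab => ?; apply: is_derive_eq; rewrite /GRing.scale/=; lra.
    by have := dgK _ xab; rewrite ler_norml => /andP[]; lra.
  rewrite -subr_ge0.
  have := @derive_ge0_le R (fun x => K * x - g x) (fun x => K - dg x) a b ab.
  rewrite -subr_ge0 => H.
  suff : 0 <= K * b - g b - (K * a - g a) by lra.
  apply: H => x xab.
    have := dgx _ xab => ?; apply: is_derive_eq; rewrite /GRing.scale/=; lra.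
  by have := dgK _ xab; rewrite ler_norml => /andP[]; lra.
apply: le_trans (normc_le_ReIm _) _; rewrite ReB ImB.
have h1 := mv (Re \o f) (Re \o df) (fun x xab => (dfx x xab).1)
  (fun x xab => le_trans (normc_Re _) (dfK x xab)).
have h2 := mv (Im \o f) (Im \o df) (fun x xab => (dfx x xab).2)
  (fun x xab => le_trans (normc_Im _) (dfK x xab)).
by rewrite /= in h1 h2; lra.
Qed.

End cderive.

(** * Complex-valued functions: measurability, convergence, integrals *)

Section cmeasurable.
Context {R : realType} {d : measure_display} {T : measurableType d}.
Implicit Types (D : set T) (f g : T -> R[i]).

Definition cmeasurable D f :=
  measurable_fun D (fun x => Re (f x)) /\ measurable_fun D (fun x => Im (f x)).

Lemma cmeasurable_cst D z : cmeasurable D (fun=> z).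
Proof. by split; exact: measurable_cst. Qed.

Lemma eq_cmeasurable D f g : {in D, f =1 g} -> cmeasurable D f -> cmeasurable D g.
Proof.
move=> fg [f1 f2]; split.
  by apply: eq_measurable_fun f1 => x xD /=; rewrite fg.
by apply: eq_measurable_fun f2 => x xD /=; rewrite fg.
Qed.

Lemma cmeasurableS D E f : measurable E -> D `<=` E -> cmeasurable E f -> cmeasurable D f.
Proof. by move=> mE DE [f1 f2]; split; apply: measurable_funS; eassumption. Qed.

Lemma cmeasurableTS D f : cmeasurable setT f -> cmeasurable D f.
Proof. by apply: cmeasurableS. Qed.

Lemma cmeasurableD D f g : cmeasurable D f -> cmeasurable D g ->
  cmeasurable D (fun x => f x + g x).
Proof.
move=> [f1 f2] [g1 g2]; split.
  by under eq_fun do rewrite ReD; exact: measurable_funD.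
by under eq_fun do rewrite ImD; exact: measurable_funD.
Qed.

Lemma cmeasurableM D f g : cmeasurable D f -> cmeasurable D g ->
  cmeasurable D (fun x => f x * g x).
Proof.
move=> [f1 f2] [g1 g2]; split.
  by under eq_fun do rewrite ReM; apply: measurable_funB; apply: measurable_funM.
by under eq_fun do rewrite ImM; apply: measurable_funD; apply: measurable_funM.
Qed.

Lemma cmeasurableN D f : cmeasurable D f -> cmeasurable D (fun x => - f x).
Proof.
move=> mf; have := cmeasurableM (cmeasurable_cst D (-1)) mf.
by apply: eq_cmeasurable => x _; rewrite mulN1r.
Qed.

Lemma cmeasurableB D f g : cmeasurable D f -> cmeasurable D g ->
  cmeasurable D (fun x => f x - g x).
Proof. by move=> mf mg; apply: cmeasurableD => //; exact: cmeasurableN. Qed.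

Lemma cmeasurable_real D (f : T -> R) : measurable_fun D f ->
  cmeasurable D (fun x => (f x)%:C).
Proof. by move=> mf; split => //=; exact: measurable_cst. Qed.

Lemma cmeasurable_cexp D f : cmeasurable D f -> cmeasurable D (fun x => cexp (f x)).
Proof.
move=> [f1 f2]; split.
  under eq_fun do rewrite Re_cexp; apply: measurable_funM.
    exact: measurableT_comp.
  by apply: measurableT_comp => //; apply: continuous_measurable_fun; exact: continuous_cos.
under eq_fun do rewrite Im_cexp; apply: measurable_funM.
  exact: measurableT_comp.
by apply: measurableT_comp => //; apply: continuous_measurable_fun; exact: continuous_sin.
Qed.

Lemma cmeasurable_sum D (n : nat) (f : nat -> T -> R[i]) :
  (forall i, cmeasurable D (f i)) -> cmeasurable D (fun x => \sum_(i < n) f i x).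
Proof.
move=> mf; elim: n => [|n IH].
  by apply: eq_cmeasurable (cmeasurable_cst D 0) => x _; rewrite big_ord0.
apply: eq_cmeasurable (cmeasurableD IH (mf n)) => x _.
by rewrite big_ord_recr.
Qed.

Lemma measurable_normc D f : cmeasurable D f -> measurable_fun D (fun x => normc (f x)).
Proof.
move=> [f1 f2].
have -> : (fun x => normc (f x)) = (fun x => Num.sqrt (Re (f x) ^+ 2 + Im (f x) ^+ 2)).
  by apply/funext => x; case: (f x).
apply: measurableT_comp; first by apply: continuous_measurable_fun; exact: sqrt_continuous.
by apply: measurable_funD; exact: measurable_funX.
Qed.

End cmeasurable.

Lemma cmeasurable_comp {R : realType} d1 d2 (T1 : measurableType d1) (T2 : measurableType d2)
    (f : T2 -> R[i]) (g : T1 -> T2) :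
  cmeasurable setT f -> measurable_fun setT g -> cmeasurable setT (fun x => f (g x)).
Proof.
by move=> [f1 f2] mg; split; [apply: (measurableT_comp f1)|apply: (measurableT_comp f2)].
Qed.

(** Convergence is measured by a real sequence, so that squeezing and limit theorems over [R] apply
    directly. *)
Definition ccvg {R : realType} (u : nat -> R[i]) (l : R[i]) : Prop :=
  normc (u n - l) @[n --> \oo] --> (0 : R).

Section ccvg.
Context {R : realType}.
Implicit Types (u v : nat -> R[i]) (l m : R[i]).

Lemma squeeze0 (u v : nat -> R) : (\forall n \near \oo, 0 <= u n <= v n) ->
  v @ \oo --> (0 : R) -> u @ \oo --> (0 : R).
Proof.
move=> uv v0; apply: (squeeze_cvgr _ (cvg_cst 0) v0).
by apply: filterS uv => n.
Qed.

Lemma ccvg_squeeze u l (v : nat -> R) : (\forall n \near \oo, normc (u n - l) <= v n) ->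
  v @ \oo --> (0 : R) -> ccvg u l.
Proof.
by move=> uv v0; apply: squeeze0 v0; apply: filterS uv => n ->; rewrite normc_ge0.
Qed.

Lemma ccvg_Re u l : ccvg u l -> Re (u n) @[n --> \oo] --> Re l.
Proof.
move=> ul; apply/cvgrPdist_le => e e0.
move/cvgrPdist_le : ul => /(_ e e0); apply: filterS => n.
rewrite sub0r normrN ger0_norm ?normc_ge0// => h.
by rewrite -ReB (le_trans (normc_Re _))// normc_distrC.
Qed.

Lemma ccvg_Im u l : ccvg u l -> Im (u n) @[n --> \oo] --> Im l.
Proof.
move=> ul; apply/cvgrPdist_le => e e0.
move/cvgrPdist_le : ul => /(_ e e0); apply: filterS => n.
rewrite sub0r normrN ger0_norm ?normc_ge0// => h.
by rewrite -ImB (le_trans (normc_Im _))// normc_distrC.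
Qed.

Lemma ccvg_cst l : ccvg (fun=> l) l.
Proof. by rewrite /ccvg; under eq_fun do rewrite subrr normc0; exact: cvg_cst. Qed.

Lemma ccvgD u v l m : ccvg u l -> ccvg v m -> ccvg (fun n => u n + v n) (l + m).
Proof.
move=> ul vm.
apply: (@ccvg_squeeze _ _ (fun n => normc (u n - l) + normc (v n - m))).
  by apply: nearW => n; rewrite opprD addrACA normcD.
by rewrite -[X in _ --> X]addr0; exact: cvgD.
Qed.

Lemma ccvgM u v l m : ccvg u l -> ccvg v m -> ccvg (fun n => u n * v n) (l * m).
Proof.
move=> ul vm.
apply: (@ccvg_squeeze _ _ (fun n => normc (u n - l) * normc (v n - m)
  + normc l * normc (v n - m) + normc m * normc (u n - l))).
  apply: nearW => n.
  have -> : u n * v n - l * m = (u n - l) * (v n - m) + l * (v n - m) + m * (u n - l) by ring.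
  by rewrite (le_trans (normcD _ _))// (le_trans (lerD (normcD _ _) (lexx _)))// !normcM.
have -> : (0 : R) = 0 * 0 + normc l * 0 + normc m * 0 by rewrite !mulr0 !addr0.
by apply: cvgD; [apply: cvgD; apply: cvgM => //; exact: cvg_cst|apply: cvgM => //; exact: cvg_cst].
Qed.

Lemma ccvgN u l : ccvg u l -> ccvg (fun n => - u n) (- l).
Proof. by rewrite /ccvg => h; under eq_fun do rewrite -opprD normcN. Qed.

Lemma ccvgB u v l m : ccvg u l -> ccvg v m -> ccvg (fun n => u n - v n) (l - m).
Proof. by move=> ul vm; apply: ccvgD => //; exact: ccvgN. Qed.

Lemma ccvg_cexp u l : ccvg u l -> ccvg (fun n => cexp (u n)) (cexp l).
Proof.
move=> ul.
apply: (@ccvg_squeeze _ _ (fun n => expR (Re l) * (3 * normc (u n - l) * expR 1))); last first.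
  have -> : (0 : R) = expR (Re l) * (3 * 0 * expR 1) by rewrite mulr0 mul0r mulr0.
  apply: cvgM; first exact: cvg_cst.
  by apply: cvgM; [apply: cvgM => //; exact: cvg_cst|exact: cvg_cst].
have := ul => /cvgrPdist_le/(_ 1 ltr01); apply: filterS => n.
rewrite sub0r normrN ger0_norm ?normc_ge0// => h.
have -> : cexp (u n) - cexp l = cexp l * (cexp (u n - l) - 1).
  by rewrite mulrBr mulr1 -cexpD (addrC l) subrK.
rewrite (normcM (cexp l)) normc_cexp ler_wpM2l ?expR_ge0//.
apply: le_trans (normc_cexp_sub1 _) _; rewrite ler_wpM2l//.
  by rewrite mulr_ge0 ?normc_ge0.
rewrite ge_max -{1}expR0 !ler_expR ler01/=.
by rewrite (le_trans (ler_norm _))// (le_trans (normc_Re _)).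
Qed.

Lemma ccvg_unique u l m : ccvg u l -> ccvg u m -> l = m.
Proof.
move=> ul um; apply: complexP.
  by rewrite -(cvg_lim _ (ccvg_Re ul))// -(cvg_lim _ (ccvg_Re um)).
by rewrite -(cvg_lim _ (ccvg_Im ul))// -(cvg_lim _ (ccvg_Im um)).
Qed.

Lemma ccvg_eq u v l : (\forall n \near \oo, u n = v n) -> ccvg u l -> ccvg v l.
Proof.
move=> uv ul; apply: (ccvg_squeeze _ ul).
by apply: filterS uv => n ->.
Qed.

Lemma ccvg_le u l (v : nat -> R) (K : R) : ccvg u l -> v @ \oo --> K ->
  (\forall n \near \oo, normc (u n) <= v n) -> normc l <= K.
Proof.
move=> ul vK uv.
have h : normc (u n - l) + v n @[n --> \oo] --> K.
  by rewrite -[X in _ --> X]add0r; exact: cvgD.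
apply: (ler_cvg_to (cvg_cst (normc l)) h).
apply: filterS uv => n h'; rewrite -[in X in X <= _](subKr (u n) l).
by rewrite (le_trans (normcB _ _))// addrC lerD2l.
Qed.

End ccvg.

Section cintegral.
Context {R : realType} {d : measure_display} {T : measurableType d}.
Variables (mu : {measure set T -> \bar R}) (D : set T).
Hypothesis mD : measurable D.
Implicit Types (f g : T -> R[i]).

Lemma cintegrable_cmeasurable f : cintegrable mu D f -> cmeasurable D f.
Proof.
by move=> [/measurable_int/measurable_EFinP h1 /measurable_int/measurable_EFinP h2]; split.
Qed.

Lemma cintegrable_dom f (g : T -> R) : cmeasurable D f ->
  mu.-integrable D (EFin \o g) -> (forall x, D x -> normc (f x) <= g x) ->
  cintegrable mu D f.
Proof.
move=> [f1 f2] ig fg; split; apply: le_integrable ig => //;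
  try exact/measurable_EFinP; move=> x Dx; rewrite /= lee_fin;
  rewrite (le_trans _ (ler_norm _))// (le_trans _ (fg _ Dx))//.
  exact: normc_Re.
exact: normc_Im.
Qed.

Lemma eq_cintegrable f g : {in D, f =1 g} -> cintegrable mu D f -> cintegrable mu D g.
Proof.
move=> fg [f1 f2]; split.
  by apply: eq_integrable f1 => // x xD; rewrite fg.
by apply: eq_integrable f2 => // x xD; rewrite fg.
Qed.

Lemma cintegrable_normc f : cintegrable mu D f ->
  mu.-integrable D (EFin \o (fun x => normc (f x))).
Proof.
move=> fi; have [f1 f2] := fi.
have := integrableD mD (integrable_abse f1) (integrable_abse f2).
apply: le_integrable => //.
  exact/measurable_EFinP/measurable_normc/cintegrable_cmeasurable.
move=> x Dx /=; rewrite lee_fin ger0_norm ?normc_ge0//.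
by rewrite (le_trans (normc_le_ReIm _))// ler_norm.
Qed.

Lemma cintegrable_real (f : T -> R) : mu.-integrable D (EFin \o f) ->
  cintegrable mu D (fun x => (f x)%:C).
Proof. by move=> fi; split => //=; exact: integrable0. Qed.

Lemma cintegrableD f g : cintegrable mu D f -> cintegrable mu D g ->
  cintegrable mu D (fun x => f x + g x).
Proof.
move=> [f1 f2] [g1 g2]; split.
  by under eq_fun do rewrite ReD EFinD; exact: integrableD.
by under eq_fun do rewrite ImD EFinD; exact: integrableD.
Qed.

Lemma cintegrableMl z f : cintegrable mu D f -> cintegrable mu D (fun x => z * f x).
Proof.
move=> [f1 f2]; split.
  under eq_fun do rewrite ReM EFinB 2!EFinM.
  by apply: integrableB => //; exact: integrableZl.
under eq_fun do rewrite ImM EFinD 2!EFinM.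
by apply: integrableD => //; exact: integrableZl.
Qed.

Lemma cintegrableN f : cintegrable mu D f -> cintegrable mu D (fun x => - f x).
Proof.
by move/(cintegrableMl (-1)); apply: eq_cintegrable => x _; rewrite mulN1r.
Qed.

Lemma cintegrableB f g : cintegrable mu D f -> cintegrable mu D g ->
  cintegrable mu D (fun x => f x - g x).
Proof. by move=> fi gi; apply: cintegrableD => //; exact: cintegrableN. Qed.

Lemma eq_cintegral f g : {in D, f =1 g} -> cintegral mu D f = cintegral mu D g.
Proof.
by move=> fg; apply: complexP; apply: eq_Rintegral => x xD; rewrite fg.
Qed.

Lemma cintegralD f g : cintegrable mu D f -> cintegrable mu D g ->
  cintegral mu D (fun x => f x + g x) = cintegral mu D f + cintegral mu D g.
Proof.
move=> [f1 f2] [g1 g2]; apply: complexP => /=; rewrite -RintegralD//;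
  by apply: eq_Rintegral => x _; rewrite (ReD, ImD).
Qed.

Lemma cintegralMl z f : cintegrable mu D f ->
  cintegral mu D (fun x => z * f x) = z * cintegral mu D f.
Proof.
move=> [f1 f2]; case: z => a b; apply: complexP => /=.
  rewrite -!RintegralZl// -RintegralB//;
    [|exact: (integrableZl mD a f1)|exact: (integrableZl mD b f2)].
  by apply: eq_Rintegral => x _; rewrite ReM.
rewrite -[X in X + _]RintegralZl// -[X in _ + X]RintegralZl// -RintegralD//;
  [|exact: (integrableZl mD a f2)|exact: (integrableZl mD b f1)].
by apply: eq_Rintegral => x _; rewrite ImM.
Qed.

Lemma cintegralN f : cintegrable mu D f ->
  cintegral mu D (fun x => - f x) = - cintegral mu D f.
Proof.
move=> fi; rewrite -mulN1r -cintegralMl//; apply: eq_cintegral => x _.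
by rewrite mulN1r.
Qed.

Lemma cintegralB f g : cintegrable mu D f -> cintegrable mu D g ->
  cintegral mu D (fun x => f x - g x) = cintegral mu D f - cintegral mu D g.
Proof. by move=> fi gi; rewrite cintegralD ?cintegralN//; exact: cintegrableN. Qed.

Lemma cintegral_real (f : T -> R) :
  cintegral mu D (fun x => (f x)%:C) = (\int[mu]_(x in D) f x)%:C.
Proof. by apply: complexP => //=; rewrite /Rintegral integral0. Qed.

(** Real and imaginary part are estimated separately, which costs the factor 2;
    [normc_cintegral_le_int] removes it where the constant matters. *)
Lemma normc_cintegral_le f (g : T -> R) : cmeasurable D f ->
  mu.-integrable D (EFin \o g) -> (forall x, D x -> normc (f x) <= g x) ->
  normc (cintegral mu D f) <= 2 * \int[mu]_(x in D) g x.
Proof.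
move=> mf ig fg; have [f1 f2] := cintegrable_dom mf ig fg.
apply: le_trans (normc_le_ReIm _) _; rewrite mulrDl !mul1r.
apply: lerD => /=; apply: le_trans (le_normr_Rintegral _ _) _ => //;
  apply: le_Rintegral => //; try exact: integrable_norm.
  by move=> x Dx; apply: le_trans (fg _ Dx); exact: normc_Re.
by move=> x Dx; apply: le_trans (fg _ Dx); exact: normc_Im.
Qed.

(** Integrability of the limit is part of the conclusion, and its measurability is derived from that
    of the sequence, so that limits defined by a formula need no separate treatment. *)
Lemma cdominated (f_ : nat -> T -> R[i]) f (g : T -> R) :
  (forall n, cmeasurable D (f_ n)) ->
  (forall x, D x -> ccvg (f_ ^~ x) (f x)) ->
  mu.-integrable D (EFin \o g) ->
  (forall n x, D x -> normc (f_ n x) <= g x) ->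
  cintegrable mu D f /\ ccvg (fun n => cintegral mu D (f_ n)) (cintegral mu D f).
Proof.
move=> mf_ f_f ig f_g.
have key (p : R[i] -> R) : (forall z w, p (z - w) = p z - p w) ->
    (forall z, `|p z| <= normc z) ->
    (forall n, measurable_fun D (fun x => p (f_ n x))) ->
    (forall u l, ccvg u l -> p (u n) @[n --> \oo] --> p l) ->
    mu.-integrable D (fun x => (p (f x))%:E) /\
    \int[mu]_(x in D) p (f_ n x) @[n --> \oo] --> \int[mu]_(x in D) p (f x).
  move=> pB pn pm pc.
  have cv x : D x -> p (f_ n x) @[n --> \oo] --> p (f x) by move=> /f_f/pc.
  have mp : measurable_fun D (fun x => p (f x)) by apply: measurable_fun_cvg pm cv.
  have := @dominated_convergence _ T R mu D mD (fun n x => (p (f_ n x))%:E)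
    (fun x => (p (f x))%:E) (EFin \o g).
  case.
  - by move=> n; exact/measurable_EFinP.
  - exact/measurable_EFinP.
  - by apply: aeW => x Dx; apply: cvg_EFin; [exact: nearW|exact: cv].
  - by [].
  - apply: aeW => x n Dx; rewrite /= lee_fin.
    exact: le_trans (pn _) (f_g _ _ Dx).
  move=> i1 _ i2; split=> //; rewrite /Rintegral.
  apply: fine_cvg; rewrite fineK//; exact: integrable_fin_num.
have [i1 c1] := key _ (@ReB R) (@normc_Re R) (fun n => (mf_ n).1) (@ccvg_Re R).
have [i2 c2] := key _ (@ImB R) (@normc_Im R) (fun n => (mf_ n).2) (@ccvg_Im R).
split; first by split.
apply: (@ccvg_squeeze _ _ _ (fun n => `|Re (cintegral mu D (f_ n)) - Re (cintegral mu D f)|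
  + `|Im (cintegral mu D (f_ n)) - Im (cintegral mu D f)|)).
  by apply: nearW => n; rewrite -ReB -ImB normc_le_ReIm.
have a0 (u : nat -> R) l : u @ \oo --> l -> `|u n - l| @[n --> \oo] --> (0 : R).
  move=> ul; rewrite -[X in _ --> X](normr0 R) -(subrr l); apply: cvg_norm.
  by apply: cvgB => //; exact: cvg_cst.
by rewrite -[X in _ --> X]addr0; apply: cvgD; exact: a0.
Qed.

End cintegral.

Section cintegral_FTC.
Context {R : realType}.
Local Notation mu := (@lebesgue_measure R).

Lemma cintegral_FTC (f df : R -> R[i]) (a b : R) : a < b ->
  (forall x, is_cderive x f (df x)) ->
  continuous (fun x : R => Re (df x) : R) -> continuous (fun x : R => Im (df x) : R) ->
  cintegral mu `[a, b] df = f b - f a.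
Proof.
move=> ab fdf c1 c2.
have key (F G : R -> R) : (forall x : R, is_derive x 1 F (G x)) -> continuous G ->
    \int[mu]_(x in `[a, b]) G x = F b - F a.
  move=> FG cG; rewrite /Rintegral (@continuous_FTC2 _ _ F)//.
  - by apply: continuous_subspaceT.
  - have cF : continuous F.
      move=> x; apply: differentiable_continuous; apply/derivable1_diffP.
      by have := FG x; case.
    split=> [x _||]; first by have := FG x; case.
    - by apply: cvg_at_right_filter; exact: cF.
    - by apply: cvg_at_left_filter; exact: cF.
  - by move=> x _; rewrite derive1E; have := FG x; case.
apply: complexP; rewrite ?ReB ?ImB /=.
  by apply: (key (Re \o f) (fun x => Re (df x))) => // x; exact: (fdf x).1.
by apply: (key (Im \o f) (fun x => Im (df x))) => // x; exact: (fdf x).2.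
Qed.

End cintegral_FTC.

(** * Power series recursions *)

Section abs_poly.
Context {R : realType}.
Implicit Types (p q : {poly R[i]}) (r : R).

(** The majorant of [p]: one value of it bounds [p] on a whole circle, and at nonnegative points
    inequalities between coefficients become inequalities between values. *)
Definition abs_poly p : {poly R} := \poly_(i < size p) normc p`_i.

Lemma coef_abs_poly p i : (abs_poly p)`_i = normc p`_i.
Proof.
rewrite coef_poly; case: ltnP => // h.
by rewrite (nth_default _ h) normc0.
Qed.

Lemma horner_le_coef (P Q : {poly R}) r : 0 <= r -> (forall i, P`_i <= Q`_i) ->
  P.[r] <= Q.[r].
Proof.
move=> r0 PQ; pose n := maxn (size P) (size Q).
rewrite (@horner_coef_wide _ n) ?leq_maxl// (@horner_coef_wide _ n Q) ?leq_maxr//.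
by apply: ler_sum => i _; rewrite ler_wpM2r ?exprn_ge0.
Qed.

Lemma abs_poly_ge0 p r : 0 <= r -> 0 <= (abs_poly p).[r].
Proof.
move=> r0; rewrite -(horner0 r) horner_le_coef// => i.
by rewrite coef0 coef_abs_poly normc_ge0.
Qed.

Lemma normc_horner p z : normc p.[z] <= (abs_poly p).[normc z].
Proof.
rewrite (@horner_coef_wide _ (size p) (abs_poly p)) ?size_poly// horner_coef.
rewrite (le_trans (normc_sum _ _ _))// ler_sum// => i _.
by rewrite normcM normcX coef_abs_poly.
Qed.

(** Every surviving term has degree at least [N], and shrinking the radius from [s] to [r]
    multiplies such a term by at most [(r / s) ^+ N]. *)
Lemma abs_poly_tail p N (r s : R) : 0 <= r -> r <= s -> 0 < s ->
  (forall i, (i < N)%N -> p`_i = 0) ->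
  (abs_poly p).[r] <= (r / s) ^+ N * (abs_poly p).[s].
Proof.
move=> r0 rs s0 p0; rewrite !horner_coef mulr_sumr ler_sum// => i _.
rewrite coef_abs_poly; have [iN|Ni] := ltnP i N.
  by rewrite p0// normc0 !mul0r mulr0.
rewrite mulrCA ler_wpM2l ?normc_ge0//.
have -> : r ^+ i = (r / s) ^+ i * s ^+ i by rewrite -exprMn divfK ?gt_eqF.
rewrite ler_wpM2r ?exprn_ge0 ?(ltW s0)// ler_wiXn2l//.
  by rewrite divr_ge0// ltW.
by rewrite ler_pdivrMr// mul1r.
Qed.

Lemma abs_poly_homo p (r s : R) : 0 <= r -> r <= s -> (abs_poly p).[r] <= (abs_poly p).[s].
Proof.
move=> r0 rs; rewrite !horner_coef ler_sum// => i _.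
by rewrite coef_abs_poly ler_wpM2l ?normc_ge0// lerXn2r ?nnegrE// (le_trans r0).
Qed.

Lemma is_derive_horner (P : {poly R}) (x : R) :
  is_derive x 1 (fun y : R => P.[y]) P^`().[x].
Proof.
elim/poly_ind: P => [|P c IH].
  rewrite (_ : (fun _ => _) = cst 0); last by apply/funext => y; rewrite horner0.
  by rewrite deriv0 horner0; exact: is_derive_cst.
rewrite (_ : (fun _ => _) = (fun y => P.[y]) * id + cst c); last first.
  by apply/funext => y; rewrite !hornerE.
apply: is_derive_eq; rewrite derivD derivM derivX derivC !hornerE /GRing.scale/=; ring.
Qed.

Lemma is_cderive_horner p (x : R) z :
  is_cderive x (fun y => p.[y%:C * z]) (z * p^`().[x%:C * z]).
Proof.
have dz : is_cderive x (fun y => y%:C * z) z.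
  apply: is_cderive_eq (is_cderiveM (is_cderive_real (is_derive_id x 1)) (is_cderive_cst x z)) _.
  by rewrite mulr0 addr0 mul1r.
elim/poly_ind: p => [|p c IH].
  apply: is_cderive_eq (is_cderive_ext _ (is_cderive_cst x 0)) _.
    by move=> y; rewrite horner0.
  by rewrite deriv0 horner0 mulr0.
apply: is_cderive_eq (is_cderive_ext _ (is_cderiveD (is_cderiveM IH dz) (is_cderive_cst x c))) _.
  by move=> y; rewrite !hornerE.
rewrite derivD derivM derivX derivC !addr0 mulr1 hornerD hornerM hornerX; ring.
Qed.

End abs_poly.

Section log_recursion.
Context {R : realType}.
Variables (N : nat) (c d : nat -> R[i]).
Hypothesis c0 : c 0%N = 1.
Hypothesis cS : forall j, j.+1%:R * c j.+1 = \sum_(k < j.+1) d k.+1 * c (j - k)%N.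

Let C := \poly_(i < N.+1) c i.
(** [cS] says that the generating series [C] of [c] satisfies [C' = L' C], hence [C = exp L] as
    [c 0 = 1]; this is [L] cut after degree [N]. Its constant term vanishes because the inverse of 0
    is 0. *)
Definition log_poly := \poly_(i < N.+1) (d i / i%:R).
Let L := log_poly.

Let dL j : L^`()`_j = if (j < N)%N then d j.+1 else 0.
Proof.
rewrite coef_deriv coef_poly ltnS; case: ifP => _; last by rewrite mul0rn.
by rewrite -[LHS]mulr_natr divfK ?pnatr_eq0.
Qed.

Let coefC j : C`_j = if (j <= N)%N then c j else 0.
Proof. by rewrite coef_poly ltnS. Qed.

Let LC j : (j < N)%N -> (L^`() * C)`_j = C^`()`_j.
Proof.
move=> jN; rewrite coefM coef_deriv coefC jN -mulr_natl cS.
apply: eq_bigr => k _; rewrite dL coefC.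
have kN : (k < N)%N by apply: leq_ltn_trans jN; rewrite -ltnS.
have jkN : (j - k <= N)%N by exact: leq_trans (leq_subr _ _) (ltnW jN).
by rewrite kN jkN.
Qed.

(** For the majorants the differential equation becomes [P' <= S' P], so that [P exp(- S)] does not
    increase from its value 1 at 0. *)
Lemma log_recursion_bound r : 0 <= r -> (abs_poly C).[r] <= expR (abs_poly L).[r].
Proof.
move=> r0; set P := abs_poly C; set S := abs_poly L.
have PS (x : R) : 0 <= x -> P^`().[x] <= S^`().[x] * P.[x].
  move=> x0; rewrite -hornerM; apply: horner_le_coef => // j.
  rewrite coef_deriv coef_abs_poly coefC; case: ifPn => [jN|_]; last first.
    rewrite normc0 mul0rn coefM sumr_ge0// => i _.
    by rewrite coef_deriv !coef_abs_poly mulr_ge0 ?mulrn_wge0 ?normc_ge0.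
  rewrite -mulr_natl; have -> : j.+1%:R * normc (c j.+1) = normc (j.+1%:R * c j.+1).
    by rewrite normcM -(rmorph_nat (real_complex R)) normcR ger0_norm.
  rewrite cS coefM (le_trans (normc_sum _ _ _))// ler_sum// => i _.
  have iN : (i < N)%N by apply: leq_ltn_trans jN; rewrite -ltnS.
  have jiN : (j - i <= N)%N by exact: leq_trans (leq_subr _ _) (ltnW jN).
  rewrite normcM coef_deriv !coef_abs_poly coefC jiN coef_poly ltnS iN.
  rewrite ler_wpM2r ?normc_ge0//.
  rewrite normcM normcV -(rmorph_nat (real_complex R)) normcR ger0_norm//.
  by rewrite -[leRHS]mulr_natr divfK ?pnatr_eq0.
have := @derive_ge0_le R (fun x => - (P.[x] * expR (- S.[x])))
  (fun x => (S^`().[x] * P.[x] - P^`().[x]) * expR (- S.[x])) 0 r r0.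
have -> : P.[0] = 1.
  by rewrite horner_coef0 coef_abs_poly coefC c0 normc1.
have -> : S.[0] = 0.
  by rewrite horner_coef0 coef_abs_poly coef_poly mulr0n invr0 mulr0 normc0.
rewrite oppr0 expR0 mulr1 lerN2 expRN => H.
suff : P.[r] / expR S.[r] <= 1 by rewrite ler_pdivrMr ?expR_gt0// mul1r.
apply: H.
  move=> x _; have := is_derive_horner P x; have := is_derive_horner S x => h1 h2.
  apply: is_derive_eq; rewrite /GRing.scale/=; ring.
by move=> x /andP[x0 _]; rewrite mulr_ge0 ?expR_ge0// subr_ge0 PS.
Qed.

(** Along the segment from 0 to [z] the function [C exp(- L)] starts at 1, and its derivative
    contains the defect [C' - L' C], which has no terms of degree below [N]; comparing the radii
    [normc z] and [s] gains the geometric factor. The three factors [exp S] come from the majorant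
    of [C], from [exp(- L)] on the segment and from [exp L] at [z]. *)
Lemma log_recursion_exp z (s : R) : normc z <= s -> 0 < s ->
  normc (C.[z] - cexp L.[z]) <=
  2 * (normc z / s) ^+ N * (N%:R * (abs_poly L).[s]) * expR ((abs_poly L).[s] *+ 3).
Proof.
move=> zs s0; set rho := normc z in zs *; set S := (abs_poly L).[s].
have rho0 : 0 <= rho := normc_ge0 z.
have S0 : 0 <= S by rewrite abs_poly_ge0// ltW.
pose H := C^`() - L^`() * C.
pose g (x : R) := C.[x%:C * z] * cexp (- L.[x%:C * z]).
pose dg (x : R) := z * H.[x%:C * z] * cexp (- L.[x%:C * z]).
have gdg x : is_cderive x g (dg x).
  have h1 := is_cderive_horner C x z.
  have h2 : is_cderive x (fun y => - L.[y%:C * z]) (- (z * L^`().[x%:C * z])).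
    apply: is_cderive_eq (is_cderive_ext _ (is_cderiveM (is_cderive_cst x (-1)) (is_cderive_horner L x z))) _.
      by move=> y; rewrite mulN1r.
    ring.
  apply: is_cderive_eq (is_cderiveM h1 (is_cderive_cexp h2)) _.
  rewrite /dg /H hornerD hornerN hornerM; ring.
have nxz (x : R) : 0 <= x <= 1 -> normc (x%:C * z) <= rho.
  by move=> /andP[x0 x1]; rewrite normcM normcR ger0_norm// ler_piMl.
have expL (w : R[i]) : normc w <= rho -> expR (- Re L.[w]) <= expR S.
  move=> wr; rewrite ler_expR (le_trans (ler_norm _))// normrN (le_trans (normc_Re _))//.
  rewrite (le_trans (normc_horner _ _))//.
  by rewrite (le_trans (abs_poly_homo _ (normc_ge0 _) wr))// abs_poly_homo.
have expL' : expR (Re L.[z]) <= expR S.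
  rewrite ler_expR (le_trans (ler_norm _))// (le_trans (normc_Re _))//.
  by rewrite (le_trans (normc_horner _ _))// abs_poly_homo.
have H0 i : (i < N)%N -> H`_i = 0 by move=> iN; rewrite coefB LC// subrr.
have HS : rho * (abs_poly H).[rho] <= (rho / s) ^+ N * (N%:R * S * expR S).
  rewrite (le_trans (ler_wpM2l rho0 (abs_poly_tail rho0 zs s0 H0)))// mulrCA.
  rewrite ler_wpM2l ?exprn_ge0 ?divr_ge0 ?(ltW s0)//.
  have h1 : (abs_poly H).[s] <= (abs_poly (L^`())).[s] * (abs_poly C).[s].
    rewrite -hornerM; apply: horner_le_coef; first exact: ltW.
    move=> j; have [jN|Nj] := ltnP j N.
      rewrite coef_abs_poly H0// normc0 coefM sumr_ge0// => i _.
      by rewrite !coef_abs_poly mulr_ge0 ?normc_ge0.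
    rewrite coef_abs_poly coefB coef_deriv coefC ltnNge Nj/= mul0rn sub0r normcN.
    rewrite !coefM (le_trans (normc_sum _ _ _))// ler_sum// => i _.
    by rewrite normcM !coef_abs_poly.
  (* Differentiation multiplies a coefficient of degree at most [N] by at most [N]. *)
  have h2 : s * (abs_poly (L^`())).[s] <= N%:R * S.
    have -> : s * (abs_poly (L^`())).[s] = (abs_poly (L^`()) * 'X).[s].
      by rewrite hornerMX mulrC.
    have -> : N%:R * S = (abs_poly L *+ N).[s] by rewrite hornerMn mulr_natl.
    apply: horner_le_coef; first exact: ltW.
    move=> j; rewrite coefMX coefMn !coef_abs_poly.
    case: j => [|j]/=; first by rewrite mulrn_wge0 ?normc_ge0.
    rewrite coef_deriv; have [jN|Nj] := ltnP j N; last first.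
      have L0 : L`_j.+1 = 0 by rewrite coef_poly ltnS ltnNge Nj.
      by rewrite L0 mul0rn normc0 mul0rn.
    rewrite -[X in normc X]mulr_natl normcM -(rmorph_nat (real_complex R)) normcR ger0_norm//.
    by rewrite -[leRHS]mulr_natl ler_wpM2r ?normc_ge0// ler_nat.
  have s0' : 0 <= s := ltW s0.
  have h3 : rho * (abs_poly H).[s] <= s * ((abs_poly (L^`())).[s] * (abs_poly C).[s]).
    by rewrite ler_pM ?abs_poly_ge0.
  apply: (le_trans h3); rewrite mulrA ler_pM ?log_recursion_bound ?abs_poly_ge0//.
  by rewrite mulr_ge0 ?abs_poly_ge0.
have := @cmean_value R g dg 0 1 ((rho / s) ^+ N * (N%:R * S * expR S) * expR S) ler01 (fun x _ => gdg x).
have -> : g 0 = 1.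
  rewrite /g mul0r !horner_coef0 coefC c0 coef_poly/= invr0 mulr0.
  by rewrite oppr0 cexp0 mulr1.
have -> : g 1 = C.[z] * cexp (- L.[z]) by rewrite /g mul1r.
move=> mv.
have -> : C.[z] - cexp L.[z] = (C.[z] * cexp (- L.[z]) - 1) * cexp L.[z].
  by rewrite mulrBl mul1r -mulrA -cexpD addNr cexp0 mulr1.
rewrite normcM normc_cexp.
have {}mv := mv _.
apply: le_trans (ler_pM (normc_ge0 _) (expR_ge0 _) (mv _) expL') _.
  move=> x x01; rewrite /dg normcM (normcM z) (normc_cexp (- _)) ReN.
  rewrite ler_pM ?mulr_ge0 ?normc_ge0 ?expR_ge0// ?expL ?nxz//.
  apply: le_trans HS; rewrite ler_wpM2l//.
  rewrite (le_trans (normc_horner _ _))// abs_poly_homo ?normc_ge0//.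
  exact: nxz.
have -> : S *+ 3 = S + S + S by rewrite !mulrS mulr0n; ring.
rewrite subr0 mulr1 !expRD.
by rewrite le_eqVlt; apply/orP; left; apply/eqP; ring.
Qed.

End log_recursion.

Section partial_sums.
Context {R : realType}.
Variables (a m : nat -> R[i]).
Hypothesis m0 : m 0%N = 1.
Hypothesis mS : forall j, j.+1%:R * m j.+1 = \sum_(k < j.+1) a k.+1 * m (j - k)%N.

(** The coefficients of [(1 - x) sum m_j x^j], the sequence being 0 before index 0. *)
Definition jump j := if j is j'.+1 then m j - m j' else m 0%N.

Lemma sum_jump n : \sum_(k < n.+1) jump (n - k)%N = m n.
Proof.
rewrite (reindex_inj rev_ord_inj)/=.
have -> : \sum_(i < n.+1) jump (n - (n.+1 - i.+1)) = \sum_(i < n.+1) jump i.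
  by apply: eq_bigr => i _; rewrite subSS subKn// -ltnS.
elim: n => [|n IH]; first by rewrite big_ord1.
by rewrite big_ord_recr IH/= addrC subrK.
Qed.

(** Since [1 - x = exp(- sum x^k / k)], multiplication by [1 - x] subtracts 1 from every [a k] in
    the logarithm. Without this subtraction the logarithm would not stay bounded as the step tends
    to 0. *)
Lemma jump_recursion j :
  j.+1%:R * jump j.+1 = \sum_(k < j.+1) (a k.+1 - 1) * jump (j - k)%N.
Proof.
under eq_bigr do rewrite mulrBl mul1r.
rewrite sumrB sum_jump /= mulrBr mS.
have -> : \sum_(k < j.+1) a k.+1 * jump (j - k) =
    \sum_(k < j.+1) a k.+1 * m (j - k)%N - j%:R * m j.
  rewrite [in LHS]big_ord_recr [in RHS]big_ord_recr/= subnn/=.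
  rewrite addrAC; congr (_ + _).
  case: j => [|j]; first by rewrite !big_ord0 mul0r subr0.
  rewrite mS -sumrB; apply: eq_bigr => i _.
  by rewrite subSn ?(ltnW (ltn_ord i))//= ?mulrBr// -ltnS.
rewrite -natr1 mulrDl mul1r; ring.
Qed.

(** Truncation leaves a single boundary term, which [normc_sum_tail] shows to be negligible. *)
Lemma partial_sums_poly N :
  (1 - 'X) * \poly_(i < N.+1) m i = \poly_(i < N.+1) jump i - (m N)%:P * 'X^(N.+1).
Proof.
apply/polyP => i; rewrite mulrBl mul1r coefB [in RHS]coefB coefXM coefCM coefXn.
rewrite !coef_poly; case: i => [|i]/=; first by rewrite mulr0.
rewrite !ltnS eqSS; have [iN|Ni|->] := ltngtP i N.
- by rewrite mulr0 subr0.
- by rewrite mulr0.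
- by rewrite mulr1.
Qed.

End partial_sums.

Section complex_multiples.
Context {R : realType}.

Lemma ReMn (z : R[i]) n : Re (z *+ n) = n%:R * Re z.
Proof. by elim: n => [|n IH]; rewrite ?mulr0n ?mul0r// mulrS ReD IH -natr1; ring. Qed.

Lemma ImMn (z : R[i]) n : Im (z *+ n) = n%:R * Im z.
Proof. by elim: n => [|n IH]; rewrite ?mulr0n ?mul0r// mulrS ImD IH -natr1; ring. Qed.

Lemma natC n : (n%:R : R)%:C = n%:R :> R[i].
Proof. exact: (rmorph_nat (real_complex R)). Qed.

Lemma realCM (x y : R) : (x * y)%:C = x%:C * y%:C :> R[i].
Proof. exact: (rmorphM (real_complex R)). Qed.

Lemma realCV (x : R) : (x^-1)%:C = (x%:C)^-1 :> R[i].
Proof. exact: (fmorphV (real_complex R)). Qed.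

End complex_multiples.

Section cintegral_more.
Context {R : realType} {d : measure_display} {T : measurableType d}.
Variables (mu : {measure set T -> \bar R}) (D : set T).
Hypothesis mD : measurable D.

Lemma cintegrable_bounded (f : T -> R[i]) (K : R) : (mu D < +oo)%E ->
  cmeasurable D f -> (forall x, D x -> normc (f x) <= K) -> cintegrable mu D f.
Proof.
move=> muD mf fK; apply: (cintegrable_dom mD mf _ fK).
apply: measurable_bounded_integrable => //.
exists `|K|; split; first exact: num_real.
by move=> x Kx y _ /=; exact: ltW.
Qed.

Lemma cintegrable_sum (n : nat) (f : nat -> T -> R[i]) :
  (forall i, cintegrable mu D (f i)) -> cintegrable mu D (fun x => \sum_(i < n) f i x).
Proof.
move=> fi; elim: n => [|n IH].
  apply: (@eq_cintegrable _ _ _ _ _ mD (fun=> 0)); last by split; exact: integrable0.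
  by move=> x _; rewrite big_ord0.
apply: (@eq_cintegrable _ _ _ _ _ mD (fun x => \sum_(i < n) f i x + f n x)).
  by move=> x _; rewrite big_ord_recr.
exact: cintegrableD.
Qed.

Lemma cintegral_sum (n : nat) (f : nat -> T -> R[i]) :
  (forall i, cintegrable mu D (f i)) ->
  cintegral mu D (fun x => \sum_(i < n) f i x) = \sum_(i < n) cintegral mu D (f i).
Proof.
move=> fi; elim: n => [|n IH].
  rewrite big_ord0 (@eq_cintegral _ _ _ _ _ _ (fun=> 0)); last first.
    by move=> x _; rewrite big_ord0.
  by apply: complexP; rewrite /= /Rintegral integral0.
rewrite big_ord_recr/= -IH -cintegralD//; last exact: cintegrable_sum.
by apply: eq_cintegral => x _; rewrite big_ord_recr.
Qed.

End cintegral_more.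

(** * Extraction of coefficients by Fourier integrals *)

Section trigonometric_integrals.
Context {R : realType}.
Local Notation mu := (@lebesgue_measure R).

Definition expi (x : R) : R[i] := cexp (0 +i* x).

Lemma expiD (x y : R) : expi (x + y) = expi x * expi y.
Proof. by rewrite /expi -cexpD; congr cexp; apply: complexP => /=; rewrite ?addr0. Qed.

Lemma expi0 : expi 0 = 1. Proof. exact: cexp0. Qed.

Lemma normc_expi x : normc (expi x) = 1.
Proof. by rewrite normc_cexp expR0. Qed.

Lemma Re_expi x : Re (expi x) = cos x.
Proof. by rewrite Re_cexp expR0 mul1r. Qed.

Lemma Im_expi x : Im (expi x) = sin x.
Proof. by rewrite Im_cexp expR0 mul1r. Qed.

Lemma conjc_expi x : conjc (expi x) = expi (- x).
Proof.
apply: complexP; rewrite ?Re_expi ?Im_expi ?cosN ?sinN.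
  by rewrite -Re_expi; case: (expi x).
by rewrite -Im_expi; case: (expi x).
Qed.

Lemma continuous_cos_lin (w : R) : continuous (fun v : R => cos (w * v) : R).
Proof.
move=> v; apply: (@continuous_comp _ _ _ (fun v : R => w * v) (@cos R)); last exact: continuous_cos.
exact: mulrl_continuous.
Qed.

Lemma continuous_sin_lin (w : R) : continuous (fun v : R => sin (w * v) : R).
Proof.
move=> v; apply: (@continuous_comp _ _ _ (fun v : R => w * v) (@sin R)); last exact: continuous_sin.
exact: mulrl_continuous.
Qed.

Lemma cmeasurable_expi (D : set R) (w : R) : cmeasurable D (fun v => expi (w * v)).
Proof.
split.
  under eq_fun do rewrite Re_expi.
  by apply: measurable_funTS; apply: continuous_measurable_fun; exact: continuous_cos_lin.
under eq_fun do rewrite Im_expi.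
by apply: measurable_funTS; apply: continuous_measurable_fun; exact: continuous_sin_lin.
Qed.

Lemma mu_itv_lty (a b : R) : (mu `[a, b] < +oo)%E.
Proof. by rewrite lebesgue_measure_itv/=; case: ifP => _; rewrite ltry. Qed.

Lemma cintegrable_expi (a b w : R) : cintegrable mu `[a, b] (fun v => expi (w * v)).
Proof.
apply: (@cintegrable_bounded _ _ _ _ _ _ _ 1) => //.
- exact: mu_itv_lty.
- exact: cmeasurable_expi.
- by move=> x _; rewrite normc_expi.
Qed.

Lemma cintegral_expi (b w : R) : 0 < b -> w != 0 ->
  cintegral mu `[- b, b] (fun v => expi (w * v)) = (2 * sin (w * b) / w)%:C.
Proof.
move=> b0 w0.
pose f v := (0 +i* - w^-1) * expi (w * v).
have df (x : R) : is_cderive x f (expi (w * x)).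
  have h : is_cderive x (fun v : R => 0 +i* (w * v)) (0 +i* w).
    split => /=.
      by rewrite (_ : _ \o _ = cst 0); [exact: is_derive_cst|exact/funext].
    rewrite (_ : _ \o _ = (fun v => w * v)); last exact/funext.
    by apply: is_derive_eq; rewrite /GRing.scale/= mulr1.
  apply: is_cderive_eq (is_cderiveM (is_cderive_cst x (0 +i* - w^-1)) (is_cderive_cexp h)) _.
  rewrite mul0r add0r mulrA (_ : _ * (0 +i* w) = 1) ?mul1r//.
  by apply: complexP => /=; [rewrite mul0r sub0r mulNr opprK mulVf|rewrite mul0r mulr0 addr0].
rewrite (cintegral_FTC _ df); last 3 first.
- lra.
- by under eq_fun do rewrite Re_expi; exact: continuous_cos_lin.
- by under eq_fun do rewrite Im_expi; exact: continuous_sin_lin.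
rewrite /f -mulrBr; apply: complexP; rewrite ?ReM ?ImM ?ReB ?ImB !Re_expi !Im_expi /=.
  by rewrite mulrN sinN; field.
by rewrite mulrN cosN; ring.
Qed.

Lemma sin_pi_nat (n : nat) : sin (pi * n%:R : R) = 0.
Proof.
elim: n => [|n IH]; first by rewrite mulr0 sin0.
by rewrite -natr1 mulrDr mulr1 sinDpi IH oppr0.
Qed.

Lemma cintegral_expi_ortho (h : R) (j k : nat) : 0 < h ->
  cintegral mu `[- (pi / h), pi / h] (fun v => expi ((j%:R - k%:R) * h * v)) =
  if j == k then (2 * pi / h)%:C else 0.
Proof.
move=> h0; have ph : 0 < pi / h by rewrite divr_gt0 ?pi_gt0.
case: eqVneq => [->|jk].
  rewrite (@eq_cintegral _ _ _ _ _ _ (fun=> (1:R)%:C)); last first.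
    by move=> x _; rewrite subrr !mul0r expi0.
  rewrite cintegral_real; congr (_%:C).
  have mupi : fine (mu `[- (pi / h), pi / h]) = 2 * pi / h.
    rewrite lebesgue_measure_itv/= lte_fin; case: ifPn => [_ /=|]; last by rewrite -leNgt; lra.
    by field; lra.
  by rewrite Rintegral_cst// mul1r.
have jk0 : (j%:R - k%:R : R) != 0 by rewrite subr_eq0 eqr_nat.
rewrite cintegral_expi//; last by rewrite mulf_neq0// gt_eqF.
have -> : (j%:R - k%:R) * h * (pi / h) = (j%:R - k%:R) * pi by field; lra.
suff -> : sin ((j%:R - k%:R) * pi : R) = 0 by rewrite mulr0 mul0r.
have [kj|/ltnW jk'] := leqP k j; first by rewrite -natrB// mulrC sin_pi_nat.
by rewrite -opprB mulNr sinN -natrB// mulrC sin_pi_nat oppr0.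
Qed.

End trigonometric_integrals.

Section coefficient_extraction.
Context {R : realType}.
Local Notation mu := (@lebesgue_measure R).
Variables (h Y : R).
Hypothesis h0 : 0 < h.

(** The argument [x = exp(- h z)] of the generating functions at [z = Y +i* v]. As [v] runs through
    [[- pi / h, pi / h]], it describes the circle of radius [exp(- Y h)] once. *)
Definition qpt (v : R) : R[i] := cexp (- (h%:C * (Y +i* v))).

Lemma qptX v n : qpt v ^+ n = (expR (- (Y * (n%:R * h))))%:C * expi (- (n%:R * h * v)).
Proof.
rewrite /qpt -cexpMn -cexpR -cexpD; congr cexp; apply: complexP.
  by rewrite ReD ReMn ReN ReM /=; ring.
by rewrite ImD ImMn ImN ImM /=; ring.
Qed.

Lemma cmeasurable_qpt (D : set R) : cmeasurable D qpt.
Proof.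
apply: (@eq_cmeasurable _ _ _ D (fun v => (expR (- (Y * h)))%:C * expi (- h * v))).
  by move=> v _; rewrite -(expr1 (qpt v)) qptX !mul1r mulNr.
by apply: cmeasurableM; [exact: cmeasurable_cst|exact: cmeasurable_expi].
Qed.

Lemma normc_qpt v : normc (qpt v) = expR (- (Y * h)).
Proof. by rewrite normc_cexp ReN ReM /= mul0r subr0 mulrC. Qed.

(** Cauchy's coefficient formula on the circle of radius [exp(- Y h)], reduced to the orthogonality
    of the exponentials. *)
Lemma cintegral_coef (p : {poly R[i]}) (n : nat) :
  cintegral mu `[- (pi / h), pi / h]
    (fun v => p.[qpt v] * cexp ((n%:R * h)%:C * (Y +i* v))) =
  (2 * pi / h)%:C * p`_n.
Proof.
have term v k : qpt v ^+ k * cexp ((n%:R * h)%:C * (Y +i* v)) =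
    (expR (Y * ((n%:R - k%:R) * h)))%:C * expi ((n%:R - k%:R) * h * v).
  rewrite /qpt -cexpMn -cexpR -!cexpD; congr cexp; apply: complexP.
    by rewrite !ReD ReMn ReN !ReM /=; ring.
  by rewrite !ImD ImMn ImN !ImM /=; ring.
(* The index [n] has to occur in the sum also when it exceeds the degree of [p]. *)
pose N := maxn (size p) n.+1.
transitivity (cintegral mu `[- (pi / h), pi / h] (fun v => \sum_(k < N)
    (p`_k * (expR (Y * ((n%:R - k%:R) * h)))%:C) * expi ((n%:R - k%:R) * h * v))).
  apply: eq_cintegral => v _; rewrite (@horner_coef_wide _ N) ?leq_maxl// mulr_suml.
  by apply: eq_bigr => k _; rewrite -mulrA term mulrA.
rewrite (@cintegral_sum _ _ _ _ _ _ _ (fun (k : nat) (v : measurableTypeR R) => (p`_k * (expR (Y * ((n%:R - k%:R) * h)))%:C) * expi ((n%:R - k%:R) * h * v)))//; last first.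
  by move=> i; apply: cintegrableMl => //; exact: cintegrable_expi.
have nN : (n < N)%N by rewrite leq_maxr.
rewrite (bigD1 (Ordinal nN))//= big1 ?addr0.
  rewrite cintegralMl//; last exact: cintegrable_expi.
  by rewrite cintegral_expi_ortho// eqxx subrr mul0r mulr0 expR0 mulr1 mulrC.
move=> k kn; rewrite cintegralMl//; last exact: cintegrable_expi.
rewrite cintegral_expi_ortho// ifN ?mulr0// eq_sym.
by apply: contra kn => /eqP e; apply/eqP/val_inj.
Qed.

Lemma parseval (p : {poly R[i]}) (N : nat) : (size p <= N)%N ->
  \int[mu]_(v in `[- (pi / h), pi / h]) (normc p.[qpt v] ^+ 2) =
  2 * pi / h * \sum_(k < N) (normc p`_k * expR (- (Y * (k%:R * h)))) ^+ 2.
Proof.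
move=> pN; pose al (k : nat) := p`_k * (expR (- (Y * (k%:R * h))))%:C.
have hor v : p.[qpt v] = \sum_(k < N) al k * expi (- (k%:R * h * v)).
  rewrite (@horner_coef_wide _ N)//; apply: eq_bigr => k _.
  by rewrite qptX /al [LHS]mulrA.
apply: (@complexI R); rewrite -cintegral_real.
transitivity (cintegral mu `[- (pi / h), pi / h] (fun v => \sum_(k < N) \sum_(j < N)
    (al k * conjc (al j)) * expi ((j%:R - k%:R) * h * v))).
  apply: eq_cintegral => v _; rewrite normcE2 add_Re2_Im2 sqr_normc hor rmorph_sum big_distrl/=.
  apply: eq_bigr => k _; rewrite mulr_sumr; apply: eq_bigr => j _.
  rewrite (rmorphM (@conjc R)) [X in _ * (_ * X)](conjc_expi _) opprK mulrACA -expiD; congr (_ * expi _); ring.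
have ii (k j : nat) : cintegrable mu `[- (pi / h), pi / h]
    (fun v => (al k * conjc (al j)) * expi ((j%:R - k%:R) * h * v)).
  by apply: cintegrableMl => //; exact: cintegrable_expi.
rewrite (@cintegral_sum _ _ _ _ _ _ _ (fun (k : nat) (v : measurableTypeR R) => \sum_(j < N) (al k * conjc (al j)) * expi ((j%:R - k%:R) * h * v)))//; last first.
  by move=> k; apply: (@cintegrable_sum _ _ _ _ _ _ _ (fun (j : nat) (v : measurableTypeR R) => (al k * conjc (al j)) * expi ((j%:R - k%:R) * h * v))).
rewrite rmorphM/= rmorph_sum mulr_sumr; apply: eq_bigr => k _.
rewrite (@cintegral_sum _ _ _ _ _ _ _ (fun (j : nat) (v : measurableTypeR R) => (al k * conjc (al j)) * expi ((j%:R - k%:R) * h * v)))//.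
rewrite (bigD1 k)//= big1 ?addr0.
  rewrite cintegralMl//; last exact: cintegrable_expi.
  rewrite cintegral_expi_ortho// eqxx mulrC; congr (_ * _).
  rewrite -sqr_normc normrcE -rmorphXn/= /al normcM normcR ger0_norm ?expR_ge0//.
move=> j jk; rewrite cintegralMl//; last exact: cintegrable_expi.
rewrite cintegral_expi_ortho// ifN ?mulr0//.
Qed.

End coefficient_extraction.

(** * The kernel [h / (1 - exp(- h z))] and its limit [1 / z] *)

Section geometric_kernel.
Context {R : realType}.

(** For [0 <= u <= 2] the cubic lower bound of the sine is at least [u (1 - 4 / 6)]. The range
    covers [[- pi / 2, pi / 2]], where the bound is applied. *)
Lemma sin_ge_third (u : R) : `|u| <= 2 -> u ^+ 2 / 9 <= sin u ^+ 2.
Proof.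
wlog u0 : u / 0 <= u.
  move=> H; have [u0|/ltW u0] := leP 0 u; first exact: H.
  by have := H (- u); rewrite oppr_ge0 normrN sqrrN sinN sqrrN; exact.
rewrite ger0_norm// => u2; have h := sin_ge u0.
have h2 : u / 3 <= sin u.
  apply: le_trans h.
  have : u ^+ 3 <= 4 * u.
    rewrite exprSr ler_wpM2r// -[leRHS](_ : 2 ^+ 2 = _) ?lerXn2r ?nnegrE//; lra.
  lra.
have -> : u ^+ 2 / 9 = (u / 3) ^+ 2 by field.
by rewrite lerXn2r// nnegrE; lra.
Qed.

(** With [w = x + i y], the identity [|1 - exp(- w)|^2 = (1 - exp(- x))^2 + 4 exp(- x) sin(y / 2)^2]
    separates the two coordinates: the first square is bounded below through
    [x exp(- x) <= 1 - exp(- x)], the second through [sin_ge_third]. *)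
Lemma normc_1Bcexp_ge (w : R[i]) : 0 <= Re w -> `|Im w| <= pi ->
  expR (- Re w) * normc w / 3 <= normc (1 - cexp (- w)).
Proof.
move=> x0 yp; set x := Re w in x0 *; set y := Im w in yp *.
have e0 := expR_gt0 (- x).
rewrite -(@ler_pXn2r _ 2) ?nnegrE ?normc_ge0 ?mulr_ge0 ?expR_ge0 ?normc_ge0//.
have -> : normc (1 - cexp (- w)) ^+ 2 = (1 - expR (- x)) ^+ 2 + 4 * expR (- x) * sin (y / 2) ^+ 2.
  rewrite normcE2 ReB ImB Re_cexp Im_cexp ReN ImN -/x -/y /= cosN sinN.
  have -> : y = (y / 2) *+ 2 by rewrite -mulr_natr divfK.
  rewrite sin_mulr2n cos_mulr2n.
  have -> : y / 2 *+ 2 / 2 = y / 2 by rewrite -mulr_natr mulfK.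
  have := cos2Dsin2 (y / 2); set c := cos _; set s := sin _ => cs.
  have c2 : c ^+ 2 = 1 - s ^+ 2 by rewrite -cs addrK.
  rewrite sub0r !mulr2n.
  have -> : (- (expR (- x) * - (c * s + c * s))) ^+ 2 = 4 * expR (- x) ^+ 2 * c ^+ 2 * s ^+ 2 by ring.
  rewrite !c2; ring.
have -> : (expR (- x) * normc w / 3) ^+ 2 = expR (- x) ^+ 2 * (x ^+ 2 + y ^+ 2) / 9.
  by rewrite !exprMn normcE2 -/x -/y; field.
have h1 : x * expR (- x) <= 1 - expR (- x).
  have := expR_ge1Dx x; rewrite expRN => h.
  have e1 := expR_gt0 x; rewrite -subr_ge0.
  have -> : 1 - (expR x)^-1 - x / expR x = (expR x - 1 - x) / expR x by field; lra.
  by apply: divr_ge0; lra.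
have h2 : (x * expR (- x)) ^+ 2 <= (1 - expR (- x)) ^+ 2.
  by rewrite lerXn2r ?nnegrE ?mulr_ge0 ?(ltW e0)//; apply: le_trans h1; rewrite mulr_ge0 ?(ltW e0).
have h3 : (y / 2) ^+ 2 / 9 <= sin (y / 2) ^+ 2.
  apply: sin_ge_third; rewrite normrM (@ger0_norm _ 2^-1)//.
  have := pihalf_lt2 R; lra.
have e1 : expR (- x) ^+ 2 <= expR (- x).
  rewrite expr2 ler_piMl ?(ltW e0)// expR_le1; lra.
have h4 : 4 * expR (- x) ^+ 2 * ((y / 2) ^+ 2 / 9) <= 4 * expR (- x) * sin (y / 2) ^+ 2.
  apply: ler_pM => //.
  - by rewrite mulr_ge0 ?sqr_ge0.
  - by rewrite ler_pM2l.
have h5 := sqr_ge0 (x * expR (- x)).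
have -> : expR (- x) ^+ 2 * (x ^+ 2 + y ^+ 2) / 9 = (x * expR (- x)) ^+ 2 / 9
   + 4 * expR (- x) ^+ 2 * ((y / 2) ^+ 2 / 9) by field.
lra.
Qed.

Lemma ccvgV (u : nat -> R[i]) l : l != 0 -> ccvg u l -> ccvg (fun n => (u n)^-1) l^-1.
Proof.
move=> l0 ul; have nl := normc_gt0 l0.
apply: (@ccvg_squeeze _ _ _ (fun n => normc (u n - l) * (2 / normc l ^+ 2))); last first.
  by rewrite -[X in _ --> X](mul0r (2 / normc l ^+ 2)); apply: cvgM => //; exact: cvg_cst.
have nl2 : 0 < normc l / 2 by rewrite divr_gt0.
have := ul => /cvgrPdist_le/(_ _ nl2); apply: filterS => n.
rewrite sub0r normrN ger0_norm ?normc_ge0// => h.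
have un : normc l / 2 <= normc (u n).
  have := normcB (u n) (u n - l); rewrite subKr; lra.
have un0 : u n != 0.
  by apply/eqP => e; move: un; rewrite e normc0; lra.
have -> : (u n)^-1 - l^-1 = - ((u n - l) * (u n)^-1 * l^-1).
  by field; rewrite l0 un0.
rewrite normcN !normcM !normcV -mulrA ler_wpM2l ?normc_ge0//.
have -> : 2 / normc l ^+ 2 = (normc l / 2)^-1 / normc l by field; lra.
by rewrite ler_wpM2r ?invr_ge0 ?normc_ge0// lef_pV2// posrE (lt_le_trans nl2).
Qed.

(** The hypothesis on [v] puts [h z] into the strip of [normc_1Bcexp_ge]. Thus the decay [1 / |z|]
    of the limit kernel holds on the entire window of integration, with a constant that stays
    bounded as [h] tends to 0. *)
Lemma geometric_kernel_bound (h Y v : R) : 0 < h -> 0 < Y -> `|v| <= pi / h ->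
  normc (h%:C / (1 - qpt h Y v)) <= 3 * expR (Y * h) / normc (Y +i* v).
Proof.
move=> h0 Y0 vh; set w := h%:C * (Y +i* v).
have z0 : Y +i* v != 0 by rewrite eq_complex /= gt_eqF.
have nz := normc_gt0 z0.
have Rw : Re w = Y * h by rewrite ReM /= mul0r subr0 mulrC.
have Iw : Im w = h * v by rewrite ImM /= mul0r addr0.
have H : expR (- (Y * h)) * normc w / 3 <= normc (1 - qpt h Y v).
  rewrite -Rw; apply: normc_1Bcexp_ge; first by rewrite Rw mulr_ge0// ltW.
  by rewrite Iw normrM (gtr0_norm h0) mulrC -ler_pdivlMr.
have nw : normc w = h * normc (Y +i* v) by rewrite normcM normcR gtr0_norm.
rewrite normcM normcV normcR (gtr0_norm h0).
have H0 : 0 < expR (- (Y * h)) * normc w / 3 by rewrite divr_gt0// mulr_gt0 ?expR_gt0// nw mulr_gt0.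
rewrite ler_pdivrMr; last exact: lt_le_trans H.
rewrite mulrC -ler_pdivrMr; last by rewrite divr_gt0// mulr_gt0// expR_gt0.
apply: le_trans H; rewrite nw expRN.
rewrite le_eqVlt; apply/orP; left; apply/eqP.
by have := expR_gt0 (Y * h) => e; field; lra.
Qed.

Lemma geometric_kernel_cvg (h : nat -> R) (Y v : R) : 0 < Y -> (forall n, 0 < h n) ->
  h @ \oo --> (0 : R) ->
  ccvg (fun n => (h n)%:C / (1 - qpt (h n) Y v)) (Y +i* v)^-1.
Proof.
move=> Y0 hp h0; set z := Y +i* v.
have z0 : z != 0 by rewrite eq_complex /= gt_eqF.
have hC n : (h n)%:C != 0 by rewrite (eq_complex _ 0) /= gt_eqF.
suff H : ccvg (fun n => (1 - qpt (h n) Y v) / (h n)%:C) z.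
  apply: ccvg_eq (ccvgV z0 H); apply: nearW => n.
  by rewrite invfM invrK mulrC.
apply: (@ccvg_squeeze _ _ _ (fun n => h n * (9 * normc z ^+ 2))); last first.
  by rewrite -[X in _ --> X](mul0r (9 * normc z ^+ 2)); apply: cvgM => //; exact: cvg_cst.
have nz := normc_gt0 z0.
have nz1 : 0 < (normc z)^-1 by rewrite invr_gt0.
have := h0 => /cvgrPdist_le/(_ _ nz1); apply: filterS => n.
rewrite sub0r normrN gtr0_norm// => hz.
have := @normc_cexp_quad R (- ((h n)%:C * z)).
rewrite normcN normcM normcR gtr0_norm// => H.
have {}H := H _.
have -> : (1 - qpt (h n) Y v) / (h n)%:C - z =
   - ((cexp (- ((h n)%:C * z)) - 1 - - ((h n)%:C * z)) / (h n)%:C).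
  by rewrite /qpt -/z; field; exact: hC.
rewrite normcN normcM normcV normcR gtr0_norm// ler_pdivrMr//.
apply: le_trans (H _) _.
  by rewrite -ler_pdivlMr// mul1r.
rewrite le_eqVlt; apply/orP; left; apply/eqP; ring.
Qed.

End geometric_kernel.

(** * Riemann sums of functions dominated by a nonincreasing one *)

Section riemann_sums.
Context {R : realType}.
Local Notation mu := (@lebesgue_measure R).

(** Open on the left, with the right end as sample point: 0 is never sampled, and the step function
    of a nonincreasing function stays below the function. *)
Definition step_itv (h : R) (k : nat) : set R := `](k%:R * h), (k.+1%:R * h)].

Lemma step_itv_ex (h s : R) : 0 < h -> 0 < s -> exists k, step_itv h k s.
Proof.
move=> h0 s0.
have ex : exists n : nat, s <= n%:R * h.
  exists (Num.truncn (s / h)).+1; rewrite -ler_pdivrMr//.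
  by apply: ltW; exact: truncnS_gt.
case: (ex_minnP ex) => n sn nmin.
case: n sn nmin => [|k] sn nmin; first by move: sn; rewrite mul0r leNgt s0.
exists k; rewrite /step_itv /= in_itv/= sn andbT ltNge.
by apply/negP => /nmin; rewrite ltnn.
Qed.

Lemma step_itv_uniq (h s : R) (j k : nat) : 0 < h ->
  step_itv h j s -> step_itv h k s -> j = k.
Proof.
move=> h0; rewrite /step_itv /= !in_itv/= => /andP[j1 j2] /andP[k1 k2].
have h1 := lt_le_trans j1 k2; have h2 := lt_le_trans k1 j2.
move: h1 h2; rewrite !ltr_pM2r// !ltr_nat !ltnS => h1 h2.
by apply/eqP; rewrite eqn_leq h1 h2.
Qed.

Lemma step_itv_sub (h : R) k : 0 < h -> step_itv h k `<=` `]0, +oo[.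
Proof.
move=> h0 s; rewrite /step_itv /= !in_itv/= andbT => /andP[h1 _].
by apply: le_lt_trans h1; rewrite mulr_ge0// ltW.
Qed.

Definition step_fun (h : R) (N : nat) (f : R -> R[i]) (s : R) : R[i] :=
  \sum_(k < N) f (k.+1%:R * h) * (\1_(step_itv h k) s : R)%:C.

Lemma step_funE (h : R) N f (s : R) k : 0 < h -> step_itv h k s ->
  step_fun h N f s = if (k < N)%N then f (k.+1%:R * h) else 0.
Proof.
move=> h0 ks; rewrite /step_fun; case: ifPn => [kN|].
  rewrite (bigD1 (Ordinal kN))//= indicE mem_set// mulr1 big1 ?addr0//.
  move=> j jk; rewrite indicE memNset ?mulr0// => js.
  by move: jk; rewrite -val_eqE/= (step_itv_uniq h0 js ks) eqxx.
rewrite -leqNgt => Nk; rewrite big1// => j _.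
rewrite indicE memNset ?mulr0// => js.
have := ltn_ord j; rewrite (step_itv_uniq h0 js ks) => kN.
by move: Nk; rewrite leqNgt kN.
Qed.

Lemma mu_step_itv (h : R) k : 0 < h -> mu (step_itv h k) = h%:E.
Proof.
move=> h0; rewrite /step_itv lebesgue_measure_itv/= lte_fin ltr_pM2r// ltr_nat ltnSn.
by rewrite -EFinB -mulrBl -natrB// subSnn mul1r.
Qed.

Lemma measurable_step_itv (h : R) k : measurable (step_itv h k : set (measurableTypeR R)).
Proof. exact: measurable_itv. Qed.

Lemma cmeasurable_step_fun h N f (D : set (measurableTypeR R)) : cmeasurable D (step_fun h N f).
Proof.
apply: (@cmeasurable_sum _ _ _ D N (fun k (s : measurableTypeR R) => f (k.+1%:R * h) * (\1_(step_itv h k) s : R)%:C)) => k.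
apply: cmeasurableM; first exact: cmeasurable_cst.
apply: cmeasurable_real; apply: measurable_funTS; apply: measurable_indic.
exact: measurable_step_itv.
Qed.

Lemma integrable_step_itv (h : R) k : 0 < h ->
  mu.-integrable `]0, +oo[ (EFin \o (fun s => \1_(step_itv h k) s : R)).
Proof.
move=> h0; apply: (@integrableS _ _ _ _ setT) => //.
exact: integrable_indic_itv.
Qed.

Lemma cintegral_step_fun (h : R) N f : 0 < h ->
  cintegral mu `]0, +oo[ (step_fun h N f) = \sum_(k < N) h%:C * f (k.+1%:R * h).
Proof.
move=> h0.
have ii (k : nat) : cintegrable mu `]0, +oo[
    (fun s : measurableTypeR R => f (k.+1%:R * h) * (\1_(step_itv h k) s : R)%:C).
  by apply: cintegrableMl => //; apply: cintegrable_real => //; exact: integrable_step_itv.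
rewrite (@cintegral_sum _ _ _ _ _ _ _ (fun (k : nat) (s : measurableTypeR R) =>
  f (k.+1%:R * h) * (\1_(step_itv h k) s : R)%:C))//.
apply: eq_bigr => k _; rewrite cintegralMl//; last first.
  by apply: cintegrable_real => //; exact: integrable_step_itv.
rewrite cintegral_real mulrC; congr (_%:C * _).
rewrite /Rintegral integral_indic//; last exact: measurable_itv.
rewrite (_ : _ `&` _ = step_itv h k); first by have /(congr1 fine) := mu_step_itv k h0.
by rewrite setIidl//; exact: step_itv_sub.
Qed.

Section bound.
Variables (g : R -> R).
Hypothesis g0 : forall s : R, 0 < s -> 0 <= g s.
Hypothesis g_noninc : forall s t : R, 0 < s -> s <= t -> g t <= g s.
Hypothesis ig : mu.-integrable `]0, +oo[ (EFin \o g).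

Lemma step_fun_le (h : R) N f (s : R) : 0 < h -> 0 < s ->
  (forall t : R, 0 < t -> normc (f t) <= g t) -> normc (step_fun h N f s) <= g s.
Proof.
move=> h0 s0 fg; have [k ks] := step_itv_ex h0 s0.
rewrite (step_funE _ _ h0 ks); case: ifPn => _; last by rewrite normc0 g0.
have kh : 0 < k.+1%:R * h by rewrite mulr_gt0.
apply: le_trans (fg _ kh) _; apply: g_noninc => //.
by move: ks; rewrite /step_itv /= in_itv/= => /andP[].
Qed.

Lemma riemann_sum_le (h : R) N : 0 < h ->
  \sum_(k < N) h * g (k.+1%:R * h) <= \int[mu]_(s in `]0, +oo[) g s.
Proof.
move=> h0; pose f s : R[i] := (g s)%:C.
have fg (t : R) : 0 < t -> normc (f t) <= g t.
  by move=> t0; rewrite normcR ger0_norm ?g0.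
have si : cintegrable mu `]0, +oo[ (step_fun h N f).
  apply: (cintegrable_dom _ _ ig) => //; first exact: cmeasurable_step_fun.
  by move=> s; rewrite /= in_itv/= andbT => s0; exact: step_fun_le.
have -> : \sum_(k < N) h * g (k.+1%:R * h) = \int[mu]_(s in `]0, +oo[) Re (step_fun h N f s).
  have := congr1 (@complex.Re R) (cintegral_step_fun N f h0); rewrite [LHS]/= => ->.
  by rewrite Re_sum; apply: eq_bigr => k _; rewrite ReM /= mul0r subr0.
apply: le_Rintegral => //; first exact: si.1.
move=> s; rewrite /= in_itv/= andbT => s0.
by rewrite (le_trans (ler_norm _))// (le_trans (normc_Re _))// step_fun_le.
Qed.

(** Dominated convergence for step functions, with the monotone majorant [g] as dominating function.
    The mesh tends to 0 while the range [N h] tends to infinity, so the limit is the integral over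
    the whole half-line. *)
Lemma riemann_sum_cvg (f : R -> R[i]) (h : nat -> R) (N : nat -> nat) :
  (forall t : R, 0 < t -> normc (f t) <= g t) ->
  (forall (s : R) (u : nat -> R), 0 < s -> u @ \oo --> s -> ccvg (f \o u) (f s)) ->
  (forall n, 0 < h n) -> h @ \oo --> (0 : R) ->
  (forall A : R, \forall n \near \oo, A <= (N n)%:R * h n) ->
  cintegrable mu `]0, +oo[ f /\
  ccvg (fun n => \sum_(k < N n) (h n)%:C * f (k.+1%:R * h n)) (cintegral mu `]0, +oo[ f).
Proof.
move=> fg cf h0 hc Nh.
have pw (s : R) : 0 < s -> ccvg (fun n => step_fun (h n) (N n) f s) (f s).
  move=> s0.
  have kn_ex n : exists k, step_itv (h n) k s by exact: step_itv_ex.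
  pose k n := projT1 (cid (kn_ex n)).
  have ks n : step_itv (h n) (k n) s by rewrite /k; case: cid.
  pose u n := (k n).+1%:R * h n.
  have us : u @ \oo --> s.
    apply: (@squeeze_cvgr _ _ _ _ (fun=> s) (fun n => s + h n)).
    - apply: nearW => n; have := ks n; rewrite /step_itv /= in_itv/= => /andP[h1 h2].
      by rewrite /u h2/= -natr1 mulrDl mul1r lerD2r ltW.
    - exact: cvg_cst.
    - by rewrite -[X in _ --> X]addr0; apply: cvgD => //; exact: cvg_cst.
  apply: ccvg_eq (cf _ _ s0 us).
  (* Once [N h] exceeds [s], the step that contains [s] is among the [N] summed ones. *)
  apply: filterS (Nh (s + 1)) => n hn /=.
  rewrite (step_funE _ _ (h0 n) (ks n)) ifT//.
  have := ks n; rewrite /step_itv /= in_itv/= => /andP[h1 h2].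
  have : (k n)%:R * h n < (N n)%:R * h n by lra.
  by rewrite ltr_pM2r// ltr_nat.
have p0 (s : R) : `]0, +oo[%classic s -> 0 < s by rewrite /= in_itv/= andbT.
have [i c] : cintegrable mu `]0, +oo[ f /\
    ccvg (fun n => cintegral mu `]0, +oo[ (step_fun (h n) (N n) f)) (cintegral mu `]0, +oo[ f).
  apply: (cdominated _ _ _ ig) => //.
  - by move=> n; exact: cmeasurable_step_fun.
  - by move=> s /p0; exact: pw.
  - by move=> n s /p0 s0; exact: step_fun_le.
split=> //; apply: ccvg_eq c; apply: nearW => n.
by rewrite cintegral_step_fun.
Qed.

End bound.
End riemann_sums.

(** * Inversion of the transform *)

Section discrete_transform.
Context {R : realType}.
Local Notation mu := (@lebesgue_measure R).
Variables (Y Y' K : R) (a : R -> R[i]) (g : R -> R).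
Hypothesis Y'0 : 0 < Y'.
Hypothesis Y'Y : Y' < Y.
Hypothesis aK : forall s : R, 0 < s -> normc (a s) * expR (- (Y' * s)) <= K.
Hypothesis g0 : forall s : R, 0 < s -> 0 <= g s.
Hypothesis g_noninc : forall s t : R, 0 < s -> s <= t -> g t <= g s.
Hypothesis ig : mu.-integrable `]0, +oo[ (EFin \o g).
Hypothesis ag : forall s : R, 0 < s -> normc (a s - 1) / s * expR (- (Y' * s)) <= g s.

Let Y0 : 0 < Y. Proof. exact: lt_trans Y'Y. Qed.
(** This mass bounds all the logarithms [sum |a(k h) - 1| r^k / k], uniformly in the step and in the
    degree. *)
Definition gsum := \int[mu]_(s in `]0, +oo[) g s.
Local Notation G := gsum.

Lemma gsum_ge0 : 0 <= G.
Proof. by apply: Rintegral_ge0 => s; rewrite /= in_itv/= andbT; exact: g0. Qed.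

Lemma aK_ge0 : 0 <= K.
Proof. by apply: le_trans (aK ltr01); rewrite mulr_ge0 ?normc_ge0 ?expR_ge0. Qed.

Section fixed_step.
Variables (h : R) (m : nat -> R[i]).
Hypothesis h0 : 0 < h.
Hypothesis m0 : m 0%N = 1.
Hypothesis mS : forall j, j.+1%:R * m j.+1 = \sum_(k < j.+1) a (k.+1%:R * h) * m (j - k)%N.

Let ak k := a (k%:R * h).
Let d k := ak k - 1.
Let c := jump m.
Let cS j : j.+1%:R * c j.+1 = \sum_(k < j.+1) d k.+1 * c (j - k)%N.
Proof. by rewrite /c (@jump_recursion _ ak m). Qed.

(** Up to truncation, [logp] is the logarithm of [jump_poly], [jump_poly] is [1 - x] times
    [sum_poly], and [step_poly] is the other factor of the convolution in Spitzer's recursion; its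
    constant term is 0 because that convolution starts at [k = 1]. *)
Definition logp N := log_poly N d.
Definition jump_poly N := \poly_(i < N.+1) c i.
Definition sum_poly N := \poly_(i < N.+1) m i.
Definition step_poly N := \poly_(i < N.+1) (if i is 0%N then 0 else ak i).

(** [r] is the radius at which majorants are summed; [q0] below is the smaller radius of the circle
    of integration. *)
Let r := expR (- (Y' * h)).
Let r0 : 0 < r. Proof. exact: expR_gt0. Qed.
Let r1 : r < 1. Proof. by rewrite expR_lt1 oppr_lt0 mulr_gt0. Qed.
Let q0 := expR (- (Y * h)).
Let q00 : 0 < q0. Proof. exact: expR_gt0. Qed.
Let q0r : q0 <= r. Proof. by rewrite ler_expR lerN2 ler_wpM2r ?ltW. Qed.

(** Since [1 / k = h / (k h)], the sum is a Riemann sum of a function dominated by [g]. *)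
Lemma abs_logp_le N : (abs_poly (logp N)).[r] <= G.
Proof.
apply: le_trans (riemann_sum_le g0 g_noninc ig N h0).
have sz : (size (abs_poly (logp N)) <= N.+1)%N.
  by apply: leq_trans (size_poly _ _) _; exact: size_poly.
rewrite (horner_coef_wide _ sz) big_ord_recl/= coef_abs_poly coef_poly/= invr0 mulr0 normc0 mul0r add0r.
apply: ler_sum => k _; rewrite coef_abs_poly coef_poly /bump/= add1n ltnS ltn_ord.
have kh : 0 < k.+1%:R * h by rewrite mulr_gt0.
apply: le_trans (ler_wpM2l (ltW h0) (ag kh)).
rewrite normcM normcV -(rmorph_nat (real_complex R)) normcR ger0_norm// /d /ak.
rewrite /r -expRM_natl.
have -> : k.+1%:R * - (Y' * h) = - (Y' * (k.+1%:R * h)) by ring.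
rewrite le_eqVlt; apply/orP; left; apply/eqP.
have k0 : (k.+1%:R : R) != 0 by rewrite pnatr_eq0.
by move: (k.+1%:R : R) k0 => kk kk0; field; rewrite kk0 gt_eqF.
Qed.

Let normq v : normc (qpt h Y v) = q0. Proof. exact: normc_qpt. Qed.

Lemma logp_riemann N v : (logp N).[qpt h Y v] =
  \sum_(k < N) h%:C * (cexp (- ((Y +i* v) * (k.+1%:R * h)%:C)) *
    ((a (k.+1%:R * h) - 1) * ((k.+1%:R * h)^-1)%:C)).
Proof.
rewrite (horner_coef_wide _ (size_poly _ _)) big_ord_recl/= coef_poly/= invr0 mulr0 mul0r add0r.
apply: eq_bigr => k _; rewrite coef_poly /bump/= add1n ltnS ltn_ord /d /ak.
have -> : qpt h Y v ^+ k.+1 = cexp (- ((Y +i* v) * (k.+1%:R * h)%:C)).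
  rewrite /qpt -cexpMn; congr cexp; apply: complexP.
    by rewrite ReMn !ReN !ReM /=; ring.
  by rewrite ImMn !ImN !ImM /=; ring.
rewrite realCV realCM natC.
have hC : h%:C != 0 by rewrite (eq_complex _ 0) /= gt_eqF.
have kC : (k.+1%:R : R[i]) != 0 by rewrite pnatr_eq0.
by move: (k.+1%:R : R[i]) (cexp _) kC => kk ee kC; field; rewrite kC hC.
Qed.

Lemma jump_poly_le N (s : R) : 0 <= s -> s <= r -> (abs_poly (jump_poly N)).[s] <= expR G.
Proof.
move=> s0 sr; apply: le_trans (log_recursion_bound N m0 cS s0) _.
by rewrite ler_expR (le_trans (abs_poly_homo _ s0 sr))// abs_logp_le.
Qed.

Lemma normc_jump_poly N v : normc (jump_poly N).[qpt h Y v] <= expR G.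
Proof.
apply: le_trans (normc_horner _ _) _; rewrite normq.
by apply: jump_poly_le; rewrite ?(ltW q00).
Qed.

(** The ratio of the two radii is [exp(- (Y - Y') h)]; the error therefore vanishes as soon as [N h]
    grows faster than [log N]. *)
Lemma jump_poly_exp N v :
  normc ((jump_poly N).[qpt h Y v] - cexp (logp N).[qpt h Y v]) <=
  2 * expR (- ((Y - Y') * h * N%:R)) * (N%:R * G) * expR (G *+ 3).
Proof.
have qr : normc (qpt h Y v) <= r by rewrite normq.
apply: le_trans (log_recursion_exp N m0 cS qr r0) _; rewrite normq.
have -> : (q0 / r) ^+ N = expR (- ((Y - Y') * h * N%:R)).
  rewrite /q0 /r -expRN -expRD -expRM_natr; congr expR; ring.
have L0 : 0 <= (abs_poly (logp N)).[r] by rewrite abs_poly_ge0// ltW.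
have LG := abs_logp_le N.
apply: ler_pM.
- by rewrite !mulr_ge0 ?expR_ge0.
- exact: expR_ge0.
- by rewrite ler_wpM2l ?mulr_ge0 ?expR_ge0// ler_wpM2l.
- by rewrite ler_expR lerMn2r.
Qed.

(** [m N] is the sum of the jumps up to [N], and [r ^+ N <= r ^+ i] for their indices, so
    [r ^+ N * normc (m N)] is at most the majorant of [jump_poly] at [r]. Besides the truncation
    error, this controls the exponential moments of the maxima in [lindley_moment_bounded]. *)
Lemma normc_sum_tail N v :
  normc (m N * qpt h Y v ^+ N.+1) <= expR (- ((Y - Y') * h * N%:R)) * expR G.
Proof.
have mN : normc (m N) <= r ^- N * expR G.
  rewrite -(sum_jump m N) (le_trans (normc_sum _ _ _))//.
  rewrite (reindex_inj rev_ord_inj)/=.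
  rewrite mulrC ler_pdivlMr ?exprn_gt0//.
  apply: le_trans (jump_poly_le N (ltW r0) (lexx r)).
  have sz : (size (abs_poly (jump_poly N)) <= N.+1)%N.
    by apply: leq_trans (size_poly _ _) _; exact: size_poly.
  rewrite (horner_coef_wide _ sz) mulr_suml ler_sum// => i _.
  rewrite coef_abs_poly coef_poly ltn_ord subSS subKn; last by rewrite -ltnS.
  rewrite ler_wpM2l ?normc_ge0// ler_wiXn2l ?(ltW r0) ?(ltW r1)//.
  by rewrite -ltnS.
rewrite normcM normcX normq exprS.
have q01 : q0 <= 1 by rewrite (le_trans q0r)// ltW.
have h1 : normc (m N) * (q0 * q0 ^+ N) <= r ^- N * expR G * (1 * q0 ^+ N).
  apply: ler_pM => //; first exact: normc_ge0.
    by rewrite mulr_ge0 ?exprn_ge0 ?(ltW q00).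
  by rewrite ler_wpM2r ?exprn_ge0 ?(ltW q00).
apply: (le_trans h1); rewrite mul1r mulrAC ler_wpM2r ?expR_ge0//.
rewrite le_eqVlt; apply/orP; left; apply/eqP.
rewrite /q0 /r -!expRM_natr -expRN -expRD; congr expR; ring.
Qed.

Let q1 v : 1 - qpt h Y v != 0.
Proof.
apply/eqP => /subr0_eq e; have := normq v; rewrite -e normc1 => e1.
by have := le_lt_trans q0r r1; rewrite -e1 ltxx.
Qed.

Lemma sum_poly_horner N v : h%:C * (sum_poly N).[qpt h Y v] =
  (h%:C / (1 - qpt h Y v)) * ((jump_poly N).[qpt h Y v] - m N * qpt h Y v ^+ N.+1).
Proof.
have := congr1 (fun p : {poly R[i]} => p.[qpt h Y v]) (partial_sums_poly m N).
rewrite /= hornerM !hornerD !hornerN hornerM hornerC hornerX hornerXn hornerC => <-.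
by rewrite -/(sum_poly N); field; exact: q1.
Qed.

Lemma normc_sum_poly N v : `|v| <= pi / h ->
  normc (h%:C * (sum_poly N).[qpt h Y v]) <= 6 * expR (Y * h) * expR G / normc (Y +i* v).
Proof.
move=> vh; rewrite sum_poly_horner normcM.
have k1 := geometric_kernel_bound h0 Y0 vh.
have k2 := normc_jump_poly N v; have k3 := normc_sum_tail N v.
have e1 : expR (- ((Y - Y') * h * N%:R)) <= 1.
  by rewrite expR_le1 oppr_le0 !mulr_ge0 ?subr_ge0// ltW.
have k4 : expR (- ((Y - Y') * h * N%:R)) * expR G <= expR G by rewrite ler_piMl ?expR_ge0.
have k5 := normcB (jump_poly N).[qpt h Y v] (m N * qpt h Y v ^+ N.+1).
have k6 : normc ((jump_poly N).[qpt h Y v] - m N * qpt h Y v ^+ N.+1) <= 2 * expR G by lra.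
apply: le_trans (ler_pM (normc_ge0 _) (normc_ge0 _) k1 k6) _.
by rewrite le_eqVlt; apply/orP; left; apply/eqP; ring.
Qed.

(** Splitting [a = (a - 1) + 1]: the constant part is a geometric sum, whose kernel tends to
    [1 / z], and only the rest is kept as a Riemann sum. The limit then has the form of
    [density_transform]. *)
Lemma step_poly_riemann N v : h%:C * (step_poly N).[qpt h Y v] =
  \sum_(k < N) h%:C * (cexp (- ((Y +i* v) * (k.+1%:R * h)%:C)) * (a (k.+1%:R * h) - 1))
  + h%:C / (1 - qpt h Y v) * (qpt h Y v - qpt h Y v ^+ N.+1).
Proof.
have qk k : qpt h Y v ^+ k.+1 = cexp (- ((Y +i* v) * (k.+1%:R * h)%:C)).
  rewrite /qpt -cexpMn; congr cexp; apply: complexP.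
    by rewrite ReMn !ReN !ReM /=; ring.
  by rewrite ImMn !ImN !ImM /=; ring.
rewrite (horner_coef_wide _ (size_poly _ _)) big_ord_recl/= coef_poly/= mul0r add0r.
have -> : h%:C / (1 - qpt h Y v) * (qpt h Y v - qpt h Y v ^+ N.+1) =
    \sum_(k < N) h%:C * qpt h Y v ^+ k.+1.
  rewrite -mulr_sumr -mulrA; congr (_ * _).
  apply: (mulfI (q1 v)); rewrite mulrA mulfV ?q1// mul1r.
  have -> : qpt h Y v - qpt h Y v ^+ N.+1 = qpt h Y v * (1 - qpt h Y v ^+ N).
    by rewrite mulrBr mulr1 exprS.
  have := subrX1 (qpt h Y v) N => e.
  have -> : 1 - qpt h Y v ^+ N = (1 - qpt h Y v) * \sum_(i < N) qpt h Y v ^+ i.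
    by rewrite -[LHS]opprB e -mulNr opprB.
  by rewrite mulrCA mulr_sumr; congr (_ * _); apply: eq_bigr => i _; rewrite exprS.
rewrite mulr_sumr -big_split/=; apply: eq_bigr => k _.
rewrite coef_poly /bump/= add1n ltnS ltn_ord -qk /ak; ring.
Qed.

Lemma normc_step_coef k : normc (ak k.+1) * q0 ^+ k.+1 <= K * expR (- ((Y - Y') * (k.+1%:R * h))).
Proof.
have kh : 0 < k.+1%:R * h by rewrite mulr_gt0.
have := aK kh; rewrite -(ler_pM2r (expR_gt0 (- ((Y - Y') * (k.+1%:R * h))))) => H.
apply: le_trans H; rewrite /q0 -expRM_natl -mulrA -expRD /ak.
by rewrite le_eqVlt; apply/orP; left; apply/eqP; congr (_ * expR _); ring.
Qed.

Lemma coef_step_sum N n : (n < N)%N ->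
  (step_poly N * sum_poly N)`_n.+1 = n.+1%:R * m n.+1.
Proof.
move=> nN; rewrite coefM big_ord_recl/= coef_poly/= mul0r add0r mS.
apply: eq_bigr => k _; have kn := ltn_ord k.
have kN : (k < N)%N by apply: leq_trans nN.
have nkN : (n - k <= N)%N by rewrite (leq_trans (leq_subr _ _))// ltnW.
by rewrite !coef_poly /bump/= add1n ltnS kN subSS ltnS nkN.
Qed.

(** By the recursion [n m_n] is a coefficient of a product of two series. Both factors are needed
    for the limit: [sum_poly] alone decays like [1 / |z|], which is not integrable along the
    line. *)
Lemma extraction_formula N n : (n < N)%N ->
  cintegral mu `[- (pi / h), pi / h] (fun v =>
    (h%:C * (step_poly N).[qpt h Y v]) * (h%:C * (sum_poly N).[qpt h Y v]) *
    cexp ((n.+1%:R * h)%:C * (Y +i* v))) =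
  (2 * pi)%:C * ((n.+1%:R * h)%:C * m n.+1).
Proof.
move=> nN.
have H := @cintegral_coef R h Y h0 (step_poly N * sum_poly N) n.+1.
transitivity (cintegral mu `[- (pi / h), pi / h] (fun v => h%:C ^+ 2 *
   ((step_poly N * sum_poly N).[qpt h Y v] * cexp ((n.+1%:R * h)%:C * (Y +i* v))))).
  by apply: eq_cintegral => v _; rewrite hornerM; ring.
have phi : 0 < pi / h by rewrite divr_gt0 ?pi_gt0.
rewrite cintegralMl ?H//; last first.
  have [B HB] : exists B, forall v : R, normc ((step_poly N * sum_poly N).[qpt h Y v]
       * cexp ((n.+1%:R * h)%:C * (Y +i* v))) <= B.
    exists ((abs_poly (step_poly N * sum_poly N)).[q0] * expR (n.+1%:R * h * Y)) => v.
    rewrite normcM normc_cexp ReM /= mul0r subr0 ler_wpM2r ?expR_ge0//.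
    by rewrite -(normq v); exact: normc_horner.
  apply: (@cintegrable_bounded _ _ _ _ _ _ _ B) => //.
  - exact: mu_itv_lty.
  - apply: cmeasurableM.
      have mh (p : {poly R[i]}) : cmeasurable `[- (pi / h), pi / h] (fun v : measurableTypeR R => p.[qpt h Y v]).
        elim/poly_ind: p => [|p e IH].
          apply: eq_cmeasurable (cmeasurable_cst _ 0) => v _; by rewrite horner0.
        apply: eq_cmeasurable (cmeasurableD (cmeasurableM IH (cmeasurable_qpt h Y _)) (cmeasurable_cst _ e)) => v _.
        by rewrite !hornerE.
      exact: mh.
    apply: cmeasurable_cexp; apply: cmeasurableM; first exact: cmeasurable_cst.
    by split => /=; [exact: measurable_cst|exact: measurable_id].
rewrite coef_step_sum// !rmorphM/= fmorphV rmorph_nat.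
have hC : h%:C != 0 by rewrite (eq_complex _ 0) /= gt_eqF.
by field; exact: hC.
Qed.

End fixed_step.
End discrete_transform.

(** * Laplace transforms, differentiated along a vertical line *)

Section laplace_derivative.
Context {R : realType}.
Local Notation mu := (@lebesgue_measure R).

Lemma integrable_expRN (dl : R) : 0 < dl ->
  mu.-integrable `]0, +oo[ (EFin \o (fun s => expR (- (dl * s)))).
Proof.
move=> d0.
have h := integrable_exponential_pdf d0.
have h1 : mu.-integrable `]0, +oo[ (EFin \o exponential_pdf dl).
  by apply: integrableS h.
have mI : measurable (`]0, +oo[ : set (measurableTypeR R)) by exact: measurable_itv.
have h2 := integrableZl mI dl^-1 h1.
apply: eq_integrable h2 => //= s; rewrite inE/= in_itv/= andbT => s0.
rewrite exponential_pdfE; last exact: ltW.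
by rewrite -EFinM mulrA mulVf ?gt_eqF// mul1r mulNr.
Qed.

Variables (Y : R) (phi : R -> R[i]) (b : R -> R).
Hypothesis mphi : cmeasurable (`]0, +oo[ : set (measurableTypeR R)) phi.
Hypothesis ib : mu.-integrable `]0, +oo[ (EFin \o b).
Hypothesis phib : forall s : R, 0 < s -> (1 + s) * normc (phi s) * expR (- (Y * s)) <= b s.

Lemma laplace_integrand (v s : R) : cexp (- ((Y +i* v) * s%:C)) * phi s =
  (expR (- (Y * s)) * (cos (v * s) * Re (phi s) + sin (v * s) * Im (phi s))) +i*
  (expR (- (Y * s)) * (cos (v * s) * Im (phi s) - sin (v * s) * Re (phi s))).
Proof.
apply: complexP; rewrite /= ?(ReM (cexp _)) ?(ImM (cexp _)) Re_cexp Im_cexp.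
  by rewrite ReN ImN !ReM !ImM /= !mulr0 subr0 add0r cosN sinN; ring.
by rewrite ReN ImN !ReM !ImM /= !mulr0 subr0 add0r cosN sinN; ring.
Qed.

Lemma cmeasurable_laplace v : cmeasurable (`]0, +oo[ : set (measurableTypeR R))
  (fun s => cexp (- ((Y +i* v) * s%:C)) * phi s).
Proof.
apply: cmeasurableM => //; apply: cmeasurable_cexp; apply: cmeasurableN.
apply: cmeasurableM; first exact: cmeasurable_cst.
by apply: cmeasurable_real; exact: measurable_id.
Qed.

Lemma cintegrable_laplace v : cintegrable mu `]0, +oo[
  (fun s => cexp (- ((Y +i* v) * s%:C)) * phi s).
Proof.
apply: (cintegrable_dom _ (cmeasurable_laplace v) ib) => // s.
rewrite /= in_itv/= andbT => s0; apply: le_trans (phib s0).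
rewrite normcM normc_cexp ReN ReM /= mulr0 subr0 mulrC ler_wpM2r ?expR_ge0//.
by rewrite ler_peMl ?normc_ge0// lerDl ltW.
Qed.

(** In the hypothesis [phib] the weight [1 + s] serves twice: the summand 1 dominates the integrand,
    and [s] the factor produced by differentiating in [v]. *)
Lemma Re_laplace_derive (v : R) :
  is_derive v (1 : R) (fun x : R => \int[mu]_(s in `]0, +oo[) Re (cexp (- ((Y +i* x) * s%:C)) * phi s))
   (\int[mu]_(s in `]0, +oo[) Re (cexp (- ((Y +i* v) * s%:C)) * (phi s * (0 +i* - s)))).
Proof.
pose f (x s : R) := Re (cexp (- ((Y +i* x) * s%:C)) * phi s).
pose df (x s : R) := s * (expR (- (Y * s)) * (cos (x * s) * Im (phi s) - sin (x * s) * Re (phi s))).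
have fdf x s : is_derive x (1 : R) (f ^~ s) (df x s).
  rewrite (_ : f ^~ s = fun x => expR (- (Y * s)) * (cos (x * s) * Re (phi s) + sin (x * s) * Im (phi s))); last first.
    by apply/funext => y; rewrite /f laplace_integrand.
  apply: is_derive_eq; rewrite /GRing.scale/= /df; ring.
have Ia : `]v - 1, v + 1[%classic v by rewrite /= in_itv/=; apply/andP; split; lra.
have mI : measurable (`]0, +oo[ : set (measurableTypeR R)) by exact: measurable_itv.
have int_f x : `]v - 1, v + 1[%classic x -> mu.-integrable `]0, +oo[ (EFin \o f x).
  by move=> _; exact: (cintegrable_laplace x).1.
have der_f (x : R) (s : measurableTypeR R) : `]v - 1, v + 1[%classic x ->
    `]0, +oo[%classic s -> derivable (f ^~ s) x 1.
  by move=> _ _; have [] := fdf x s.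
have d1 x s : partial1of2 f x s = df x s.
  by rewrite partial1of2E; have [] := fdf x s.
(* The cosine and the sine term are bounded separately, whence the 2; the absolute value makes [B]
   nonnegative also off the half-line. *)
pose B (s : R) := 2 * `|b s|.
have B0 s : 0 <= B s by rewrite mulr_ge0.
have iB : mu.-integrable `]0, +oo[ (EFin \o B).
  exact: (integrableZl mI 2 (integrable_abse ib)).
have ubB (x : R) (s : measurableTypeR R) : `]v - 1, v + 1[%classic x ->
    `]0, +oo[%classic s -> `|partial1of2 f x s| <= B s.
  move=> _; rewrite /= in_itv/= andbT => s0; rewrite d1 /B.
  have h1 : (1 + s) * normc (phi s) * expR (- (Y * s)) <= `|b s|.
    by rewrite (le_trans (phib s0))// ler_norm.
  have e0 := expR_ge0 (- (Y * s)).
  have h2 : `|cos (x * s) * Im (phi s) - sin (x * s) * Re (phi s)| <= 2 * normc (phi s).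
    rewrite (le_trans (ler_normB _ _))// !normrM mulrDl !mul1r lerD//.
      by rewrite -[leRHS]mul1r ler_pM ?cos_max ?normc_Im.
    by rewrite -[leRHS]mul1r ler_pM ?sin_max ?normc_Re.
  rewrite /df !normrM (ger0_norm e0) (gtr0_norm s0).
  have h3 : s * (expR (- (Y * s)) * `|cos (x * s) * Im (phi s) - sin (x * s) * Re (phi s)|)
     <= s * (expR (- (Y * s)) * (2 * normc (phi s))).
    by rewrite ler_wpM2l ?(ltW s0)// ler_wpM2l.
  apply: (le_trans h3).
  have h4 : 0 <= normc (phi s) * expR (- (Y * s)) by rewrite mulr_ge0 ?normc_ge0.
  lra.
have D1 := derivable_under_integral mI Ia int_f der_f B0 iB ubB.
have D2 := differentiation_under_integral mI Ia int_f der_f B0 iB ubB.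
split; first exact: D1.
rewrite -derive1E D2; apply: eq_Rintegral => s _; rewrite d1 /df.
rewrite [X in _ = Re X](_ : _ = cexp (- ((Y +i* v) * s%:C)) * phi s * (0 +i* - s)) ?mulrA//.
by rewrite laplace_integrand /=; ring.
Qed.

End laplace_derivative.

Section laplace_cderive.
Context {R : realType}.
Local Notation mu := (@lebesgue_measure R).
Variables (Y : R) (phi : R -> R[i]) (b : R -> R).
Hypothesis mphi : cmeasurable (`]0, +oo[ : set (measurableTypeR R)) phi.
Hypothesis ib : mu.-integrable `]0, +oo[ (EFin \o b).
Hypothesis phib : forall s : R, 0 < s -> (1 + s) * normc (phi s) * expR (- (Y * s)) <= b s.

(** As [Im w = Re (- i w)], the imaginary part is the real part belonging to [- i phi]. *)
Lemma laplace_cderive (v : R) :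
  is_cderive v (fun x : R => cintegral mu `]0, +oo[ (fun s => cexp (- ((Y +i* x) * s%:C)) * phi s))
   (cintegral mu `]0, +oo[ (fun s => cexp (- ((Y +i* v) * s%:C)) * (phi s * (0 +i* - s)))).
Proof.
split; first exact: (Re_laplace_derive mphi ib phib).
have mphi' : cmeasurable (`]0, +oo[ : set (measurableTypeR R)) (fun s => (0 -i* 1) * phi s).
  by apply: cmeasurableM => //; exact: cmeasurable_cst.
have phib' (s : R) : 0 < s -> (1 + s) * normc ((0 -i* 1) * phi s) * expR (- (Y * s)) <= b s.
  move=> s0; rewrite normcM (_ : normc (0 -i* 1) = 1) ?mul1r ?phib//.
  by rewrite /= expr0n/= add0r sqrrN expr1n sqrtr1.
have := Re_laplace_derive mphi' ib phib' v.
have e (w : R[i]) : Re ((0 -i* 1) * w) = Im w by rewrite ReM /= mul0r mulN1r sub0r opprK.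
rewrite (_ : (fun x : R => _) = (fun x => Im (cintegral mu `]0, +oo[ (fun s => cexp (- ((Y +i* x) * s%:C)) * phi s)))); last first.
  by apply/funext => x /=; apply: eq_Rintegral => s _; rewrite mulrCA e.
rewrite (_ : \int[mu]_(s in `]0, +oo[) Re _ = Im (cintegral mu `]0, +oo[ (fun s => cexp (- ((Y +i* v) * s%:C)) * (phi s * (0 +i* - s))))) //.
by apply: eq_Rintegral => s _; rewrite -mulrA mulrCA e.
Qed.

End laplace_cderive.

Section ccvg_real.
Context {R : realType}.

Lemma ccvg_real (u : nat -> R) (l : R) : u @ \oo --> l -> ccvg (fun n => (u n)%:C) l%:C.
Proof.
move=> ul; rewrite /ccvg.
have -> : (fun n => normc ((u n)%:C - l%:C)) = (fun n => `|u n - l|).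
  by apply/funext => n; rewrite -rmorphB normcR.
rewrite -[X in _ --> X](normr0 R) -(subrr l).
by apply: cvg_norm; apply: cvgB => //; exact: cvg_cst.
Qed.

Lemma cvg_geo2 : (2 ^+ n)^-1 @[n --> \oo] --> (0 : R).
Proof.
rewrite (_ : (fun n => _) = GRing.exp (2^-1 : R)); last by apply/funext => n; rewrite exprVn.
by apply: cvg_expr; rewrite ger0_norm; lra.
Qed.

(** The truncation error with [N = (2 ^+ n) ^+ 2] terms, when [N h] is proportional to [2 ^+ n]. The
    cubic term of the exponential series is enough. *)
Lemma exp_beats_square (kp : R) : 0 < kp ->
  ((2 ^+ n) ^+ 2 * expR (- (kp * 2 ^+ n))) @[n --> \oo] --> (0 : R).
Proof.
move=> kp0; apply: (@squeeze0 _ _ (fun n => 6 / kp ^+ 3 * (2 ^+ n)^-1)); last first.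
  rewrite -[X in _ --> X](mulr0 (6 / kp ^+ 3)); apply: cvgM; first exact: cvg_cst.
  exact: cvg_geo2.
apply: nearW => n; set x : R := 2 ^+ n; have x0 : 0 < x by rewrite exprn_gt0.
rewrite mulr_ge0 ?sqr_ge0 ?expR_ge0//=.
have kx : 0 < kp * x by rewrite mulr_gt0.
have := @expR_ge1Dxn R (kp * x) 2 (ltW kx); rewrite (_ : 3`!%:R = 6) // => h.
have h3 : (kp * x) ^+ 3 / 6 <= expR (kp * x) by lra.
rewrite expRN ler_pdivrMr ?expR_gt0//.
have -> : x ^+ 2 = 6 / kp ^+ 3 / x * ((kp * x) ^+ 3 / 6) by field; lra.
by rewrite ler_wpM2l// !divr_ge0 ?exprn_ge0// ltW.
Qed.

End ccvg_real.

Section integrable_real.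
Context {R : realType} d {T : measurableType d}.
Variables (mu : {measure set T -> \bar R}) (D : set T).
Hypothesis mD : measurable D.

Lemma integrable_scale (k : R) (f : T -> R) : mu.-integrable D (EFin \o f) ->
  mu.-integrable D (EFin \o (fun x => k * f x)).
Proof. exact: integrableZl. Qed.

Lemma integrable_add (f g : T -> R) : mu.-integrable D (EFin \o f) ->
  mu.-integrable D (EFin \o g) -> mu.-integrable D (EFin \o (fun x => f x + g x)).
Proof. exact: integrableD. Qed.

End integrable_real.


(** * The limit of vanishing step *)

Section transform_inversion.
Context {R : realType}.
Local Notation mu := (@lebesgue_measure R).
Variables (t Y Y' K : R) (a : R -> R[i]) (g : R -> R).
Hypothesis t0 : 0 < t.
Hypothesis Y'0 : 0 < Y'.
Hypothesis Y'Y : Y' < Y.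
Hypothesis aK : forall s : R, 0 < s -> normc (a s) * expR (- (Y' * s)) <= K.
Hypothesis ac : forall (s : R) (u : nat -> R), 0 < s -> u @ \oo --> s -> ccvg (a \o u) (a s).
Hypothesis g0 : forall s : R, 0 < s -> 0 <= g s.
Hypothesis g_noninc : forall s t : R, 0 < s -> s <= t -> g t <= g s.
Hypothesis ig : mu.-integrable `]0, +oo[ (EFin \o g).
Hypothesis ag : forall s : R, 0 < s -> normc (a s - 1) / s * expR (- (Y' * s)) <= g s.

Let dl := Y - Y'.
Let dl0 : 0 < dl. Proof. by rewrite subr_gt0. Qed.
Let Y0 : 0 < Y. Proof. exact: lt_trans Y'Y. Qed.
Let K0 : 0 <= K. Proof. exact: aK_ge0 aK. Qed.
Local Notation G := (gsum g).
Let G0 : 0 <= G. Proof. exact: gsum_ge0. Qed.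

Let h (j : nat) : R := t / 2 ^+ j.
Let h0 j : 0 < h j. Proof. by rewrite divr_gt0// exprn_gt0. Qed.
Let h_cvg : h @ \oo --> (0 : R).
Proof.
by rewrite -[X in _ --> X](mulr0 t); apply: cvgM; [exact: cvg_cst|exact: cvg_geo2].
Qed.
Let h_le j : h j <= t.
Proof.
rewrite /h ler_pdivrMr ?exprn_gt0// ler_peMr ?(ltW t0)//.
by rewrite exprn_ege1// ler1n.
Qed.

(** With [4^j] terms of step [t / 2^j] the sums reach up to time [t 2^j]: mesh and range pass to
    their limits together, and the coefficient of index [2^j], which belongs to time [t], lies
    within the degree. *)
Let N (j : nat) : nat := (2 ^ j * 2 ^ j)%N.
Let Nh j : (N j)%:R * h j = t * 2 ^+ j.
Proof. by rewrite /N /h natrM !natrX; field; rewrite expf_neq0. Qed.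
Let Nh_oo (A : R) : \forall j \near \oo, A <= (N j)%:R * h j.
Proof.
have e0 : 0 < t / (`|A| + 1) by rewrite divr_gt0// ltr_wpDl.
have := cvg_geo2 (R := R) => /cvgrPdist_le/(_ _ e0); apply: filterS => j.
rewrite sub0r normrN gtr0_norm ?invr_gt0 ?exprn_gt0// => H.
have A1 : 0 < `|A| + 1 by rewrite ltr_wpDl.
have p0 : 0 < (2:R) ^+ j by rewrite exprn_gt0.
rewrite Nh; have : `|A| + 1 <= t * 2 ^+ j.
  by move: H; rewrite ler_pdivlMr// mulrC ler_pdivrMr.
have := ler_norm A; lra.
Qed.
Let half_turn (A : R) : \forall j \near \oo, A <= pi / h j.
Proof.
have := Nh_oo (A * t / pi * t); apply: filterS => j; rewrite Nh mulrC ler_pM2l// => H.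
have p0 := pi_gt0 R.
rewrite ler_pdivlMr// /h mulrA ler_pdivrMr ?exprn_gt0// mulrC.
by move: H; rewrite ler_pdivrMr// mulrC [leRHS]mulrC.
Qed.

Variables (m : nat -> nat -> R[i]) (l : R[i]).
Hypothesis m0 : forall j, m j 0%N = 1.
Hypothesis mS : forall j i, i.+1%:R * m j i.+1 =
  \sum_(k < i.+1) a (k.+1%:R * h j) * m j (i - k)%N.
Hypothesis ml : ccvg (fun j => m j (2 ^ j)%N) l.

(* With [a s = E exp(- beta L_s^+)] this is the logarithm of the ratio of ladder exponents at [Y + iv]. *)
Definition log_transform (v : R) : R[i] := cintegral mu `]0, +oo[
  (fun s => cexp (- ((Y +i* v) * s%:C)) * ((a s - 1) * (s^-1)%:C)).
(** The Laplace transform of [a] itself, its constant part 1 being integrated to [1 / z]. In this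
    form it is [i] times the derivative of [log_transform], plus [1 / z]. *)
Definition density_transform (v : R) : R[i] := cintegral mu `]0, +oo[
  (fun s => cexp (- ((Y +i* v) * s%:C)) * (a s - 1)) + (Y +i* v)^-1.
(** The integrand of the inversion formula, once [ladder_up_ratio] has identified the exponential of
    [log_transform] with the ratio of ladder exponents. *)
Definition resolvent_kernel (v : R) : R[i] :=
  cexp (t%:C * (Y +i* v)) * cexp (log_transform v) * (Y +i* v)^-1.
Let RI := log_transform.
Let uf := density_transform.

Let logpj j v := (logp a (h j) (N j)).[qpt (h j) Y v].
(** [W] tends to [exp(log_transform) / z] and is bounded by a constant over [|z|]; [U] tends to
    [density_transform] and is bounded both uniformly and in mean square. *)
Let W j v := (h j)%:C * (sum_poly (m j) (N j)).[qpt (h j) Y v].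
Let U j v := (h j)%:C * (step_poly a (h j) (N j)).[qpt (h j) Y v].

Let ccvg_kernel (v s : R) (u : nat -> R) : u @ \oo --> s ->
  ccvg (fun n => cexp (- ((Y +i* v) * (u n)%:C))) (cexp (- ((Y +i* v) * s%:C))).
Proof.
move=> us; apply: ccvg_cexp; apply: ccvgN; apply: ccvgM; first exact: ccvg_cst.
exact: ccvg_real.
Qed.

Let normc_kernel (v s : R) : normc (cexp (- ((Y +i* v) * s%:C))) = expR (- (Y * s)).
Proof. by rewrite normc_cexp ReN ReM /= mulr0 subr0. Qed.

Let exp_split (s : R) : expR (- (Y * s)) = expR (- (Y' * s)) * expR (- (dl * s)).
Proof. by rewrite -expRD; congr expR; rewrite /dl; ring. Qed.

Let aB1 (s : R) : 0 < s -> normc (a s - 1) * expR (- (Y' * s)) <= K + 1.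
Proof.
move=> s0; have := normcB (a s) 1; rewrite normc1 => h1.
have e0 := expR_ge0 (- (Y' * s)).
have e1 : expR (- (Y' * s)) <= 1 by rewrite expR_le1 oppr_le0 mulr_ge0// ltW.
have h2 := ler_wpM2r e0 h1; rewrite mulrDl mul1r in h2.
have := aK s0; lra.
Qed.

Let g2 (s : R) : R := (K + 1) * expR (- (dl * s)).
Let g20 (s : R) : 0 < s -> 0 <= g2 s.
Proof. by move=> _; rewrite mulr_ge0 ?expR_ge0// addr_ge0. Qed.
Let g2_noninc (s r : R) : 0 < s -> s <= r -> g2 r <= g2 s.
Proof.
move=> s0 sr; rewrite ler_wpM2l ?addr_ge0// ler_expR lerN2 ler_wpM2l//.
exact: ltW.
Qed.
Let mI : measurable (`]0, +oo[ : set (measurableTypeR R)). Proof. exact: measurable_itv. Qed.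
Let ig2 : mu.-integrable `]0, +oo[ (EFin \o g2).
Proof. exact: (integrableZl mI (K + 1) (integrable_expRN dl0)). Qed.

Let phi1 (s : R) : R[i] := (a s - 1) * (s^-1)%:C.
Let phi2 (s : R) : R[i] := a s - 1.

Let phi1_cvg (v : R) : cintegrable mu `]0, +oo[ (fun s => cexp (- ((Y +i* v) * s%:C)) * phi1 s) /\
  ccvg (fun j => logpj j v) (RI v).
Proof.
have [i c] : cintegrable mu `]0, +oo[ (fun s => cexp (- ((Y +i* v) * s%:C)) * phi1 s) /\
    ccvg (fun j => \sum_(k < N j) (h j)%:C * (cexp (- ((Y +i* v) * (k.+1%:R * h j)%:C)) * phi1 (k.+1%:R * h j))) (RI v).
  apply: (@riemann_sum_cvg R g g0 g_noninc ig (fun s => cexp (- ((Y +i* v) * s%:C)) * phi1 s) h N).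
  - move=> s s0; rewrite normcM normc_kernel; apply: le_trans (ag s0).
    rewrite normcM normcR gtr0_norm ?invr_gt0// mulrC ler_wpM2l ?divr_ge0 ?normc_ge0 ?(ltW s0)//.
    by rewrite ler_expR lerN2 ler_wpM2r ?(ltW s0) ?(ltW Y'Y).
  - move=> s u s0 us; apply: ccvgM; first exact: ccvg_kernel.
    apply: ccvgM; first by apply: ccvgB; [exact: ac|exact: ccvg_cst].
    by apply: ccvg_real; apply: cvgV => //; rewrite gt_eqF.
  - exact: h0.
  - exact: h_cvg.
  - exact: Nh_oo.
split=> //; apply: ccvg_eq c; apply: nearW => j.
by rewrite /logpj logp_riemann.
Qed.

Let phi2_cvg (v : R) : cintegrable mu `]0, +oo[ (fun s => cexp (- ((Y +i* v) * s%:C)) * phi2 s) /\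
  ccvg (fun j => \sum_(k < N j) (h j)%:C * (cexp (- ((Y +i* v) * (k.+1%:R * h j)%:C)) * phi2 (k.+1%:R * h j)))
   (cintegral mu `]0, +oo[ (fun s => cexp (- ((Y +i* v) * s%:C)) * phi2 s)).
Proof.
apply: (@riemann_sum_cvg R g2 g20 g2_noninc ig2 (fun s => cexp (- ((Y +i* v) * s%:C)) * phi2 s) h N).
- move=> s s0; rewrite normcM normc_kernel exp_split /g2 mulrC mulrA ler_wpM2r ?expR_ge0//.
  exact: aB1.
- move=> s u s0 us; apply: ccvgM; first exact: ccvg_kernel.
  by apply: ccvgB; [exact: ac|exact: ccvg_cst].
- exact: h0.
- exact: h_cvg.
- exact: Nh_oo.
Qed.

(** Measurability of [phi] is recovered from the damped integrand at [v = 0] by multiplying the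
    exponential away. *)
Let mphi (phi : R -> R[i]) : cintegrable mu `]0, +oo[ (fun s => cexp (- ((Y +i* 0) * s%:C)) * phi s) ->
  cmeasurable (`]0, +oo[ : set (measurableTypeR R)) phi.
Proof.
move/cintegrable_cmeasurable => H.
have mk : cmeasurable (`]0, +oo[ : set (measurableTypeR R)) (fun s : measurableTypeR R => cexp ((Y +i* 0) * s%:C)).
  apply: cmeasurable_cexp; apply: cmeasurableM; first exact: cmeasurable_cst.
  by apply: cmeasurable_real; exact: measurable_id.
apply: eq_cmeasurable (cmeasurableM mk H) => s _.
by rewrite mulrA -cexpD subrr cexp0 mul1r.
Qed.

Let exp_err j : expR (- ((Y - Y') * h j * (N j)%:R)) = expR (- (dl * t * 2 ^+ j)).
Proof. by congr expR; rewrite -mulrA (mulrC (h j)) Nh /dl; ring. Qed.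

Let err_cvg : (N j)%:R * expR (- ((Y - Y') * h j * (N j)%:R)) @[j --> \oo] --> (0 : R).
Proof.
have dt : 0 < dl * t by rewrite mulr_gt0.
rewrite (_ : (fun j => _) = (fun j => (2 ^+ j) ^+ 2 * expR (- (dl * t * 2 ^+ j)))).
  exact: exp_beats_square.
by apply/funext => j; rewrite exp_err /N natrM !natrX expr2.
Qed.

Let err_cvg1 : expR (- ((Y - Y') * h j * (N j)%:R)) @[j --> \oo] --> (0 : R).
Proof.
apply: squeeze0 err_cvg; apply: nearW => j; rewrite expR_ge0/=.
by rewrite ler_peMl ?expR_ge0// ler1n /N muln_gt0 expn_gt0.
Qed.

Let jump_cvg v : ccvg (fun j => (jump_poly (m j) (N j)).[qpt (h j) Y v]) (cexp (RI v)).
Proof.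
have H : ccvg (fun j => (jump_poly (m j) (N j)).[qpt (h j) Y v] - cexp (logpj j v)) 0.
  apply: (@ccvg_squeeze _ _ _ (fun j => 2 * ((N j)%:R * expR (- ((Y - Y') * h j * (N j)%:R))) * (G * expR (G *+ 3)))).
    apply: nearW => j; rewrite subr0.
    apply: le_trans (jump_poly_exp Y'Y g0 g_noninc ig ag (h0 j) (m0 j) (mS j) _ _) _.
    by rewrite le_eqVlt; apply/orP; left; apply/eqP; ring.
  rewrite -[X in _ --> X](mul0r (G * expR (G *+ 3))); apply: cvgM; last exact: cvg_cst.
  by rewrite -[X in _ --> X](mulr0 2); apply: cvgM => //; exact: cvg_cst.
have := ccvgD H (ccvg_cexp (phi1_cvg v).2); rewrite add0r.
by apply: ccvg_eq; apply: nearW => j; rewrite subrK.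
Qed.

Let tail_cvg v : ccvg (fun j => m j (N j) * qpt (h j) Y v ^+ (N j).+1) 0.
Proof.
apply: (@ccvg_squeeze _ _ _ (fun j => expR (- ((Y - Y') * h j * (N j)%:R)) * expR G)).
  apply: nearW => j; rewrite subr0.
  exact: (normc_sum_tail Y'0 Y'Y g0 g_noninc ig ag (h0 j) (m0 j) (mS j)).
by rewrite -[X in _ --> X](mul0r (expR G)); apply: cvgM => //; exact: cvg_cst.
Qed.

Let W_cvg v : ccvg (W ^~ v) (cexp (RI v) * (Y +i* v)^-1).
Proof.
rewrite mulrC -[X in _ * X]subr0.
have := ccvgM (geometric_kernel_cvg v Y0 h0 h_cvg) (ccvgB (jump_cvg v) (tail_cvg v)).
apply: ccvg_eq; apply: nearW => j.
by rewrite /W (sum_poly_horner Y'0 Y'Y).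
Qed.

Let U_cvg v : ccvg (U ^~ v) (uf v).
Proof.
have h1 : ccvg (fun j => qpt (h j) Y v) 1.
  have := @ccvg_cexp _ (fun j => - ((h j)%:C * (Y +i* v))) 0.
  rewrite cexp0; apply; rewrite -oppr0 -(mul0r (Y +i* v)).
  by apply: ccvgN; apply: ccvgM; [exact: ccvg_real|exact: ccvg_cst].
have h2 : ccvg (fun j => qpt (h j) Y v ^+ (N j).+1) 0.
  apply: (@ccvg_squeeze _ _ _ (fun j => expR (- ((Y - Y') * h j * (N j)%:R)))) => //.
  apply: nearW => j; rewrite subr0 normcX normc_qpt -expRM_natr ler_expR.
  have := h0 j => hj; rewrite mulNr lerN2 -natr1 mulrDr mulr1.
  apply: (@le_trans _ _ (Y * h j * (N j)%:R)); last by rewrite lerDl mulr_ge0 ?ltW.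
  by rewrite ler_wpM2r// ler_wpM2r ?(ltW hj)// gerBl ltW.
have := ccvgD (phi2_cvg v).2 (ccvgM (geometric_kernel_cvg v Y0 h0 h_cvg) (ccvgB h1 h2)).
rewrite subr0 mulr1 -/(uf v); apply: ccvg_eq; apply: nearW => j.
by rewrite /U (step_poly_riemann _ Y'0 Y'Y (h0 j)).
Qed.

Let C2 := 6 * expR (Y * t) * expR G.
Let C20 : 0 < C2. Proof. by rewrite !mulr_gt0 ?expR_gt0. Qed.

Let normc_z (v : R) : 0 < normc (Y +i* v).
Proof. by apply: normc_gt0; rewrite eq_complex /= gt_eqF. Qed.

Let W_bound j v : `|v| <= pi / h j -> normc (W j v) <= C2 / normc (Y +i* v).
Proof.
move=> vh; apply: le_trans (normc_sum_poly Y'0 Y'Y g0 g_noninc ig ag (h0 j) (m0 j) (mS j) _ vh) _.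
rewrite /C2 ler_wpM2r ?invr_ge0 ?normc_ge0// ler_wpM2r ?expR_ge0// ler_wpM2l//.
by rewrite ler_expR ler_wpM2l ?(ltW Y0).
Qed.

Let g3 (s : R) : R := K * expR (- (dl * s)).
Let C5 := \int[mu]_(s in `]0, +oo[) g3 s.
Let U_bound j v : normc (U j v) <= C5.
Proof.
have g30 (s : R) : 0 < s -> 0 <= g3 s by move=> _; rewrite mulr_ge0 ?expR_ge0.
have g3n (s r : R) : 0 < s -> s <= r -> g3 r <= g3 s.
  by move=> s0 sr; rewrite ler_wpM2l// ler_expR lerN2 ler_wpM2l// ltW.
have ig3 : mu.-integrable `]0, +oo[ (EFin \o g3).
  exact: (integrableZl mI K (integrable_expRN dl0)).
apply: le_trans (riemann_sum_le g30 g3n ig3 (N j) (h0 j)).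
rewrite /U normcM normcR gtr0_norm// -mulr_sumr ler_wpM2l ?(ltW (h0 j))//.
apply: le_trans (normc_horner _ _) _; rewrite normc_qpt.
have sz : (size (abs_poly (step_poly a (h j) (N j))) <= (N j).+1)%N.
  by apply: leq_trans (size_poly _ _) _; exact: size_poly.
rewrite (horner_coef_wide _ sz) big_ord_recl [X in X + _](_ : _ = 0) ?add0r; last first.
  by rewrite coef_abs_poly coef_poly normc0 mul0r.
apply: ler_sum => k _; rewrite coef_abs_poly coef_poly lift0 ltnS ltn_ord.
exact: (normc_step_coef _ aK (h0 j)).
Qed.

Let g4 (s : R) : R := K ^+ 2 * expR (- (dl * 2 * s)).
Let C3 := 2 * pi * \int[mu]_(s in `]0, +oo[) g4 s.
(** Parseval's identity turns the mean square into [2 pi / h] times the sum of the squared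
    coefficients of [U], which is at most a Riemann sum of [2 pi K^2 exp(- 2 (Y - Y') s)]. The
    growing window does not affect the bound. *)
Let U_parseval j : \int[mu]_(v in `[- (pi / h j), pi / h j]) (normc (U j v) ^+ 2) <= C3.
Proof.
have dl2 : 0 < dl * 2 by rewrite mulr_gt0.
have g40 (s : R) : 0 < s -> 0 <= g4 s by move=> _; rewrite mulr_ge0 ?sqr_ge0 ?expR_ge0.
have g4n (s r : R) : 0 < s -> s <= r -> g4 r <= g4 s.
  by move=> s0 sr; rewrite ler_wpM2l ?sqr_ge0// ler_expR lerN2 ler_wpM2l// ltW.
have ig4 : mu.-integrable `]0, +oo[ (EFin \o g4).
  exact: (integrableZl mI (K ^+ 2) (integrable_expRN dl2)).
rewrite /C3; have p0 := pi_gt0 R.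
apply: le_trans (ler_wpM2l _ (riemann_sum_le g40 g4n ig4 (N j) (h0 j))); last by rewrite mulr_ge0// ltW.
have hj := h0 j.
pose p := (h j)%:C *: step_poly a (h j) (N j).
have sz : (size p <= (N j).+1)%N by apply: leq_trans (size_scale_leq _ _) _; exact: size_poly.
have -> : \int[mu]_(v in `[- (pi / h j), pi / h j]) (normc (U j v) ^+ 2) =
    \int[mu]_(v in `[- (pi / h j), pi / h j]) (normc p.[qpt (h j) Y v] ^+ 2).
  by apply: eq_Rintegral => v _; rewrite /U /p hornerZ.
rewrite (parseval Y hj sz) -mulrA ler_pM2l ?mulr_gt0// mulrC ler_pdivrMr//.
rewrite big_ord_recl [X in X + _](_ : _ = 0) ?add0r; last first.
  by rewrite coefZ coef_poly mulr0 normc0 mul0r expr0n.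
rewrite mulr_suml.
apply: ler_sum => k _; rewrite coefZ coef_poly lift0 ltnS ltn_ord.
rewrite normcM normcR gtr0_norm//.
have := normc_step_coef Y aK hj k; rewrite -expRM_natl.
have -> : k.+1%:R * - (Y * h j) = - (Y * (k.+1%:R * h j)) by ring.
move=> H.
have -> : h j * g4 (k.+1%:R * h j) * h j = (h j * (K * expR (- ((Y - Y') * (k.+1%:R * h j))))) ^+ 2.
  rewrite /g4 (_ : dl * 2 * (k.+1%:R * h j) = dl * (k.+1%:R * h j) + dl * (k.+1%:R * h j)); last by ring.
  by rewrite opprD expRD /dl; ring.
rewrite lerXn2r ?nnegrE//.
- by apply: mulr_ge0; rewrite ?expR_ge0// mulr_ge0 ?normc_ge0 ?(ltW hj).
- by apply: mulr_ge0; rewrite ?(ltW hj)// mulr_ge0 ?expR_ge0.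
- by rewrite -mulrA ler_wpM2l// ltW.
Qed.

Let itv_normle (A v : R) : `[- A, A]%classic v -> `|v| <= A.
Proof. by rewrite /= in_itv/= ler_norml. Qed.

Let measurable_uv j : cmeasurable (setT : set (measurableTypeR R))
  (fun v => U j v * W j v * cexp (t%:C * (Y +i* v))).
Proof.
have mh (p : {poly R[i]}) : cmeasurable setT (fun v : measurableTypeR R => p.[qpt (h j) Y v]).
  elim/poly_ind: p => [|p e IH].
    by apply: eq_cmeasurable (cmeasurable_cst _ 0) => v _; rewrite horner0.
  apply: eq_cmeasurable (cmeasurableD (cmeasurableM IH (cmeasurable_qpt (h j) Y _)) (cmeasurable_cst _ e)) => v _.
  by rewrite !hornerE.
apply: cmeasurableM; first by apply: cmeasurableM; apply: cmeasurableM;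
  first [exact: cmeasurable_cst|exact: mh].
apply: cmeasurable_cexp; apply: cmeasurableM; first exact: cmeasurable_cst.
by split => /=; [exact: measurable_cst|exact: measurable_id].
Qed.

Let F j (v : R) := U j v * W j v * cexp (t%:C * (Y +i* v)).
Let Flim (v : R) := uf v * resolvent_kernel v.

Let normc_tz v : normc (cexp (t%:C * (Y +i* v))) = expR (Y * t).
Proof. by rewrite normc_cexp ReM /= mul0r subr0 mulrC. Qed.

Let C50 : 0 <= C5.
Proof. exact: le_trans (normc_ge0 _) (U_bound 0 0). Qed.

Let F_bound j v : `|v| <= pi / h j ->
  normc (F j v) <= normc (U j v) * (C2 / normc (Y +i* v)) * expR (Y * t).
Proof.
move=> vh; rewrite /F normcM normc_tz ler_wpM2r ?expR_ge0// normcM ler_wpM2l ?normc_ge0//.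
exact: W_bound.
Qed.

Let bulk_cvg (A : R) :
  ccvg (fun j => cintegral mu `[- A, A] (F j)) (cintegral mu `[- A, A] Flim).
Proof.
(* The bound on [W] requires [A <= pi / h j]. Setting the finitely many other terms to 0 leaves the
   limit unchanged and makes the domination valid for all [j]. *)
pose F' j v := if A <= pi / h j then F j v else 0.
have mF' j : cmeasurable (`[- A, A] : set (measurableTypeR R)) (F' j).
  rewrite /F'; case: (A <= pi / h j); last exact: cmeasurable_cst.
  exact: cmeasurableTS (measurable_uv j).
pose B := C5 * (C2 / Y) * expR (Y * t).
have [_ c] : cintegrable mu `[- A, A] Flim /\
    ccvg (fun j => cintegral mu `[- A, A] (F' j)) (cintegral mu `[- A, A] Flim).
  apply: (@cdominated _ _ _ _ _ _ _ _ (fun=> B)) => //.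
  - move=> v vA.
    have := ccvgM (ccvgM (U_cvg v) (W_cvg v)) (ccvg_cst (cexp (t%:C * (Y +i* v)))).
    have -> : uf v * (cexp (RI v) / (Y +i* v)) * cexp (t%:C * (Y +i* v)) = Flim v.
      by rewrite /Flim /resolvent_kernel -/(RI v); ring.
    apply: ccvg_eq; apply: filterS (half_turn A) => j Aj.
    by rewrite /F' Aj.
  - apply: (@measurable_bounded_integrable) => //.
    + exact: mu_itv_lty.
    + exists `|B|; split; first exact: num_real.
      by move=> x Bx v _ /=; exact: ltW.
  - move=> j v vA; rewrite /F'; case: ifPn => [Aj|_]; last first.
      by rewrite normc0 !mulr_ge0 ?expR_ge0 ?invr_ge0 ?(ltW C20) ?(ltW Y0).
    apply: le_trans (F_bound (le_trans (itv_normle vA) Aj)) _.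
    rewrite ler_wpM2r ?expR_ge0// ler_pM ?normc_ge0 ?U_bound//.
      by rewrite divr_ge0 ?normc_ge0 ?(ltW C20).
    rewrite ler_wpM2l ?(ltW C20)// lef_pV2 ?posrE//.
    by rewrite (le_trans _ (normc_Re _))//= ler_norm.
apply: ccvg_eq c; apply: filterS (half_turn A) => j Aj.
by apply: eq_cintegral => v _; rewrite /F' Aj.
Qed.

(** Over a full window the integral is known exactly for every [j]: it extracts the coefficient of
    index [2^j], whose time is [2^j h = t]. Only the convergence of the [m j (2 ^ j)] enters the
    limit. *)
Let big_cvg : ccvg (fun j => cintegral mu `[- (pi / h j), pi / h j] (F j)) ((2 * pi)%:C * (t%:C * l)).
Proof.
have := ccvgM (ccvg_cst (2 * pi)%:C) (ccvgM (ccvg_cst t%:C) ml).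
apply: ccvg_eq; apply: nearW => j.
have e : (2 ^ j)%N = (2 ^ j).-1.+1 by rewrite prednK// expn_gt0.
have jN : ((2 ^ j).-1 < N j)%N.
  by rewrite -ltnS -e ltnS /N leq_pmull// expn_gt0.
have := extraction_formula Y (h0 j) (mS j) jN; rewrite -e.
have -> : (2 ^ j)%:R * h j = t by rewrite /h natrX; field; rewrite expf_neq0.
by move=> <-.
Qed.

(** The primitive is [atan (v / A) / A], and [atan] takes values between [- pi / 2] and [pi / 2]. *)
Let integrable_atan (A b : R) : 0 < A -> 0 < b ->
  mu.-integrable `[- b, b] (EFin \o (fun v => (A ^+ 2 + v ^+ 2)^-1)) /\
  \int[mu]_(v in `[- b, b]) (A ^+ 2 + v ^+ 2)^-1 <= pi / A.
Proof.
move=> A0 b0.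
have p0 (v : R) : 0 < A ^+ 2 + v ^+ 2 by rewrite ltr_wpDr ?sqr_ge0 ?exprn_gt0.
have cf : continuous (fun v : R => (A ^+ 2 + v ^+ 2)^-1 : R).
  move=> v; apply: cvgV; first by rewrite gt_eqF.
  by apply: cvgD; [exact: cvg_cst|exact: exprn_continuous].
split.
  by apply: continuous_compact_integrable; [exact: segment_compact|exact: continuous_subspaceT].
have dF (v : R) : is_derive v 1 (fun v : R => A^-1 * atan (v / A)) ((A ^+ 2 + v ^+ 2)^-1).
  apply: is_derive_eq; rewrite /GRing.scale/=.
  have := p0 v; have := p0 (v / A) => h1 h2.
  have h3 : 1 + (v / A) ^+ 2 != 0 by rewrite gt_eqF// ltr_wpDr ?sqr_ge0.
  by rewrite expr_div_n in h3 *; field; rewrite (gt_eqF h2) (gt_eqF A0).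
rewrite /Rintegral (@continuous_FTC2 _ _ (fun v : R => A^-1 * atan (v / A))).
- have h1 := atan_ltpi2 (b / A); have h2 := atan_gtNpi2 (- b / A).
  rewrite -EFinB/= -mulrBr mulrC ler_wpM2r ?invr_ge0 ?(ltW A0)//; lra.
- lra.
- exact: continuous_subspaceT.
- have cF : continuous (fun v : R => A^-1 * atan (v / A) : R).
    move=> x; apply: differentiable_continuous; apply/derivable1_diffP.
    by have [] := dF x.
  split; [by move=> x _; have [] := dF x|by apply: cvg_at_right_filter; exact: cF|
    by apply: cvg_at_left_filter; exact: cF].
- by move=> x _; rewrite derive1E; have [] := dF x.
Qed.

Let C4 := 2 * (C2 * expR (Y * t)).

(* AM-GM splits the tail into the mean square of [U], bounded by Parseval, and an integral of [1 / v ^ 2]. *)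
Let tail_bound (A eta : R) j : 0 < A -> 0 < eta -> A <= pi / h j ->
  normc (cintegral mu `[- (pi / h j), pi / h j] (F j) - cintegral mu `[- A, A] (F j)) <=
  C4 * (eta * C3 + pi / (2 * eta * A)).
Proof.
move=> A0 e0; set b := pi / h j => Ah.
have b0 : 0 < b by exact: lt_le_trans Ah.
have mF : cmeasurable (`[- b, b] : set (measurableTypeR R)) (F j).
  exact: cmeasurableTS (measurable_uv j).
have iF (D : set (measurableTypeR R)) : D `<=` `[- b, b] -> measurable D -> cintegrable mu D (F j).
  move=> Db mD; apply: (@cintegrable_bounded _ _ _ _ _ mD _ (C5 * (C2 / Y) * expR (Y * t))).
  - apply: le_lt_trans (mu_itv_lty (- b) b).
    by apply: le_measure; rewrite ?inE//.
  - exact: cmeasurableTS (measurable_uv j).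
  - move=> v /Db /itv_normle vb; apply: le_trans (F_bound vb) _.
    rewrite ler_wpM2r ?expR_ge0// ler_pM ?normc_ge0 ?U_bound//.
      by rewrite divr_ge0 ?normc_ge0 ?(ltW C20).
    rewrite ler_wpM2l ?(ltW C20)// lef_pV2 ?posrE//.
    by rewrite (le_trans _ (normc_Re _))//= ler_norm.
have mA : measurable (`[- A, A] : set (measurableTypeR R)) by exact: measurable_itv.
have mb : measurable (`[- b, b] : set (measurableTypeR R)) by exact: measurable_itv.
have Ab : (`[- A, A] : set (measurableTypeR R)) `<=` `[- b, b].
  by move=> v; rewrite /= !in_itv/= => /andP[h1 h2]; apply/andP; split; lra.
pose E := (`[- b, b] : set (measurableTypeR R)) `\` `[- A, A].
have mE : measurable E by exact: measurableD.
have Eb : E `<=` `[- b, b] by move=> v [].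
have split_int (f : R -> R) : mu.-integrable `[- b, b] (EFin \o f) ->
    \int[mu]_(v in `[- b, b]) f v = \int[mu]_(v in `[- A, A]) f v + \int[mu]_(v in E) f v.
  move=> fi; rewrite -Rintegral_setU//.
  - by rewrite setDUK.
  - by rewrite setDUK.
  - by rewrite /E setDE disj_set2E; apply/eqP; rewrite setICA setICr setI0.
have -> : cintegral mu `[- b, b] (F j) - cintegral mu `[- A, A] (F j) = cintegral mu E (F j).
  have sub (x y : R) : x + y - x = y by rewrite addrAC subrr add0r.
  apply: complexP; rewrite ?ReB ?ImB /= split_int ?sub//.
  - exact: (iF _ _ mb).1.
  - exact: (iF _ _ mb).2.
have [i2 I2] := integrable_atan A0 b0.
have iU : mu.-integrable `[- b, b] (EFin \o (fun v => normc (U j v) ^+ 2)).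
  apply: (@measurable_bounded_integrable) => //.
  - exact: mu_itv_lty.
  - apply: measurable_funX; apply: measurable_normc.
    have mh (p : {poly R[i]}) : cmeasurable `[- b, b] (fun v : measurableTypeR R => p.[qpt (h j) Y v]).
      elim/poly_ind: p => [|p e IH].
        by apply: eq_cmeasurable (cmeasurable_cst _ 0) => v _; rewrite horner0.
      apply: eq_cmeasurable (cmeasurableD (cmeasurableM IH (cmeasurable_qpt (h j) Y _)) (cmeasurable_cst _ e)) => v _.
      by rewrite !hornerE.
    by apply: cmeasurableM; [exact: cmeasurable_cst|exact: mh].
  - exists (C5 ^+ 2); split; first exact: num_real.
    move=> x Cx v _ /=; rewrite ger0_norm ?sqr_ge0//; apply: le_trans (ltW Cx).
    by rewrite lerXn2r ?nnegrE ?normc_ge0// U_bound.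
pose B v := C2 * expR (Y * t) * (eta * normc (U j v) ^+ 2 + (2 * eta)^-1 * (A ^+ 2 + v ^+ 2)^-1).
have iB : mu.-integrable `[- b, b] (EFin \o B).
  by apply: integrable_scale => //; apply: integrable_add => //; exact: integrable_scale.
have B0 v : 0 <= B v.
  apply: mulr_ge0; first by rewrite mulr_ge0 ?expR_ge0 ?(ltW C20).
  apply: addr_ge0; first by rewrite mulr_ge0 ?(ltW e0) ?sqr_ge0.
  apply: mulr_ge0; rewrite invr_ge0; last by rewrite addr_ge0 ?sqr_ge0.
  lra.
have FB v : E v -> normc (F j v) <= B v.
  move=> [vb vA]; have nvb := itv_normle vb.
  have vA' : A < `|v|.
    by rewrite ltNge; apply/negP => vA'; apply: vA; rewrite /= in_itv/= -ler_norml.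
  apply: le_trans (F_bound nvb) _; rewrite /B.
  have -> : normc (U j v) * (C2 / normc (Y +i* v)) * expR (Y * t) =
    C2 * expR (Y * t) * (normc (U j v) / normc (Y +i* v)) by ring.
  rewrite ler_wpM2l ?mulr_ge0 ?expR_ge0 ?(ltW C20)//.
  (* On [E] one has [A ^+ 2 <= v ^+ 2], so [1 / v ^+ 2] may be replaced by a multiple of
     [1 / (A ^+ 2 + v ^+ 2)], which is integrable across 0 as well. *)
  have nv : A ^+ 2 + v ^+ 2 <= 2 * normc (Y +i* v) ^+ 2.
    rewrite normcE2 /=; have := sqr_ge0 Y.
    have : A ^+ 2 <= v ^+ 2.
      by rewrite -[v ^+ 2]real_normK ?num_real// lerXn2r ?nnegrE ?(ltW A0)// ltW.
    lra.
  have n0 := normc_z v; set x := normc (U j v); set y := normc (Y +i* v) in n0 nv *.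
  have h1 : (2 * y ^+ 2)^-1 <= (A ^+ 2 + v ^+ 2)^-1.
    by rewrite lef_pV2 ?posrE ?mulr_gt0 ?exprn_gt0// ltr_wpDr ?sqr_ge0 ?exprn_gt0.
  have h2 : (2 * eta)^-1 * (2 * y ^+ 2)^-1 <= (2 * eta)^-1 * (A ^+ 2 + v ^+ 2)^-1.
    by rewrite ler_wpM2l// invr_ge0 mulr_ge0// ltW.
  (* Expanding this square gives [x / y <= eta x^2 + 1 / (4 eta y^2)]. *)
  have : 0 <= eta * (x - (2 * eta * y)^-1) ^+ 2 by rewrite mulr_ge0 ?sqr_ge0 ?ltW.
  have -> : eta * (x - (2 * eta * y)^-1) ^+ 2 = eta * x ^+ 2 - x / y + (2 * eta)^-1 * (2 * y ^+ 2)^-1.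
    by field; lra.
  lra.
have iBE : mu.-integrable E (EFin \o B) by apply: integrableS iB.
apply: le_trans (normc_cintegral_le mE _ iBE FB) _.
  exact: cmeasurableTS (measurable_uv j).
rewrite /C4 -mulrA ler_pM2l//.
have h1 : \int[mu]_(v in E) B v <= \int[mu]_(v in `[- b, b]) B v.
  rewrite split_int// lerDr; exact: Rintegral_ge0.
apply: (le_trans h1); rewrite /B RintegralZl//; last first.
  by apply: integrable_add => //; exact: integrable_scale.
rewrite ler_wpM2l ?mulr_ge0 ?expR_ge0 ?(ltW C20)// RintegralD//; last 2 first.
  exact: integrable_scale.
  exact: integrable_scale.
rewrite !RintegralZl// lerD//.
  by rewrite ler_wpM2l ?(ltW e0)//; exact: U_parseval.
have -> : pi / (2 * eta * A) = (2 * eta)^-1 * (pi / A) by field; lra.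
by rewrite ler_wpM2l// invr_ge0 mulr_ge0// ltW.
Qed.

(** [tail_bound] is uniform in [j] and survives the limit. Choosing [eta] first and [A] afterwards
    makes the right-hand side arbitrarily small. *)
Let limit_bound (A eta : R) : 0 < A -> 0 < eta ->
  normc ((2 * pi)%:C * (t%:C * l) - cintegral mu `[- A, A] Flim) <=
  C4 * (eta * C3 + pi / (2 * eta * A)).
Proof.
move=> A0 e0.
apply: (ccvg_le (ccvgB big_cvg (bulk_cvg A)) (cvg_cst _)).
by apply: filterS (half_turn A) => j Aj; exact: tail_bound.
Qed.

Let g5 (s : R) : R := g s + g2 s.
Let exp_le (s : R) : 0 < s -> expR (- (Y * s)) <= expR (- (Y' * s)).
Proof. by move=> s0; rewrite ler_expR lerN2 ler_wpM2r ?(ltW s0) ?(ltW Y'Y). Qed.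
Let aB1Y (s : R) : 0 < s -> normc (a s - 1) * expR (- (Y * s)) <= g2 s.
Proof.
by move=> s0; rewrite exp_split /g2 mulrA ler_wpM2r ?expR_ge0//; exact: aB1.
Qed.
Let agY (s : R) : 0 < s -> normc (a s - 1) / s * expR (- (Y * s)) <= g s.
Proof.
move=> s0; apply: le_trans (ag s0).
by rewrite ler_wpM2l ?exp_le// divr_ge0 ?normc_ge0 ?(ltW s0).
Qed.
Let normc_phi1 (s : R) : 0 < s -> normc (phi1 s) = normc (a s - 1) / s.
Proof. by move=> s0; rewrite /phi1 normcM normcR gtr0_norm ?invr_gt0. Qed.

(** The factor [- i s] from differentiation cancels the [1 / s], so the derivative is [- i] times
    the transform of [a - 1]. *)
Let dlog v : is_cderive v RI ((0 -i* 1) * (uf v - (Y +i* v)^-1)).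
Proof.
have m1 := mphi (phi1_cvg 0).1.
have i5 : mu.-integrable `]0, +oo[ (EFin \o g5) by exact: (integrableD mI ig ig2).
have b1 (s : R) : 0 < s -> (1 + s) * normc (phi1 s) * expR (- (Y * s)) <= g5 s.
  move=> s0; rewrite normc_phi1//.
  have -> : (1 + s) * (normc (a s - 1) / s) * expR (- (Y * s)) =
    normc (a s - 1) / s * expR (- (Y * s)) + normc (a s - 1) * expR (- (Y * s)) by field; lra.
  by apply: lerD; [exact: agY|exact: aB1Y].
apply: is_cderive_eq (laplace_cderive m1 i5 b1 v) _.
rewrite /uf /density_transform addrK -cintegralMl; last exact: (phi2_cvg v).1.
apply: eq_cintegral => s /[!inE]/=; rewrite in_itv/= andbT => s0.
rewrite [RHS]mulrCA; congr (_ * _); rewrite /phi1 -mulrA mulrC; congr (_ * _).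
  by apply: complexP; rewrite ?ReM ?ImM/=; field; lra.
exact: measurable_itv.
Qed.

(** Half of the exponential decay absorbs the weight: [1 + s <= (1 + 2 / dl) exp (dl s / 2)]. *)
Let g6 (s : R) : R := (K + 1) * (1 + 2 / dl) * expR (- (dl / 2 * s)).

(** The value of the derivative is irrelevant; its existence gives the continuity that the
    fundamental theorem of calculus asks of [Flim]. *)
Let ddensity v : exists D, is_cderive v
  (fun x => cintegral mu `]0, +oo[ (fun s => cexp (- ((Y +i* x) * s%:C)) * (a s - 1))) D.
Proof.
have dl2 : 0 < dl / 2 by rewrite divr_gt0.
have m2 := mphi (phi2_cvg 0).1.
have i6 : mu.-integrable `]0, +oo[ (EFin \o g6).
  exact: (integrableZl mI ((K + 1) * (1 + 2 / dl)) (integrable_expRN dl2)).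
have b2 (s : R) : 0 < s -> (1 + s) * normc (phi2 s) * expR (- (Y * s)) <= g6 s.
  move=> s0; rewrite -mulrA.
  have s1 : 0 <= 1 + s by lra.
  apply: le_trans (ler_wpM2l s1 (aB1Y s0)) _; rewrite /g2 /g6 -[leRHS]mulrA mulrCA.
  rewrite ler_wpM2l ?addr_ge0//.
  have -> : expR (- (dl * s)) = expR (- (dl / 2 * s)) * expR (- (dl / 2 * s)).
    by rewrite -expRD; congr expR; field.
  rewrite mulrA ler_wpM2r ?expR_ge0//.
  have h1 := expR_ge1Dx (dl / 2 * s).
  have p0 : 0 < dl / 2 * s by rewrite mulr_gt0.
  rewrite expRN ler_pdivrMr ?expR_gt0//.
  have -> : 1 + s = (1 + 2 / dl) * (1 + dl / 2 * s) - dl / 2 * s - 2 / dl by field; lra.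
  have q0 : 0 < 2 / dl by rewrite divr_gt0.
  have q1 : 0 <= 1 + 2 / dl by lra.
  have := ler_wpM2l q1 h1; lra.
by eexists; exact: (laplace_cderive m2 i6 b2 v).
Qed.

Let dinv (v : R) : is_cderive v (fun x => (Y +i* x)^-1) ((0 -i* 1) * (Y +i* v)^-1 ^+ 2).
Proof.
have p (x : R) : 0 < Y ^+ 2 + x ^+ 2 by rewrite ltr_wpDr ?sqr_ge0 ?exprn_gt0.
have dp : is_derive v (1 : R) (fun x : R => Y ^+ 2 + x ^+ 2) (v *+ 2).
  by apply: is_derive_eq; rewrite /GRing.scale/=; ring.
have di : is_derive v (1 : R) (fun x : R => (Y ^+ 2 + x ^+ 2)^-1) (- (v *+ 2) / (Y ^+ 2 + v ^+ 2) ^+ 2).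
  have := p v => /lt0r_neq0 q.
  have dV := @realfun.is_deriveV R (fun x : R => Y ^+ 2 + x ^+ 2) v _ _ q dp.
  by apply: is_derive_eq dV _; rewrite /GRing.scale/=; field.
have e x : (Y +i* x)^-1 = ((Y ^+ 2 + x ^+ 2)^-1)%:C * (Y -i* x).
  apply: complexP; rewrite ?ReM ?ImM /= ?mul0r ?subr0 ?addr0.
    by rewrite mulrC.
  by rewrite mulrN mulrC.
apply: (@is_cderive_ext _ _ (fun x => ((Y ^+ 2 + x ^+ 2)^-1)%:C * (Y -i* x))) => //.
have dc : is_cderive v (fun x => Y -i* x) (0 -i* 1).
  split => /=; first exact: is_derive_cst.
  by apply: is_derive_eq.
apply: is_cderive_eq (is_cderiveM (is_cderive_real di) dc) _.
rewrite e; have := p v => pv.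
by apply: complexP; rewrite expr2 ?ReD ?ImD ?ReM ?ImM /= ?ReM ?ImM /=; field; lra.
Qed.

Let dtz (v : R) : is_cderive v (fun x => cexp (t%:C * (Y +i* x))) ((0 +i* t) * cexp (t%:C * (Y +i* v))).
Proof.
apply: is_cderive_cexp; split => /=.
  apply: is_derive_eq; rewrite /GRing.scale/=; ring.
by apply: is_derive_eq; rewrite /GRing.scale/=; ring.
Qed.

(** The [1 / z] in the derivative of [log_transform] cancels against the derivative of the factor
    [1 / z]. What remains exhibits [t K - Flim] as an exact derivative up to a factor [i], for the
    kernel [K]. *)
Let dkernel v : is_cderive v resolvent_kernel ((0 +i* 1) * (t%:C * resolvent_kernel v - Flim v)).
Proof.
apply: is_cderive_eq (is_cderiveM (is_cderiveM (dtz v) (is_cderive_cexp (dlog v))) (dinv v)) _.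
have -> : (0 +i* t : R[i]) = (0 +i* 1) * t%:C by apply: complexP; rewrite ?ReM ?ImM/=; ring.
have -> : (0 -i* 1 : R[i]) = - (0 +i* 1) by apply: complexP; rewrite ?ReN ?ImN/= ?oppr0.
by rewrite /Flim /resolvent_kernel -/RI; ring.
Qed.

Let cderive_continuous (f : R -> R[i]) : (forall v, exists D, is_cderive v f D) ->
  continuous (fun v => Re (f v) : R) /\ continuous (fun v => Im (f v) : R).
Proof.
move=> H; split => v; apply: differentiable_continuous; apply/derivable1_diffP;
  by have [D [[d1 _] [d2 _]]] := H v.
Qed.

Let kernel_FTC (A : R) : 0 < A ->
  (0 +i* 1) * (t%:C * cintegral mu `[- A, A] resolvent_kernel - cintegral mu `[- A, A] Flim) =
  resolvent_kernel A - resolvent_kernel (- A) /\ cintegrable mu `[- A, A] resolvent_kernel.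
Proof.
move=> A0.
have [c1 c2] : continuous (fun v => Re (resolvent_kernel v) : R) /\ continuous (fun v => Im (resolvent_kernel v) : R).
  by apply: cderive_continuous => v; eexists; exact: dkernel.
have dF v : exists D, is_cderive v Flim D.
  have [D hD] := ddensity v.
  by eexists; apply: is_cderiveM (dkernel v); apply: is_cderiveD hD (dinv v).
have [c3 c4] := cderive_continuous dF.
have dG v : exists D, is_cderive v (fun v => (0 +i* 1) * (t%:C * resolvent_kernel v - Flim v)) D.
  have [D hD] := dF v.
  eexists; apply: is_cderiveM (is_cderive_cst _ _) _.
  apply: (@is_cderive_ext _ _ (fun v => t%:C * resolvent_kernel v + (-1) * Flim v)).
    by move=> x; rewrite mulN1r.
  apply: is_cderiveD (is_cderiveM (is_cderive_cst _ _) (dkernel v)) (is_cderiveM (is_cderive_cst _ _) hD).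
have [c5 c6] := cderive_continuous dG.
have int (f : R -> R[i]) : continuous (fun v => Re (f v) : R) -> continuous (fun v => Im (f v) : R) ->
    cintegrable mu `[- A, A] f.
  by move=> f1 f2; split; apply: continuous_compact_integrable;
    [exact: segment_compact|exact: continuous_subspaceT|exact: segment_compact|exact: continuous_subspaceT].
have i1 := int _ c1 c2; have i2 := int _ c3 c4; split => //.
have mA : measurable (`[- A, A] : set (measurableTypeR R)) by exact: measurable_itv.
rewrite -(cintegralMl mA)// -(cintegralB mA)//; last exact: (cintegrableMl mA).
rewrite -(cintegralMl mA); last by apply: cintegrableB => //; exact: cintegrableMl.
by apply: cintegral_FTC => //; lra.
Qed.

(** [log_transform] is at most [2 G] in modulus, so the kernel is [O(1 / |v|)]: too slow for
    absolute integrability, but enough for the boundary terms to vanish. *)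
Let kernel_bound (v : R) : v != 0 -> normc (resolvent_kernel v) <= expR (Y * t) * expR (2 * G) / `|v|.
Proof.
move=> v0; rewrite /resolvent_kernel normcM normcM normc_tz normcV.
apply: ler_pM; rewrite ?mulr_ge0 ?expR_ge0 ?normc_ge0 ?invr_ge0 ?normc_ge0//.
  rewrite ler_wpM2l ?expR_ge0// normc_cexp ler_expR.
  apply: le_trans (ler_norm _) _; apply: le_trans (normc_Re _) _.
  apply: normc_cintegral_le => //; first exact: (cintegrable_cmeasurable (phi1_cvg v).1).
  move=> s; rewrite /= in_itv/= andbT => s0.
  by rewrite normcM normc_kernel -/(phi1 s) normc_phi1// mulrC; exact: agY.
rewrite lef_pV2 ?posrE ?normr_gt0 ?normc_z//.
exact: (normc_Im (Y +i* v)).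
Qed.

(** [limit_bound] compares [2 pi t l] with the integral of [Flim], and [kernel_FTC] compares the
    latter with [t] times the integral of the kernel, up to boundary terms of order [1 / A]. *)
Lemma transform_inversion (eps : R) : 0 < eps -> exists A0 : R, forall A : R, A0 <= A ->
  normc (((2 * pi)^-1)%:C * cintegral mu `[- A, A] resolvent_kernel - l) <= eps.
Proof.
move=> eps0; have p0 := pi_gt0 R.
have pt0 : 0 < pi * t by rewrite mulr_gt0.
(* The errors add up to at most [2 e], and the final division by [2 pi t] returns [eps]. *)
pose e := pi * t * eps; have e0 : 0 < e by rewrite mulr_gt0.
have C40 : 0 < C4 by rewrite !mulr_gt0 ?expR_gt0.
have C30 : 0 <= C3.
  by apply: le_trans (U_parseval 0); apply: Rintegral_ge0 => v _; exact: sqr_ge0.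
have C31 : 0 < C3 + 1 by lra.
(* [C3] may vanish, whence the denominator [C3 + 1]. *)
pose eta := e / (C4 * (C3 + 1)); have eta0 : 0 < eta by rewrite divr_gt0// mulr_gt0.
pose Q := C4 * pi / (2 * eta) + 2 * (expR (Y * t) * expR (2 * G)).
have Q0 : 0 < Q.
  rewrite /Q; have q1 : 0 < C4 * pi / (2 * eta) by apply: divr_gt0; apply: mulr_gt0.
  have q2 : 0 < expR (Y * t) * expR (2 * G) by rewrite mulr_gt0 ?expR_gt0.
  lra.
exists (Q / e) => A QA; have A0 : 0 < A by apply: lt_le_trans QA; rewrite divr_gt0.
have QA' : Q / A <= e by move: QA; rewrite !ler_pdivrMr// mulrC.
have h1 := limit_bound A0 eta0.
have [h2 _] := kernel_FTC A0.
set I := cintegral mu `[- A, A] resolvent_kernel in h2 *.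
have h3 : normc (t%:C * I - cintegral mu `[- A, A] Flim) <= 2 * (expR (Y * t) * expR (2 * G)) / A.
  have <- : normc (resolvent_kernel A - resolvent_kernel (- A)) = normc (t%:C * I - cintegral mu `[- A, A] Flim).
    rewrite -h2 normcM (_ : normc (0 +i* 1) = 1) ?mul1r//.
    by rewrite /= expr0n/= add0r expr1n sqrtr1.
  have k1 := kernel_bound (lt0r_neq0 A0); have := kernel_bound (v := - A).
  rewrite oppr_eq0 gt_eqF// => /(_ isT) k2; rewrite normrN in k2; rewrite gtr0_norm// in k1 k2.
  have := normcB (resolvent_kernel A) (resolvent_kernel (- A)); lra.
have h4 : normc (t%:C * I - (2 * pi)%:C * (t%:C * l)) <= 2 * e.
  have -> : t%:C * I - (2 * pi)%:C * (t%:C * l) = (t%:C * I - cintegral mu `[- A, A] Flim) -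
    ((2 * pi)%:C * (t%:C * l) - cintegral mu `[- A, A] Flim) by ring.
  apply: le_trans (normcB _ _) _.
  have : C4 * (eta * C3 + pi / (2 * eta * A)) + 2 * (expR (Y * t) * expR (2 * G)) / A =
    C4 * eta * C3 + Q / A by rewrite /Q; field; lra.
  have : C4 * eta * C3 <= e.
    have -> : C4 * eta * C3 = e * (C3 / (C3 + 1)).
      by rewrite /eta; move: C40 => /lt0r_neq0; move: C4 => x x0; field; rewrite x0; lra.
    by rewrite ler_piMr ?(ltW e0)// ler_pdivrMr//; lra.
  lra.
have q0 : (2 * pi)%:C != 0 :> R[i] by rewrite realCM; apply/eqP => -[]; lra.
have -> : ((2 * pi)^-1)%:C * I - l = ((2 * pi * t)^-1)%:C * (t%:C * I - (2 * pi)%:C * (t%:C * l)).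
  have e1 : ((2 * pi * t)^-1)%:C * t%:C = ((2 * pi)^-1)%:C :> R[i].
    by rewrite -realCM (invfM (2 * pi) t) mulfVK ?gt_eqF.
  have e2 : ((2 * pi * t)^-1)%:C * ((2 * pi)%:C * t%:C) = 1 :> R[i].
    by rewrite -!realCM mulVf// gt_eqF// mulr_gt0 ?mulr_gt0.
  by rewrite -e1 -{1}[l]mul1r -e2; ring.
have r0 : 0 < 2 * pi * t by lra.
rewrite normcM normcR gtr0_norm ?invr_gt0// mulrC ler_pdivrMr//.
by apply: (le_trans h4); rewrite /e; lra.
Qed.

End transform_inversion.

(** * Fubini's theorem and distributions *)

Section complex_fubini.
Context {R : realType} {d1 d2 : measure_display}
  {T1 : measurableType d1} {T2 : measurableType d2}.
Variables (m1 : {sigma_finite_measure set T1 -> \bar R})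
  (m2 : {sigma_finite_measure set T2 -> \bar R}).
Variables (f : T1 * T2 -> R[i]) (g1 : T1 -> R) (g2 : T2 -> R).
Hypothesis mf : cmeasurable setT f.
Hypothesis ig1 : m1.-integrable setT (EFin \o g1).
Hypothesis ig2 : m2.-integrable setT (EFin \o g2).
Hypothesis fg : forall x y, normc (f (x, y)) <= g1 x * g2 y.

(** Domination by a product of integrable functions of one variable each is the criterion behind all
    complex double integrals below. *)
Lemma product_integrable (h : T1 * T2 -> R) : measurable_fun setT h ->
  (forall x y, `|h (x, y)| <= `|g1 x| * `|g2 y|) ->
  (m1 \x m2)%E.-integrable setT (EFin \o h).
Proof.
move=> mh hg; have mh' : measurable_fun setT (EFin \o h) by exact/measurable_EFinP.
apply: (proj2 (integrable12ltyP m1 m2 mh')).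
have j1 := integrable_abse ig1; have j2 := integrable_abse ig2.
have [r2 r2E] : exists r2 : R, (\int[m2]_y `|(g2 y)%:E| = r2%:E)%E.
  exists (fine (\int[m2]_y `|(g2 y)%:E|)%E); rewrite fineK//.
  exact: integrable_fin_num j2.
apply: (@le_lt_trans _ _ (\int[m1]_x (`|(g1 x)%:E| * r2%:E))%E).
  apply: ge0_le_integral => //.
  - by move=> x _; apply: integral_ge0 => y _; exact: abse_ge0.
  - have mh2 : measurable_fun setT (fun z => `|(h z)%:E|)%E by exact: measurableT_comp.
    by apply: (measurable_fun_fubini_tonelli_F _ mh2) => z; exact: abse_ge0.
  - by apply: emeasurable_funM => //; exact: (measurable_int _ j1).
  - move=> x _; rewrite -r2E -ge0_integralZl//; last exact: (measurable_int _ j2).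
    apply: ge0_le_integral => //.
    + by apply: measurableT_comp => //; apply: (measurableT_comp mh'); exact: measurable_pair1.
    + by apply: emeasurable_funM => //; exact: (measurable_int _ j2).
    + by move=> y _; rewrite /= -EFinM lee_fin.
rewrite ge0_integralZr//; last 2 first.
- exact: (measurable_int _ j1).
- by rewrite -r2E; apply: integral_ge0 => y _.
by rewrite ltey_eq fin_numM// (integrable_fin_num measurableT j1).
Qed.

Let fg' x y : normc (f (x, y)) <= `|g1 x| * `|g2 y|.
Proof. by rewrite -normrM (le_trans (fg x y))// ler_norm. Qed.

Lemma cintegrable_product : cintegrable (m1 \x m2)%E setT f.
Proof.
have [m1f m2f] := mf; split; apply: product_integrable => // x y; apply: le_trans (fg' x y).
  exact: normc_Re.
exact: normc_Im.
Qed.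

Let section1 (h : T1 * T2 -> R) : measurable_fun setT h ->
  (forall x y, `|h (x, y)| <= `|g1 x| * `|g2 y|) ->
  forall x, m2.-integrable setT (EFin \o (fun y => h (x, y))).
Proof.
move=> mh hg x.
apply: (@le_integrable _ _ _ _ _ measurableT _ (EFin \o (fun y => `|g1 x| * `|g2 y|))) => //.
- by apply/measurable_EFinP; apply: (measurableT_comp mh); exact: measurable_pair1.
- by move=> y _ /=; rewrite lee_fin (le_trans (hg x y))// ler_norm.
- by apply: integrable_scale => //; exact: integrable_abse ig2.
Qed.

Let section2 (h : T1 * T2 -> R) : measurable_fun setT h ->
  (forall x y, `|h (x, y)| <= `|g1 x| * `|g2 y|) ->
  forall y, m1.-integrable setT (EFin \o (fun x => h (x, y))).
Proof.
move=> mh hg y.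
apply: (@le_integrable _ _ _ _ _ measurableT _ (EFin \o (fun x => `|g2 y| * `|g1 x|))) => //.
- by apply/measurable_EFinP; apply: (measurableT_comp mh); exact: measurable_pair2.
- by move=> x _ /=; rewrite lee_fin (le_trans (hg x y))// mulrC ler_norm.
- by apply: integrable_scale => //; exact: integrable_abse ig1.
Qed.

Let real_fubini (h : T1 * T2 -> R) : measurable_fun setT h ->
  (forall x y, `|h (x, y)| <= `|g1 x| * `|g2 y|) ->
  [/\ \int[(m1 \x m2)%E]_z h z = \int[m1]_x \int[m2]_y h (x, y),
      \int[(m1 \x m2)%E]_z h z = \int[m2]_y \int[m1]_x h (x, y) &
      m1.-integrable setT (EFin \o (fun x => \int[m2]_y h (x, y)))].
Proof.
move=> mh hg; have ih := product_integrable mh hg.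
have e1 : EFin \o (fun x => \int[m2]_y h (x, y)) = fubini_F m2 (EFin \o h).
  by apply/funext => x /=; rewrite /Rintegral fineK//;
    exact: integrable_fin_num (section1 mh hg x).
have e2 : EFin \o (fun y => \int[m1]_x h (x, y)) = fubini_G m1 (EFin \o h).
  by apply/funext => y /=; rewrite /Rintegral fineK//;
    exact: integrable_fin_num (section2 mh hg y).
split.
- by rewrite {1}/Rintegral -(integral12_prod_meas1 ih) -e1.
- by rewrite {1}/Rintegral -(integral21_prod_meas1 ih) -e2.
- by rewrite e1; exact: integrable_fubini_F ih.
Qed.

Let fR : forall x y, `|Re (f (x, y))| <= `|g1 x| * `|g2 y|.
Proof. by move=> x y; apply: le_trans (fg' x y); exact: normc_Re. Qed.
Let fI : forall x y, `|Im (f (x, y))| <= `|g1 x| * `|g2 y|.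
Proof. by move=> x y; apply: le_trans (fg' x y); exact: normc_Im. Qed.

Lemma cintegral_product12 : cintegral (m1 \x m2)%E setT f =
  cintegral m1 setT (fun x => cintegral m2 setT (fun y => f (x, y))).
Proof.
have [m1f m2f] := mf.
have [a1 _ _] := real_fubini m1f fR; have [b1 _ _] := real_fubini m2f fI.
by apply: complexP => /=; [exact: a1|exact: b1].
Qed.

Lemma cintegral_product21 : cintegral (m1 \x m2)%E setT f =
  cintegral m2 setT (fun y => cintegral m1 setT (fun x => f (x, y))).
Proof.
have [m1f m2f] := mf.
have [_ a1 _] := real_fubini m1f fR; have [_ b1 _] := real_fubini m2f fI.
by apply: complexP => /=; [exact: a1|exact: b1].
Qed.

Lemma cintegrable_section1 : cintegrable m1 setT (fun x => cintegral m2 setT (fun y => f (x, y))).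
Proof.
have [m1f m2f] := mf.
by have [_ _ a1] := real_fubini m1f fR; have [_ _ b1] := real_fubini m2f fI.
Qed.

Lemma cFubini : cintegral m1 setT (fun x => cintegral m2 setT (fun y => f (x, y))) =
  cintegral m2 setT (fun y => cintegral m1 setT (fun x => f (x, y))).
Proof. by rewrite -cintegral_product12 cintegral_product21. Qed.

End complex_fubini.

Lemma cintegrable_section2 {R : realType} {d1 d2 : measure_display}
    {T1 : measurableType d1} {T2 : measurableType d2}
    (m1 : {sigma_finite_measure set T1 -> \bar R}) (m2 : {sigma_finite_measure set T2 -> \bar R})
    (f : T1 * T2 -> R[i]) (g1 : T1 -> R) (g2 : T2 -> R) :
  cmeasurable setT f -> m1.-integrable setT (EFin \o g1) -> m2.-integrable setT (EFin \o g2) ->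
  (forall x y, normc (f (x, y)) <= g1 x * g2 y) ->
  cintegrable m2 setT (fun y => cintegral m1 setT (fun x => f (x, y))).
Proof.
move=> mf ig1 ig2 fg.
have ms : cmeasurable setT (fun z : T2 * T1 => f (z.2, z.1)).
  apply: (cmeasurable_comp mf (g := fun z : T2 * T1 => (z.2, z.1))).
  by apply: measurable_fun_pair; [exact: measurable_snd|exact: measurable_fst].
by apply: (cintegrable_section1 ms ig2 ig1) => x y; rewrite mulrC; exact: fg.
Qed.

Section complex_distribution.
Context {R : realType} {d1 d2 : measure_display}
  {T1 : measurableType d1} {T2 : measurableType d2}.
Variables (P : probability T1 R) (X : {mfun T1 >-> T2}).

Lemma cintegrable_distribution (f : T2 -> R[i]) : cmeasurable setT f ->
  cintegrable P setT (fun x => f (X x)) <-> cintegrable (distribution P X) setT f.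
Proof.
move=> [f1 f2].
have key (h : T2 -> R) : measurable_fun setT h ->
    (P.-integrable setT (EFin \o (h \o X))) <-> ((distribution P X).-integrable setT (EFin \o h)).
  move=> mh; have mh' : measurable_fun setT (EFin \o h) by exact/measurable_EFinP.
  split=> /integrableP[_ H]; apply/integrableP; split.
  - exact: mh'.
  - by rewrite ge0_integral_distribution//; exact: measurableT_comp.
  - by apply/measurable_EFinP; exact: measurableT_comp.
  - by rewrite ge0_integral_distribution// in H; exact: measurableT_comp.
split=> -[h1 h2]; split.
- exact: (proj1 (key _ f1)).
- exact: (proj1 (key _ f2)).
- exact: (proj2 (key _ f1)).
- exact: (proj2 (key _ f2)).
Qed.

Lemma cintegral_distribution (f : T2 -> R[i]) : cmeasurable setT f ->
  cintegrable P setT (fun x => f (X x)) ->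
  cintegral (distribution P X) setT f = cintegral P setT (fun x => f (X x)).
Proof.
move=> [f1 f2] [i1 i2].
have key (h : T2 -> R) : measurable_fun setT h -> P.-integrable setT (EFin \o (h \o X)) ->
    \int[distribution P X]_y h y = \int[P]_x h (X x).
  move=> mh ih; have mh' : measurable_fun setT (EFin \o h) by exact/measurable_EFinP.
  by rewrite /Rintegral integral_distribution.
by apply: complexP => /=; exact: key.
Qed.

End complex_distribution.

Section line_integrals.
Context {R : realType}.
Local Notation RR := (measurableTypeR R).
Local Notation mu := (@lebesgue_measure R).

(** Translations preserve the length of half-open intervals, and this characterises the Lebesgue
    measure. *)
Lemma lebesgue_translation (x : R) (f : RR -> \bar R) : measurable_fun setT f ->
  (forall y, 0 <= f y)%E -> (\int[mu]_y f (y - x)%R = \int[mu]_y f y)%E.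
Proof.
move=> mf f0.
have mphi : measurable_fun setT ((fun y => y - x) : RR -> RR) by exact: measurable_funB.
pose phi : RR -> RR := fun y => y - x.
transitivity (\int[mu]_(y in phi @^-1` setT) (f \o phi) y)%E.
  by rewrite preimage_setT.
rewrite -(ge0_integral_pushforward mphi mu measurableT mf)//.
have e A : measurable A -> mu A = pushforward mu phi A.
  apply: lebesgue_measure_unique => X [[a b]] _ <-.
  rewrite /pushforward [X in _ = lebesgue_measure X](_ : _ = `]a + x, b + x]%classic); last first.
    by apply/seteqP; split => y; rewrite /= !in_itv/= ltrBrDr lerBlDr.
  by rewrite !lebesgue_measure_itv/= !lte_fin ltrD2r -!EFinB; case: ifP => // _; congr EFin; ring.
apply: eq_measure_integral => A mA _; exact/esym/e.
Qed.

Lemma Rintegral_limit (f : RR -> R) : mu.-integrable setT (EFin \o f) ->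
  (fun n => \int[mu]_(x in `[- n%:R, n%:R]) f x) @ \oo --> \int[mu]_x f x.
Proof.
move=> fi; have mf : measurable_fun setT f by apply/measurable_EFinP; exact: (measurable_int _ fi).
pose F n := f \_ (`[- n%:R, n%:R] : set RR).
have mF n : measurable_fun setT (F n) by apply/(measurable_restrictT f) => //; exact: measurable_funS mf.
have [_ c] : cintegrable mu setT (fun x => (f x)%:C) /\
    ccvg (fun n => cintegral mu setT (fun x => (F n x)%:C)) (cintegral mu setT (fun x => (f x)%:C)).
  apply: (@cdominated _ _ _ _ _ _ _ _ (fun x => `|f x|)) => //.
  - by move=> n; exact: cmeasurable_real.
  - move=> x _; apply: ccvg_eq (ccvg_cst (f x)%:C).
    have [k kx] : exists k, `|x| <= k%:R.
      by exists (Num.truncn `|x|).+1; rewrite ltW// truncnS_gt.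
    exists k => // n /= kn; rewrite /F patchE ifT// inE/= in_itv/= -ler_norml.
    by rewrite (le_trans kx)// ler_nat.
  - exact: integrable_abse fi.
  - by move=> n x _; rewrite normcR /F patchE; case: ifP => //; rewrite normr0.
have := ccvg_Re c; rewrite cintegral_real /=.
apply: cvg_trans; apply: near_eq_cvg; apply: nearW => n /=.
by rewrite [RHS]Rintegral_mkcond.
Qed.

Lemma Rintegral_derive0 (f df : R -> R) : (forall x : R, is_derive x (1 : R) f (df x)) ->
  continuous df -> mu.-integrable setT (EFin \o df) ->
  f n%:R @[n --> \oo] --> (0 : R) -> f (- n%:R) @[n --> \oo] --> (0 : R) ->
  \int[mu]_x df x = 0.
Proof.
move=> fdf cdf idf f1 f2.
apply: (cvg_unique _ (Rintegral_limit idf)) => //.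
have c : (fun n => f n%:R - f (- n%:R)) @ \oo --> (0 : R).
  by rewrite -[X in _ --> X](subrr (0:R)); exact: cvgB.
(* For [n = 0] the interval [[- n, n]] degenerates, hence the start at 1. *)
apply: cvg_trans c; apply: near_eq_cvg; exists 1%N => // n /= n1.
have := @cintegral_FTC R (fun x => (f x)%:C) (fun x => (df x)%:C) (- n%:R) n%:R.
rewrite cintegral_real => /(_ _ _ _ _)/(congr1 (fun z => Re z))/= ->; rewrite ?subr0//.
- have : (0:R) < n%:R by rewrite ltr0n. lra.
- by move=> x; exact: is_cderive_real.
- by move=> x; exact: cvg_cst.
Qed.

End line_integrals.

(** * Gaussian smoothing and characteristic functions *)

Section gauss_fourier.
Context {R : realType}.
Local Notation RR := (measurableTypeR R).
Local Notation mu := (@lebesgue_measure R).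

(** Left without normalisation since it plays two parts: [gauss s] is a multiple of the normal
    density of standard deviation [s], and [gauss s^-1] is the characteristic function of that
    centred law. *)
Definition gauss (s z : R) : R := expR (- (z ^+ 2 / (2 * s ^+ 2))).
Definition gauss_mass (s : R) : R := (normal_peak s)^-1.

Lemma normal_pdf_gauss (m s z : R) : 0 < s ->
  normal_pdf m s z = (gauss_mass s)^-1 * gauss s (z - m).
Proof.
move=> s0; rewrite normal_pdfE ?gt_eqF// /gauss_mass invrK /normal_fun /gauss.
by congr (_ * expR _); rewrite mulNr mulr_natl.
Qed.

Variable s : R.
Hypothesis s0 : 0 < s.

Lemma gauss_mass_gt0 : 0 < gauss_mass s.
Proof. by rewrite invr_gt0 normal_peak_gt0// gt_eqF. Qed.

Lemma gauss_gt0 z : 0 < gauss s z. Proof. exact: expR_gt0. Qed.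

Lemma gauss_le1 z : gauss s z <= 1.
Proof. by rewrite /gauss expR_le1 oppr_le0 divr_ge0 ?sqr_ge0// mulr_ge0 ?sqr_ge0. Qed.

Lemma is_derive_gauss (z : R) : is_derive z (1 : R) (gauss s) (- (z / s ^+ 2) * gauss s z).
Proof.
apply: is_derive_eq; rewrite /GRing.scale/= /gauss; field; rewrite gt_eqF//.
Qed.

Lemma continuous_gauss : continuous (gauss s).
Proof.
move=> z; apply: differentiable_continuous; apply/derivable1_diffP.
by have [] := is_derive_gauss z.
Qed.

Lemma measurable_gauss : measurable_fun (setT : set RR) (gauss s).
Proof. exact: continuous_measurable_fun continuous_gauss. Qed.

Lemma integrable_gauss : mu.-integrable setT (EFin \o gauss s).
Proof.
have := integrable_scale measurableT (gauss_mass s) (integrable_normal_pdf 0 s).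
congr (_.-integrable _ _); apply/funext => z /=.
by rewrite normal_pdf_gauss// subr0 mulrA divff ?mul1r// gt_eqF// gauss_mass_gt0.
Qed.

Lemma integral_gauss m : (\int[mu]_z (gauss s (z - m))%:E = (gauss_mass s)%:E)%E.
Proof.
have i := integrable_normal_pdf m s.
have := integral_normal_pdf m s; move/(congr1 (fun x => (gauss_mass s)%:E * x)%E).
rewrite mule1 -integralZl// => <-; apply: eq_integral => z _.
by rewrite -EFinM normal_pdf_gauss// mulrA divff ?mul1r// gt_eqF// gauss_mass_gt0.
Qed.

(** With [y = |z| / (2 s)] the Gaussian is the square of [exp(- y^2)]: one factor absorbs [y], the
    other lies below the Gaussian of double width. *)
Lemma gauss_lin (z : R) : `|z| * gauss s z <= 2 * s * gauss (2 * s) z.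
Proof.
set y := `|z| / (2 * s); have y0 : 0 <= y by rewrite divr_ge0// mulr_ge0// ltW.
have -> : gauss s z = expR (- y ^+ 2) * expR (- y ^+ 2).
  by rewrite -expRD; congr expR; rewrite /y expr_div_n real_normK ?num_real//; field; rewrite gt_eqF.
have h1 : y * expR (- y ^+ 2) <= 1.
  rewrite expRN ler_pdivrMr ?expR_gt0// mul1r.
  by have := expR_ge1Dx (y ^+ 2); have := sqr_ge0 (y - 1); nra.
have h2 : expR (- y ^+ 2) <= gauss (2 * s) z.
  rewrite ler_expR lerN2 /y expr_div_n real_normK ?num_real//.
  rewrite ler_wpM2l ?sqr_ge0// lef_pV2 ?posrE ?mulr_gt0 ?exprn_gt0 ?mulr_gt0//.
  by have := sqr_ge0 s; nra.
have -> : `|z| = 2 * s * y by rewrite /y; field; rewrite gt_eqF.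
have e0 := expR_ge0 (- y ^+ 2).
have -> : 2 * s * y * (expR (- y ^+ 2) * expR (- y ^+ 2)) =
  2 * s * (y * expR (- y ^+ 2) * expR (- y ^+ 2)) by ring.
rewrite ler_pM2l ?mulr_gt0//; apply: le_trans h2.
by rewrite -[leRHS]mul1r ler_wpM2r.
Qed.

End gauss_fourier.

Section gauss_fourier_transform.
Context {R : realType}.
Local Notation RR := (measurableTypeR R).
Local Notation mu := (@lebesgue_measure R).
Variable s : R.
Hypothesis s0 : 0 < s.

Let s20 : 0 < 2 * s. Proof. by rewrite mulr_gt0. Qed.

Let gauss_cvg0 (u : nat -> R) : (forall n, n%:R = `|u n|) -> gauss s (u n) @[n --> \oo] --> (0 : R).
Proof.
move=> un; apply: (@squeeze0 _ _ (fun n => 2 * s * n%:R^-1)).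
  exists 1%N => // n /= n1; rewrite expR_ge0 ler_pdivlMr ?ltr0n// mulrC un.
  by apply: le_trans (gauss_lin s0 _) _; rewrite ler_piMr ?(ltW s20)// gauss_le1.
rewrite -[X in _ --> X](mulr0 (2 * s)); apply: cvgM; first exact: cvg_cst.
apply/gtr0_cvgV0; last exact: cvgr_idn.
by exists 1%N => // n /= n1; rewrite ltr0n.
Qed.

Let dom (f : R -> R) (C : R) : measurable_fun (setT : set RR) f ->
  (forall z, `|f z| <= C * gauss s z + `|z| * gauss s z) ->
  mu.-integrable setT (EFin \o f).
Proof.
move=> mf fg.
apply: (@le_integrable _ _ _ _ _ measurableT _ (EFin \o (fun z : RR => C * gauss s z + 2 * s * gauss (2 * s) z))).
- exact/measurable_EFinP.
- move=> z _; rewrite /= lee_fin; apply: le_trans (ler_norm _).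
  by apply: le_trans (fg z) _; rewrite lerD2l gauss_lin.
- apply: integrable_add => //; apply: integrable_scale => //; exact: integrable_gauss.
Qed.

Let F (u : R) : R := \int[mu]_(z in (setT : set RR)) (cos (u * z) * gauss s z).

Let mcos (u : R) : measurable_fun (setT : set RR) (fun z => cos (u * z)).
Proof. by apply: continuous_measurable_fun; exact: continuous_cos_lin. Qed.
Let msin (u : R) : measurable_fun (setT : set RR) (fun z => sin (u * z)).
Proof. by apply: continuous_measurable_fun; exact: continuous_sin_lin. Qed.

Let iF (u : R) : mu.-integrable setT (EFin \o (fun z => cos (u * z) * gauss s z)).
Proof.
apply: (@dom _ 1).
  by apply: measurable_funM; [exact: mcos|exact: measurable_gauss].
move=> z; rewrite normrM (gtr0_norm (gauss_gt0 s _)).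
have g0 := gauss_gt0 s z.
apply: (@le_trans _ _ (1 * gauss s z)); first by rewrite ler_wpM2r ?(ltW g0) ?cos_max.
by rewrite lerDl mulr_ge0 ?(ltW g0).
Qed.

Let iS (u : R) : mu.-integrable setT (EFin \o (fun z => z * sin (u * z) * gauss s z)).
Proof.
apply: (@dom _ 0).
  apply: measurable_funM; last exact: measurable_gauss.
  by apply: measurable_funM => //; exact: msin.
move=> z; rewrite !normrM (gtr0_norm (gauss_gt0 s _)) mul0r add0r.
rewrite ler_wpM2r ?(ltW (gauss_gt0 s _))//.
by rewrite ler_piMr ?sin_max.
Qed.

Let by_parts (u : R) :
  \int[mu]_(z in (setT : set RR)) (z * sin (u * z) * gauss s z) = s ^+ 2 * u * F u.
Proof.
pose f z := sin (u * z) * gauss s z.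
pose df z := u * (cos (u * z) * gauss s z) - (s ^+ 2)^-1 * (z * sin (u * z) * gauss s z).
have fdf z : is_derive z (1 : R) f (df z).
  have := is_derive_gauss s0 z => dg.
  by apply: is_derive_eq; rewrite /GRing.scale/= /df; field; rewrite gt_eqF.
have idf : mu.-integrable setT (EFin \o df).
  apply: (@integrable_add _ _ _ _ _ measurableT (fun z : RR => u * (cos (u * z) * gauss s z))
     (fun z : RR => - ((s ^+ 2)^-1 * (z * sin (u * z) * gauss s z)))).
    by apply: integrable_scale => //; exact: iF.
  rewrite (_ : (fun z => _) = (fun z => - (s ^+ 2)^-1 * (z * sin (u * z) * gauss s z))).
    by apply: integrable_scale => //; exact: iS.
  by apply/funext => z; rewrite mulNr.
have cdf : continuous df.
  have ddf z : exists D, is_derive z (1 : R) df D.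
    have := is_derive_gauss s0 z => dg.
    by eexists; rewrite /df; apply: is_derive_eq.
  move=> z; apply: differentiable_continuous; apply/derivable1_diffP.
  by have [D []] := ddf z.
have b0 (v : nat -> R) : (forall n, n%:R = `|v n|) -> f (v n) @[n --> \oo] --> (0 : R).
  move=> vn; have /cvg_norm := gauss_cvg0 vn; rewrite normr0 => c.
  apply/norm_cvg0P; apply: squeeze0 c; apply: nearW => n.
  by rewrite normr_ge0/= normrM -[leRHS]mul1r ler_wpM2r// sin_max.
have := Rintegral_derive0 fdf cdf idf.
move=> /(_ (b0 (fun n => n%:R) _) (b0 (fun n => - n%:R) _)) H.
have : \int[mu]_x df x = 0.
  by apply: H => n; rewrite ?normrN normr_nat.
rewrite /df RintegralB//; last 2 first.
- by apply: integrable_scale => //; exact: iF.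
- by apply: integrable_scale => //; exact: iS.
rewrite !RintegralZl//.
  by rewrite -/(F u) => /eqP; rewrite subr_eq0 => /eqP /(congr1 ( *%R (s ^+ 2))) e;
    rewrite -mulrA e mulrA divff ?mul1r// expf_neq0// gt_eqF.
all: by [exact: iF|exact: iS].
Qed.

Let dF (u : R) : is_derive u (1 : R) F (- (s ^+ 2 * u * F u)).
Proof.
pose f (x : R) (z : RR) := cos (x * z) * gauss s z.
have fdf x z : is_derive x (1 : R) (f ^~ z) (- (z * sin (x * z) * gauss s z)).
  by rewrite /f; apply: is_derive_eq; rewrite /GRing.scale/=; ring.
have Ia : `]u - 1, u + 1[%classic u by rewrite /= in_itv/=; apply/andP; split; lra.
have int_f x : `]u - 1, u + 1[%classic x -> mu.-integrable setT (EFin \o f x).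
  by move=> _; exact: iF.
have der_f (x : R) (z : RR) : `]u - 1, u + 1[%classic x -> setT z -> derivable (f ^~ z) x 1.
  by move=> _ _; have [] := fdf x z.
have d1 x z : partial1of2 f x z = - (z * sin (x * z) * gauss s z).
  by rewrite partial1of2E; have [] := fdf x z.
pose B (z : R) := 2 * s * gauss (2 * s) z.
have B0 z : 0 <= B z by rewrite mulr_ge0 ?(ltW s20)// ltW// gauss_gt0.
have iB : mu.-integrable setT (EFin \o B).
  by apply: integrable_scale => //; exact: integrable_gauss.
have ubB (x : R) (z : RR) : `]u - 1, u + 1[%classic x -> setT z -> `|partial1of2 f x z| <= B z.
  move=> _ _; rewrite d1 normrN !normrM (gtr0_norm (gauss_gt0 s _)).
  apply: le_trans (gauss_lin s0 z); rewrite ler_wpM2r ?(ltW (gauss_gt0 s _))//.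
  by rewrite ler_piMr ?sin_max.
have D1 := derivable_under_integral measurableT Ia int_f der_f B0 iB ubB.
have D2 := differentiation_under_integral measurableT Ia int_f der_f B0 iB ubB.
split; first exact: D1.
rewrite -derive1E D2 -by_parts.
transitivity (\int[mu]_(z in (setT : set RR)) ((-1) * (z * sin (u * z) * gauss s z))).
  by apply: eq_Rintegral => z _; rewrite d1 mulN1r.
by rewrite RintegralZl// ?mulN1r//; exact: iS.
Qed.

(** Differentiation under the integral and integration by parts give [F' = - s^2 u F], an equation
    also solved by [gauss s^-1]; the quotient is constant, and its value at 0 is the mass. *)
Lemma gauss_fourier (u : R) :
  \int[mu]_(z in (setT : set RR)) (cos (u * z) * gauss s z) = gauss_mass s * gauss s^-1 u.
Proof.
have si : 0 < s^-1 by rewrite invr_gt0.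
pose H x := F x / gauss s^-1 x.
have gn x : gauss s^-1 x != 0 by rewrite gt_eqF// gauss_gt0.
have dH x : is_derive x (1 : R) H 0.
  have dg := is_derive_gauss si x.
  have dV := @realfun.is_deriveV R (gauss s^-1) x _ _ (gn x) dg.
  have := dF x => dFx; rewrite /H.
  apply: is_derive_eq; rewrite /GRing.scale/=.
  by move: (gauss s^-1 x) (gn x) => G G0; field; rewrite G0 gt_eqF.
have e : F u = H 0 * gauss s^-1 u.
  have -> : H 0 = H u by exact: is_derive_0_is_cst.
  by rewrite /H divfK.
rewrite -/(F u) e /H /gauss expr0n/= mul0r oppr0 expR0 divr1 /F.
congr (_ * _); rewrite (_ : gauss_mass s = fine (gauss_mass s)%:E)// -(integral_gauss s0 0).
by rewrite /Rintegral; congr fine; apply: eq_integral => z _; rewrite mul0r cos0 mul1r subr0.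
Qed.

Lemma gauss_massV : gauss_mass s * gauss_mass s^-1 = 2 * pi.
Proof.
rewrite /gauss_mass /normal_peak !invrK -sqrtrM; last by rewrite mulrn_wge0// mulr_ge0 ?sqr_ge0 ?pi_ge0.
have -> : s ^+ 2 * pi *+ 2 * (s^-1 ^+ 2 * pi *+ 2) = (2 * pi) ^+ 2 :> R.
  by field; rewrite gt_eqF.
by rewrite sqrtr_sqr ger0_norm// mulr_ge0// pi_ge0.
Qed.

End gauss_fourier_transform.

Section triangle.
Context {R : realType} {d : measure_display} {T : measurableType d}.
Variables (m : {measure set T -> \bar R}) (D : set T).
Hypothesis mD : measurable D.

(** Multiplication by the conjugate of the integral rotates it onto the real axis, where the
    constant is 1. *)
Lemma normc_cintegral_le_int (f : T -> R[i]) : cintegrable m D f ->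
  normc (cintegral m D f) <= \int[m]_(x in D) normc (f x).
Proof.
move=> fi; set z := cintegral m D f.
have [z0|z0] := eqVneq z 0.
  by rewrite z0 normc0; apply: Rintegral_ge0 => x _; exact: normc_ge0.
have nz := normc_gt0 z0.
have inf_ := cintegrable_normc mD fi.
rewrite -(ler_pM2l nz) -expr2 normcE2.
have -> : Re z ^+ 2 + Im z ^+ 2 = Re (conjc z * z).
  by case: (z) => a b; rewrite ReM /=; ring.
rewrite {2}/z -cintegralMl// /= -RintegralZl//.
have [i1 _] := cintegrableMl mD (conjc z) fi.
apply: le_Rintegral => //.
- exact: integrable_scale.
- move=> x _; apply: le_trans (ler_norm _) _; apply: le_trans (normc_Re _) _.
  by rewrite normcM; have -> : normc (conjc z) = normc z by case: (z) => a b /=; rewrite sqrrN.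
Qed.

End triangle.

Section fourier_inverse.
Context {R : realType}.
Local Notation RR := (measurableTypeR R).
Local Notation mu := (@lebesgue_measure R).

Lemma cmeasurable_expi_comp d (T : measurableType d) (D : set T) (g : T -> R) :
  measurable_fun D g -> cmeasurable D (fun x => expi (g x)).
Proof. by move=> mg; apply: cmeasurable_cexp; split => //=; exact: measurable_cst. Qed.

(** The inverse Fourier transform. [dens] takes a real part so as to be a real function before [psi]
    is known to be the characteristic function of anything. Domination by one fixed Gaussian gives
    integrability, and dominated convergence for sequences of such [psi]. *)
Definition cinv (psi : R -> R[i]) (y : R) : R[i] :=
  cintegral mu setT (fun u : RR => expi (- (u * y)) * psi u).
Definition dens (psi : R -> R[i]) (y : R) : R := (2 * pi)^-1 * Re (cinv psi y).
Definition gauss_dominated (r : R) (psi : R -> R[i]) :=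
  cmeasurable (setT : set RR) psi /\ forall u, normc (psi u) <= gauss r u.

Variable r : R.
Hypothesis r0 : 0 < r.
Implicit Types psi : R -> R[i].

Let norm_kernel (a : R) psi u : normc (expi a * psi u) = normc (psi u).
Proof. by rewrite (normcM (expi a)) normc_expi mul1r. Qed.

Lemma cmeasurable_cinv psi y : gauss_dominated r psi ->
  cmeasurable (setT : set RR) (fun u : RR => expi (- (u * y)) * psi u).
Proof.
move=> [mpsi _]; apply: cmeasurableM => //; apply: cmeasurable_expi_comp.
by apply: measurableT_comp => //; exact: measurable_funM.
Qed.

Lemma cintegrable_cinv psi y : gauss_dominated r psi ->
  cintegrable mu setT (fun u : RR => expi (- (u * y)) * psi u).
Proof.
move=> hpsi; apply: (cintegrable_dom measurableT (cmeasurable_cinv y hpsi) (integrable_gauss r0)).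
by move=> u _; rewrite norm_kernel; exact: hpsi.2.
Qed.

Lemma cinv_limit (psi_ : nat -> R -> R[i]) psi (y_ : nat -> R) y :
  (forall n, gauss_dominated r (psi_ n)) -> y_ @ \oo --> y ->
  (forall u, ccvg (psi_ ^~ u) (psi u)) ->
  ccvg (fun n => cinv (psi_ n) (y_ n)) (cinv psi y).
Proof.
move=> hpsi yc psic.
have [_ //] : cintegrable mu setT (fun u : RR => expi (- (u * y)) * psi u) /\
  ccvg (fun n => cinv (psi_ n) (y_ n)) (cinv psi y).
apply: (cdominated measurableT (f_ := fun n (u : RR) => expi (- (u * y_ n)) * psi_ n u) _ _ (integrable_gauss r0)).
- by move=> n; exact: cmeasurable_cinv.
- move=> u _; apply: ccvgM => //; apply: ccvg_cexp.
  apply: (@ccvg_squeeze _ _ _ (fun n => `|u * (y_ n - y)|)).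
    apply: nearW => n; apply: le_trans (normc_le_ReIm _) _.
    rewrite ReB ImB /= subrr normr0 add0r -normrN.
    by rewrite le_eqVlt; apply/orP; left; apply/eqP; congr (`|_|); ring.
  rewrite -[X in _ --> X](normr0 R) -(mulr0 u) -(subrr y); apply: cvg_norm.
  by apply: cvgM; [exact: cvg_cst|apply: cvgB => //; exact: cvg_cst].
- by move=> n u _; rewrite norm_kernel; exact: (hpsi n).2.
Qed.

Lemma dens_continuous psi : gauss_dominated r psi -> continuous (dens psi).
Proof.
move=> hpsi y; apply/(@cvg_nbhsP R R^o) => u uy.
apply: cvgM; first exact: cvg_cst.
by apply: ccvg_Re; apply: cinv_limit => // v; exact: ccvg_cst.
Qed.

Lemma measurable_dens psi : gauss_dominated r psi -> measurable_fun (setT : set RR) (dens psi).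
Proof. by move=> hpsi; apply: continuous_measurable_fun; exact: dens_continuous. Qed.

Section average.
Variables (m : {sigma_finite_measure set RR -> \bar R}) (w : RR -> R) (psi : R -> R[i]).
Hypothesis iw : m.-integrable setT (EFin \o w).
Hypothesis hpsi : gauss_dominated r psi.

Definition weighted_charf (u : R) : R[i] :=
  cintegral m setT (fun x : RR => (w x)%:C * expi (u * x)).

Let mw : measurable_fun setT w.
Proof. by apply/measurable_EFinP; exact: (measurable_int _ iw). Qed.

Lemma cintegrable_weighted (u : R) : cintegrable m setT (fun x : RR => (w x)%:C * expi (u * x)).
Proof.
apply: (cintegrable_dom measurableT _ (integrable_abse iw)).
  apply: cmeasurableM; first exact: cmeasurable_real.
  by apply: cmeasurable_expi_comp; exact: measurable_funM.
by move=> x _; rewrite (normcM _ (expi _)) normc_expi mulr1 normcR.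
Qed.

Let f (y : R) (z : RR * RR) : R[i] := (w z.1)%:C * (expi (- (z.2 * (y - z.1))) * psi z.2).

Let mf y : cmeasurable setT (f y).
Proof.
apply: cmeasurableM.
  by apply: cmeasurable_real; apply: measurableT_comp => //; exact: measurable_fst.
apply: cmeasurableM; last by apply: (cmeasurable_comp hpsi.1); exact: measurable_snd.
apply: cmeasurable_expi_comp; apply: measurableT_comp => //; apply: measurable_funM.
  exact: measurable_snd.
by apply: measurable_funB => //; exact: measurable_fst.
Qed.

Let iaw : m.-integrable setT (EFin \o (fun x => `|w x|)).
Proof. exact: integrable_abse iw. Qed.

Let fg y (x u : RR) : normc (f y (x, u)) <= `|w x| * gauss r u.
Proof. by rewrite /f normcM normcR norm_kernel ler_wpM2l//; exact: hpsi.2. Qed.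

(** By Fubini's theorem, superposing translates of [cinv psi] with weights multiplies [psi] by the
    transform of the weights. Measurability of the product in [u] comes along, and later gives that
    of the transform itself. *)
Lemma cinv_average y :
  cintegrable m setT (fun x : RR => (w x)%:C * cinv psi (y - x)) /\
  cintegral m setT (fun x : RR => (w x)%:C * cinv psi (y - x)) =
    cinv (fun u => weighted_charf u * psi u) y /\
  cmeasurable (setT : set RR) (fun u => weighted_charf u * psi u).
Proof.
have e x : (w x)%:C * cinv psi (y - x) = cintegral mu setT (fun u : RR => f y (x, u)).
  by rewrite -(cintegralMl measurableT _ (cintegrable_cinv _ hpsi)).
have e2 y' u : cintegral m setT (fun x : RR => f y' (x, u)) =
    expi (- (u * y')) * (weighted_charf u * psi u).
  rewrite [weighted_charf u * _]mulrC mulrA -(cintegralMl measurableT _ (cintegrable_weighted u)).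
  apply: eq_cintegral => x _; rewrite /f.
  have -> : expi (- (u * (y' - x))) = expi (- (u * y')) * expi (u * x).
    by rewrite -expiD; congr expi; ring.
  by rewrite [RHS]mulrCA; congr (_ * _); rewrite mulrAC.
split; [|split].
- have := cintegrable_section1 (mf y) iaw (integrable_gauss r0) (fg y).
  by apply: eq_cintegrable => // x _; rewrite e.
- transitivity (cintegral m setT (fun x : RR => cintegral mu setT (fun u : RR => f y (x, u)))).
    by apply: eq_cintegral => x _; rewrite e.
  rewrite (cFubini (mf y) iaw (integrable_gauss r0) (fg y)).
  by apply: eq_cintegral => u _; rewrite e2.
- have := cintegrable_section2 (mf 0) iaw (integrable_gauss r0) (fg 0).
  move/cintegrable_cmeasurable; apply: eq_cmeasurable => u _.
  by rewrite e2 mulr0 oppr0 expi0 mul1r.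
Qed.

Lemma dens_average y :
  m.-integrable setT (EFin \o (fun x : RR => w x * dens psi (y - x))) /\
  \int[m]_x (w x * dens psi (y - x)) = dens (fun u => weighted_charf u * psi u) y.
Proof.
have [[i1 _] [e _]] := cinv_average y.
have Re_w (x : RR) : (2 * pi)^-1 * Re ((w x)%:C * cinv psi (y - x)) = w x * dens psi (y - x).
  by rewrite /dens ReM /= mul0r subr0 mulrCA.
have -> : (fun x : RR => w x * dens psi (y - x)) = (fun x => (2 * pi)^-1 * Re ((w x)%:C * cinv psi (y - x))).
  by apply/funext => x; rewrite Re_w.
split; first exact: integrable_scale.
by rewrite RintegralZl// /dens -e.
Qed.

End average.

Section base.
Variables (q b : R).
Hypothesis q0 : 0 < q.
Hypothesis rq : q^-1 <= r.

(** The characteristic function of the normal law of mean [b] and standard deviation [q]. *)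
Definition gauss_charf (u : R) : R[i] := expi (u * b) * (gauss q^-1 u)%:C.

Lemma gauss_charf_dominated : gauss_dominated r gauss_charf.
Proof.
have qi : 0 < q^-1 by rewrite invr_gt0.
split.
  apply: cmeasurableM; first by apply: cmeasurable_expi_comp; exact: measurable_funM.
  by apply: cmeasurable_real; exact: measurable_gauss.
move=> u; rewrite norm_kernel normcR gtr0_norm ?gauss_gt0// ler_expR lerN2.
rewrite ler_wpM2l ?sqr_ge0// lef_pV2 ?posrE ?mulr_gt0 ?exprn_gt0//.
by rewrite ler_pM2l// lerXn2r// nnegrE ltW.
Qed.

(** Fourier inversion is verified explicitly for normal laws; the inversion for smoothed laws
    follows from it by averaging. *)
Lemma dens_gauss y : dens gauss_charf y = normal_pdf b q y.
Proof.
have qi : 0 < q^-1 by rewrite invr_gt0.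
rewrite normal_pdf_gauss// /dens /cinv /=.
have -> : \int[mu]_x Re (expi (- (x * y)) * gauss_charf x) = gauss_mass q^-1 * gauss q (y - b).
  rewrite -{2}(invrK q) -gauss_fourier//; apply: eq_Rintegral => u _.
  rewrite /gauss_charf mulrA -expiD (ReM (expi _)) Re_expi /= mulr0 subr0.
  by rewrite -cosN; congr (cos _ * _); ring.
rewrite mulrA; congr (_ * _); apply: (@mulIf _ (gauss_mass q)).
  by rewrite gt_eqF// gauss_mass_gt0.
rewrite mulVf ?gt_eqF ?gauss_mass_gt0// -mulrA [gauss_mass _ * _]mulrC gauss_massV//.
by rewrite mulVf// gt_eqF// mulr_gt0// pi_gt0.
Qed.

(** Completing the square shifts the mean by [q ^+ 2 * th]. *)
Lemma gauss_moment (th : R) :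
  (\int[mu]_y (expR (th * y) * normal_pdf b q y)%:E = (expR (th * b + q ^+ 2 * th ^+ 2 / 2))%:E)%E.
Proof.
set k := expR _.
have -> : (\int[mu]_y (expR (th * y) * normal_pdf b q y)%:E =
   \int[mu]_y (k%:E * (normal_pdf (b + q ^+ 2 * th) q y)%:E))%E.
  apply: eq_integral => y _; rewrite -EFinM !normal_pdf_gauss//; congr EFin.
  rewrite mulrCA [RHS]mulrCA; congr (_ * _); rewrite /k /gauss -!expRD; congr expR.
  by field; rewrite gt_eqF.
by rewrite integralZl ?integral_normal_pdf ?mule1//; exact: integrable_normal_pdf.
Qed.

End base.

End fourier_inverse.

(** * Characteristic functions determine laws *)

Section characteristic_function.
Context {R : realType}.
Local Notation RR := (measurableTypeR R).
Local Notation mu := (@lebesgue_measure R).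

Definition charf (m : {measure set RR -> \bar R}) (u : R) : R[i] :=
  cintegral m setT (fun x : RR => expi (u * x)).

Lemma integrable_prob_cst d (T : measurableType d) (m : probability T R) (k : R) :
  m.-integrable setT (EFin \o (fun=> k)).
Proof. exact: finite_measure_integrable_cst. Qed.

(** Normal smoothing multiplies the characteristic function by a Gaussian, which makes it integrable
    and the inversion formula available for an arbitrary law. *)
Lemma smooth_charf (m : probability RR R) (s y : R) : 0 < s ->
  m.-integrable setT (EFin \o (fun x : RR => normal_pdf x s y)) /\
  \int[m]_x normal_pdf x s y = dens (fun u => charf m u * (gauss s^-1 u)%:C) y.
Proof.
move=> s0; have si : 0 < s^-1 by rewrite invr_gt0.
have hg : gauss_dominated s^-1 (gauss_charf s 0) by exact: gauss_charf_dominated.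
have [i e] := dens_average si (integrable_prob_cst m 1) hg y.
have ex : (fun x : RR => 1 * dens (gauss_charf s 0) (y - x)) = (fun x : RR => normal_pdf x s y).
  by apply/funext => x; rewrite mul1r dens_gauss// !normal_pdf_gauss// subr0.
rewrite ex in i e; split; first exact: i.
have eu : (fun u => weighted_charf m (fun=> 1) u * gauss_charf s 0 u) =
    (fun u => charf m u * (gauss s^-1 u)%:C).
  apply/funext => u; rewrite /gauss_charf mulr0 expi0 mul1r; congr (_ * _).
  by apply: eq_cintegral => x _; rewrite mul1r.
by rewrite e eu.
Qed.

Lemma measurable_normal_kernel (s : R) : 0 < s ->
  measurable_fun setT (fun z : RR * RR => normal_pdf z.1 s z.2).
Proof.
move=> s0; rewrite (_ : (fun z => _) = (fun z : RR * RR => (gauss_mass s)^-1 * gauss s (z.2 - z.1))).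
  apply: measurable_funM => //.
  apply: (measurableT_comp (measurable_gauss s0)).
  by apply: measurable_funB; [exact: measurable_snd|exact: measurable_fst].
by apply/funext => z; rewrite normal_pdf_gauss.
Qed.

(** On [A] the factor [del] is at most [|y - x|], so [gauss_lin] bounds the density by [2 s / del]
    times a Gaussian of double width; the mass of the latter is doubled as well, which makes the 2 a
    4. *)
Lemma normal_tail (x s del : R) (A : set RR) : 0 < s -> 0 < del -> measurable A ->
  A `<=` [set y | del <= `|y - x|] -> (normal_prob x s A <= (4 * s / del)%:E)%E.
Proof.
move=> s0 del0 mA Adel.
have m0 := gauss_mass_gt0 s0.
have s20 : 0 < 2 * s by rewrite mulr_gt0.
have m2 : gauss_mass (2 * s) = 2 * gauss_mass s.
  rewrite /gauss_mass /normal_peak !invrK.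
  have -> : (2 * s) ^+ 2 * pi *+ 2 = 2 ^+ 2 * (s ^+ 2 * pi *+ 2) by ring.
  by rewrite sqrtrM ?sqr_ge0// sqrtr_sqr ger0_norm.
have h (y : RR) : A y -> normal_pdf x s y <= (2 * s / del / gauss_mass s) * gauss (2 * s) (y - x).
  move=> /Adel /= dy; rewrite normal_pdf_gauss//.
  have := gauss_lin s0 (y - x) => h1.
  have g0 := gauss_gt0 s (y - x).
  have h2 : del * gauss s (y - x) <= 2 * s * gauss (2 * s) (y - x).
    by apply: le_trans h1; rewrite ler_wpM2r// ltW.
  have -> : 2 * s / del / gauss_mass s * gauss (2 * s) (y - x) =
    (gauss_mass s)^-1 * (2 * s * gauss (2 * s) (y - x) / del).
    by field; rewrite (gt_eqF m0) (gt_eqF del0).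
  by rewrite ler_wpM2l ?invr_ge0 ?(ltW m0)// ler_pdivlMr// mulrC.
have k0 : 0 <= 2 * s / del / gauss_mass s.
  by rewrite !divr_ge0 ?mulr_ge0 ?(ltW s0) ?(ltW del0) ?(ltW m0).
have mg : measurable_fun (setT : set RR) (fun y => gauss (2 * s) (y - x)).
  by apply: (measurableT_comp (measurable_gauss s20)); exact: measurable_funB.
rewrite /normal_prob.
apply: (@le_trans _ _ (\int[mu]_(y in A) ((2 * s / del / gauss_mass s)%:E * (gauss (2 * s) (y - x))%:E))%E).
  apply: ge0_le_integral => //.
  - by move=> y _; rewrite lee_fin normal_pdf_ge0.
  - by apply/measurable_EFinP; apply: measurable_funTS; exact: measurable_normal_pdf.
  - by apply/measurable_EFinP; apply: measurable_funTS; exact: measurable_funM.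
apply: (@le_trans _ _ (\int[mu]_y ((2 * s / del / gauss_mass s)%:E * (gauss (2 * s) (y - x))%:E))%E).
  apply: ge0_subset_integral => //.
  - by apply/measurable_EFinP; exact: measurable_funM.
  - by move=> y _; rewrite -EFinM lee_fin mulr_ge0// ltW// gauss_gt0.
rewrite ge0_integralZl//; last 2 first.
- exact/measurable_EFinP.
- by move=> y _; rewrite lee_fin ltW// gauss_gt0.
rewrite integral_gauss// m2 -EFinM lee_fin le_eqVlt; apply/orP; left; apply/eqP.
by field; rewrite (gt_eqF m0) (gt_eqF del0).
Qed.

Section injectivity.
Variables m1 m2 : probability RR R.
Hypothesis m12 : charf m1 =1 charf m2.

Let below (b s : R) (x : RR) : R := fine (normal_prob x s `]-oo, b]).

Let below_E (b s : R) x : ((below b s x)%:E = normal_prob x s `]-oo, b])%E.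
Proof. by rewrite /below fineK// fin_num_measure. Qed.

Let below_kernel (b s : R) x : 0 < s ->
  ((below b s x)%:E = \int[mu]_y ((\1_(`]-oo, b] : set RR) y) * normal_pdf x s y)%:E)%E.
Proof.
move=> s0; rewrite below_E /normal_prob integral_mkcond; apply: eq_integral => y _.
by rewrite patchE indicE; case: ifPn => _; rewrite ?mul1r ?mul0r.
Qed.

Let kernel (b s : R) (z : RR * RR) : \bar R := ((\1_(`]-oo, b] : set RR) z.2) * normal_pdf z.1 s z.2)%:E.

Let mkernel b s : 0 < s -> measurable_fun setT (kernel b s).
Proof.
move=> s0; apply/measurable_EFinP; apply: measurable_funM; last exact: measurable_normal_kernel.
apply: measurableT_comp; last exact: measurable_snd.
by apply: measurable_indic; exact: measurable_itv.
Qed.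

Let kernel0 b s z : (0 <= kernel b s z)%E.
Proof. by rewrite lee_fin mulr_ge0 ?normal_pdf_ge0. Qed.

Let measurable_below b s : 0 < s -> measurable_fun setT (below b s).
Proof.
move=> s0; apply/measurable_EFinP.
have -> : EFin \o below b s = fubini_F mu (kernel b s).
  by apply/funext => x /=; rewrite below_kernel.
by apply: measurable_fun_fubini_tonelli_F; [exact: mkernel|exact: kernel0].
Qed.

Let integral_below (m : probability RR R) b s : 0 < s ->
  (\int[m]_x (below b s x)%:E = \int[mu]_y ((\1_(`]-oo, b] : set RR) y) *
     dens (fun u => charf m u * (gauss s^-1 u)%:C) y)%:E)%E.
Proof.
move=> s0; transitivity (\int[m]_x \int[mu]_y kernel b s (x, y))%E.
  by apply: eq_integral => x _; rewrite below_kernel.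
rewrite (fubini_tonelli _ (mkernel b s0) (kernel0 b s)); apply: eq_integral => y _.
have [i e] := smooth_charf m y s0.
rewrite -e EFinM /Rintegral fineK; last exact: integrable_fin_num i.
by rewrite -integralZl.
Qed.

Let below_bound b s x : 0 <= below b s x <= 1.
Proof.
by rewrite fine_ge0//= -lee_fin below_E probability_le1.
Qed.

(** The width of the smoothing is the square of the shift [1 / (k + 1)]. Being of smaller order than
    the shift, it lets the smoothed indicator of []-oo, b - 1 / (k + 1)]] tend to 0 also at [x = b],
    hence to the indicator of the open ray at every point. *)
Let sq (k : nat) : R := (k.+1%:R^-1) ^+ 2.
Let sq0 k : 0 < sq k. Proof. by rewrite exprn_gt0// invr_gt0. Qed.

Let below_limit (b : R) (x : RR) :
  below (b - k.+1%:R^-1) (sq k) x @[k --> \oo] --> (\1_(`]-oo, b[ : set RR) x : R).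
Proof.
have hc := @cvg_harmonic R.
have sqc : sq k @[k --> \oo] --> (0 : R).
  by rewrite -[X in _ --> X](mul0r 0) /sq; under eq_fun do rewrite expr2; exact: cvgM.
rewrite indicE; have [xb|bx] := ltP x b; last first.
  rewrite memNset /=; last by rewrite in_itv/= ltNge bx.
  apply: (@squeeze0 _ _ (fun k => 4 * k.+1%:R^-1)).
    apply: nearW => k; have /andP[-> _]/= := below_bound (b - k.+1%:R^-1) (sq k) x.
    rewrite -lee_fin below_E.
    have k0 : (0 : R) < k.+1%:R^-1 by rewrite invr_gt0.
    have -> : 4 * k.+1%:R^-1 = 4 * sq k / k.+1%:R^-1.
      by move: k0; rewrite /sq; move: (k.+1%:R^-1 : R) => q q0; field; rewrite gt_eqF.
    apply: normal_tail => //.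
    by move=> y; rewrite /= in_itv/=; move: (k.+1%:R^-1 : R) k0 => q q0 yb; rewrite distrC ger0_norm; lra.
  by rewrite -[X in _ --> X](mulr0 4); apply: cvgM => //; exact: cvg_cst.
rewrite mem_set /=; last by rewrite in_itv.
pose del := (b - x) / 2; have del0 : 0 < del by rewrite divr_gt0// subr_gt0.
have c1 : 1 - below (b - k.+1%:R^-1) (sq k) x @[k --> \oo] --> (0 : R).
  apply: (@squeeze0 _ _ (fun k => 4 / del * sq k)).
    have /cvgrPdist_le/(_ _ del0) := hc; apply: filterS => k.
    rewrite sub0r normrN ger0_norm ?invr_ge0// => kd.
    have /andP[_ h1] := below_bound (b - k.+1%:R^-1) (sq k) x; rewrite subr_ge0 h1/=.
    have -> : 4 / del * sq k = 4 * sq k / del by rewrite mulrAC.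
    rewrite -lee_fin EFinB below_E -probability_setC; last exact: measurable_itv.
    apply: normal_tail => //.
      by apply: measurableC; exact: measurable_itv.
    move=> y /=; rewrite in_itv/= => /negP; rewrite -ltNge => yb.
    have kd' : (k.+1%:R^-1 : R) <= del by [].
    move: kd' yb; rewrite /del; move: (k.+1%:R^-1 : R) => q qd yb.
    by rewrite ger0_norm; lra.
  by rewrite -[X in _ --> X](mulr0 (4 / del)); apply: cvgM => //; exact: cvg_cst.
rewrite (_ : (fun k => _) = (fun k => 1 - (1 - below (b - k.+1%:R^-1) (sq k) x))).
  by rewrite -[X in _ --> X](subr0 1); apply: cvgB => //; exact: cvg_cst.
by apply/funext => k; rewrite subKr.
Qed.

Let ray_limit (m : probability RR R) b :
  ccvg (fun k => (\int[m]_x below (b - k.+1%:R^-1) (sq k) x)%:C) (\int[m]_x (\1_(`]-oo, b[ : set RR) x : R))%:C.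
Proof.
have [_ c] : cintegrable m setT (fun x : RR => (\1_(`]-oo, b[ : set RR) x : R)%:C) /\
  ccvg (fun k => cintegral m setT (fun x : RR => (below (b - k.+1%:R^-1) (sq k) x)%:C))
    (cintegral m setT (fun x : RR => (\1_(`]-oo, b[ : set RR) x : R)%:C)).
  apply: (cdominated measurableT _ _ (integrable_prob_cst m 1)).
  - by move=> k; apply: cmeasurable_real; exact: measurable_below.
  - by move=> x _; apply: ccvg_real; exact: below_limit.
  - move=> k x _; have /andP[h0 h1] := below_bound (b - k.+1%:R^-1) (sq k) x.
    by rewrite normcR ger0_norm.
by rewrite -cintegral_real; apply: ccvg_eq c; apply: nearW => k; rewrite cintegral_real.
Qed.

(** The density of a smoothed law depends on the characteristic function alone; removing the
    smoothing identifies the masses of open rays, which are stable under intersection and generate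
    the Borel sets. *)
Lemma charf_inj (A : set RR) : measurable A -> m1 A = m2 A.
Proof.
have ray b : m1 `]-oo, b[%classic = m2 `]-oo, b[%classic.
  have mr : measurable (`]-oo, b[ : set RR) by exact: measurable_itv.
  have e : \int[m1]_x (\1_(`]-oo, b[ : set RR) x : R) = \int[m2]_x (\1_(`]-oo, b[ : set RR) x : R).
    suff : (\int[m1]_x (\1_(`]-oo, b[ : set RR) x : R))%:C = (\int[m2]_x (\1_(`]-oo, b[ : set RR) x : R))%:C :> R[i] by case.
    apply: ccvg_unique (ray_limit m1 b) _.
    apply: ccvg_eq (ray_limit m2 b); apply: nearW => k; congr _%:C.
    have := integral_below m2 (b - k.+1%:R^-1) (sq0 k).
    rewrite (_ : (fun u => charf m2 u * (gauss (sq k)^-1 u)%:C) = (fun u => charf m1 u * (gauss (sq k)^-1 u)%:C)).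
      by rewrite -integral_below// => /(congr1 fine).
    by apply/funext => u; rewrite m12.
  have key (m : probability RR R) : m `]-oo, b[%classic = (\int[m]_x (\1_(`]-oo, b[ : set RR) x : R))%:E.
    by rewrite /Rintegral integral_indic// setIT fineK// fin_num_measure.
  by rewrite !key e.
move=> mA.
refine (@measure_unique _ R RR (@RGenInftyO.G R) (fun n => (`]-oo, n%:R[%classic : set RR)) _ _ _ _ m1  m2 _ _ A mA).
- exact: RGenInftyO.measurableE.
- move=> _ _ [x ->] [y ->]; exists (Num.min x y); apply/seteqP; split => z /=;
    by rewrite !in_itv/= lt_min => /andP.
- by move=> n; exists n%:R.
- apply/seteqP; split => // x _; exists (Num.truncn `|x|).+1 => //=.
  by rewrite in_itv/= (le_lt_trans (ler_norm x))// truncnS_gt.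
- by move=> _ [x ->]; exact: ray.
- by move=> n; rewrite (le_lt_trans (probability_le1 _ _))// ?ltry//; exact: measurable_itv.
Qed.

End injectivity.

End characteristic_function.

(** * Exponential moments *)

Section exponential_limit.
Context {R : realType}.

Lemma normc_expB_le (x y : R[i]) (K : R) n : 1 <= K -> normc x <= K -> normc y <= K ->
  normc (x ^+ n - y ^+ n) <= n%:R * normc (x - y) * K ^+ n.
Proof.
move=> K1 xK yK; have K0 : 0 <= K by rewrite (le_trans _ K1).
elim: n => [|n IH]; first by rewrite !expr0 subrr normc0 !mul0r.
have -> : x ^+ n.+1 - y ^+ n.+1 = x * (x ^+ n - y ^+ n) + (x - y) * y ^+ n.
  by rewrite !exprS; ring.
apply: le_trans (normcD _ _) _; rewrite !normcM normcX.
have h1 : normc x * normc (x ^+ n - y ^+ n) <= K * (n%:R * normc (x - y) * K ^+ n).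
  by rewrite ler_pM ?normc_ge0.
have h2 : normc (x - y) * normc y ^+ n <= normc (x - y) * K ^+ n.+1.
  rewrite ler_wpM2l ?normc_ge0// exprS.
  apply: (@le_trans _ _ (K ^+ n)); first by rewrite lerXn2r ?nnegrE ?normc_ge0.
  by rewrite ler_peMl ?exprn_ge0.
rewrite -natr1 exprS in h2 *.
apply: le_trans (lerD h1 h2) _; rewrite le_eqVlt; apply/orP; left; apply/eqP; ring.
Qed.

(** [1 + z / n] and [exp (z / n)] differ by [O(1 / n^2)], and passing to [n]-th powers loses only
    one factor [n]. *)
Lemma cexp_limit (z : R[i]) : ccvg (fun n => (1 + z * (n%:R^-1)%:C) ^+ n) (cexp z).
Proof.
apply: (@ccvg_squeeze _ _ _ (fun n => 9 * normc z ^+ 2 * expR (normc z) * n%:R^-1)); last first.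
  rewrite -[X in _ --> X](mulr0 (9 * normc z ^+ 2 * expR (normc z))).
  apply: cvgM; first exact: cvg_cst.
  by apply/gtr0_cvgV0; [exists 1%N => // n /= n1; rewrite ltr0n|exact: cvgr_idn].
exists (Num.truncn (normc z)).+1 => // n /= zn.
have n0 : (0 : R) < n%:R by rewrite ltr0n (leq_trans _ zn).
have zn' : normc z <= n%:R.
  apply: (@le_trans _ _ (Num.truncn (normc z)).+1%:R); first by rewrite ltW// truncnS_gt.
  by rewrite ler_nat.
set w := z * (n%:R^-1)%:C.
have nw : normc w = normc z / n%:R by rewrite normcM normcR gtr0_norm ?invr_gt0.
have w1 : normc w <= 1 by rewrite nw ler_pdivrMr// mul1r.
have -> : cexp z = cexp w ^+ n.
  rewrite -cexpMn -mulr_natr; congr cexp; rewrite /w -mulrA -natC -realCM mulVf ?mulr1//.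
  by rewrite gt_eqF.
pose K := expR (normc w).
have K1 : 1 <= K by rewrite /K -expR0 ler_expR normc_ge0.
have aK : normc (1 + w) <= K.
  apply: le_trans (normcD _ _) _; rewrite normc1.
  exact: expR_ge1Dx.
have bK : normc (cexp w) <= K.
  by rewrite normc_cexp ler_expR (le_trans (ler_norm _))// normc_Re.
apply: le_trans (normc_expB_le n K1 aK bK) _.
have KE : K ^+ n = expR (normc z).
  by rewrite /K -expRM_natr nw divfK// gt_eqF.
have h1 : normc (1 + w - cexp w) <= 9 * (normc z / n%:R) ^+ 2.
  rewrite -nw -normcN (_ : - (1 + w - cexp w) = cexp w - 1 - w); last by ring.
  exact: normc_cexp_quad.
rewrite KE.
have -> : 9 * normc z ^+ 2 * expR (normc z) * n%:R^-1 = n%:R * (9 * (normc z / n%:R) ^+ 2) * expR (normc z).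
  by move: n0 => /lt0r_neq0; move: (n%:R : R) => x x0; field.
by rewrite ler_wpM2r ?expR_ge0// ler_wpM2l// ltW.
Qed.

Lemma ccvg_addn (u : nat -> R[i]) l k : ccvg u l -> ccvg (fun n => u (n + k)%N) l.
Proof. by rewrite /ccvg => h; exact: (cvg_comp _ _ (cvg_addnr k) h). Qed.

End exponential_limit.

Section exponential_moments.
Context {R : realType}.
Local Notation RR := (measurableTypeR R).
Local Notation mu := (@lebesgue_measure R).
Variables (th r : R).
Hypothesis r0 : 0 < r.

(* [psi] stands for the characteristic function of a law smoothed by a Gaussian, [dens psi] for its density;
   the property passes to limits and to compound Poisson steps. *)
Definition moment_bounded (psi : R -> R[i]) (K : R) := [/\ gauss_dominated r psi,
  forall y, 0 <= dens psi y & (\int[mu]_y (expR (th * y) * dens psi y)%:E <= K%:E)%E].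

Lemma moment_bounded_le psi K K' : K <= K' -> moment_bounded psi K -> moment_bounded psi K'.
Proof. by move=> KK' [h1 h2 h3]; split => //; apply: le_trans h3 _; rewrite lee_fin. Qed.

Let mexp : measurable_fun (setT : set RR) (fun y => expR (th * y)).
Proof. by apply: measurableT_comp => //; exact: measurable_funM. Qed.

Let mdens psi : gauss_dominated r psi ->
  measurable_fun (setT : set RR) (fun y => (expR (th * y) * dens psi y)%:E).
Proof.
by move=> h; apply/measurable_EFinP; apply: measurable_funM => //; exact: (measurable_dens r0).
Qed.

(** Gaussian domination makes the densities converge pointwise; positivity passes to the limit, and
    the moment bound does so by Fatou's lemma. *)
Lemma moment_bounded_limit (psi_ : nat -> R -> R[i]) psi K :
  (forall n, moment_bounded (psi_ n) K) -> cmeasurable (setT : set RR) psi ->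
  (forall u, ccvg (psi_ ^~ u) (psi u)) -> moment_bounded psi K.
Proof.
move=> hpsi mpsi psic.
have dom : gauss_dominated r psi.
  split=> // u; apply: (ccvg_le (psic u) (cvg_cst _)).
  by apply: nearW => n; have [[_ h] _ _] := hpsi n; exact: h.
have dc y : dens (psi_ n) y @[n --> \oo] --> dens psi y.
  apply: cvgM; first exact: cvg_cst.
  apply: ccvg_Re; apply: (cinv_limit r0 (y_ := fun=> y)) => //; last exact: cvg_cst.
  by move=> n; have [] := hpsi n.
split => //.
- move=> y; apply: (cvgr_to_ge (dc y)); apply: nearW => n.
  by have [_ h _] := hpsi n; exact: h.
- have -> : (\int[mu]_y (expR (th * y) * dens psi y)%:E =
      \int[mu]_y limn_einf (fun n => (expR (th * y) * dens (psi_ n) y)%:E))%E.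
    apply: eq_integral => y _; apply/esym.
    have c : (expR (th * y) * dens (psi_ n) y)%:E @[n --> \oo] --> (expR (th * y) * dens psi y)%:E.
      by apply: cvg_EFin; [exact: nearW|apply: cvgM => //; exact: cvg_cst].
    by have [-> _] := cvg_limn_einf_sup c.
  apply: le_trans (fatou mu measurableT _ _) _.
  + by move=> n; apply: mdens; have [] := hpsi n.
  + move=> n y _; rewrite lee_fin mulr_ge0 ?expR_ge0//.
    by have [_ h _] := hpsi n; exact: h.
  rewrite limn_einf_lim; apply: lime_le; first exact: is_cvg_einfs.
  apply: nearW => n; apply: (@le_trans _ _ (\int[mu]_y (expR (th * y) * dens (psi_ n) y)%:E)%E).
    by apply: ereal_inf_lbound; exists n => //=.
  by have [_ _ h] := hpsi n.
Qed.

Lemma moment_bounded_gauss (q b : R) : 0 < q -> q^-1 <= r ->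
  moment_bounded (gauss_charf q b) (expR (th * b + q ^+ 2 * th ^+ 2 / 2)).
Proof.
move=> q0 qr; split; first exact: gauss_charf_dominated.
  by move=> y; rewrite dens_gauss// normal_pdf_ge0.
rewrite -(gauss_moment b q0); apply: ge0_le_integral => //.
- by move=> y _; rewrite lee_fin dens_gauss// mulr_ge0 ?expR_ge0 ?normal_pdf_ge0.
- by apply: mdens; exact: gauss_charf_dominated.
- apply/measurable_EFinP; apply: measurable_funM => //; exact: measurable_normal_pdf.
- by move=> y _; rewrite dens_gauss.
Qed.

Section jumps.
Variables (m : {sigma_finite_measure set RR -> \bar R}) (w : RR -> R).
Hypothesis w0 : forall x, 0 <= w x.
Hypothesis iw : m.-integrable setT (EFin \o w).
Hypothesis iew : m.-integrable setT (EFin \o (fun x => w x * expR (th * x))).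

Let mw : measurable_fun setT w.
Proof. by apply/measurable_EFinP; exact: (measurable_int _ iw). Qed.

Let Lam := \int[m]_x w x.
Let E := \int[m]_x (w x * expR (th * x)).
Local Notation wh := (weighted_charf m w).

Let E0 : 0 <= E. Proof. by apply: Rintegral_ge0 => x _; rewrite mulr_ge0 ?expR_ge0. Qed.

Let wh_le u : normc (wh u) <= Lam.
Proof.
apply: le_trans (normc_cintegral_le_int measurableT (cintegrable_weighted iw u)) _.
rewrite le_eqVlt; apply/orP; left; apply/eqP; apply: eq_Rintegral => x _.
by rewrite (normcM _ (expi _)) normc_expi mulr1 normcR ger0_norm.
Qed.

Section step.
Variables (psi : R -> R[i]) (K tau : R).
Hypothesis hpsi : moment_bounded psi K.
Hypothesis tau0 : 0 <= tau.
Hypothesis tauL : tau * Lam <= 1.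

Let dom : gauss_dominated r psi. Proof. by have [] := hpsi. Qed.
Let d0 y : 0 <= dens psi y. Proof. by have [_ + _] := hpsi; exact. Qed.
Let K0 : 0 <= K.
Proof.
have [_ _ h] := hpsi; rewrite -lee_fin; apply: le_trans h.
by apply: integral_ge0 => y _; rewrite lee_fin mulr_ge0 ?expR_ge0.
Qed.

Let psi1 u := wh u * psi u.
Let psi' u := ((1 - tau * Lam)%:C + tau%:C * wh u) * psi u.

Let mpsi1 : cmeasurable (setT : set RR) psi1.
Proof. by have [_ [_ h]] := cinv_average r0 iw dom 0. Qed.

Let ipsi1 y : cintegrable mu setT (fun u : RR => expi (- (u * y)) * psi1 u).
Proof.
apply: (cintegrable_dom measurableT _ (integrable_scale measurableT Lam (integrable_gauss r0))).
  apply: cmeasurableM => //; apply: cmeasurable_expi_comp.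
  by apply: measurableT_comp => //; exact: measurable_funM.
move=> u _; rewrite (normcM (expi _)) normc_expi mul1r normcM ler_pM ?normc_ge0//.
exact: dom.2.
Qed.

Let dens_step y : dens psi' y = (1 - tau * Lam) * dens psi y + tau * dens psi1 y.
Proof.
have i1 := cintegrableMl measurableT (1 - tau * Lam)%:C (cintegrable_cinv r0 y dom).
have i2 := cintegrableMl measurableT tau%:C (ipsi1 y).
rewrite /dens; have -> : cinv psi' y = (1 - tau * Lam)%:C * cinv psi y + tau%:C * cinv psi1 y.
  rewrite /cinv -(cintegralMl measurableT _ (cintegrable_cinv r0 y dom)).
  rewrite -(cintegralMl measurableT _ (ipsi1 y)) -(cintegralD measurableT i1 i2).
  apply: eq_cintegral => u _; rewrite /psi' /psi1.
  by move: (expi _) => e; ring.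
by rewrite ReD !ReM /= !mul0r !subr0; ring.
Qed.

Let dens1_ge0 y : 0 <= dens psi1 y.
Proof.
have [_ <-] := dens_average r0 iw dom y.
by apply: Rintegral_ge0 => x _; rewrite mulr_ge0.
Qed.

Let jump_kernel (z : RR * RR) : \bar R := (expR (th * z.2) * (w z.1 * dens psi (z.2 - z.1)))%:E.

Let mjump : measurable_fun setT jump_kernel.
Proof.
apply/measurable_EFinP; apply: measurable_funM.
  by apply: (measurableT_comp mexp); exact: measurable_snd.
apply: measurable_funM; first by apply: measurableT_comp => //; exact: measurable_fst.
apply: (measurableT_comp (measurable_dens r0 dom)).
by apply: measurable_funB; [exact: measurable_snd|exact: measurable_fst].
Qed.

Let jump0 z : (0 <= jump_kernel z)%E.
Proof.
by rewrite /jump_kernel lee_fin; apply: mulr_ge0; rewrite ?expR_ge0//; apply: mulr_ge0.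
Qed.

Let e0 y : 0 <= expR (th * y) * dens psi y.
Proof. by apply: mulr_ge0 => //; exact: expR_ge0. Qed.
Let e1 y : 0 <= expR (th * y) * dens psi1 y.
Proof. by apply: mulr_ge0 => //; exact: expR_ge0. Qed.


(** By Tonelli's theorem, since [exp (th y) = exp (th x) exp (th (y - x))] and the Lebesgue measure
    is translation invariant. *)
Let jump_moment : (\int[mu]_y (expR (th * y) * dens psi1 y)%:E <= (E * K)%:E)%E.
Proof.
have -> : (\int[mu]_y (expR (th * y) * dens psi1 y)%:E = \int[mu]_y \int[m]_x jump_kernel (x, y))%E.
  apply: eq_integral => y _; have [i e] := dens_average r0 iw dom y.
  rewrite -e EFinM /Rintegral fineK; last exact: integrable_fin_num i.
  by rewrite -integralZl.
rewrite -(fubini_tonelli _ mjump jump0).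
have inner x : (\int[mu]_y jump_kernel (x, y) <= (w x * expR (th * x) * K)%:E)%E.
  have -> : (\int[mu]_y jump_kernel (x, y) =
      \int[mu]_y ((w x * expR (th * x))%:E * (expR (th * y) * dens psi y)%:E))%E.
    rewrite -[RHS](lebesgue_translation x).
    - apply: eq_integral => y _; rewrite /jump_kernel -EFinM; congr EFin => /=.
      have -> : expR (th * y) = expR (th * x) * expR (th * (y - x)).
        by rewrite -expRD; congr expR; ring.
      ring.
    - by apply: emeasurable_funM => //; exact: mdens.
    - by move=> y; rewrite -EFinM lee_fin; apply: mulr_ge0 => //; rewrite mulr_ge0 ?expR_ge0.
  rewrite ge0_integralZl//; last 3 first.
  - exact: mdens.
  - by move=> y _; rewrite lee_fin mulr_ge0 ?expR_ge0.
  - by rewrite lee_fin mulr_ge0 ?expR_ge0.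
  rewrite [leRHS]EFinM; apply: lee_pmul => //.
  - by rewrite lee_fin mulr_ge0 ?expR_ge0.
  - by apply: integral_ge0 => y _; rewrite lee_fin.
  - by have [_ _ h] := hpsi.
apply: (@le_trans _ _ (\int[m]_x (K%:E * (w x * expR (th * x))%:E))%E).
  apply: ge0_le_integral => //.
  - by move=> x _; apply: integral_ge0 => y _; exact: jump0.
  - exact: measurable_fun_fubini_tonelli_F mjump jump0.
  - by apply: emeasurable_funM => //; exact: (measurable_int _ iew).
  - by move=> x _; rewrite -EFinM mulrC; exact: inner.
rewrite ge0_integralZl//; last 2 first.
- exact: (measurable_int _ iew).
- by move=> x _; rewrite lee_fin mulr_ge0 ?expR_ge0.
by rewrite mulrC EFinM /E /Rintegral fineK//; exact: integrable_fin_num iew.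
Qed.

(** The factor is the transform of a positive measure: no move with mass [1 - tau Lam], a jump with
    intensity [tau w]. The condition [tau Lam <= 1] ensures the positivity, and the exponential
    moment of that measure multiplies [K]. *)
Lemma moment_bounded_step : moment_bounded psi' ((1 - tau * Lam + tau * E) * K).
Proof.
have t1 : 0 <= 1 - tau * Lam by rewrite subr_ge0.
split.
- split.
    apply: (@eq_cmeasurable _ _ _ _ (fun u : RR => (1 - tau * Lam)%:C * psi u + tau%:C * psi1 u)).
      by move=> u _; rewrite /psi' /psi1; ring.
    apply: cmeasurableD; apply: cmeasurableM; try exact: cmeasurable_cst.
      exact: dom.1.
    exact: mpsi1.
  move=> u; rewrite /psi' normcM; apply: le_trans (dom.2 u).
  rewrite ler_piMl ?normc_ge0//; apply: le_trans (normcD _ _) _.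
  rewrite normcR ger0_norm// normcM normcR ger0_norm//.
  have := ler_wpM2l tau0 (wh_le u); lra.
- by move=> y; rewrite dens_step; apply: addr_ge0; apply: mulr_ge0.
have -> : (\int[mu]_y (expR (th * y) * dens psi' y)%:E =
    \int[mu]_y ((1 - tau * Lam)%:E * (expR (th * y) * dens psi y)%:E +
                tau%:E * (expR (th * y) * dens psi1 y)%:E))%E.
  by apply: eq_integral => y _; rewrite dens_step -!EFinM -EFinD; congr EFin; ring.
(* [psi1] is dominated by [Lam] times the Gaussian rather than by the Gaussian itself, so the
   measurability of its density is taken from the averaging integral. *)
have md1 : measurable_fun (setT : set RR) (fun y => (expR (th * y) * dens psi1 y)%:E).
  apply/measurable_EFinP; apply: measurable_funM => //.
  apply/measurable_EFinP; rewrite (_ : EFin \o dens psi1 = fun y => (\int[m]_x (w x * dens psi (y - x))%:E)%E); last first.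
    apply/funext => y /=; have [i <-] := dens_average r0 iw dom y.
    by rewrite /Rintegral fineK//; exact: integrable_fin_num i.
  have mk : measurable_fun setT (fun z : RR * RR => (w z.2 * dens psi (z.1 - z.2))%:E).
    apply/measurable_EFinP; apply: measurable_funM.
      by apply: measurableT_comp => //; exact: measurable_snd.
    apply: (measurableT_comp (measurable_dens r0 dom)).
    by apply: measurable_funB; [exact: measurable_fst|exact: measurable_snd].
  apply: (measurable_fun_fubini_tonelli_F (m2 := m) _ mk) => z.
  by rewrite lee_fin mulr_ge0.
rewrite ge0_integralD//; last 4 first.
- by move=> y _; rewrite -EFinM lee_fin; apply: mulr_ge0.
- by apply: emeasurable_funM => //; exact: mdens.
- by move=> y _; rewrite -EFinM lee_fin; apply: mulr_ge0.
- by apply: emeasurable_funM.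
rewrite ge0_integralZl//; last 2 first.
- exact: mdens.
- by move=> y _; rewrite lee_fin.
rewrite ge0_integralZl//; last by move=> y _; rewrite lee_fin.
have -> : ((1 - tau * Lam + tau * E) * K)%:E = ((1 - tau * Lam)%:E * K%:E + tau%:E * (E * K)%:E)%E.
  by rewrite -!EFinM -EFinD; congr EFin; ring.
apply: leeD; apply: lee_pmul => //.
- by apply: integral_ge0 => y _; rewrite lee_fin.
- by have [_ _ h] := hpsi.
- by apply: integral_ge0 => y _; rewrite lee_fin.
Qed.

End step.

Lemma moment_bounded_iter (psi : R -> R[i]) K tau n : 0 <= tau -> tau * Lam <= 1 ->
  moment_bounded psi K ->
  moment_bounded (fun u => ((1 - tau * Lam)%:C + tau%:C * wh u) ^+ n * psi u)
    ((1 - tau * Lam + tau * E) ^+ n * K).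
Proof.
move=> tau0 tauL; elim: n => [|n IH] hpsi.
  by rewrite expr0 mul1r; under eq_fun do rewrite expr0 mul1r.
have := moment_bounded_step (IH hpsi) tau0 tauL.
by rewrite mulrA -exprS; under eq_fun do rewrite mulrA -exprS.
Qed.

(** The compound Poisson factor is the limit of [n] steps with [tau = t / n], and [(1 + t (E - Lam)
    / n)^n <= exp (t (E - Lam))] holds before the limit. *)
Lemma moment_bounded_poisson (psi : R -> R[i]) K (t : R) : 0 <= t ->
  moment_bounded psi K ->
  moment_bounded (fun u => cexp (t%:C * (wh u - Lam%:C)) * psi u) (expR (t * (E - Lam)) * K).
Proof.
(* The index is shifted by [k] so that already the first step satisfies [tau * Lam <= 1]. *)
move=> t0 hpsi; pose k := (Num.truncn (t * Lam)).+1.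
have K0 : 0 <= K.
  have [_ d0 h] := hpsi; rewrite -lee_fin; apply: le_trans h.
  by apply: integral_ge0 => y _; rewrite lee_fin mulr_ge0 ?expR_ge0.
have nk n : (0 : R) < (n + k)%:R by rewrite ltr0n addnS.
have tauL n : t / (n + k)%:R * Lam <= 1.
  rewrite mulrAC ler_pdivrMr ?nk// mul1r; apply: (@le_trans _ _ k%:R).
    by rewrite ltW// truncnS_gt.
  by rewrite ler_nat leq_addl.
apply: (@moment_bounded_limit (fun n u => ((1 - t / (n + k)%:R * Lam)%:C + (t / (n + k)%:R)%:C * wh u) ^+ (n + k) * psi u)).
- move=> n; have tn : 0 <= t / (n + k)%:R by rewrite divr_ge0// ltW.
  apply: moment_bounded_le (moment_bounded_iter (n + k) tn (tauL n) hpsi).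
  rewrite ler_wpM2r//.
  have -> : expR (t * (E - Lam)) = expR (t / (n + k)%:R * (E - Lam)) ^+ (n + k).
    rewrite -expRM_natr; congr expR; rewrite mulrAC divfK//.
    by rewrite gt_eqF.
  have h1 : 0 <= 1 - t / (n + k)%:R * Lam + t / (n + k)%:R * E.
    by rewrite addr_ge0 ?subr_ge0// mulr_ge0.
  rewrite lerXn2r ?nnegrE ?expR_ge0//.
  have := expR_ge1Dx (t / (n + k)%:R * (E - Lam)); lra.
- have [[mpsi _] _ _] := hpsi; apply: cmeasurableM => //; apply: cmeasurable_cexp.
  apply: cmeasurableM; first exact: cmeasurable_cst.
  apply: cmeasurableB; last exact: cmeasurable_cst.
  (* [wh] is measurable because its product with a Gaussian is, and the Gaussian can be divided
     out. *)
  have hg : gauss_dominated r (gauss_charf r^-1 0).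
    by apply: gauss_charf_dominated; rewrite ?invr_gt0// invrK.
  have [_ [_ h]] := cinv_average r0 iw hg 0.
  apply: (@eq_cmeasurable _ _ _ _ (fun u : RR => (wh u * gauss_charf r^-1 0 u) * cexp ((u ^+ 2 / (2 * r ^+ 2))%:C))).
    move=> u _; rewrite /gauss_charf mulr0 expi0 mul1r invrK /gauss -cexpNR.
    by rewrite -mulrA -cexpD addNr cexp0 mulr1.
  apply: cmeasurableM => //; apply: cmeasurable_cexp; apply: cmeasurable_real.
  by apply: measurable_funM => //; exact: measurable_funX.
- move=> u; apply: ccvgM; last exact: ccvg_cst.
  have := ccvg_addn k (cexp_limit (t%:C * (wh u - Lam%:C))).
  apply: ccvg_eq; apply: nearW => n; congr (_ ^+ _).
  have e1 (x : R) : (1 - x)%:C = 1 - x%:C :> R[i].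
    by apply: complexP; rewrite ?ReB ?ImB /= ?subr0.
  by rewrite e1 !realCM; ring.
Qed.

End jumps.

End exponential_moments.

Section hyperbolic.
Context {R : realType}.

(** The right-hand side is the square of [2 sinh (y / 2)], and [sinh a >= a] for [a >= 0]. *)
Lemma sqr_le_cosh (y : R) : y ^+ 2 <= expR y + expR (- y) - 2.
Proof.
have h a : 0 <= a -> 2 * a <= expR a - expR (- a) :> R.
  move=> a0; have := @derive_ge0_le _ (fun x : R => expR x - expR (- x) - 2 * x)
    (fun x => expR x + expR (- x) - 2) _ _ a0.
  rewrite oppr0 expR0 subrr mulr0 subrr => H.
  rewrite -subr_ge0; apply: H.
  - by move=> x _; apply: is_derive_eq; rewrite /GRing.scale/=; ring.
  - by move=> x _; have := expR_ge1Dx x; have := expR_ge1Dx (- x); lra.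
pose a := `|y| / 2; have a0 : 0 <= a by rewrite divr_ge0.
have -> : expR y + expR (- y) - 2 = (expR a - expR (- a)) ^+ 2.
  have -> : expR y + expR (- y) = expR (a + a) + expR (- a - a).
    rewrite /a; have [y0|/ltW y0] := leP 0 y; first by rewrite ger0_norm//; congr (expR _ + expR _); field.
    by rewrite ler0_norm// addrC; congr (expR _ + expR _); field.
  by rewrite !expRD expRN; have := expR_gt0 a => /lt0r_neq0 e; field.
have -> : y ^+ 2 = (2 * a) ^+ 2 by rewrite /a -[y ^+ 2]real_normK ?num_real//; field.
by rewrite lerXn2r ?nnegrE ?mulr_ge0// ?h// (le_trans _ (h a a0)) ?mulr_ge0.
Qed.

(** The left-hand side factors as [(exp y - 1)(1 - exp(- y))], and each factor is at most
    [|y| exp K] in absolute value. *)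
Lemma cosh_le_sqr (y K : R) : `|y| <= K -> expR y + expR (- y) - 2 <= expR K ^+ 2 * y ^+ 2.
Proof.
move=> yK; have K0 : 0 <= K by exact: le_trans yK.
have -> : expR y + expR (- y) - 2 = (expR y - 1) * - (expR (- y) - 1).
  by rewrite expRN; have := expR_gt0 y => /lt0r_neq0 e; field.
apply: le_trans (ler_norm _) _; rewrite normrM normrN.
have E1 : 1 <= expR K by rewrite -expR0 ler_expR.
have b z : `|z| <= K -> `|expR z - 1| <= `|z| * expR K.
  move=> zK; apply: le_trans (expR_lin z) _; rewrite ler_wpM2l//.
  by rewrite ge_max E1 ler_expR (le_trans (ler_norm z)).
have h1 := b y yK; have h2 := b (- y); rewrite normrN in h2.
have -> : expR K ^+ 2 * y ^+ 2 = (`|y| * expR K) * (`|y| * expR K).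
  by rewrite -[y ^+ 2]real_normK ?num_real//; ring.
by rewrite ler_pM// h2.
Qed.

End hyperbolic.

Section sigma_finite_wrapper.
Context {R : realType} {d : measure_display} {T : measurableType d}.
Variable m : {measure set T -> \bar R}.
Hypothesis mfin : sigma_finite setT m.

(** [lam] comes as a bare measure, while Fubini's theorem expects a sigma-finite structure. The
    alias carries the proof as an argument, so that the structure can be attached to it. *)
Definition with_sigma_finite of sigma_finite setT m : set T -> \bar R := m.

HB.instance Definition _ := Measure.on (with_sigma_finite mfin).
HB.instance Definition _ :=
  Measure_isSigmaFinite.Build _ _ _ (with_sigma_finite mfin) mfin.

End sigma_finite_wrapper.

(** * Exponential moments of a law given by its Levy characteristics *)

Section levy_exponential_moments.
Context {R : realType}.
Local Notation RR := (measurableTypeR R).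
Local Notation mu := (@lebesgue_measure R).
Variables (b c M t : R) (lam : {measure set RR -> \bar R}).
Hypothesis M1 : 1 < M.
Hypothesis c0 : 0 <= c.
Hypothesis t0 : 0 < t.
Hypothesis hlam : levy_measure lam.
Hypothesis hM : exp_moments M lam.

Let M0 : 0 < M. Proof. exact: lt_trans M1. Qed.
(** Of order [x^2] at 0 and of order [exp (M |x|)] at infinity: a single function that is integrable
    under the conditions on [lam] and dominates, up to constants, the integrands of the exponents
    below. *)
Let hx (x : R) : R := expR (M * x) + expR (- (M * x)) - 2.

Let sq_hx (x : R) : M ^+ 2 * x ^+ 2 <= hx x.
Proof. by rewrite -exprMn; exact: sqr_le_cosh. Qed.
Let hx0 (x : R) : 0 <= hx x.
Proof. by apply: le_trans (sq_hx x); rewrite mulr_ge0 ?sqr_ge0. Qed.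

Let mexp (a : R) : measurable_fun (setT : set RR) (fun x => expR (a * x)).
Proof. by apply: measurableT_comp => //; exact: measurable_funM. Qed.
Let mhx : measurable_fun (setT : set RR) hx.
Proof.
apply: measurable_funB => //; apply: measurable_funD; first exact: mexp.
by under eq_fun do rewrite -mulNr; exact: mexp.
Qed.

(** Large jumps are controlled by the exponential moments at [M] and [- M], small ones by the
    integral of [min(1, x^2)]. *)
Let ihx : lam.-integrable setT (EFin \o hx).
Proof.
apply/integrableP; split; first exact/measurable_EFinP.
under eq_integral => x _ do rewrite /= ger0_norm//.
pose D1 := [set x : RR | 1 < `|x|].
have mD1 : measurable D1.
  rewrite (_ : D1 = (fun x : RR => `|x|) @^-1` `]1, +oo[).
    by rewrite -[X in measurable X]setTI; apply: measurableT_comp => //; exact: measurable_itv.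
  by apply/seteqP; split => x; rewrite /D1 /= in_itv/= andbT.
rewrite -(setUv D1) ge0_integral_setU//=; last 4 first.
- exact: measurableC.
- by rewrite setUv; exact/measurable_EFinP.
- by move=> x _; rewrite lee_fin.
- by rewrite disj_set2E setICr.
apply: lte_add_pinfty.
- apply: (@le_lt_trans _ _ (\int[lam]_(x in D1) ((expR (M * x))%:E + (expR (- M * x))%:E))%E).
    apply: ge0_le_integral => //.
    + by move=> x _; rewrite lee_fin.
    + by apply/measurable_EFinP; exact: measurable_funTS.
    + by apply: emeasurable_funD; apply/measurable_EFinP; apply: measurable_funTS; exact: mexp.
    + by move=> x _; rewrite -EFinD lee_fin /hx mulNr; lra.
  have me (a : R) : measurable_fun D1 (fun x => (expR (a * x))%:E).
    by apply/measurable_EFinP; apply: measurable_funTS; exact: mexp.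
  rewrite ge0_integralD//; try (by move=> x _; rewrite lee_fin expR_ge0).
  have MM : - M <= M by apply: (@le_trans _ _ 0); rewrite ?oppr_le0 ltW.
  by apply: lte_add_pinfty; apply: hM; rewrite ?lexx ?MM.
- have mmin : measurable_fun (setT : set RR) (fun x => Num.min 1 (x ^+ 2)).
    by apply: measurable_minr => //; exact: measurable_funX.
  have min0 (x : R) : 0 <= Num.min 1 (x ^+ 2) by rewrite le_min ler01 sqr_ge0.
  have k0 : 0 <= expR M ^+ 2 * M ^+ 2 by rewrite mulr_ge0 ?sqr_ge0.
  apply: (@le_lt_trans _ _ (\int[lam]_(x in ~` D1) ((expR M ^+ 2 * M ^+ 2)%:E * (Num.min 1 (x ^+ 2))%:E))%E).
    apply: ge0_le_integral => //.
    + exact: measurableC.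
    + by move=> x _; rewrite lee_fin.
    + by apply/measurable_EFinP; exact: measurable_funTS.
    + by apply: emeasurable_funM => //; apply/measurable_EFinP; exact: measurable_funTS.
    + move=> x /negP; rewrite -leNgt => x1; rewrite -EFinM lee_fin.
      have x2 : x ^+ 2 <= 1 by rewrite -[x ^+ 2]real_normK ?num_real// expr_le1.
      rewrite (min_idPr x2) -mulrA -exprMn; apply: cosh_le_sqr.
      by rewrite normrM (gtr0_norm M0) ler_piMr// ltW.
  apply: (@le_lt_trans _ _ (\int[lam]_x ((expR M ^+ 2 * M ^+ 2)%:E * (Num.min 1 (x ^+ 2))%:E))%E).
    apply: ge0_subset_integral => //.
    + exact: measurableC.
    + by apply: emeasurable_funM => //; exact/measurable_EFinP.
    + by move=> x _; rewrite -EFinM lee_fin mulr_ge0.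
  rewrite ge0_integralZl//; last 2 first.
  + exact/measurable_EFinP.
  + by move=> x _; rewrite lee_fin.
  by apply: lte_mul_pinfty => //; have [_] := hlam.
Qed.

(** These sets exhaust the complement of 0, and Markov's inequality for [hx] makes their mass
    finite. Jumps in [D n] alone form a compound Poisson part. *)
Let D (n : nat) : set RR := [set x | n.+1%:R^-1 <= hx x].
Let mD n : measurable (D n).
Proof.
rewrite (_ : D n = hx @^-1` `[n.+1%:R^-1, +oo[).
  by rewrite -[X in measurable X]setTI; apply: mhx => //; exact: measurable_itv.
by apply/seteqP; split => x; rewrite /D /= in_itv/= andbT.
Qed.
Let w (n : nat) (x : RR) : R := \1_(D n) x.
Let w0 n x : 0 <= w n x. Proof. by []. Qed.
Let w1 n x : w n x <= 1. Proof. by rewrite /w indicE lern1; case: (_ \in _). Qed.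
Let mw n : measurable_fun setT (w n).
Proof. exact: measurable_indic. Qed.

Let w_hx n x : w n x <= n.+1%:R * hx x.
Proof.
rewrite /w indicE; have [xD|xD] := boolP (x \in D n); last by rewrite mulr_ge0.
by move: xD; rewrite inE /D /= -ler_pdivrMl// mulr1.
Qed.

Let idom (f g : RR -> R) : measurable_fun setT f -> lam.-integrable setT (EFin \o g) ->
  (forall x, `|f x| <= g x) -> lam.-integrable setT (EFin \o f).
Proof.
move=> mf ig fg; apply: (le_integrable measurableT _ _ ig); first exact/measurable_EFinP.
by move=> x _ /=; rewrite lee_fin (le_trans (fg x))// ler_norm.
Qed.

Let iw n : lam.-integrable setT (EFin \o w n).
Proof.
apply: (idom (mw n) (integrable_scale measurableT n.+1%:R ihx)) => x.
by rewrite ger0_norm// w_hx.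
Qed.

Let lam_sigma_finite : sigma_finite setT lam.
Proof.
exists (fun n => if n is n'.+1 then D n' else [set 0 : RR]).
  apply/esym/seteqP; split => // x _.
  have [->|x0] := eqVneq x 0; first by exists 0%N.
  have h0 : 0 < hx x.
    by apply: lt_le_trans (sq_hx x); apply: mulr_gt0; [exact: exprn_gt0|rewrite exprn_even_gt0].
  exists (Num.truncn (hx x)^-1).+1 => //.
  rewrite /D /= -[leRHS]invrK lef_pV2 ?posrE ?invr_gt0//.
  by rewrite ltW// truncnS_gt.
case=> [|n]; split => //; first by have [-> _] := hlam.
have := iw n => /integrableP[_]; under eq_integral => x _ do rewrite /= ger0_norm//.
by rewrite /w integral_indic// setIT.
Qed.

Let lamS : {sigma_finite_measure set RR -> \bar R} := with_sigma_finite lam_sigma_finite.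

Variable th : R.
Hypothesis thM : th = M \/ th = - M.

Let exp_th (x : R) : expR (th * x) <= hx x + 2.
Proof.
have e1 := expR_ge0 (M * x); have e2 := expR_ge0 (- (M * x)).
by case: thM => ->; rewrite /hx ?mulNr; lra.
Qed.
Let quad_th (x : R) : 0 <= expR (th * x) - 1 - th * x <= hx x.
Proof.
have e1 := expR_ge1Dx (M * x); have e2 := expR_ge1Dx (- (M * x)).
by case: thM => ->; rewrite /hx ?mulNr; apply/andP; split; lra.
Qed.

Let iquad : lam.-integrable setT (EFin \o (fun x : RR => expR (th * x) - 1 - th * x)).
Proof.
apply: (idom _ ihx).
  by apply: measurable_funB; [apply: measurable_funB => //; exact: mexp|exact: measurable_funM].
by move=> x; have /andP[h1 h2] := quad_th x; rewrite ger0_norm.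
Qed.

Let ihw n : lam.-integrable setT (EFin \o (fun x : RR => hx x + 2 * w n x)).
Proof. exact: (integrable_add measurableT ihx (integrable_scale measurableT 2 (iw n))). Qed.

Let wexp n x : w n x * (hx x + 2) <= hx x + 2 * w n x.
Proof. by have := w1 n x; have := w0 n x; have := hx0 x; nra. Qed.

Let iew n : lam.-integrable setT (EFin \o (fun x : RR => w n x * expR (th * x))).
Proof.
apply: (idom _ (ihw n)); first by apply: measurable_funM => //; exact: mexp.
move=> x; rewrite ger0_norm ?mulr_ge0 ?expR_ge0//.
by apply: le_trans (wexp n x); rewrite ler_wpM2l.
Qed.

Let ixw n : lam.-integrable setT (EFin \o (fun x : RR => w n x * x)).
Proof.
apply: (idom _ (ihw n)); first exact: measurable_funM.
move=> x; rewrite normrM (ger0_norm (w0 n x)); apply: le_trans (wexp n x).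
rewrite ler_wpM2l//.
have : `|x| <= M * `|x| by rewrite ler_peMl// ltW.
have := @expR_ge1Dx R (M * x); have := @expR_ge1Dx R (- (M * x)).
have e1 := expR_ge0 (M * x); have e2 := expR_ge0 (- (M * x)).
by rewrite /hx; have [x0|x0] := leP 0 x; [rewrite ger0_norm|rewrite ltr0_norm]; lra.
Qed.

Let J (u : R) : R[i] := cintegral lam setT (fun x : RR => expi (u * x) - 1 - 0 +i* (u * x)).
Let Jn n (u : R) : R[i] := cintegral lam setT (fun x : RR => (w n x)%:C * (expi (u * x) - 1 - 0 +i* (u * x))).

Let quad_u (u x : R) : normc (expi (u * x) - 1 - 0 +i* (u * x)) <= 2 * u ^+ 2 / M ^+ 2 * hx x.
Proof.
apply: le_trans (normc_expi_quad (u * x)) _; rewrite exprMn mulrA -[leRHS]mulrA.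
apply: ler_wpM2l; first by rewrite mulr_ge0 ?sqr_ge0.
by rewrite ler_pdivlMl ?exprn_gt0.
Qed.

Let mquad (u : R) : cmeasurable (setT : set RR) (fun x : RR => expi (u * x) - 1 - 0 +i* (u * x)).
Proof.
apply: cmeasurableB.
  apply: cmeasurableB; last exact: cmeasurable_cst.
  by apply: cmeasurable_expi_comp; exact: measurable_funM.
by split => /=; [exact: measurable_cst|exact: measurable_funM].
Qed.

Let J_limit u : ccvg (Jn ^~ u) (J u).
Proof.
have [_ //] : cintegrable lam setT (fun x : RR => expi (u * x) - 1 - 0 +i* (u * x)) /\ ccvg (Jn ^~ u) (J u).
apply: (cdominated measurableT _ _ (integrable_scale measurableT (2 * u ^+ 2 / M ^+ 2) ihx)).
- by move=> n; apply: cmeasurableM => //; exact: cmeasurable_real.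
- move=> x _; have [x0|x0] := eqVneq x 0.
    rewrite x0 mulr0 expi0 subrr sub0r (_ : - (0 +i* 0) = 0) ?mulr0; last first.
      by apply: complexP => /=; rewrite oppr0.
    by apply: ccvg_eq (ccvg_cst 0); apply: nearW => n; rewrite mulr0.
  have h0 : 0 < hx x.
    by apply: lt_le_trans (sq_hx x); apply: mulr_gt0; [exact: exprn_gt0|rewrite exprn_even_gt0].
  apply: ccvg_eq (ccvg_cst _); exists (Num.truncn (hx x)^-1) => // n /= nx.
  rewrite /w indicE mem_set ?mul1r// /D /= -[leRHS]invrK lef_pV2 ?posrE ?invr_gt0//.
  apply: (@le_trans _ _ (Num.truncn (hx x)^-1).+1%:R); first by rewrite ltW// truncnS_gt.
  by rewrite ler_nat.
- move=> n x _; rewrite normcM normcR ger0_norm//; apply: le_trans (quad_u u x).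
  by rewrite ler_piMl ?normc_ge0.
Qed.

Let X n : R := \int[lam]_x (w n x * x).
Let Lam n : R := \int[lam]_x w n x.

(** For a jump measure of finite mass the compensator is a number, [X n], which can be moved into
    the drift; a compound Poisson exponent remains. *)
Let Jn_split n u : Jn n u = weighted_charf lamS (w n) u - (Lam n)%:C - 0 +i* (u * X n).
Proof.
have iwh : cintegrable lam setT (fun x : RR => (w n x)%:C * expi (u * x)).
  exact: (@cintegrable_weighted _ lamS (w n) (iw n) u).
have i1 := cintegrable_real (iw n).
have i2 := cintegrableMl measurableT (0 +i* u) (cintegrable_real (ixw n)).
have -> : (0 +i* (u * X n)) = (0 +i* u) * (X n)%:C :> R[i].
  by apply: complexP; rewrite ?ReM ?ImM /=; ring.
rewrite -[(Lam n)%:C]cintegral_real -[(X n)%:C]cintegral_real.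
rewrite -(cintegralMl measurableT _ (cintegrable_real (ixw n))).
rewrite -(cintegralB measurableT iwh i1) -(cintegralB measurableT (cintegrableB measurableT iwh i1) i2).
apply: eq_cintegral => x _; move: (expi _) => e.
by apply: complexP; rewrite ?ReB ?ImB ?ReM ?ImM ?ReB ?ImB ?ReM ?ImM /=; ring.
Qed.

(** The variance is [c t] from the Gaussian part plus 1 from an auxiliary smoothing, which provides
    a density even for [c = 0] and is divided out in [exp_moment_le_kappa]. *)
Let q : R := Num.sqrt (1 + c * t).
Let qq : q ^+ 2 = 1 + c * t.
Proof. by rewrite sqr_sqrtr// addr_ge0 ?mulr_ge0// ltW. Qed.
Let q1 : 1 <= q.
Proof. by rewrite -(sqrtr1 R) ler_sqrt ?lerDl ?mulr_ge0 ?(ltW t0)// addr_ge0 ?mulr_ge0// ltW. Qed.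
Let q0 : 0 < q. Proof. exact: lt_le_trans q1. Qed.

Let bn n := t * (b - X n).
Let psin n (u : R) : R[i] := cexp (t%:C * (weighted_charf lamS (w n) u - (Lam n)%:C)) * gauss_charf q (bn n) u.
(** The Laplace exponent at the real point [th], that is, at [M] or [- M]. *)
Let kap : R := th * b + c * th ^+ 2 / 2 + \int[lam]_x (expR (th * x) - 1 - th * x).

Let psinE n u : psin n u =
  cexp (t%:C * ((0 +i* u) * b%:C + (0 +i* u) ^+ 2 / 2 * c%:C + Jn n u)) * (gauss 1^-1 u)%:C.
Proof.
rewrite /psin /gauss_charf Jn_split /gauss -!cexpNR /expi mulrA -!cexpD; congr cexp.
set W := weighted_charf _ _ _.
have -> : q^-1 ^+ 2 = (1 + c * t)^-1 by rewrite exprVn qq.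
have -> : 0 +i* (u * bn n) = (0 +i* u) * (t * b)%:C - t%:C * (0 +i* (u * X n)) :> R[i].
  by apply: complexP; rewrite ?ReB ?ImB ?ReM ?ImM /= /bn; ring.
have -> : (0 +i* u) ^+ 2 / 2 * c%:C = - (u ^+ 2 / 2 * c)%:C :> R[i].
  rewrite -natC -realCV.
  by apply: complexP; rewrite expr2 ?ReN ?ImN ?ReM ?ImM /= ?ReM ?ImM /= ?ReM ?ImM /=; ring.
have -> : (u ^+ 2 / (2 * (1 + c * t)^-1))%:C = (u ^+ 2 / 2)%:C + t%:C * (u ^+ 2 / 2 * c)%:C :> R[i].
  have ct : 1 + c * t != 0 by rewrite gt_eqF// ltr_pwDl// mulr_ge0// ltW.
  by apply: complexP; rewrite ?ReD ?ImD ?ReM ?ImM /=; field.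
have -> : (u ^+ 2 / (2 * 1^-1 ^+ 2))%:C = (u ^+ 2 / 2)%:C :> R[i].
  by congr _%:C; field.
rewrite (realCM t b); ring.
Qed.

(** As [exp (th x) - 1 - th x] is nonnegative, restricting the jumps to [D n] only lowers the
    exponent, so one bound serves all [n]. The summand [th ^+ 2 / 2] is due to the smoothing. *)
Let bounded n : moment_bounded th 1 (psin n) (expR (t * kap + th ^+ 2 / 2)).
Proof.
have q11 : q^-1 <= 1 by rewrite invf_le1.
have := moment_bounded_gauss th ltr01 (bn n) q0 q11.
move/(moment_bounded_poisson ltr01 (m := lamS) (w0 n) (iw n) (iew n) (ltW t0)).
apply: moment_bounded_le; rewrite -expRD ler_expR.
have -> : \int[lamS]_x w n x = Lam n by [].
have -> : \int[lamS]_x (w n x * expR (th * x)) = \int[lam]_x (w n x * expR (th * x)) by [].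
have e : \int[lam]_x (w n x * expR (th * x)) - Lam n - th * X n = \int[lam]_x (w n x * (expR (th * x) - 1 - th * x)).
  rewrite -RintegralB// -RintegralZl// -RintegralB//; last 2 first.
  - by apply: (integrableB measurableT (iew n) (iw n)).
  - exact: integrable_scale.
  by apply: eq_Rintegral => x _; ring.
have h : \int[lam]_x (w n x * (expR (th * x) - 1 - th * x)) <= \int[lam]_x (expR (th * x) - 1 - th * x).
  apply: le_Rintegral => //.
    apply: (idom _ iquad); first by apply: measurable_funM => //; apply/measurable_EFinP; exact: (measurable_int _ iquad).
    move=> x; have /andP[h1 _] := quad_th x; rewrite normrM !ger0_norm//.
    by rewrite ler_piMl.
  by move=> x _; have /andP[h1 _] := quad_th x; rewrite ler_piMl.
rewrite -e in h; have := ler_wpM2l (ltW t0) h; rewrite qq /kap /bn; lra.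
Qed.

Variable m : probability RR R.
Hypothesis hm : forall u : R, charf m u = cexp (t%:C * cumulant b c lam (0 +i* u)).

Let psi u := charf m u * (gauss 1^-1 u)%:C.

Let psi_bounded : moment_bounded th 1 psi (expR (t * kap + th ^+ 2 / 2)).
Proof.
apply: (moment_bounded_limit ltr01 bounded).
  have hg : gauss_dominated 1 (gauss_charf (1 : R) 0).
    by apply: gauss_charf_dominated => //; rewrite invr1.
  have [_ [_ h]] := cinv_average ltr01 (integrable_prob_cst m 1) hg 0.
  apply: eq_cmeasurable h => u _; rewrite /gauss_charf mulr0 expi0 mul1r; congr (_ * _).
  by apply: eq_cintegral => x _; rewrite mul1r.
move=> u; apply: (@ccvg_eq _ (fun n => cexp (t%:C * ((0 +i* u) * b%:C + (0 +i* u) ^+ 2 / 2 * c%:C + Jn n u)) * (gauss 1^-1 u)%:C)).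
  by apply: nearW => n; rewrite psinE.
rewrite /psi hm; apply: ccvgM; last exact: ccvg_cst.
apply: ccvg_cexp; apply: ccvgM; first exact: ccvg_cst.
apply: ccvgD; first exact: ccvg_cst.
rewrite (_ : cintegral _ _ _ = J u); first exact: J_limit.
apply: eq_cintegral => x _.
have -> : (0 +i* u) * x%:C = 0 +i* (u * x) :> R[i] by apply: complexP; rewrite ?ReM ?ImM /=; ring.
by [].
Qed.

(** [dens psi] is the density of [m] convolved with the standard normal law, so its exponential
    moment is that of [m] times exactly [exp (th ^+ 2 / 2)], which cancels. *)
Lemma exp_moment_le_kappa : (\int[m]_x (expR (th * x))%:E <= (expR (t * kap))%:E)%E.
Proof.
have [_ _ h] := psi_bounded.
pose k (z : RR * RR) : \bar R := (expR (th * z.2) * normal_pdf z.1 1 z.2)%:E.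
have mk : measurable_fun setT k.
  apply/measurable_EFinP; apply: measurable_funM; last exact: measurable_normal_kernel.
  by apply: (measurableT_comp (mexp th)); exact: measurable_snd.
have k0 z : (0 <= k z)%E by rewrite lee_fin mulr_ge0 ?expR_ge0 ?normal_pdf_ge0.
have e : (\int[mu]_y (expR (th * y) * dens psi y)%:E = \int[m]_x ((expR (th ^+ 2 / 2))%:E * (expR (th * x))%:E))%E.
  transitivity (\int[mu]_y \int[m]_x k (x, y))%E.
    apply: eq_integral => y _; have [i <-] := smooth_charf m y ltr01.
    rewrite EFinM /Rintegral fineK; last exact: integrable_fin_num i.
    by rewrite -integralZl.
  rewrite -(fubini_tonelli _ mk k0); apply: eq_integral => x _.
  by rewrite gauss_moment// -EFinM -expRD expr1n mul1r addrC.
have me : measurable_fun (setT : set RR) (fun x => (expR (th * x))%:E).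
  by apply/measurable_EFinP; exact: mexp.
rewrite e (@ge0_integralZl _ _ _ m _ measurableT _ me) in h; last 2 first.
- by move=> x _; rewrite lee_fin expR_ge0.
- by rewrite lee_fin expR_ge0.
by move: h; rewrite addrC expRD EFinM lee_pmul2l// ?lte_fin ?expR_gt0.
Qed.

End levy_exponential_moments.

Section alpha_star_moments.
Context {R : realType}.
Local Notation RR := (measurableTypeR R).
Variables (b c M : R) (lam : {measure set RR -> \bar R}).
Hypothesis M1 : 1 < M.
Hypothesis c0 : 0 <= c.

Let M0 : 0 < M. Proof. exact: lt_trans M1. Qed.

Lemma alpha_star_ge0 : 0 <= alpha_star b c lam M.
Proof.
rewrite /alpha_star le_max /alpha_up; apply/orP; left.
apply: addr_ge0; first by rewrite addr_ge0// !mulr_ge0 ?exprn_ge0 ?(ltW M0).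
exact: Rintegral_ge0.
Qed.

Hypothesis hlam : levy_measure lam.
Hypothesis hM : exp_moments M lam.

(** Since [exp x >= 1 + x], the integrals in [alpha_up] and [alpha_down] equal those in the Laplace
    exponent at [M] and [- M]; only the drift term is enlarged. *)
Lemma exp_moment_le_alpha (t : R) (m : probability RR R) : 0 < t ->
  (forall u : R, charf m u = cexp (t%:C * cumulant b c lam (0 +i* u))) ->
  (\int[m]_x (expR (M * x))%:E <= (expR (t * alpha_star b c lam M))%:E)%E /\
  (\int[m]_x (expR (- M * x))%:E <= (expR (t * alpha_star b c lam M))%:E)%E.
Proof.
move=> t0 hm; split.
- apply: le_trans (exp_moment_le_kappa M1 c0 t0 hlam hM (or_introl erefl) hm) _.
  rewrite lee_fin ler_expR ler_pM2l// /alpha_star le_max; apply/orP; left.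
  rewrite /alpha_up; apply: lerD.
    by apply: lerD; [rewrite ler_pM2l// ler_norm|rewrite le_eqVlt; apply/orP; left; apply/eqP; field].
  rewrite le_eqVlt; apply/orP; left; apply/eqP; apply: eq_Rintegral => x _.
  by rewrite ger0_norm//; have := expR_ge1Dx (M * x); lra.
- apply: le_trans (exp_moment_le_kappa M1 c0 t0 hlam hM (or_intror erefl) hm) _.
  rewrite lee_fin ler_expR ler_pM2l// /alpha_star le_max; apply/orP; right.
  rewrite /alpha_down; apply: lerD.
    apply: lerD; last by rewrite le_eqVlt; apply/orP; left; apply/eqP; field.
    by rewrite mulNr -mulrN ler_pM2l// -normrN ler_norm.
  rewrite le_eqVlt; apply/orP; left; apply/eqP; apply: eq_Rintegral => x _.
  by rewrite mulNr opprK ger0_norm//; have := expR_ge1Dx (- (M * x)); lra.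
Qed.

End alpha_star_moments.

(** * Spitzer's recursion *)

Section exp_growth.
Context {R : realType}.
Local Notation RR := (measurableTypeR R).
Variable th : R.
Hypothesis th0 : 0 <= th.

Definition pos_part (x : R) : R := Num.max x 0.
(** A weight that is submultiplicative along [pos_partD], so that functions of at most this growth
    are stable under the reflected sums of a random walk. *)
Definition exp_pos (x : R) : R := expR (th * pos_part x).

Lemma pos_part_ge0 x : 0 <= pos_part x. Proof. by rewrite le_max lexx orbT. Qed.
Lemma le_pos_part x : x <= pos_part x. Proof. by rewrite le_max lexx. Qed.
Lemma pos_part_id x : 0 <= x -> pos_part x = x. Proof. by move=> /max_idPl. Qed.
Lemma pos_part_le0 x : x <= 0 -> pos_part x = 0. Proof. by move=> /max_idPr. Qed.
Lemma pos_part_le x y : x <= y -> 0 <= y -> pos_part x <= y.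
Proof. by move=> xy y0; rewrite ge_max xy. Qed.
Lemma pos_partD x y : pos_part (x + y) <= pos_part x + pos_part y.
Proof. by apply: pos_part_le; rewrite ?addr_ge0 ?pos_part_ge0// lerD ?le_pos_part. Qed.
Lemma measurable_pos_part : measurable_fun (setT : set RR) (pos_part : RR -> RR).
Proof. exact: measurable_maxr. Qed.

Lemma exp_pos_ge0 x : 0 <= exp_pos x. Proof. exact: expR_ge0. Qed.
Lemma exp_pos_le x y z : pos_part z <= pos_part x + pos_part y -> exp_pos z <= exp_pos x * exp_pos y.
Proof. by move=> h; rewrite /exp_pos -expRD -mulrDr ler_expR ler_wpM2l. Qed.

Lemma measurable_exp_pos : measurable_fun (setT : set RR) exp_pos.
Proof.
apply: measurableT_comp => //; apply: measurable_funM => //; exact: measurable_pos_part.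
Qed.

Definition growth (f : RR -> R[i]) := cmeasurable setT f /\
  exists2 C, 0 <= C & forall x, normc (f x) <= C * exp_pos x.
Definition growth2 (f : RR * RR -> R[i]) := cmeasurable setT f /\
  exists2 C, 0 <= C & forall x y, normc (f (x, y)) <= C * exp_pos x * exp_pos y.
Definition exp_integrable (m : {measure set RR -> \bar R}) :=
  m.-integrable setT (EFin \o exp_pos).

Lemma growth_integrable m f : exp_integrable m -> growth f -> cintegrable m setT f.
Proof.
move=> im [mf [C C0 fC]].
exact: (cintegrable_dom measurableT mf (integrable_scale measurableT C im)).
Qed.

Lemma growth2_swap f : growth2 f -> growth2 (fun z => f (z.2, z.1)).
Proof.
move=> [mf [C C0 fC]]; split.
  apply: (cmeasurable_comp mf (g := fun z : RR * RR => (z.2, z.1))).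
  by apply: measurable_fun_pair; [exact: measurable_snd|exact: measurable_fst].
by exists C => // x y; rewrite mulrAC; exact: fC.
Qed.

Lemma growth2_section f x : growth2 f -> growth (fun y => f (x, y)).
Proof.
move=> [mf [C C0 fC]]; split.
  by apply: (cmeasurable_comp mf (g := fun y : RR => (x, y))); exact: measurable_pair1.
by exists (C * exp_pos x); rewrite ?mulr_ge0 ?exp_pos_ge0.
Qed.

Lemma exp_integrable_dirac : exp_integrable \d_(0 : RR).
Proof.
apply/integrableP; split; first by apply/measurable_EFinP; exact: measurable_exp_pos.
rewrite integral_dirac//=; last first.
  by apply/measurable_EFinP; apply: measurableT_comp => //; exact: measurable_exp_pos.
by rewrite diracT mul1e ltry.
Qed.

Lemma growth2_fubini (m1 m2 : {sigma_finite_measure set RR -> \bar R}) f :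
  exp_integrable m1 -> exp_integrable m2 -> growth2 f ->
  cintegral m1 setT (fun x => cintegral m2 setT (fun y => f (x, y))) =
  cintegral m2 setT (fun y => cintegral m1 setT (fun x => f (x, y))).
Proof.
move=> i1 i2 [mf [C C0 fC]].
exact: (cFubini mf (integrable_scale measurableT C i1) i2 fC).
Qed.

Lemma growth2_integral (m2 : {sigma_finite_measure set RR -> \bar R}) f :
  exp_integrable m2 -> growth2 f ->
  growth (fun x => cintegral m2 setT (fun y => f (x, y))).
Proof.
move=> i2 gf; have [mf [C C0 fC]] := gf; split.
  (* Measurability in [x] is extracted from Fubini's theorem with a Dirac mass as first measure,
     under which the weight is integrable. *)
  have := cintegrable_section1 mf (integrable_scale measurableT C exp_integrable_dirac) i2 fC.
  exact: cintegrable_cmeasurable.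
have E0 : 0 <= \int[m2]_y exp_pos y by apply: Rintegral_ge0 => y _; exact: exp_pos_ge0.
exists (C * \int[m2]_y exp_pos y); first exact: mulr_ge0.
move=> x; have gx := growth2_section x gf.
apply: le_trans (normc_cintegral_le_int measurableT (growth_integrable i2 gx)) _.
have -> : C * (\int[m2]_y exp_pos y) * exp_pos x = \int[m2]_y (C * exp_pos x * exp_pos y).
  by rewrite RintegralZl//; ring.
apply: le_Rintegral => //.
- exact: (cintegrable_normc measurableT (growth_integrable i2 gx)).
- exact: integrable_scale.
Qed.

Lemma growth3_integral (m2 : {sigma_finite_measure set RR -> \bar R}) (f : (RR * RR) * RR -> R[i]) (C : R) :
  exp_integrable m2 -> cmeasurable setT f -> 0 <= C ->
  (forall z y, normc (f (z, y)) <= C * exp_pos z.1 * exp_pos z.2 * exp_pos y) ->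
  growth2 (fun z => cintegral m2 setT (fun y => f (z, y))).
Proof.
move=> i2 mf C0 fC.
have d1 : (\d_((0, 0) : RR * RR)).-integrable setT (EFin \o (fun z : RR * RR => C * exp_pos z.1 * exp_pos z.2)).
  have mz : measurable_fun setT (EFin \o (fun z : RR * RR => C * exp_pos z.1 * exp_pos z.2)).
    apply/measurable_EFinP; apply: measurable_funM; first apply: measurable_funM => //.
      by apply: (measurableT_comp measurable_exp_pos); exact: measurable_fst.
    by apply: (measurableT_comp measurable_exp_pos); exact: measurable_snd.
  apply/integrableP; split => //.
  rewrite integral_dirac//=; first by rewrite diracT mul1e ltry.
  by apply/measurable_EFinP; apply: measurableT_comp => //; exact/measurable_EFinP.
split.
  by have := cintegrable_section1 mf d1 i2 fC; exact: cintegrable_cmeasurable.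
have E0 : 0 <= \int[m2]_y exp_pos y by apply: Rintegral_ge0 => y _; exact: exp_pos_ge0.
exists (C * \int[m2]_y exp_pos y); first exact: mulr_ge0.
move=> x z.
have mfz : cmeasurable setT (fun y : RR => f ((x, z), y)).
  by apply: (cmeasurable_comp mf (g := fun y : RR => ((x, z), y))); exact: measurable_pair1.
have iz : cintegrable m2 setT (fun y => f ((x, z), y)).
  exact: (cintegrable_dom measurableT mfz (integrable_scale measurableT (C * exp_pos x * exp_pos z) i2) (fun y _ => fC (x, z) y)).
apply: le_trans (normc_cintegral_le_int measurableT iz) _.
have -> : C * (\int[m2]_y exp_pos y) * exp_pos x * exp_pos z = \int[m2]_y (C * exp_pos x * exp_pos z * exp_pos y).
  by rewrite RintegralZl//; ring.
apply: le_Rintegral => //.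
- exact: (cintegrable_normc measurableT iz).
- exact: integrable_scale.
Qed.

Lemma growth_comp2 f (phi : RR * RR -> RR) : growth f -> measurable_fun setT phi ->
  (forall x y, pos_part (phi (x, y)) <= pos_part x + pos_part y) ->
  growth2 (fun z => f (phi z)).
Proof.
move=> [mf [C C0 fC]] mphi h; split; first exact: (cmeasurable_comp mf mphi).
exists C => // x y; apply: le_trans (fC _) _; rewrite -mulrA ler_wpM2l//.
exact: exp_pos_le.
Qed.

End exp_growth.

Section lindley.
Context {R : realType}.
Local Notation RR := (measurableTypeR R).

Definition sum_rv (z : RR * RR) : RR := z.1 + z.2.
Lemma measurable_sum_rv : measurable_fun setT sum_rv.
Proof. by apply: measurable_funD; [exact: measurable_fst|exact: measurable_snd]. Qed.
HB.instance Definition _ := isMeasurableFun.Build _ _ _ _ sum_rv measurable_sum_rv.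

Definition reflected_sum (z : RR * RR) : RR := pos_part (z.1 + z.2).
Lemma measurable_reflected_sum : measurable_fun setT reflected_sum.
Proof. exact: (measurableT_comp measurable_pos_part measurable_sum_rv). Qed.
HB.instance Definition _ := isMeasurableFun.Build _ _ _ _ reflected_sum measurable_reflected_sum.

Definition convolution (m1 m2 : probability RR R) : probability RR R :=
  distribution (m1 \x m2)%E (sum_rv : {mfun _ >-> _}).

(* The law of the maximum of 0 and of the first [n] partial sums of independent steps of law [m]. *)
Fixpoint lindley (m : probability RR R) (n : nat) : probability RR R :=
  if n is n'.+1 then distribution (m \x lindley m n')%E (reflected_sum : {mfun _ >-> _})
  else \d_(0 : RR).

Lemma eq_measure_cintegral d (T : measurableType d) (m1 m2 : {measure set T -> \bar R}) (f : T -> R[i]) :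
  (forall A, measurable A -> m1 A = m2 A) -> cintegral m1 setT f = cintegral m2 setT f.
Proof.
move=> e; have e' A : measurable A -> A `<=` setT -> m1 A = m2 A by move=> mA _; exact: e.
by rewrite /cintegral /Rintegral; congr (fine _ +i* fine _); exact: eq_measure_integral.
Qed.

Lemma charf_convolution (m1 m2 : probability RR R) u :
  charf (convolution m1 m2) u = charf m1 u * charf m2 u.
Proof.
have me : cmeasurable (setT : set RR) (fun x : RR => expi (u * x)).
  by apply: cmeasurable_expi_comp; exact: measurable_funM.
have me2 : cmeasurable setT (fun z : RR * RR => expi (u * (sum_rv z))).
  exact: (cmeasurable_comp me measurable_sum_rv).
have b1 (x y : RR) : normc (expi (u * sum_rv (x, y))) <= 1 * 1 by rewrite normc_expi mulr1.
have i1 := integrable_prob_cst m1 1; have i2 := integrable_prob_cst m2 1.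
have ie (m : probability RR R) : cintegrable m setT (fun x : RR => expi (u * x)).
  by apply: (cintegrable_dom measurableT me (integrable_prob_cst m 1)) => x _; rewrite normc_expi.
rewrite /charf cintegral_distribution//; last exact: (cintegrable_product me2 i1 i2 b1).
rewrite (cintegral_product12 me2 i1 i2 b1).
rewrite [RHS]mulrC -(cintegralMl measurableT _ (ie m1)); apply: eq_cintegral => x _.
rewrite [RHS]mulrC -(cintegralMl measurableT _ (ie m2)); apply: eq_cintegral => y _.
by rewrite -expiD; congr expi; rewrite /sum_rv /=; ring.
Qed.

Section lindley_integrals.
Variable th : R.
Hypothesis th0 : 0 <= th.
Local Notation growth := (growth th).
Local Notation exp_integrable := (exp_integrable th).

Let integrable_pair (m1 m2 : probability RR R) (f : RR -> R[i]) (phi : {mfun (RR * RR)%type >-> RR}) :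
  exp_integrable m1 -> exp_integrable m2 -> growth f ->
  (forall x y, pos_part (phi (x, y)) <= pos_part x + pos_part y) ->
  cintegrable (distribution (m1 \x m2)%E phi) setT f /\
  cintegral (distribution (m1 \x m2)%E phi) setT f =
    cintegral m1 setT (fun x => cintegral m2 setT (fun y => f (phi (x, y)))).
Proof.
move=> i1 i2 gf h; have [mf2 [C C0 fC]] := growth_comp2 th0 gf (measurable_funPT phi) h.
have ip := cintegrable_product mf2 (integrable_scale measurableT C i1) i2 fC.
have [mf _] := gf.
split; first exact: (proj1 (cintegrable_distribution _ _ mf)).
rewrite cintegral_distribution//.
exact: (cintegral_product12 mf2 (integrable_scale measurableT C i1) i2 fC).
Qed.

Lemma exp_pos_growth : growth (fun x => (exp_pos th x)%:C).
Proof.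
split; first by apply: cmeasurable_real; exact: measurable_exp_pos.
by exists 1 => // x; rewrite mul1r normcR ger0_norm ?exp_pos_ge0.
Qed.

Lemma exp_integrable_complex (m : {measure set RR -> \bar R}) :
  cintegrable m setT (fun x : RR => (exp_pos th x)%:C) -> exp_integrable m.
Proof. by case. Qed.

(** [m] is known only through its characteristic function; [charf_inj] identifies it with the
    convolution. *)
Lemma cintegral_convolution (m m1 m2 : probability RR R) f :
  exp_integrable m1 -> exp_integrable m2 -> growth f ->
  (forall u, charf m u = charf m1 u * charf m2 u) ->
  cintegral m setT f = cintegral m1 setT (fun x => cintegral m2 setT (fun y => f (x + y))).
Proof.
move=> i1 i2 gf hm.
have [_ <-] := integrable_pair (phi := (sum_rv : {mfun _ >-> _})) i1 i2 gf (fun x y => pos_partD x y).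
by apply: eq_measure_cintegral => A mA; apply: charf_inj => // u; rewrite hm -charf_convolution.
Qed.

Lemma reflected_sum_le x y : pos_part (reflected_sum (x, y)) <= pos_part x + pos_part y.
Proof.
by rewrite /reflected_sum /= (pos_part_id (pos_part_ge0 _)); exact: pos_partD.
Qed.

Variable m : probability RR R.
Hypothesis im : exp_integrable m.

Lemma exp_integrable_lindley n : exp_integrable (lindley m n).
Proof.
elim: n => [|n IH]; first exact: exp_integrable_dirac.
apply: exp_integrable_complex.
have [h _] := integrable_pair (phi := (reflected_sum : {mfun _ >-> _})) im IH exp_pos_growth reflected_sum_le.
exact: h.
Qed.

Lemma cintegral_lindleyS n f : growth f -> cintegral (lindley m n.+1) setT f =
  cintegral m setT (fun x => cintegral (lindley m n) setT (fun y => f (pos_part (x + y)))).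
Proof.
move=> gf.
have [_ h] := integrable_pair (phi := (reflected_sum : {mfun _ >-> _})) im (exp_integrable_lindley n) gf reflected_sum_le.
exact: h.
Qed.

Lemma cintegral_lindley0 f : cmeasurable setT f -> cintegral (lindley m 0) setT f = f 0.
Proof.
move=> [f1 f2]; apply: complexP; rewrite /= /Rintegral integral_dirac ?diracT ?mul1e//;
  exact/measurable_EFinP.
Qed.

(** The laws of the recursion live on [[0, +oo[]: the first is the mass at 0, and the later ones are
    laws of positive parts. *)
Lemma cintegral_lindley_pos n f : growth f ->
  cintegral (lindley m n) setT f = cintegral (lindley m n) setT (fun x => f (pos_part x)).
Proof.
move=> gf.
have gf' : growth (fun x => f (pos_part x)).
  have [mf [C C0 fC]] := gf; split; first exact: (cmeasurable_comp mf measurable_pos_part).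
  exists C => // x; apply: le_trans (fC _) _.
  by rewrite /exp_pos (pos_part_id (pos_part_ge0 _)).
case: n => [|n]; last first.
  rewrite (cintegral_lindleyS n gf) (cintegral_lindleyS n gf'); apply: eq_cintegral => x _; apply: eq_cintegral => y _.
  by rewrite (pos_part_id (pos_part_ge0 _)).
by rewrite (cintegral_lindley0 gf.1) (cintegral_lindley0 gf'.1) pos_part_id.
Qed.

End lindley_integrals.

End lindley.

Section spitzer.
Context {R : realType}.
Local Notation RR := (measurableTypeR R).
Variables (th : R) (mu_ : nat -> probability RR R).
Hypothesis th0 : 0 <= th.
Hypothesis imu : forall k, exp_integrable th (mu_ k).
Hypothesis charf_mu : forall k u, charf (mu_ k.+1) u = charf (mu_ k) u * charf (mu_ 0%N) u.

Local Notation nu := (lindley (mu_ 0%N)).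
Let inu n : exp_integrable th (nu n). Proof. exact: exp_integrable_lindley. Qed.

(** The expectation of [g] at an independent pair of laws [mu_ k] and [nu j]. As [mu_ 0] is the law
    of one step, [mu_ k] is the law of the sum of [k.+1] steps. *)
Let m2 (k j : nat) (g : RR * RR -> R[i]) : R[i] :=
  cintegral (mu_ k) setT (fun y => cintegral (nu j) setT (fun m => g (y, m))).

Let m2D k j g h : growth2 th g -> growth2 th h ->
  m2 k j (fun z => g z + h z) = m2 k j g + m2 k j h.
Proof.
move=> gg gh; rewrite /m2.
have ig y := growth_integrable (inu j) (growth2_section y gg).
have ih y := growth_integrable (inu j) (growth2_section y gh).
have iig := growth_integrable (imu k) (growth2_integral (inu j) gg).
have iih := growth_integrable (imu k) (growth2_integral (inu j) gh).
rewrite -(cintegralD measurableT iig iih); apply: eq_cintegral => y _.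
by rewrite -(cintegralD measurableT (ig y) (ih y)).
Qed.

Let growth2N g : growth2 th g -> growth2 th (fun z => - g z).
Proof.
move=> [mg [C C0 gC]]; split; first exact: cmeasurableN.
by exists C => // x y; rewrite normcN.
Qed.

Let m2N k j g : growth2 th g -> m2 k j (fun z => - g z) = - m2 k j g.
Proof.
move=> gg; rewrite /m2.
have iig := growth_integrable (imu k) (growth2_integral (inu j) gg).
rewrite -(cintegralN measurableT iig); apply: eq_cintegral => y _.
by rewrite -(cintegralN measurableT (growth_integrable (inu j) (growth2_section y gg))).
Qed.

Section step.
Variable f : RR -> R[i].
Hypothesis gf : growth th f.

(** The adjoint of one step of the recursion: integrating [F] against [nu n] is integrating [f]
    against [nu n.+1]. The induction proves the identity for all [f] at once and applies its
    hypothesis to [F]. *)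
Let F (m : RR) : R[i] := cintegral (mu_ 0%N) setT (fun x => f (pos_part (x + m))).

Let gF2 : growth2 th (fun z : RR * RR => f (pos_part (z.2 + z.1))).
Proof.
apply: (growth_comp2 th0 (phi := fun z : RR * RR => pos_part (z.2 + z.1)) gf).
  apply: (measurableT_comp measurable_pos_part).
  by apply: measurable_funD; [exact: measurable_snd|exact: measurable_fst].
by move=> x y /=; rewrite (pos_part_id (pos_part_ge0 _)) addrC; exact: pos_partD.
Qed.

Lemma growth_step : growth th F.
Proof. exact: (growth2_integral (imu 0%N) gF2). Qed.

(** [A k j] is the summand of Spitzer's recursion; [T k j], where the sum is reflected as a whole,
    is the auxiliary quantity that will telescope. *)
Let T k j : R[i] := m2 k j (fun z => f (pos_part (z.1 + z.2))).
Let A k j : R[i] := m2 k j (fun z => f (pos_part z.1 + z.2)).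

Let lindleyF n : cintegral (nu n.+1) setT f = cintegral (nu n) setT F.
Proof.
rewrite (cintegral_lindleyS th0 (imu 0%N) n gf).
have g2 : growth2 th (fun z : RR * RR => f (pos_part (z.1 + z.2))).
  exact: (growth2_swap gF2).
by rewrite (growth2_fubini (imu 0%N) (inu n) g2).
Qed.

Let T0 n : T 0%N n = cintegral (nu n) setT F.
Proof.
by rewrite -lindleyF (cintegral_lindleyS th0 (imu 0%N) n gf).
Qed.

Let Tn0 n : T n 0%N = A n 0%N.
Proof.
apply: eq_cintegral => y _.
have m1 : cmeasurable (setT : set RR) (fun m : RR => f (pos_part (y + m))).
  apply: (cmeasurable_comp gf.1 (g := fun m : RR => pos_part (y + m))).
  by apply: (measurableT_comp measurable_pos_part); exact: measurable_funD.
have m2' : cmeasurable (setT : set RR) (fun m : RR => f (pos_part y + m)).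
  apply: (cmeasurable_comp gf.1 (g := fun m : RR => pos_part y + m)).
  exact: measurable_funD.
by rewrite (cintegral_lindley0 _ m1) (cintegral_lindley0 _ m2') !addr0.
Qed.

(* Indexed by ((y, m), x), with y the jump of length [k.+1] and x the new step. *)
Let f1 (z : (RR * RR) * RR) : R[i] := f (pos_part z.1.1 + pos_part (z.2 + z.1.2)).
Let f2 (z : (RR * RR) * RR) : R[i] := f (pos_part (z.1.1 + z.2 + z.1.2)).
Let f3 (z : (RR * RR) * RR) : R[i] := f (pos_part (z.1.1 + pos_part (z.2 + z.1.2))).

(** A bound by the product of three weights legitimates the integrals of each of the terms in
    Baxter's identity. *)
Let g3 (phi : (RR * RR) * RR -> RR) : measurable_fun setT phi ->
  (forall y m x, pos_part (phi ((y, m), x)) <= pos_part y + pos_part m + pos_part x) ->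
  growth2 th (fun z => cintegral (mu_ 0%N) setT (fun x => f (phi (z, x)))) /\
  forall z, cintegrable (mu_ 0%N) setT (fun x => f (phi (z, x))).
Proof.
move=> mphi hphi; have [mf [C C0 fC]] := gf.
have bd z x : normc (f (phi (z, x))) <= C * exp_pos th z.1 * exp_pos th z.2 * exp_pos th x.
  case: z => y m; apply: le_trans (fC _) _; rewrite -!mulrA ler_wpM2l//.
  by rewrite /exp_pos -!expRD -!mulrDr ler_expR ler_wpM2l// addrA.
have mfphi := cmeasurable_comp mf mphi.
split; first exact: (growth3_integral (imu 0%N) mfphi C0 bd).
move=> z; apply: (cintegrable_dom measurableT _
  (integrable_scale measurableT (C * exp_pos th z.1 * exp_pos th z.2) (imu 0%N)) (fun x _ => bd z x)).
by apply: (cmeasurable_comp mfphi (g := fun x : RR => (z, x))); exact: measurable_pair1.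
Qed.

Let mz11 : measurable_fun setT (fun z : (RR * RR) * RR => z.1.1).
Proof. by apply: (measurableT_comp measurable_fst); exact: measurable_fst. Qed.
Let mz12 : measurable_fun setT (fun z : (RR * RR) * RR => z.1.2).
Proof. by apply: (measurableT_comp measurable_snd); exact: measurable_fst. Qed.
Let mz2 : measurable_fun setT (fun z : (RR * RR) * RR => z.2).
Proof. exact: measurable_snd. Qed.

Let pp := fun x : R => pos_part_id (pos_part_ge0 x).

Let G1 : growth2 th (fun z => cintegral (mu_ 0%N) setT (fun x => f1 (z, x))) /\
  forall z, cintegrable (mu_ 0%N) setT (fun x => f1 (z, x)).
Proof.
apply: (@g3 (fun z => pos_part z.1.1 + pos_part (z.2 + z.1.2))).
  apply: measurable_funD; first exact: (measurableT_comp measurable_pos_part).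
  by apply: (measurableT_comp measurable_pos_part); exact: measurable_funD.
move=> y m x /=; rewrite pos_part_id ?addr_ge0 ?pos_part_ge0// -addrA lerD2l addrC.
by rewrite [leRHS]addrC addrC; exact: pos_partD.
Qed.
Let G2 : growth2 th (fun z => cintegral (mu_ 0%N) setT (fun x => f2 (z, x))) /\
  forall z, cintegrable (mu_ 0%N) setT (fun x => f2 (z, x)).
Proof.
apply: (@g3 (fun z => pos_part (z.1.1 + z.2 + z.1.2))).
  apply: (measurableT_comp measurable_pos_part).
  by apply: measurable_funD => //; exact: measurable_funD.
move=> y m x /=; rewrite pp addrAC; apply: le_trans (pos_partD _ _) _.
by rewrite lerD2r; exact: pos_partD.
Qed.
Let G3 : growth2 th (fun z => cintegral (mu_ 0%N) setT (fun x => f3 (z, x))) /\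
  forall z, cintegrable (mu_ 0%N) setT (fun x => f3 (z, x)).
Proof.
apply: (@g3 (fun z => pos_part (z.1.1 + pos_part (z.2 + z.1.2)))).
  apply: (measurableT_comp measurable_pos_part); apply: measurable_funD => //.
  by apply: (measurableT_comp measurable_pos_part); exact: measurable_funD.
move=> y m x /=; rewrite pp; apply: le_trans (pos_partD _ _) _.
by rewrite -addrA lerD2l pp addrC [leRHS]addrC addrC; exact: pos_partD.
Qed.

(* Baxter's identity: as unordered pairs, [y^+ + z^+, (y + z)^+] and [(y + z^+)^+, (y^+ + z)^+] agree. *)
Let baxter (y z : R) :
  f (pos_part (pos_part y + z)) = f (pos_part y + pos_part z) + f (pos_part (y + z)) - f (pos_part (y + pos_part z)).
Proof.
have [y0|/ltW y0] := leP 0 y.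
  rewrite (pos_part_id y0) (@pos_part_id _ (y + pos_part z)) ?addr_ge0 ?pos_part_ge0//.
  by rewrite addrAC subrr add0r.
rewrite (pos_part_le0 y0) !add0r.
have -> : pos_part (y + pos_part z) = pos_part (y + z).
  have [z0|/ltW z0] := leP 0 z; first by rewrite (pos_part_id z0).
  by rewrite (pos_part_le0 z0) addr0 (pos_part_le0 y0) pos_part_le0// -(addr0 0) lerD.
by rewrite addrK.
Qed.

(** [baxter] with [z = x + m], integrated over the sum [y], the new step [x] and the maximum [m].
    Joining [x] to [m] advances the maximum, which gives [A k j.+1] and [T k j.+1]; joining [x] to
    [y] lengthens the sum, which gives [T k.+1 j]. *)
Let step_identity k j : m2 k j (fun z => F (pos_part z.1 + z.2)) = A k j.+1 + T k.+1 j - T k j.+1.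
Proof.
have [g1 i1] := G1; have [g2 i2] := G2; have [g3' i3] := G3.
have -> : m2 k j (fun z => F (pos_part z.1 + z.2)) = m2 k j (fun z =>
    cintegral (mu_ 0%N) setT (fun x => f1 (z, x)) + cintegral (mu_ 0%N) setT (fun x => f2 (z, x)) +
    - cintegral (mu_ 0%N) setT (fun x => f3 (z, x))).
  apply: eq_cintegral => y _; apply: eq_cintegral => m _.
  rewrite /F -(cintegralD measurableT (i1 _) (i2 _)).
  rewrite -(cintegralB measurableT (cintegrableD measurableT (i1 _) (i2 _)) (i3 _)).
  apply: eq_cintegral => x _; rewrite /f1 /f2 /f3 /=.
  have -> : x + (pos_part y + m) = pos_part y + (x + m) by rewrite addrCA.
  by rewrite baxter addrA.
rewrite m2D; [|split|exact: growth2N]; last 2 first.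
- by apply: cmeasurableD; [exact: g1.1|exact: g2.1].
- have [_ [C1 C10 h1]] := g1; have [_ [C2 C20 h2]] := g2.
  exists (C1 + C2); first exact: addr_ge0.
  by move=> x y; rewrite !mulrDl; apply: le_trans (normcD _ _) _; exact: lerD.
rewrite m2D// m2N//; congr (_ + _ - _).
- apply: eq_cintegral => y _ /=.
  have gy : growth th (fun m : RR => f (pos_part y + m)).
    have [mf [C C0 fC]] := gf; split.
      apply: (cmeasurable_comp mf (g := fun m : RR => pos_part y + m)); exact: measurable_funD.
    exists (C * exp_pos th y); first by rewrite mulr_ge0// exp_pos_ge0.
    move=> x; apply: le_trans (fC _) _; rewrite -mulrA ler_wpM2l//.
    by apply: exp_pos_le => //; rewrite -{2}(pp y); exact: pos_partD.
  rewrite (cintegral_lindleyS th0 (imu 0%N) j gy).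
  have g2y : growth2 th (fun z : RR * RR => f (pos_part y + pos_part (z.1 + z.2))).
    apply: (growth_comp2 th0 (phi := fun z : RR * RR => pos_part (z.1 + z.2)) gy).
      by apply: (measurableT_comp measurable_pos_part); exact: measurable_sum_rv.
    by move=> a b /=; rewrite pp; exact: pos_partD.
  by rewrite (growth2_fubini (imu 0%N) (inu j) g2y).
- rewrite /T {2}/m2.
  pose H (x : RR) : R[i] := cintegral (nu j) setT (fun m => f (pos_part (x + m))).
  have gT : growth2 th (fun z : RR * RR => f (pos_part (z.1 + z.2))) by exact: (growth2_swap gF2).
  have gH : growth th H by exact: (growth2_integral (inu j) gT).
  rewrite (cintegral_convolution th0 (imu k) (imu 0%N) gH (charf_mu k)).
  apply: eq_cintegral => y _; rewrite /H.
  have gy : growth2 th (fun z : RR * RR => f (pos_part (y + z.1 + z.2))).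
    have [mf [C C0 fC]] := gf; split.
      apply: (cmeasurable_comp mf (g := fun z : RR * RR => pos_part (y + z.1 + z.2))).
      apply: (measurableT_comp measurable_pos_part); apply: measurable_funD; last exact: measurable_snd.
      by apply: measurable_funD => //; exact: measurable_fst.
    exists (C * exp_pos th y); first by rewrite mulr_ge0// exp_pos_ge0.
    move=> a b; apply: le_trans (fC _) _; rewrite -!mulrA ler_wpM2l//.
    rewrite /exp_pos -!expRD -!mulrDr ler_expR ler_wpM2l// pp addrA.
    by apply: le_trans (pos_partD _ _) _; rewrite lerD2r; exact: pos_partD.
  by rewrite (growth2_fubini (imu 0%N) (inu j) gy).
- rewrite /T; apply: eq_cintegral => y _ /=.
  have gy : growth th (fun m : RR => f (pos_part (y + m))).
    have [mf [C C0 fC]] := gf; split.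
      apply: (cmeasurable_comp mf (g := fun m : RR => pos_part (y + m))).
      by apply: (measurableT_comp measurable_pos_part); exact: measurable_funD.
    exists (C * exp_pos th y); first by rewrite mulr_ge0// exp_pos_ge0.
    move=> x; apply: le_trans (fC _) _; rewrite -mulrA ler_wpM2l//.
    by apply: exp_pos_le => //; rewrite pp; exact: pos_partD.
  rewrite (cintegral_lindleyS th0 (imu 0%N) j gy).
  have g2y : growth2 th (fun z : RR * RR => f (pos_part (y + pos_part (z.1 + z.2)))).
    apply: (growth_comp2 th0 (phi := fun z : RR * RR => pos_part (z.1 + z.2)) gy).
      by apply: (measurableT_comp measurable_pos_part); exact: measurable_sum_rv.
    by move=> a b /=; rewrite pp; exact: pos_partD.
  by rewrite (growth2_fubini (imu 0%N) (inu j) g2y).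
Qed.

(** The [T] terms telescope to [T n 0 - T 0 n]. Here [T 0 n] is the integral of [F] against [nu n]
    and cancels the extra term in [n.+1 = n + 1], while [T n 0 = A n 0] is the missing summand, the
    maximum of no steps being 0. *)
Lemma spitzer_step n :
  n%:R * cintegral (nu n) setT F = \sum_(k < n) m2 k (n.-1 - k)%N (fun z => F (pos_part z.1 + z.2)) ->
  n.+1%:R * cintegral (nu n.+1) setT f = \sum_(k < n.+1) A k (n - k)%N.
Proof.
move=> IH; rewrite lindleyF -natr1 mulrDl mul1r IH.
have -> : \sum_(k < n) m2 k (n.-1 - k)%N (fun z => F (pos_part z.1 + z.2)) =
    \sum_(k < n) A k (n - k)%N + \sum_(k < n) (T k.+1 (n - k.+1)%N - T k (n - k)%N).
  rewrite -big_split; apply: eq_bigr => k _; rewrite step_identity /= -addrA.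
  have -> : (n.-1 - k)%N = (n - k.+1)%N by rewrite -subn1 -subnDA add1n.
  by rewrite subnSK// ltn_ord.
rewrite -(big_mkord xpredT (fun k => T k.+1 (n - k.+1)%N - T k (n - k)%N)).
rewrite (telescope_sumr (fun k => T k (n - k)%N))// subnn subn0 T0 Tn0.
by rewrite big_ord_recr /= subnn -addrA; congr (_ + _); rewrite subrK.
Qed.

End step.

(** Summand [k] pairs the sum of [k.+1] steps with the maximum over the [n - k.+1] others. *)
Theorem spitzer_recursion n f : growth th f ->
  n%:R * cintegral (nu n) setT f =
  \sum_(k < n) cintegral (mu_ k) setT (fun y =>
    cintegral (nu (n.-1 - k)%N) setT (fun m => f (pos_part y + m))).
Proof.
elim: n f => [|n IH] f gf; first by rewrite mul0r big_ord0.
apply: (spitzer_step gf); apply: IH.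
exact: growth_step.
Qed.

End spitzer.

(** * The transform of the positive part *)

Section inverse_sqrt.
Context {R : realType}.
Local Notation RR := (measurableTypeR R).
Local Notation mu := (@lebesgue_measure R).

Let Dpos : set RR := `]0, +oo[%classic.
Let msqrt : measurable_fun Dpos (fun s => (Num.sqrt s)^-1).
Proof.
apply: open_continuous_measurable_fun; first exact: interval_open.
move=> s; rewrite inE /Dpos /= in_itv/= andbT => s0; apply: cvgV.
  by rewrite gt_eqF// sqrtr_gt0.
exact: sqrt_continuous.
Qed.

Let integral_sqrt (n : nat) :
  (\int[mu]_(s in `[(n.+1%:R^-1)%R, 1%R]) ((Num.sqrt s)^-1)%:E <= 2%:E)%E.
Proof.
have [->|n0] := eqVneq n 0%N.
  by rewrite invr1 set_itv1 integral_set1// lee_fin.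
have e0 : (0 : R) < n.+1%:R^-1 by rewrite invr_gt0.
have e1 : n.+1%:R^-1 < 1 :> R by rewrite invf_lt1// ltr1n ltnS lt0n.
have dF (s : R) : 0 < s -> is_derive s (1 : R) (fun s => 2 * Num.sqrt s) (Num.sqrt s)^-1.
  move=> s0; have := is_derive1_sqrt s0 => ds.
  apply: is_derive_eq; rewrite /GRing.scale/=.
  have : Num.sqrt s != 0 by rewrite gt_eqF// sqrtr_gt0.
  by move: (Num.sqrt s) => q q0; field.
have cF : continuous (fun s : R => 2 * Num.sqrt s : R).
  by move=> s; apply: cvgM; [exact: cvg_cst|exact: sqrt_continuous].
rewrite (@continuous_FTC2 _ _ (fun s : R => 2 * Num.sqrt s))//.
- by rewrite -EFinB lee_fin sqrtr1; have := sqrtr_ge0 (n.+1%:R^-1 : R); lra.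
- apply: continuous_in_subspaceT => s; rewrite inE /= in_itv/= => /andP[s0 _].
  apply: cvgV; first by rewrite gt_eqF// sqrtr_gt0 (lt_le_trans e0).
  exact: sqrt_continuous.
- split; [move=> s /[!in_itv]/= /andP[s0 _]|by apply: cvg_at_right_filter; exact: cF|
    by apply: cvg_at_left_filter; exact: cF].
  by have [] := dF s (lt_trans e0 s0).
- move=> s /[!in_itv]/= /andP[s0 _]; rewrite derive1E.
  by have [_ ->] := dF s (lt_trans e0 s0).
Qed.

Let integrable_sqrt1 : mu.-integrable `]0, 1] (EFin \o (fun s : R => (Num.sqrt s)^-1)).
Proof.
have mI : measurable (`]0, 1] : set RR) by exact: measurable_itv.
have mID : (`]0, 1] : set RR) `<=` Dpos.
  by move=> s; rewrite /Dpos /= !in_itv/= andbT => /andP[].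
have mD : measurable Dpos by exact: measurable_itv.
pose g (s : RR) : \bar R := ((Num.sqrt s)^-1)%:E.
have mg : measurable_fun (`]0, 1] : set RR) g.
  by apply/measurable_EFinP; exact: measurable_funS msqrt.
have g0 s : (0 <= g s)%E by rewrite lee_fin invr_ge0 sqrtr_ge0.
pose f n := g \_ (`[(n.+1%:R^-1)%R, 1%R] : set RR).
have mE n : measurable (`[(n.+1%:R^-1)%R, 1%R] : set RR) by exact: measurable_itv.
have mf n : measurable_fun (`]0, 1] : set RR) (f n).
  apply: (measurable_restrict _ (mE n) mI).1; apply: measurable_funS mg => //.
have f0 n s : (0 <= f n s)%E by rewrite /f patchE; case: ifP.
apply/integrableP; split; first exact: mg.
apply: (@le_lt_trans _ _ 2%:E); last exact: ltry.
have -> : (\int[mu]_(s in `]0%R, 1%R]) `|(EFin \o (fun s : R => (Num.sqrt s)^-1%R)) s| =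
    \int[mu]_(s in `]0%R, 1%R]) limn_einf (f ^~ s))%E.
  apply: eq_integral => s; rewrite inE /= in_itv/= => /andP[s0 s1].
  rewrite ger0_norm ?invr_ge0 ?sqrtr_ge0//; apply/esym.
  have c : f n s @[n --> \oo] --> ((Num.sqrt s)^-1)%:E.
    apply: cvg_near_cst; exists (Num.truncn s^-1) => // n /= ns.
    rewrite /f patchE mem_set//= in_itv/= s1 andbT -[leRHS]invrK lef_pV2 ?posrE ?invr_gt0//.
    apply: (@le_trans _ _ (Num.truncn s^-1).+1%:R); first by rewrite ltW// truncnS_gt.
    by rewrite ler_nat.
  by have [-> _] := cvg_limn_einf_sup c.
apply: le_trans (fatou mu mI mf (fun n s _ => f0 n s)) _.
rewrite limn_einf_lim; apply: lime_le; first exact: is_cvg_einfs.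
apply: nearW => n; apply: (@le_trans _ _ (\int[mu]_(s in `]0%R, 1%R]) f n s)%E).
  by apply: ereal_inf_lbound; exists n => //=.
apply: le_trans (integral_sqrt n).
rewrite /f -integral_mkcondr (_ : `]0, 1] `&` _ = `[(n.+1%:R^-1)%R, 1%R]%classic)//.
apply/setIidPr => s; rewrite /= !in_itv/= => /andP[s0 ->]; rewrite andbT.
by apply: lt_le_trans s0; rewrite invr_gt0.
Qed.

(** Near 0 the primitive [2 sqrt s] is bounded, and Fatou's lemma has passed from [[1 / (n + 1), 1]]
    to []0, 1]]; beyond 1 the exponential is enough. *)
Lemma integrable_sqrt_expRN (dl : R) : 0 < dl ->
  mu.-integrable `]0, +oo[ (EFin \o (fun s => (Num.sqrt s)^-1 * expR (- (dl * s)))).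
Proof.
move=> dl0.
have mexpN : measurable_fun (setT : set RR) (fun s => expR (- (dl * s))).
  by apply: measurableT_comp => //; apply: measurableT_comp => //; exact: measurable_funM.
have mD : measurable Dpos by exact: measurable_itv.
have m1 (E : set RR) : E `<=` Dpos -> measurable_fun E (fun s => (Num.sqrt s)^-1 * expR (- (dl * s))).
  move=> ED; apply: (measurable_funS mD ED); apply: measurable_funM; first exact: msqrt.
  exact: measurable_funTS.
have e1 (s : R) : 0 < s -> expR (- (dl * s)) <= 1.
  by move=> s0; rewrite expR_le1 oppr_le0 mulr_ge0// ltW.
have -> : (`]0, +oo[%classic : set RR) = `]0, 1]%classic `|` `]1, +oo[%classic.
  apply/seteqP; split => s; rewrite /= !in_itv/= ?andbT; last by case=> [/andP[]|]//; exact: lt_trans.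
  by move=> s0; have [s1|s1] := leP s 1; [left; rewrite s0|right].
have mI1 : measurable (`]0, 1] : set RR) by exact: measurable_itv.
have mI2 : measurable (`]1, +oo[ : set RR) by exact: measurable_itv.
have sub1 : (`]0, 1] : set RR) `<=` Dpos.
  by move=> s; rewrite /Dpos /= !in_itv/= andbT => /andP[].
have sub2 : (`]1, +oo[ : set RR) `<=` Dpos.
  by move=> s; rewrite /Dpos /= !in_itv/= !andbT; exact: lt_trans.
have sub12 : (`]0, 1] `|` `]1, +oo[ : set RR) `<=` Dpos by move=> s [/sub1|/sub2].
have mabs (E : set RR) : E `<=` Dpos -> measurable_fun E (fun s => `|(Num.sqrt s)^-1 * expR (- (dl * s))|%:E).
  by move=> ED; apply/measurable_EFinP; apply: measurableT_comp => //; exact: m1.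
apply/integrableP; split; first by apply/measurable_EFinP; exact: m1.
rewrite ge0_integral_setU//=; last 2 first.
- exact: mabs.
- by apply/disj_setPS => s [] /=; rewrite !in_itv/= => /andP[_ s1]; rewrite andbT ltNge s1.
apply: lte_add_pinfty.
  have /integrableP[_] := integrable_sqrt1; apply: le_lt_trans; apply: ge0_le_integral => //=.
  - exact: mabs.
  - by apply/measurable_EFinP; apply: measurableT_comp => //; exact: measurable_funS msqrt.
  move=> s /[!in_itv]/= /andP[s0 _]; rewrite lee_fin normrM ler_piMr//.
  by rewrite ger0_norm ?expR_ge0// e1.
have i2 : mu.-integrable `]1, +oo[ (EFin \o (fun s => expR (- (dl * s)))).
  apply: (integrableS _ _ _ (integrable_expRN dl0)) => //.
have /integrableP[mi2] := i2; apply: le_lt_trans; apply: ge0_le_integral => //=.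
- exact: mabs.
- by apply/measurable_EFinP; apply: measurableT_comp => //; exact: measurable_funTS.
move=> s; rewrite in_itv/= andbT => s1.
rewrite lee_fin normrM ler_piMl//.
rewrite ger0_norm ?invr_ge0 ?sqrtr_ge0// invf_le1 ?sqrtr_gt0 ?(lt_trans _ s1)//.
by rewrite -(sqrtr1 R) ler_sqrt ltW// (lt_trans _ s1).
Qed.

End inverse_sqrt.

Section probability_constants.
Context {R : realType} {d : measure_display} {T : measurableType d}.
Variable m : probability T R.

Lemma Rintegral_prob_cst (k : R) : \int[m]_(x in setT) k = k.
Proof.
have H : m setT = 1%E := probability_setT m.
transitivity (fine (k%:E * m setT)%E); last by rewrite H mule1.
by congr fine; exact: integral_cst.
Qed.

Lemma cintegral_prob_cst (z : R[i]) : cintegral m setT (fun=> z) = z.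
Proof. by apply: complexP; rewrite /= Rintegral_prob_cst. Qed.

Lemma cintegrable_prob_cst (z : R[i]) : cintegrable m setT (fun=> z).
Proof. by split; exact: integrable_prob_cst. Qed.

End probability_constants.

Section law_family.
Context {R : realType}.
Local Notation RR := (measurableTypeR R).
Local Notation mu := (@lebesgue_measure R).
Variables (PL : R -> probability RR R) (M al : R).
Hypothesis M0 : 0 < M.
Hypothesis al0 : 0 <= al.
Hypothesis charf_PL : forall s r u : R, 0 < s -> 0 < r ->
  charf (PL (s + r)) u = charf (PL s) u * charf (PL r) u.
Hypothesis moment_PL : forall s : R, 0 < s ->
  (\int[PL s]_x (expR (M * x))%:E <= (expR (s * al))%:E)%E /\
  (\int[PL s]_x (expR (- M * x))%:E <= (expR (s * al))%:E)%E.

Let phi (x : R) : R := expR (M * x) + expR (- (M * x)) - 2.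
Let phi_sqr (x : R) : M ^+ 2 * x ^+ 2 <= phi x.
Proof. by rewrite -exprMn; exact: sqr_le_cosh. Qed.
Let phi0 x : 0 <= phi x.
Proof. by apply: le_trans (phi_sqr x); rewrite mulr_ge0 ?sqr_ge0. Qed.

Let mexp (a : R) : measurable_fun (setT : set RR) (fun x => expR (a * x)).
Proof. by apply: measurableT_comp => //; exact: measurable_funM. Qed.

Let iexp (s : R) : 0 < s -> (PL s).-integrable setT (EFin \o (fun x => expR (M * x))) /\
  (PL s).-integrable setT (EFin \o (fun x => expR (- M * x))).
Proof.
move=> s0; have [h1 h2] := moment_PL s0; split; apply/integrableP; split;
  try (by apply/measurable_EFinP; exact: mexp);
  under eq_integral => x _ do rewrite /= ger0_norm ?expR_ge0//.
  by apply: le_lt_trans h1 _; exact: ltry.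
by apply: le_lt_trans h2 _; exact: ltry.
Qed.

Let exp_le (s : R) : 0 < s -> \int[PL s]_x expR (M * x) <= expR (s * al) /\
  \int[PL s]_x expR (- M * x) <= expR (s * al).
Proof.
move=> s0; have [h1 h2] := moment_PL s0; have [i1 i2] := iexp s0.
by split; rewrite -lee_fin /Rintegral fineK//; exact: integrable_fin_num.
Qed.

(** Subtracting 2 turns the moment bounds at [M] and [- M] into a statement about small times: the
    expectation of [phi] is [O(s)]. *)
Let iphi (s : R) : 0 < s -> (PL s).-integrable setT (EFin \o (phi : RR -> R)) /\
  \int[PL s]_x phi x <= 2 * (expR (s * al) - 1).
Proof.
move=> s0; have [i1 i2] := iexp s0; have [e1 e2] := exp_le s0.
have i3 := integrable_prob_cst (PL s) (- 2).
have i12 := integrable_add measurableT i1 i2.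
have e : phi = fun x => expR (M * x) + expR (- M * x) + - 2.
  by apply/funext => x; rewrite /phi mulNr.
rewrite e; split; first exact: (integrable_add measurableT i12 i3).
rewrite RintegralD// RintegralD// Rintegral_prob_cst.
lra.
Qed.

Variable th : R.
Hypothesis th0 : 0 <= th.
Hypothesis thM : th < M.

Let exp_pos_le2 x : exp_pos th x <= expR (M * x) + 1.
Proof.
rewrite /exp_pos; have [x0|/ltW x0] := leP 0 x.
  rewrite (pos_part_id x0) (@le_trans _ _ (expR (M * x)))//.
    by rewrite ler_expR ler_wpM2r// ltW.
  by rewrite lerDl.
by rewrite (pos_part_le0 x0) mulr0 expR0 lerDr expR_ge0.
Qed.

Lemma exp_integrable_PL (s : R) : 0 < s -> exp_integrable th (PL s).
Proof.
move=> s0; have [i1 _] := iexp s0.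
have i := integrable_add measurableT i1 (integrable_prob_cst (PL s) 1).
apply: (le_integrable measurableT _ _ i); first by apply/measurable_EFinP; exact: measurable_exp_pos.
by move=> x _ /=; rewrite lee_fin !ger0_norm ?exp_pos_ge0 ?addr_ge0 ?expR_ge0.
Qed.

Lemma exp_integral_PL (s : R) : 0 < s -> \int[PL s]_x exp_pos th x <= 2 * expR (s * al).
Proof.
move=> s0; have [i1 _] := iexp s0; have [e1 _] := exp_le s0.
have i3 := integrable_prob_cst (PL s) 1.
apply: (@le_trans _ _ (\int[PL s]_x (expR (M * x) + 1))).
  apply: le_Rintegral => //; first exact: exp_integrable_PL.
  exact: (integrable_add measurableT i1 i3).
rewrite RintegralD// Rintegral_prob_cst.
have : 1 <= expR (s * al) by rewrite -expR0 ler_expR mulr_ge0// ltW.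
lra.
Qed.

(** The first summand settles [|x| <= 1], where [phi] dominates [M^2 x^2]; the second settles
    [|x| > 1], where the gap [M - th] absorbs the linear factor and [phi] is comparable to
    [exp (M |x|)]. *)
Let c : R := expR M / M + (1 + 2 / M ^+ 2) / (M - th).
Let c0 : 0 <= c.
Proof.
rewrite addr_ge0 ?divr_ge0 ?expR_ge0 ?(ltW M0)//; last by rewrite subr_ge0 ltW.
by rewrite addr_ge0 ?divr_ge0 ?exprn_ge0 ?(ltW M0).
Qed.

Let linear_exp (x : R) : `|x| * expR (th * `|x|) <= `|x| + c * phi x.
Proof.
set y := `|x|; have y0 : 0 <= y by exact: normr_ge0.
have phiE : phi x = expR (M * y) + expR (- (M * y)) - 2.
  rewrite /phi /y; have [x0|/ltW x0] := leP 0 x; first by rewrite ger0_norm.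
  by rewrite ler0_norm// mulrN opprK; congr (_ - 2); rewrite addrC.
have phi_y : M ^+ 2 * y ^+ 2 <= phi x by rewrite /y real_normK ?num_real.
have d0 : 0 < M - th by rewrite subr_gt0.
have k1 : 0 <= expR M / M by rewrite divr_ge0 ?expR_ge0 ?(ltW M0).
have k2 : 0 <= (1 + 2 / M ^+ 2) / (M - th).
  by rewrite divr_ge0 ?(ltW d0)// addr_ge0 ?divr_ge0 ?exprn_ge0 ?(ltW M0).
have p := phi0 x.
have [y1|y1] := leP y 1.
  have h1 : expR (th * y) - 1 <= th * y * expR M.
    apply: le_trans (ler_norm _) _; apply: le_trans (expR_lin _) _.
    rewrite ger0_norm ?mulr_ge0// ler_wpM2l ?mulr_ge0// ge_max -{1}expR0 !ler_expR (ltW M0)/=.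
    by rewrite -[leRHS]mulr1 ler_pM// ltW.
  have h2 : y * (expR (th * y) - 1) <= expR M / M * phi x.
    apply: le_trans (ler_wpM2l y0 h1) _.
    have -> : y * (th * y * expR M) = expR M / M * (M * th * y ^+ 2) by field; rewrite gt_eqF.
    rewrite ler_wpM2l//; apply: le_trans phi_y; rewrite ler_wpM2r ?sqr_ge0//.
    by rewrite expr2 ler_wpM2l ?(ltW M0)// ltW.
  have := mulr_ge0 k2 p; rewrite /c mulrDl; lra.
have h1 : y * expR (th * y) <= expR (M * y) / (M - th).
  rewrite ler_pdivlMr//.
  have -> : expR (M * y) = expR ((M - th) * y) * expR (th * y).
    by rewrite -expRD; congr expR; ring.
  rewrite mulrAC ler_wpM2r ?expR_ge0// mulrC.
  by have := expR_ge1Dx ((M - th) * y); lra.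
have h2 : 2 <= 2 / M ^+ 2 * phi x.
  have M2 : 0 < M ^+ 2 by rewrite exprn_gt0.
  rewrite mulrAC ler_pdivlMr// ler_pM2l//; apply: le_trans phi_y.
  by rewrite ler_peMr ?(ltW M2)// expr_ge1// ltW.
have h3 : expR (M * y) <= (1 + 2 / M ^+ 2) * phi x.
  by rewrite mulrDl mul1r {1}phiE; have := expR_ge0 (- (M * y)); lra.
have h4 : expR (M * y) / (M - th) <= (1 + 2 / M ^+ 2) / (M - th) * phi x.
  by rewrite [leRHS]mulrAC ler_wpM2r// invr_ge0 ltW.
have := mulr_ge0 k1 p; rewrite /c mulrDl; lra.
Qed.

(** [|x| <= r + x^2 / r] for every [r > 0]; the choice of [r] is left open until the time [s] is
    known. *)
Let linear_exp_r (x r : R) : 0 < r ->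
  `|x| * expR (th * `|x|) <= r + ((M ^+ 2 * r)^-1 + c) * phi x.
Proof.
move=> r0; apply: le_trans (linear_exp x) _; rewrite (mulrDl (M ^+ 2 * r)^-1 c) [leRHS]addrA lerD2r.
have h : `|x| <= r + x ^+ 2 / r.
  rewrite -(ler_pM2r r0) mulrDl divfK ?gt_eqF//.
  by rewrite -[x ^+ 2]real_normK ?num_real//; have := sqr_ge0 (`|x| - r); have := sqr_ge0 `|x|; nra.
apply: (le_trans h); rewrite lerD2l.
have -> : (M ^+ 2 * r)^-1 * phi x = phi x / M ^+ 2 / r by rewrite invfM; ring.
by rewrite ler_wpM2r ?invr_ge0 ?(ltW r0)// ler_pdivlMr ?exprn_gt0// mulrC.
Qed.

Let mlin : measurable_fun (setT : set RR) (fun x => `|x| * expR (th * `|x|)).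
Proof.
apply: measurable_funM => //; apply: measurableT_comp => //.
by apply: measurable_funM => //; exact: measurableT_comp.
Qed.

Let A : R := 1 + 2 * al / M ^+ 2.
Let B : R := 2 * c * al.
Let A0 : 0 <= A.
Proof. by rewrite addr_ge0// divr_ge0 ?exprn_ge0 ?mulr_ge0 ?(ltW M0). Qed.
Let B0 : 0 <= B. Proof. by rewrite !mulr_ge0. Qed.

Let AB0 (h : R) : 0 <= h -> 0 <= A * Num.sqrt h + B * h.
Proof. by move=> h0; apply: addr_ge0; apply: mulr_ge0 => //; exact: sqrtr_ge0. Qed.

(** The choice [r = sqrt s] balances [r] against [E x^2 / r], which is of order [s / r]. This is the
    origin of the order [sqrt s]. *)
Let small_moment (s : R) : 0 < s ->
  (PL s).-integrable setT (EFin \o (fun x : RR => `|x| * expR (th * `|x|))) /\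
  \int[PL s]_x (`|x| * expR (th * `|x|)) <= expR (s * al) * (A * Num.sqrt s + B * s).
Proof.
move=> s0; have [ip ep] := iphi s0.
have r0 : 0 < Num.sqrt s by rewrite sqrtr_gt0.
set r := Num.sqrt s in r0 *; have rs : r ^+ 2 = s by rewrite sqr_sqrtr// ltW.
have ib := integrable_add measurableT (integrable_prob_cst (PL s) r)
  (integrable_scale measurableT ((M ^+ 2 * r)^-1 + c) ip).
have i : (PL s).-integrable setT (EFin \o (fun x : RR => `|x| * expR (th * `|x|))).
  apply: (le_integrable measurableT _ _ ib); first exact/measurable_EFinP.
  move=> x _ /=; rewrite lee_fin ger0_norm ?mulr_ge0 ?expR_ge0//.
  by apply: le_trans (ler_norm _); exact: linear_exp_r.
split=> //.
apply: (@le_trans _ _ (\int[PL s]_x (r + ((M ^+ 2 * r)^-1 + c) * phi x))).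
  by apply: le_Rintegral => // x _; exact: linear_exp_r.
rewrite RintegralD//; last 2 first.
- exact: (integrable_prob_cst (PL s) r).
- exact: (integrable_scale measurableT ((M ^+ 2 * r)^-1 + c) ip).
rewrite Rintegral_prob_cst RintegralZl//.
have k0 : 0 <= (M ^+ 2 * r)^-1 + c by rewrite addr_ge0// invr_ge0 mulr_ge0 ?exprn_ge0 ?(ltW M0) ?(ltW r0).
have E1 : 1 <= expR (s * al) by rewrite -expR0 ler_expR mulr_ge0// ltW.
have eal : expR (s * al) - 1 <= s * al * expR (s * al).
  apply: le_trans (ler_norm _) _; apply: le_trans (expR_lin _) _.
  by rewrite ger0_norm ?mulr_ge0 ?(ltW s0)// (max_idPr E1).
have h : \int[PL s]_x phi x <= 2 * (s * al * expR (s * al)) by apply: (le_trans ep); lra.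
have h1 := ler_wpM2l k0 h.
have h2 : r <= expR (s * al) * r by rewrite ler_peMl// ltW.
have e : expR (s * al) * (A * r + B * s) =
  expR (s * al) * r + ((M ^+ 2 * r)^-1 + c) * (2 * (s * al * expR (s * al))).
  by rewrite /A /B -rs; field; rewrite (gt_eqF M0) (gt_eqF r0).
by rewrite e; lra.
Qed.

Variable beta : R[i].
Hypothesis beta_th : - Re beta <= th.

Definition damped_exp (x : R) : R[i] := cexp (- (beta * (pos_part x)%:C)).
Definition damped_transform (s : R) : R[i] := cintegral (PL s) setT (fun x : RR => damped_exp x).

Let Re_beta (p : R) : Re (- (beta * p%:C)) = - Re beta * p.
Proof. by rewrite ReN ReM /= mulr0 subr0 mulNr. Qed.

Lemma normc_damped_exp x : normc (damped_exp x) <= exp_pos th x.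
Proof. by rewrite normc_cexp Re_beta ler_expR ler_wpM2r// pos_part_ge0. Qed.

Lemma growth_damped_exp : growth th damped_exp.
Proof.
split.
  apply: cmeasurable_cexp; apply: cmeasurableN; apply: cmeasurableM; first exact: cmeasurable_cst.
  by apply: cmeasurable_real; exact: measurable_pos_part.
by exists 1 => // x; rewrite mul1r; exact: normc_damped_exp.
Qed.

Let ordered_diff (p q : R) : 0 <= p -> p <= q ->
  normc (cexp (- (beta * q%:C)) - cexp (- (beta * p%:C))) <=
  expR (th * p) * (3 * normc beta * ((q - p) * expR (th * (q - p)))).
Proof.
move=> p0 pq; have d0 : 0 <= q - p by rewrite subr_ge0.
have -> : cexp (- (beta * q%:C)) = cexp (- (beta * p%:C)) * cexp (- (beta * (q - p)%:C)).
  rewrite -cexpD; congr cexp; have -> : (q - p)%:C = q%:C - p%:C :> R[i].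
    by apply: complexP; rewrite ?ReB ?ImB /= ?subr0.
  by ring.
set e := cexp (- (beta * p%:C)); set w := cexp _.
have -> : e * w - e = e * (w - 1) by ring.
rewrite normcM; apply: ler_pM; rewrite ?normc_ge0//.
  by rewrite normc_cexp Re_beta ler_expR ler_wpM2r.
apply: le_trans (normc_cexp_sub1 _) _; rewrite Re_beta normcN normcM normcR ger0_norm//.
rewrite -!mulrA !ler_wpM2l ?normc_ge0// ge_max -{1}expR0 !ler_expR mulr_ge0//=.
by rewrite ler_wpM2r.
Qed.

(** The positive part is 1-Lipschitz, so the exponent moves by at most [|y|]; [ordered_diff] applies
    to the two positive parts in either order. *)
Let damped_diff (x y : R) : normc (damped_exp (x + y) - damped_exp x) <=
  exp_pos th x * (3 * normc beta * (`|y| * expR (th * `|y|))).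
Proof.
have b0 := normc_ge0 beta.
have mono (d : R) : 0 <= d -> d <= `|y| -> d * expR (th * d) <= `|y| * expR (th * `|y|).
  by move=> d0 dy; rewrite ler_pM ?expR_ge0// ler_expR ler_wpM2l.
have dist : `|pos_part (x + y) - pos_part x| <= `|y|.
  have h1 := pos_partD x y; have h2 := pos_partD (x + y) (- y); rewrite addrK in h2.
  have p1 : pos_part y <= `|y| by rewrite ge_max ler_norm normr_ge0.
  have p2 : pos_part (- y) <= `|y| by rewrite ge_max -normrN ler_norm normr_ge0.
  by rewrite ler_norml; apply/andP; split; lra.
rewrite /damped_exp /exp_pos; have px := pos_part_ge0 x; have pxy := pos_part_ge0 (x + y).
have [le|/ltW le] := leP (pos_part x) (pos_part (x + y)).
  apply: le_trans (ordered_diff px le) _; rewrite ler_wpM2l ?expR_ge0// ler_wpM2l ?mulr_ge0//.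
  by apply: mono; [rewrite subr_ge0|move: dist; rewrite ger0_norm// subr_ge0].
rewrite normc_distrC; apply: le_trans (ordered_diff pxy le) _.
apply: ler_pM; rewrite ?expR_ge0//.
- by rewrite mulr_ge0 ?mulr_ge0 ?expR_ge0// subr_ge0.
- by rewrite ler_expR ler_wpM2l.
- rewrite ler_wpM2l ?mulr_ge0//; apply: mono; first by rewrite subr_ge0.
  by move: dist; rewrite distrC ger0_norm// subr_ge0.
Qed.

Let idamped (s : R) : 0 < s -> cintegrable (PL s) setT (fun x : RR => damped_exp x).
Proof. by move=> s0; apply: growth_integrable growth_damped_exp; exact: exp_integrable_PL. Qed.

Lemma normc_damped_transform (s : R) : 0 < s -> normc (damped_transform s) <= 2 * expR (s * al).
Proof.
move=> s0; apply: le_trans (normc_cintegral_le_int measurableT (idamped s0)) _.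
apply: le_trans (exp_integral_PL s0); apply: le_Rintegral => //.
- exact: (cintegrable_normc measurableT (idamped s0)).
- exact: exp_integrable_PL.
- by move=> x _; exact: normc_damped_exp.
Qed.

Let bound3 (s : R) : R := 3 * normc beta * (expR (s * al) * (A * Num.sqrt s + B * s)).

Lemma damped_transform_sub1 (s : R) : 0 < s ->
  normc (damped_transform s - 1) <= 3 * normc beta * (expR (s * al) * (A * Num.sqrt s + B * s)).
Proof.
move=> s0; have [i h] := small_moment s0.
have -> : damped_transform s - 1 = cintegral (PL s) setT (fun x : RR => damped_exp x - 1).
  by rewrite (cintegralB measurableT (idamped s0) (cintegrable_prob_cst _ _)) cintegral_prob_cst.
have ib : cintegrable (PL s) setT (fun x : RR => damped_exp x - 1).
  by apply: cintegrableB => //; [exact: idamped|split; exact: integrable_prob_cst].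
apply: le_trans (normc_cintegral_le_int measurableT ib) _.
have b0 : 0 <= 3 * normc beta by rewrite mulr_ge0 ?normc_ge0.
apply: le_trans (ler_wpM2l b0 h); rewrite -RintegralZl//.
apply: le_Rintegral => //.
- exact: (cintegrable_normc measurableT ib).
- exact: integrable_scale.
- move=> x _; have := damped_diff 0 x; rewrite add0r.
  have p0 : pos_part (0 : R) = 0 by rewrite pos_part_id.
  rewrite /exp_pos p0 mulr0 expR0 mul1r.
  by rewrite {2}/damped_exp p0 mulr0 oppr0 cexp0.
Qed.

(** The law at [s + r] is the convolution of those at [s] and [r], so the difference is an average
    of [damped_diff] over an increment of duration [r]. *)
Let damped_transform_diff (s r : R) : 0 < s -> 0 < r ->
  normc (damped_transform (s + r) - damped_transform s) <= 2 * expR (s * al) * bound3 r.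
Proof.
move=> s0 r0; have [ir hr] := small_moment r0.
have gd := growth_damped_exp.
have is_ := exp_integrable_PL s0; have ier := exp_integrable_PL r0.
rewrite /damped_transform (cintegral_convolution th0 is_ ier gd (fun u => charf_PL u s0 r0)).
have g2 : growth2 th (fun z : RR * RR => damped_exp (z.1 + z.2)).
  apply: (growth_comp2 th0 (phi := sum_rv) gd); first exact: measurable_sum_rv.
  by move=> x y; exact: pos_partD.
have i1 := growth_integrable is_ (growth2_integral ier g2).
have iin x := growth_integrable ier (growth2_section x g2).
have ic x : cintegrable (PL r) setT (fun=> damped_exp x) by split; exact: integrable_prob_cst.
have ib x : cintegrable (PL r) setT (fun y : RR => damped_exp (x + y) - damped_exp x).
  by apply: cintegrableB => //; exact: iin.
rewrite -(cintegralB measurableT i1 (idamped s0)).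
have e x : cintegral (PL r) setT (fun y : RR => damped_exp (x + y)) - damped_exp x =
    cintegral (PL r) setT (fun y : RR => damped_exp (x + y) - damped_exp x).
  rewrite (cintegralB measurableT (iin x) (ic x)); congr (_ - _).
  by rewrite cintegral_prob_cst.
have b0 : 0 <= 3 * normc beta by rewrite mulr_ge0 ?normc_ge0.
have bd x : normc (cintegral (PL r) setT (fun y : RR => damped_exp (x + y)) - damped_exp x) <= bound3 r * exp_pos th x.
  rewrite e; apply: le_trans (normc_cintegral_le_int measurableT (ib x)) _.
  apply: (@le_trans _ _ (\int[PL r]_y (exp_pos th x * (3 * normc beta) * (`|y| * expR (th * `|y|))))).
    apply: le_Rintegral => //.
    - exact: (cintegrable_normc measurableT (ib x)).
    - exact: integrable_scale.
    - by move=> y _; rewrite -mulrA; exact: damped_diff.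
  rewrite RintegralZl// -mulrA [leRHS]mulrC ler_wpM2l ?exp_pos_ge0//.
  by rewrite /bound3 ler_wpM2l.
have isub := cintegrableB measurableT i1 (idamped s0).
apply: le_trans (normc_cintegral_le_int measurableT isub) _.
have r3 : 0 <= bound3 r.
  by rewrite /bound3 mulr_ge0// mulr_ge0 ?expR_ge0// AB0// ltW.
apply: (@le_trans _ _ (\int[PL s]_x (bound3 r * exp_pos th x))).
  apply: le_Rintegral => //.
  - exact: (cintegrable_normc measurableT isub).
  - exact: integrable_scale.
  - by move=> x _; exact: bd.
by rewrite RintegralZl// mulrC ler_wpM2r// exp_integral_PL.
Qed.

Lemma damped_transform_continuous (s : R) (u : nat -> R) : 0 < s -> u @ \oo --> s ->
  ccvg (damped_transform \o u) (damped_transform s).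
Proof.
move=> s0 us.
pose d n := `|u n - s|.
have dc : d @ \oo --> (0 : R).
  rewrite -[X in _ --> X](normr0 R) -(subrr s); apply: cvg_norm.
  by apply: cvgB => //; exact: cvg_cst.
pose K := 2 * expR ((s + 1) * al) * (3 * normc beta * expR al).
have K0 : 0 <= K by rewrite !mulr_ge0 ?expR_ge0 ?normc_ge0.
apply: (@ccvg_squeeze _ _ _ (fun n => K * (A * Num.sqrt (d n) + B * d n))); last first.
  rewrite -[X in _ --> X](mulr0 K); apply: cvgM; first exact: cvg_cst.
  have sc : Num.sqrt (d n) @[n --> \oo] --> (0 : R).
    by rewrite -[X in _ --> X](@sqrtr0 R); apply: (cvg_comp _ _ dc); exact: sqrt_continuous.
  have e : A * 0 + B * 0 = 0 by rewrite !mulr0 addr0.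
  rewrite -[X in _ --> X]e; apply: cvgD; apply: cvgM => //; exact: cvg_cst.
have e0 : 0 < Num.min 1 (s / 2) by rewrite lt_min ltr01 divr_gt0.
have /cvgrPdist_le/(_ _ e0) := us; apply: filterS => n.
rewrite le_min distrC -/(d n) => /andP[d1 d2]; rewrite /comp.
(* The estimate goes forward in time, so the smaller of [u n] and [s] is taken as the starting
   point. *)
have key (x y : R) : 0 < x -> x < y -> x <= s + 1 -> y - x = d n ->
    normc (damped_transform y - damped_transform x) <= K * (A * Num.sqrt (d n) + B * d n).
  move=> x0 xy xs1 e; have h0 : 0 < y - x by rewrite subr_gt0.
  have := damped_transform_diff x0 h0; rewrite (addrC x) subrK e => h; apply: (le_trans h).
  have t0 : 0 <= A * Num.sqrt (d n) + B * d n by rewrite AB0 ?normr_ge0.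
  have -> : 2 * expR (x * al) * bound3 (d n) = (2 * expR (x * al) * (3 * normc beta * expR (d n * al))) * (A * Num.sqrt (d n) + B * d n).
    by rewrite /bound3; ring.
  rewrite ler_wpM2r// /K ler_pM ?mulr_ge0 ?expR_ge0 ?normc_ge0//.
    by rewrite ler_wpM2l// ler_expR ler_wpM2r.
  by rewrite ler_wpM2l ?mulr_ge0 ?normc_ge0// ler_expR ler_piMl.
have [un|un|un] := ltgtP (u n) s; last first.
- by rewrite {1}un subrr normc0 mulr_ge0// AB0 ?normr_ge0.
- by apply: key => //; [lra|rewrite /d ger0_norm ?subr_ge0 ?(ltW un)].
- have e : s - u n = d n by rewrite /d distrC ger0_norm ?subr_ge0 ?(ltW un).
  by rewrite normc_distrC; apply: key => //; lra.
Qed.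

End law_family.

Section sequential_continuity.
Context {R : realType}.
Local Notation RR := (measurableTypeR R).

Lemma cmeasurable_sequential (f : R -> R[i]) :
  (forall (s : R) (u : nat -> R), 0 < s -> u @ \oo --> s -> ccvg (f \o u) (f s)) ->
  cmeasurable (`]0, +oo[ : set RR) (f : RR -> R[i]).
Proof.
move=> fc; split; apply: open_continuous_measurable_fun; try exact: interval_open;
  move=> s; rewrite inE /= in_itv/= andbT => s0; apply/(@cvg_nbhsP R R^o) => u us.
  exact: (ccvg_Re (fc s u s0 us)).
exact: (ccvg_Im (fc s u s0 us)).
Qed.

Lemma cmeasurable_cvg {d} {T : measurableType d} (D : set T) (f_ : nat -> T -> R[i]) f :
  (forall n, cmeasurable D (f_ n)) -> (forall x, D x -> ccvg (f_ ^~ x) (f x)) -> cmeasurable D f.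
Proof.
move=> mf f_f; split.
  by apply: (measurable_fun_cvg (h := fun n x => Re (f_ n x))) => [n|x Dx]; [exact: (mf n).1|exact: ccvg_Re (f_f x Dx)].
by apply: (measurable_fun_cvg (h := fun n x => Im (f_ n x))) => [n|x Dx]; [exact: (mf n).2|exact: ccvg_Im (f_f x Dx)].
Qed.

Lemma cintegral_extend {d} {T : measurableType d} (m : {measure set T -> \bar R}) (D : set T) (f g : T -> R[i]) :
  (forall x, D x -> f x = g x) -> (forall x, ~ D x -> g x = 0) ->
  cintegral m D f = cintegral m setT g.
Proof.
move=> fg g0; apply: complexP; rewrite /= Rintegral_mkcond; congr Rintegral; apply/funext => x;
  rewrite patchE; have [Dx|Dx] := pselect (D x);
  by [rewrite (mem_set Dx) fg|rewrite (memNset Dx) g0].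
Qed.

End sequential_continuity.

Section one_sided_inversion.
Context {R : realType}.
Local Notation RR := (measurableTypeR R).
Local Notation mu := (@lebesgue_measure R).
Variables (PL : R -> probability RR R) (M al : R).
Hypothesis M0 : 0 < M.
Hypothesis al0 : 0 <= al.
Hypothesis charf_PL : forall s r u : R, 0 < s -> 0 < r ->
  charf (PL (s + r)) u = charf (PL s) u * charf (PL r) u.
Hypothesis moment_PL : forall s : R, 0 < s ->
  (\int[PL s]_x (expR (M * x))%:E <= (expR (s * al))%:E)%E /\
  (\int[PL s]_x (expR (- M * x))%:E <= (expR (s * al))%:E)%E.
Variable th : R.
Hypothesis th0 : 0 <= th.
Hypothesis thM : th < M.

(** The majorant is a combination of [s^(-1/2)] and 1, times [exp(- (Y' - al) s)]: integrable at
    both ends, and nonincreasing as the Riemann sums require. *)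
Lemma damped_transform_dominated (beta : R[i]) Y' : - Re beta <= th -> al < Y' -> exists g : R -> R,
  [/\ forall s, 0 < s -> 0 <= g s, forall s t, 0 < s -> s <= t -> g t <= g s,
   mu.-integrable `]0, +oo[ (EFin \o g) &
   forall s, 0 < s -> normc (damped_transform PL beta s - 1) / s * expR (- (Y' * s)) <= g s].
Proof.
move=> bth alY'; have dl0 : 0 < Y' - al by rewrite subr_gt0.
pose A : R := 1 + 2 * al / M ^+ 2.
pose B : R := 2 * (expR M / M + (1 + 2 / M ^+ 2) / (M - th)) * al.
have A0 : 0 <= A by rewrite addr_ge0// divr_ge0 ?exprn_ge0 ?mulr_ge0 ?(ltW M0).
have B0 : 0 <= B.
  rewrite mulr_ge0// mulr_ge0// addr_ge0 ?divr_ge0 ?expR_ge0 ?(ltW M0)//; last by rewrite subr_ge0 ltW.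
  by rewrite addr_ge0 ?divr_ge0 ?exprn_ge0 ?(ltW M0).
have C0 : 0 <= 3 * normc beta by rewrite mulr_ge0 ?normc_ge0.
have CA : 0 <= 3 * normc beta * A by apply: mulr_ge0.
have CB : 0 <= 3 * normc beta * B by apply: mulr_ge0.
exists (fun s => 3 * normc beta * A * ((Num.sqrt s)^-1 * expR (- ((Y' - al) * s))) +
  3 * normc beta * B * expR (- ((Y' - al) * s))); split.
- move=> s s0; apply: addr_ge0; apply: mulr_ge0; rewrite ?expR_ge0//.
- move=> s t s0 st; have e1 : expR (- ((Y' - al) * t)) <= expR (- ((Y' - al) * s)).
    by rewrite ler_expR lerN2 ler_wpM2l// ltW.
  apply: lerD; apply: ler_wpM2l => //; apply: ler_pM; rewrite ?expR_ge0 ?invr_ge0 ?sqrtr_ge0//.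
  by rewrite lef_pV2 ?posrE ?sqrtr_gt0 ?(lt_le_trans s0 st)// ler_wsqrtr.
- have mI : measurable (`]0, +oo[ : set RR) by exact: measurable_itv.
  exact: (integrable_add mI (integrable_scale mI (3 * normc beta * A) (integrable_sqrt_expRN dl0))
    (integrable_scale mI (3 * normc beta * B) (integrable_expRN dl0))).
- move=> s s0; have := damped_transform_sub1 M0 al0 moment_PL th0 thM bth s0.
  rewrite -/A -/B => h.
  have s1 : 0 < s^-1 by rewrite invr_gt0.
  have := ler_wpM2r (ltW s1) h => {}h.
  apply: le_trans (ler_wpM2r (expR_ge0 _) h) _; rewrite le_eqVlt; apply/orP; left; apply/eqP.
  have -> : expR (- ((Y' - al) * s)) = expR (s * al) * expR (- (Y' * s)).
    by rewrite -expRD; congr expR; ring.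
  have r0 : 0 < Num.sqrt s by rewrite sqrtr_gt0.
  have rs : Num.sqrt s ^+ 2 = s by rewrite sqr_sqrtr// ltW.
  move: (expR (s * al)) (expR _) => a1 a2; clear h A0 B0 CA CB; clearbody A B.
  move: r0 rs; move: (Num.sqrt s) => r r0 <-; move: (normc beta) => nb.
  by field; rewrite gt_eqF.
Qed.

Let damped0 (beta : R[i]) : damped_exp beta 0 = 1.
Proof. by rewrite /damped_exp pos_part_id// mulr0 oppr0 cexp0. Qed.

Let dampedD (beta : R[i]) (p q : R) : 0 <= p -> 0 <= q ->
  damped_exp beta (p + q) = damped_exp beta p * damped_exp beta q.
Proof.
move=> p0 q0; rewrite /damped_exp !pos_part_id ?addr_ge0// -cexpD; congr cexp.
by have -> : (p + q)%:C = p%:C + q%:C :> R[i]; [apply: complexP; rewrite ?ReD ?ImD/= ?addr0|ring].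
Qed.

Let damped_pos (beta : R[i]) (x : R) : damped_exp beta (pos_part x) = damped_exp beta x.
Proof. by rewrite /damped_exp (pos_part_id (pos_part_ge0 x)). Qed.

(** On nonnegative arguments [damped_exp] is multiplicative, so each double integral in Spitzer's
    recursion splits into a product. *)
Let lindley_recursion (beta : R[i]) (h : R) : - Re beta <= th -> 0 < h ->
  let m i := cintegral (lindley (PL h) i) setT (damped_exp beta : RR -> R[i]) in
  m 0%N = 1 /\ forall i, i.+1%:R * m i.+1 =
    \sum_(k < i.+1) damped_transform PL beta (k.+1%:R * h) * m (i - k)%N.
Proof.
move=> bth h0 m; have gd := growth_damped_exp bth.
split; first by rewrite /m cintegral_lindley0//; exact: gd.1.
move=> i.
pose mu_ k := PL (k.+1%:R * h).
have k0 k : 0 < k.+1%:R * h by rewrite mulr_gt0.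
have imu k : exp_integrable th (mu_ k) by exact: (exp_integrable_PL moment_PL thM (k0 k)).
have cmu k u : charf (mu_ k.+1) u = charf (mu_ k) u * charf (mu_ 0%N) u.
  by rewrite -charf_PL//; congr (charf (PL _) u); rewrite -[k.+2%:R]natr1 mulrDl mul1r.
have e0 : mu_ 0%N = PL h by rewrite /mu_ mul1r.
have := spitzer_recursion th0 imu cmu i.+1 gd; rewrite e0 => ->.
have ih : exp_integrable th (PL h) by rewrite -e0.
apply: eq_bigr => k _ /=; rewrite mulrC /m /damped_transform.
rewrite -(cintegralMl measurableT); last exact: (growth_integrable (imu k) gd).
apply: eq_cintegral => y _.
have gy : growth th (fun x : RR => damped_exp beta (pos_part y + x)).
  have g2 : growth2 th (fun z : RR * RR => damped_exp beta (z.1 + z.2)).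
    apply: (growth_comp2 th0 (phi := sum_rv) gd); first exact: measurable_sum_rv.
    by move=> x z; exact: pos_partD.
  exact: growth2_section g2.
rewrite (cintegral_lindley_pos th0 ih _ gy).
have -> : (fun x : RR => damped_exp beta (pos_part y + pos_part x)) =
    (fun x : RR => damped_exp beta y * damped_exp beta x).
  by apply/funext => x; rewrite dampedD ?pos_part_ge0// !damped_pos.
rewrite (cintegralMl measurableT) 1?mulrC//.
by apply: growth_integrable gd; exact: exp_integrable_lindley.
Qed.

Lemma one_sided_inversion (t Y : R) (beta l : R[i]) : 0 < t -> al < Y -> - Re beta <= th ->
  ccvg (fun j => cintegral (lindley (PL (t / 2 ^+ j)) (2 ^ j)) setT (damped_exp beta : RR -> R[i])) l ->
  forall eps : R, 0 < eps -> exists A0 : R, forall A : R, A0 <= A ->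
  normc (((2 * pi)^-1)%:C * cintegral mu `[- A, A] (resolvent_kernel t Y (damped_transform PL beta)) - l) <= eps.
Proof.
move=> t0 alY bth ml eps eps0.
(* Any exponent strictly between [al] and [Y] would do. The bound [K = 2] chosen below stems from
   [normc_damped_transform]. *)
pose Y' := (al + Y) / 2.
have alY' : al < Y' by rewrite /Y'; lra.
have Y'Y : Y' < Y by rewrite /Y'; lra.
have Y'0 : 0 < Y' by exact: le_lt_trans alY'.
have [g [g0 gn ig ag]] := damped_transform_dominated bth alY'.
have h0 j : 0 < t / 2 ^+ j by rewrite divr_gt0// exprn_gt0.
apply: (transform_inversion t0 Y'0 Y'Y (K := 2) _ _ g0 gn ig ag
  (m := fun j i => cintegral (lindley (PL (t / 2 ^+ j)) i) setT (damped_exp beta : RR -> R[i])) _ _ ml) => //.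
- move=> s s0; apply: (@le_trans _ _ (2 * expR (s * al) * expR (- (Y' * s)))).
    by rewrite ler_wpM2r ?expR_ge0// (normc_damped_transform al0 moment_PL thM bth).
  rewrite -mulrA ler_piMr// -expRD -expR0 ler_expR.
  have : 0 <= s * (Y' - al) by rewrite mulr_ge0 ?(ltW s0)// subr_ge0 ltW.
  lra.
- exact: (damped_transform_continuous M0 al0 charf_PL moment_PL th0 thM bth).
- by move=> j; have [] := lindley_recursion bth (h0 j).
- by move=> j i; have [_] := lindley_recursion bth (h0 j).
Qed.

(** For [beta = - th] the coefficients [m] are exponential moments of the grid maxima, and
    [normc_sum_tail] at degree [2^j] bounds them: undoing the power of [exp(- Y h)] costs at most
    [exp (2 Y t)], whatever the grid. *)
Lemma lindley_moment_bounded (t : R) : 0 < t -> exists C : R, forall j : nat,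
  normc (cintegral (lindley (PL (t / 2 ^+ j)) (2 ^ j)) setT (damped_exp (- th%:C) : RR -> R[i])) <= C.
Proof.
move=> t0.
have bth : - Re (- th%:C : R[i]) <= th by rewrite ReN /= opprK.
pose Y := al + 2; pose Y' := al + 1.
have alY' : al < Y' by rewrite /Y'; lra.
have Y'Y : Y' < Y by rewrite /Y'/Y; lra.
have Y'0 : 0 < Y' by exact: le_lt_trans alY'.
have [g [g0 gn ig ag]] := damped_transform_dominated bth alY'.
exists (expR (2 * Y * t) * expR (gsum g)) => j.
have q0 : (0 : R) < 2 ^+ j by rewrite exprn_gt0.
have h0 : 0 < t / 2 ^+ j by rewrite divr_gt0.
have [m0 mS] := lindley_recursion bth h0.
set m := cintegral _ _ _.
have := normc_sum_tail (a := damped_transform PL (- th%:C)) Y'0 Y'Y g0 gn ig ag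
  (m := fun i => cintegral (lindley (PL (t / 2 ^+ j)) i) setT (damped_exp (- th%:C) : RR -> R[i])) h0 m0 mS (2 ^ j) 0.
rewrite -/m qptX normcM normcM normcR (ger0_norm (expR_ge0 _)) (normc_cexp (0 +i* _)) [Re (_ +i* _)]/= expR0 mulr1 => h.
have e1 : expR (- ((Y - Y') * (t / 2 ^+ j) * (2 ^ j)%:R)) <= 1.
  have YY : 0 <= Y - Y' by rewrite subr_ge0 ltW.
  rewrite expR_le1 oppr_le0; exact: (mulr_ge0 (mulr_ge0 YY (ltW h0)) (ler0n _ _)).
have {}h := le_trans h (ler_wpM2r (expR_ge0 (gsum g)) e1).
rewrite mul1r in h.
have e2 : Y * ((2 ^ j).+1%:R * (t / 2 ^+ j)) <= 2 * Y * t.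
  have -> : (2 ^ j).+1%:R * (t / 2 ^+ j) = t + t / 2 ^+ j.
    by rewrite -natr1 natrX; field; rewrite gt_eqF.
  have Y0 : 0 < Y by exact: lt_trans Y'Y.
  have -> : 2 * Y * t = Y * (t + t) by ring.
  rewrite (ler_pM2l Y0) lerD2l ler_pdivrMr// ler_peMr ?(ltW t0)//.
  by rewrite exprn_ege1// ler1n.
have h2 : normc m <= expR (gsum g) * expR (Y * ((2 ^ j).+1%:R * (t / 2 ^+ j))).
  by rewrite -ler_pdivrMr ?expR_gt0// -expRN.
apply: (le_trans h2); rewrite mulrC ler_wpM2r ?expR_ge0// ler_expR//.
Qed.

End one_sided_inversion.

(** * The ladder exponents *)

Section ladder_ratio.
Context {R : realType}.
Local Notation RR := (measurableTypeR R).
Local Notation mu := (@lebesgue_measure R).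
Variables (PL : R -> probability RR R) (M al : R).
Hypothesis M0 : 0 < M.
Hypothesis al0 : 0 <= al.
Hypothesis charf_PL : forall s r u : R, 0 < s -> 0 < r ->
  charf (PL (s + r)) u = charf (PL s) u * charf (PL r) u.
Hypothesis moment_PL : forall s : R, 0 < s ->
  (\int[PL s]_x (expR (M * x))%:E <= (expR (s * al))%:E)%E /\
  (\int[PL s]_x (expR (- M * x))%:E <= (expR (s * al))%:E)%E.
Variable th : R.
Hypothesis th0 : 0 <= th.
Hypothesis thM : th < M.

Let nonpos (x : R) : R[i] := (if x <= 0 then 1 else 0)%:C.
Let cmeasurable_nonpos : cmeasurable (setT : set RR) (fun x : RR => nonpos x).
Proof.
apply: cmeasurable_real; apply: measurable_fun_ifT => //; exact: measurable_fun_ler.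
Qed.
Let normc_nonpos x : normc (nonpos x) <= 1.
Proof. by rewrite normcR; case: ifP; rewrite ?normr0 ?normr1. Qed.

Let mass (s : R) : R[i] := cintegral (PL s) setT (fun x : RR => nonpos x).

Let cintegrable_nonpos s : cintegrable (PL s) setT (fun x : RR => nonpos x).
Proof.
apply: (cintegrable_dom measurableT cmeasurable_nonpos (integrable_prob_cst (PL s) 1)) => x _.
exact: normc_nonpos.
Qed.

Let damped_cvg x : ccvg (fun n : nat => damped_exp (n%:R%:C) x) (nonpos x).
Proof.
rewrite /nonpos; have [x0|x0] := leP x 0.
  apply: ccvg_eq (ccvg_cst _); apply: nearW => n.
  by rewrite /damped_exp pos_part_le0// mulr0 oppr0 cexp0.
have e n : normc (damped_exp (n%:R%:C) x - 0%:C) = expR (- x) ^+ n.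
  rewrite subr0 normc_cexp -expRM_natl ReN (ReM (n%:R)%:C) /= mulr0 subr0 pos_part_id ?(ltW x0)//.
  by congr expR; rewrite mulrN.
rewrite /ccvg; under eq_fun do rewrite e.
by apply: cvg_expr; rewrite ger0_norm ?expR_ge0// expR_lt1 oppr_lt0.
Qed.

Let Re_natC (n : nat) : - Re (n%:R%:C : R[i]) <= th.
Proof. by rewrite /= (le_trans _ th0)// oppr_le0. Qed.

(** The mass of []-oo, 0]] is the limit of [damped_transform] at [beta = n], and each of these is
    continuous in [s]. *)
Let cmeasurable_mass : cmeasurable (`]0, +oo[ : set RR) (fun s : RR => mass s).
Proof.
apply: (cmeasurable_cvg (f_ := fun n s => damped_transform PL (n%:R%:C) s)) => [n|s].
  apply: cmeasurable_sequential => s u s0 us.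
  exact: (damped_transform_continuous M0 al0 charf_PL moment_PL th0 thM (Re_natC n)).
rewrite /= in_itv/= andbT => s0.
have bd (n : nat) (x : RR) : setT x -> normc (damped_exp (n%:R%:C) x) <= 1.
  move=> _; rewrite normc_cexp expR_le1 ReN (ReM (n%:R)%:C) /= mul0r subr0 oppr_le0.
  by rewrite mulr_ge0// pos_part_ge0.
exact: (cdominated (f_ := fun n (x : RR) => damped_exp (n%:R%:C) x) (f := fun x : RR => nonpos x) (g := fun=> 1)
  (mu := PL s) measurableT (fun n => (growth_damped_exp (Re_natC n)).1) (fun x _ => damped_cvg x)
  (integrable_prob_cst (PL s) 1) bd).2.
Qed.

Let normc_mass s : normc (1 - mass s) <= 2.
Proof.
apply: le_trans (normcB _ _) _; rewrite normc1.
have : normc (mass s) <= 1; last by lra.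
apply: le_trans (normc_cintegral_le_int measurableT (cintegrable_nonpos s)) _.
rewrite -[leRHS](Rintegral_prob_cst (PL s) 1); apply: le_Rintegral => //.
- exact: (cintegrable_normc measurableT (cintegrable_nonpos s)).
- exact: integrable_prob_cst.
Qed.

(** On []0, +oo[] the functions [1 - nonpos] and [damped_exp - nonpos] are 1 and [exp(- beta x)];
    elsewhere both vanish. The first resulting term is independent of [beta] and will cancel in the
    ratio. *)
Let ladder_inner (z beta : R[i]) (s : R) : - Re beta <= th -> 0 < s ->
  cintegral (PL s) `]0, +oo[ (fun x : R =>
      (cexp (- s%:C) - cexp (- (z * s%:C) - beta * x%:C)) * (s^-1)%:C) =
  (cexp (- s%:C) - cexp (- (z * s%:C))) * (1 - mass s) * (s^-1)%:C -
  cexp (- (z * s%:C)) * ((damped_transform PL beta s - 1) * (s^-1)%:C).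
Proof.
move=> bth s0.
pose c1 := cexp (- s%:C) * (s^-1)%:C; pose c2 := cexp (- (z * s%:C)) * (s^-1)%:C.
have i1 := cintegrable_nonpos s.
have i2 : cintegrable (PL s) setT (fun x : RR => 1 - nonpos x).
  exact: (cintegrableB measurableT (cintegrable_prob_cst (PL s) 1) i1).
have i3 : cintegrable (PL s) setT (fun x : RR => damped_exp beta x).
  exact: (growth_integrable (exp_integrable_PL moment_PL thM s0) (growth_damped_exp bth)).
have i4 : cintegrable (PL s) setT (fun x : RR => damped_exp beta x - nonpos x).
  exact: (cintegrableB measurableT i3 i1).
transitivity (cintegral (PL s) setT (fun x : RR => c1 * (1 - nonpos x) - c2 * (damped_exp beta x - nonpos x))).
  apply: cintegral_extend => x.
    rewrite /= in_itv/= andbT => x0; rewrite /nonpos leNgt x0/= subr0 subr0 mulr1.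
    by rewrite cexpD /damped_exp (pos_part_id (ltW x0)) /c1 /c2; ring.
  move/negP; rewrite /= in_itv/= andbT -leNgt => x0.
  by rewrite /nonpos x0 /damped_exp (pos_part_le0 x0) mulr0 oppr0 cexp0 !subrr !mulr0 subrr.
rewrite (cintegralB measurableT (cintegrableMl measurableT c1 i2) (cintegrableMl measurableT c2 i4)).
rewrite (cintegralMl measurableT c1 i2) (cintegralMl measurableT c2 i4).
rewrite (cintegralB measurableT (cintegrable_prob_cst (PL s) 1) i1) (cintegralB measurableT i3 i1) cintegral_prob_cst.
by rewrite -/(mass s) -/(damped_transform PL beta s) /c1 /c2; ring.
Qed.

Variables (k Y v : R) (beta : R[i]).
Hypothesis k0 : 0 < k.
Hypothesis alY : al < Y.
Hypothesis bth : - Re beta <= th.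

Let z : R[i] := Y +i* v.
Let main s : R[i] := (cexp (- s%:C) - cexp (- (z * s%:C))) * (1 - mass s) * (s^-1)%:C.
Let corr s : R[i] := cexp (- (z * s%:C)) * ((damped_transform PL beta s - 1) * (s^-1)%:C).

Let Re_zs (s : R) : Re (- (z * s%:C)) = - (Y * s).
Proof. by rewrite ReN ReM /= mulr0 subr0. Qed.

Let cmeasurable_id : cmeasurable (`]0, +oo[ : set RR) (fun s : RR => s%:C).
Proof. exact: cmeasurable_real. Qed.

Let cmeasurable_expz : cmeasurable (`]0, +oo[ : set RR) (fun s : RR => cexp (- (z * s%:C))).
Proof.
by apply: cmeasurable_cexp; apply: cmeasurableN; apply: cmeasurableM => //; exact: cmeasurable_cst.
Qed.

Let cmeasurable_inv : cmeasurable (`]0, +oo[ : set RR) (fun s : RR => (s^-1)%:C).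
Proof.
apply: cmeasurable_real; apply: open_continuous_measurable_fun; first exact: interval_open.
move=> s; rewrite inE /= in_itv/= andbT => s0; apply: cvgV; last exact: cvg_id.
by rewrite gt_eqF.
Qed.

Let mI : measurable (`]0, +oo[ : set RR). Proof. exact: measurable_itv. Qed.

Let cintegrable_corr : cintegrable mu `]0, +oo[ corr.
Proof.
have [g [g0 gn ig ag]] := damped_transform_dominated M0 al0 moment_PL th0 thM bth alY.
apply: (cintegrable_dom mI _ ig).
  apply: cmeasurableM => //; apply: cmeasurableM => //.
  apply: cmeasurableB; last exact: cmeasurable_cst.
  apply: cmeasurable_sequential => s u s0 us.
  exact: (damped_transform_continuous M0 al0 charf_PL moment_PL th0 thM bth).
move=> s sI; have s0 : 0 < s by move: sI; rewrite /= in_itv/= andbT.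
apply: le_trans (ag s s0); by rewrite /corr normcM normc_cexp Re_zs normcM normcR ger0_norm ?invr_ge0 ?(ltW s0)// mulrC.
Qed.

(** Near 0 the factor [1 / s] is compensated by [exp(- s) - exp(- z s)], which is of order [s]. The
    constant 6 is the 3 of [normc_cexp_sub1] times the 2 of [normc_mass]. *)
Let cintegrable_main : cintegrable mu `]0, +oo[ main.
Proof.
have Y0 : 0 < Y by exact: le_lt_trans alY.
have ig : mu.-integrable `]0, +oo[ (EFin \o (fun s : RR =>
    6 * normc (z - 1) * (expR (- (1 * s)) + expR (- (Y * s))))).
  apply: (integrable_scale mI).
  exact: (integrable_add mI (integrable_expRN ltr01) (integrable_expRN Y0)).
apply: (cintegrable_dom mI _ ig).
  apply: cmeasurableM => //; apply: cmeasurableM; apply: cmeasurableB => //.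
    by apply: cmeasurable_cexp; exact: cmeasurableN.
move=> s sI; have s0 : 0 < s by move: sI; rewrite /= in_itv/= andbT.
rewrite /main.
have -> : cexp (- s%:C) - cexp (- (z * s%:C)) = - (cexp (- s%:C) * (cexp (- ((z - 1) * s%:C)) - 1)).
  by rewrite mulrBr -cexpD mulr1 opprB; congr (_ - cexp _); ring.
have r1 : Re (- ((z - 1) * s%:C)) = s - Y * s.
  have -> : - ((z - 1) * s%:C) = s%:C - z * s%:C by ring.
  by rewrite ReB (ReM z) /= mulr0 subr0.
have h := normc_cexp_sub1 (- ((z - 1) * s%:C)).
rewrite r1 normcN normcM normcR gtr0_norm// in h.
have e1 : expR (- s) * Num.max 1 (expR (s - Y * s)) <= expR (- (1 * s)) + expR (- (Y * s)).
  rewrite mul1r; have [_|_] := leP 1 (expR (s - Y * s)).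
    rewrite -expRD (_ : - s + _ = - (Y * s)); last by ring.
    by rewrite lerDr expR_ge0.
  by rewrite mulr1 lerDl expR_ge0.
rewrite normcM normcM normcN normcM normcR ger0_norm ?invr_ge0 ?(ltW s0)// cexpNR normcR (ger0_norm (expR_ge0 _)).
have n0 := normc_ge0 (z - 1).
set E := normc (cexp _ - 1) in h *.
have h1 : expR (- s) * E <= 3 * normc (z - 1) * s * (expR (- (1 * s)) + expR (- (Y * s))).
  apply: le_trans (ler_wpM2l (expR_ge0 _) h) _.
  have -> : expR (- s) * (3 * (normc (z - 1) * s) * Num.max 1 (expR (s - Y * s))) =
     3 * normc (z - 1) * s * (expR (- s) * Num.max 1 (expR (s - Y * s))) by ring.
  by rewrite ler_wpM2l// mulr_ge0 ?(ltW s0)// mulr_ge0.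
have E0 : 0 <= expR (- s) * E by rewrite mulr_ge0 ?expR_ge0 ?normc_ge0.
rewrite ler_pdivrMr//.
apply: le_trans (ler_pM E0 (normc_ge0 _) h1 (normc_mass s)) _.
by rewrite le_eqVlt; apply/orP; left; apply/eqP; ring.
Qed.

(** For second argument 0 only the common part [main] is left, so [main] and the constant [k] cancel
    and the exponential of the correction remains. *)
Lemma ladder_up_ratio :
  ladder_up k PL (Y +i* v) 0 / ladder_up k PL (Y +i* v) beta =
  cexp (log_transform Y (damped_transform PL beta) v).
Proof.
rewrite /ladder_up -/z.
have -> : cintegral mu `]0, +oo[ (fun s : R => cintegral (PL s) `]0, +oo[ (fun x : R =>
      (cexp (- s%:C) - cexp (- (z * s%:C) - 0 * x%:C)) * (s^-1)%:C)) = cintegral mu `]0, +oo[ main.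
  apply: eq_cintegral => s; rewrite inE /= in_itv/= andbT => s0.
  rewrite (ladder_inner _ (Re_natC 0) s0).
  have -> : damped_transform PL 0 s = 1.
    rewrite -[RHS](cintegral_prob_cst (PL s) 1); apply: eq_cintegral => x _.
    by rewrite /damped_exp mul0r oppr0 cexp0.
  by rewrite subrr mul0r mulr0 subr0.
have -> : cintegral mu `]0, +oo[ (fun s : R => cintegral (PL s) `]0, +oo[ (fun x : R =>
      (cexp (- s%:C) - cexp (- (z * s%:C) - beta * x%:C)) * (s^-1)%:C)) =
      cintegral mu `]0, +oo[ main - log_transform Y (damped_transform PL beta) v.
  rewrite -[log_transform _ _ _]/(cintegral mu `]0, +oo[ corr) -(cintegralB mI cintegrable_main cintegrable_corr).
  apply: eq_cintegral => s; rewrite inE /= in_itv/= andbT => s0.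
  exact: ladder_inner.
set I := cintegral mu _ main; set W := log_transform _ _ _.
have eW : W = I - (I - W) by ring.
rewrite [in RHS]eW (cexpB I (I - W)) -mulf_div divff ?mul1r//.
by apply/eqP => -[] k00; move: k0; rewrite k00 ltxx.
Qed.

End ladder_ratio.

(** * The running supremum *)

Section lindley_maximum.
Context {R : realType} {d : measure_display} {Omega : measurableType d}.
Local Notation RR := (measurableTypeR R).
Variables (P : probability Omega R) (n : nat) (X : nat -> Omega -> RR) (m : probability RR R).
Hypothesis mX : forall i, measurable_fun setT (X i).
Hypothesis law_X : forall B : nat -> set RR, (forall i, measurable (B i)) ->
  P (\bigcap_(i in `I_n) (X i @^-1` B i)) = (\prod_(i < n) m (B i))%E.

(* The maximum of 0 and of the partial sums of the last [j] increments. *)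
Fixpoint tail_max (j : nat) (w : Omega) : RR :=
  if j is j'.+1 then pos_part (X (n - j'.+1) w + tail_max j' w) else 0.

Lemma measurable_tail_max j : measurable_fun setT (tail_max j).
Proof.
elim: j => [|j IH] /=; first exact: measurable_cst.
exact: (measurableT_comp measurable_pos_part (measurable_funD (mX _) IH)).
Qed.

Let mpre (i : nat) (B : set RR) : measurable B -> measurable (X i @^-1` B).
Proof. by move=> mB; rewrite -[X in measurable X]setTI; exact: mX. Qed.

Let mcap k (B : nat -> set RR) : (forall i, measurable (B i)) ->
  measurable (\bigcap_(i in `I_k) (X i @^-1` B i)).
Proof. by move=> mB; apply: bigcap_measurableType => i _; exact: mpre. Qed.

(** The product rule on rectangles says that the pair of [x] and [y], restricted to the event [E],
    has [c] times the product law. After division by [c] the uniqueness of product measures extends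
    the rule to preimages under the reflected sum; [c = 0] is treated apart. *)
Let mult_measure (E : set Omega) (x y : Omega -> RR) (c : \bar R) (nu : probability RR R) (C : set RR) :
  measurable E -> measurable_fun setT x -> measurable_fun setT y ->
  (forall A C : set RR, measurable A -> measurable C ->
    P (E `&` x @^-1` A `&` y @^-1` C) = (c * m A * nu C)%E) ->
  measurable C ->
  P (E `&` (fun w => pos_part (x w + y w)) @^-1` C) = (c * (m \x nu)%E (reflected_sum @^-1` C))%E.
Proof.
move=> mE mx my H mC.
have PE : P E = c.
  have := H setT setT measurableT measurableT; rewrite !preimage_setT !setIT => ->.
  have -> : m setT = 1%E := probability_setT m.
  by have -> : nu setT = 1%E := probability_setT nu; rewrite !mule1.
have mxy : measurable_fun setT (fun w => (x w, y w)) by exact: measurable_fun_pair.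
have mpos : measurable_fun setT (fun w => pos_part (x w + y w)).
  apply: (measurableT_comp measurable_pos_part); exact: measurable_funD.
have mpC : measurable ((fun w => pos_part (x w + y w)) @^-1` C).
  by rewrite -[X in measurable X]setTI; exact: mpos.
have [c0|c0] := eqVneq c 0%E.
  rewrite c0 mul0e; apply/eqP; rewrite eq_le measure_ge0 andbT -c0 -PE.
  by apply: le_measure; rewrite ?inE//; exact: measurableI.
have cfin : c \is a fin_num by rewrite -PE fin_num_measure.
have cpos : 0 < fine c.
  by rewrite fine_gt0// lt0e c0 -PE measure_ge0/= ltey_eq fin_num_measure.
have r0 : 0 <= (fine c)^-1 by rewrite invr_ge0 ltW.
pose nuE : {measure set (RR * RR) -> \bar R} :=
  mscale (NngNum r0) (measure_function_pushforward__canonical__measure_function_Measure (mrestr P mE) mxy).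
have unique : forall A : set (RR * RR), measurable A -> (m \x nu)%E A = nuE A.
  apply: product_measure_unique => A D mA mD.
  transitivity (((fine c)^-1)%:E * P ((fun w => (x w, y w)) @^-1` (A `*` D) `&` E))%E; first by [].
  have -> : (fun w => (x w, y w)) @^-1` (A `*` D) `&` E = E `&` x @^-1` A `&` y @^-1` D.
    by apply/seteqP; split=> w /=; [move=> [[]]|move=> [[]]].
  by rewrite H// -{2}(fineK cfin) !muleA -EFinM mulVf ?gt_eqF// mul1e.
rewrite unique; last first.
  by rewrite -[X in measurable X]setTI; exact: measurable_reflected_sum.
transitivity (c * (((fine c)^-1)%:E * P ((fun w => (x w, y w)) @^-1` (reflected_sum @^-1` C) `&` E)))%E; last by [].
rewrite -{1}(fineK cfin) muleA -EFinM mulfV ?gt_eqF// mul1e setIC.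
by congr (P _).
Qed.

(** Keeping the events of the first increments in the statement is what carries independence through
    the induction. *)
Lemma tail_max_law j (B : nat -> set RR) (C : set RR) : (j <= n)%N ->
  (forall i, measurable (B i)) -> measurable C ->
  P (\bigcap_(i in `I_(n - j)) (X i @^-1` B i) `&` tail_max j @^-1` C) =
  (\prod_(i < n - j) m (B i) * lindley m j C)%E.
Proof.
elim: j B C => [|j IH] B C jn mB mC.
  rewrite subn0 -law_X//= diracE; have [C0|C0] := boolP (0 \in C).
    rewrite mule1; congr (P _); apply/seteqP; split => w /=; first by case.
    by move=> H; split=> //; exact: set_mem.
  rewrite mule0 -(measure0 P); congr (P _); apply/seteqP; split => w //= -[_ C0'].
  by move: C0; rewrite mem_set.
set k := (n - j.+1)%N; have kj : (n - j = k.+1)%N by rewrite /k subnSK.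
have := @mult_measure (\bigcap_(i in `I_k) (X i @^-1` B i)) (X k) (tail_max j)
  (\prod_(i < k) m (B i))%E (lindley m j) C (mcap k mB) (mX k) (measurable_tail_max j).
apply => // A D mA mD.
(* The condition on the increment of index [k] is appended to the list of events, so that the
   hypothesis for [j] applies. *)
pose B' i := if (i < k)%N then B i else A.
have mB' i : measurable (B' i) by rewrite /B'; case: ifP.
have := IH B' D (ltnW jn) mB' mD; rewrite kj big_ord_recr /=.
have -> : B' k = A by rewrite /B' ltnn.
have -> : (\prod_(i < k) m (B' i) = \prod_(i < k) m (B i))%E.
  by apply: eq_bigr => i _; rewrite /B' ltn_ord.
move=> <-; congr (P (_ `&` _)); apply/seteqP; split => w /=.
  move=> [HB HA] i; rewrite /= ltnS leq_eqVlt => /orP[/eqP ->|ik].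
    by rewrite /B' ltnn.
  by rewrite /B' ik; exact: HB.
move=> H; split.
  by move=> i /= ik; have := H i (ltnW ik); rewrite /B' /= ik.
by have := H k (ltnSn k); rewrite /B' /= ltnn.
Qed.

Lemma lindley_law (C : set RR) : measurable C -> P (tail_max n @^-1` C) = lindley m n C.
Proof.
move=> mC; have := @tail_max_law n (fun=> setT) C (leqnn n) (fun=> measurableT) mC.
by rewrite subnn II0 bigcap_set0 setTI big_ord0 mul1e.
Qed.

End lindley_maximum.

Section partial_maximum.
Context {R : realType} {d : measure_display} {Omega : measurableType d}.
Variables (n : nat) (X : nat -> Omega -> measurableTypeR R) (w : Omega) (S : nat -> R).
Hypothesis XS : forall i, X i w = S i.+1 - S i.

(** The maximum over the longer range is either attained at its left end, with value 0, or later, in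
    which case the first increment is added to the maximum over the shorter range. *)
Lemma tail_max_spec j : (j <= n)%N ->
  (forall i, (n - j <= i <= n)%N -> S i - S (n - j)%N <= tail_max n X j w) /\
  (exists2 i, (n - j <= i <= n)%N & tail_max n X j w = S i - S (n - j)%N).
Proof.
elim: j => [|j IH] jn.
  rewrite subn0; split => [i|]; last by exists n; rewrite ?leqnn ?subrr.
  by rewrite -eqn_leq => /eqP <-; rewrite subrr.
have [IH1 [i0 i0n e0]] := IH (ltnW jn).
set k := (n - j.+1)%N in IH1 i0n e0 *; have kj : (n - j = k.+1)%N by rewrite /k subnSK.
rewrite kj in IH1 i0n e0.
have e : tail_max n X j.+1 w = pos_part (S k.+1 - S k + tail_max n X j w) by rewrite /= -/k XS.
rewrite e; split.
  move=> i /andP[]; rewrite leq_eqVlt => /orP[/eqP <-|ki] le_in.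
    by rewrite subrr pos_part_ge0.
  apply: le_trans (le_pos_part _); have := IH1 i; rewrite ki le_in => /(_ isT); lra.
have [h|/ltW h] := leP 0 (S k.+1 - S k + tail_max n X j w).
  exists i0; last by rewrite (pos_part_id h) e0; ring.
  by case/andP: i0n => /ltnW -> ->.
by exists k; [rewrite leqnn leq_subr|rewrite (pos_part_le0 h) subrr].
Qed.

Lemma tail_max_ge i : (i <= n)%N -> S i - S 0%N <= tail_max n X n w.
Proof. by move=> le_in; have [h _] := tail_max_spec (leqnn n); rewrite subnn in h; exact: h. Qed.

Lemma tail_max_attained : exists2 i, (i <= n)%N & tail_max n X n w = S i - S 0%N.
Proof. by have [_] := tail_max_spec (leqnn n); rewrite subnn. Qed.

End partial_maximum.

(** * Suprema of cadlag functions and maxima over dyadic grids *)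

Section cadlag_supremum.
Context {R : realType}.
Variables (f : R -> R) (t : R).
Hypothesis t0 : 0 < t.
Hypothesis f_right : forall s, 0 <= s -> s < t -> f r @[r --> s^'+] --> f s.
Hypothesis f_left : forall s, 0 < s -> s <= t -> cvg (f r @[r --> s^'-]).

(** The one-sided limits bound [f] on both sides of each point, and compactness of [[0, t]], as a
    covering property with the bound tending to infinity, makes a single bound sufficient. *)
Lemma cadlag_has_sup : has_sup [set f s | s in `[0, t]].
Proof.
split; first by exists (f 0), 0 => //; rewrite /= in_itv/= lexx ltW.
have /compact_near_coveringP : compact (`[0, t]%classic : set R) by exact: segment_compact.
move=> /(_ R (pinfty_nbhs R) (fun i x => 0 <= x -> x <= t -> f x <= i)).
have near_bd (x : R) : `[0, t]%classic x -> \forall x' \near x & i \near +oo, 0 <= x' -> x' <= t -> f x' <= i.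
  rewrite /= in_itv/= => /andP[x0 xt].
  have [c1 h1] : exists c : R, \forall y \near x, x < y -> y <= t -> f y <= c.
    have [xt'|tx] := ltP x t; last by exists 0; exists 1 => //= y _ xy /(lt_le_trans xy); rewrite ltNge tx.
    exists (f x + 1); have /cvgrPdist_le/(_ 1 ltr01) := f_right x0 xt'.
    rewrite near_withinE; apply: filterS => y h xy _; have := h xy; rewrite distrC => /(le_trans (ler_norm _)); lra.
  have [c2 h2] : exists c : R, \forall y \near x, y < x -> 0 <= y -> f y <= c.
    have [x0'|xN] := ltP 0 x; last by exists 0; exists 1 => //= y _ yx y0; move: (lt_le_trans yx xN); rewrite ltNge y0.
    set l := lim (f r @[r --> x^'-]).
    exists (l + 1); have /cvgrPdist_le/(_ 1 ltr01) := f_left x0' xt.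
    rewrite near_withinE; apply: filterS => y h xy _; have := h xy; rewrite distrC => /(le_trans (ler_norm _)); rewrite -/l; lra.
  exists ([set y | (x < y -> y <= t -> f y <= c1) /\ (y < x -> 0 <= y -> f y <= c2)],
      [set i | Num.max (f x) (Num.max c1 c2) <= i]).
    split; first exact: filterI h1 h2.
    by apply: nbhs_pinfty_ge; exact: num_real.
  move=> [y i] /= [[g1 g2]]; rewrite !ge_max => /and3P[ix ic1 ic2] y0 yt.
  have [xy|yx|<-//] := ltgtP x y.
    exact: le_trans (g1 xy yt) ic1.
  exact: le_trans (g2 yx y0) ic2.
move=> /(_ _ near_bd) [M [_ HM]].
exists (M + 1) => _ [s /= sI <-]; apply: (HM (M + 1)) => //.
- by rewrite ltrDl.
- by move: sI; rewrite in_itv/= => /andP[].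
- by move: sI; rewrite in_itv/= => /andP[].
Qed.

Let h (j : nat) : R := t / 2 ^+ j.
Let h0 j : 0 < h j. Proof. by rewrite divr_gt0// exprn_gt0. Qed.
Let hN j : (2 ^ j)%:R * h j = t.
Proof. by rewrite /h natrX mulrC divfK// gt_eqF// exprn_gt0. Qed.
Let hc : h @ \oo --> (0 : R).
Proof. by rewrite -[X in _ --> X](mulr0 t); apply: cvgM; [exact: cvg_cst|exact: cvg_geo2]. Qed.
Let grid_in j i : (i <= 2 ^ j)%N -> `[0, t]%classic (i%:R * h j).
Proof.
move=> ij; rewrite /= in_itv/= mulr_ge0 ?(ltW (h0 j))//= -(hN j) ler_pM2r//.
by rewrite ler_nat.
Qed.

Variable G : nat -> R.
Hypothesis G_ge : forall j i, (i <= 2 ^ j)%N -> f (i%:R * h j) - f 0 <= G j.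
Hypothesis G_attained : forall j, exists2 i, (i <= 2 ^ j)%N & G j = f (i%:R * h j) - f 0.

Lemma grid_maximum_le j : G j <= sup [set f s | s in `[0, t]] - f 0.
Proof.
have [i ij ->] := G_attained j; rewrite lerD2r.
apply: (sup_upper_bound cadlag_has_sup); exists (i%:R * h j) => //; exact: grid_in.
Qed.

(** A nearly maximal point [s < t] is followed by a grid point at distance at most [h], where
    right-continuity almost preserves the value; [t] itself lies on every grid. *)
Lemma grid_maximum_cvg : G @ \oo --> sup [set f s | s in `[0, t]] - f 0.
Proof.
set top := sup _; apply/cvgrPdist_le => e e0.
suff : \forall j \near \oo, top - e <= G j + f 0.
  apply: filterS => j hj; have := grid_maximum_le j; rewrite -/top => hj2.
  by rewrite ger0_norm; lra.
have [_ [s /= sI <-] fs] := sup_adherent (divr_gt0 e0 (ltr0n R 2)) cadlag_has_sup.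
rewrite -/top in fs; move: sI; rewrite in_itv/= => /andP[s0]; rewrite le_eqVlt => /orP[/eqP st|st].
  apply: nearW => j; have := G_ge (leqnn (2 ^ j)); rewrite hN -st; lra.
have /cvgrPdist_le/(_ _ (divr_gt0 e0 (ltr0n R 2))) [dl /= dl0 H] := f_right s0 st.
have /cvgrPdist_lt/(_ _ dl0) := hc; apply: filterS => j; rewrite sub0r normrN gtr0_norm// => hj.
set i := (Num.truncn (s / h j)).+1.
have sh0 : 0 <= s / h j by rewrite divr_ge0// ltW.
have i1 : s < i%:R * h j by rewrite -ltr_pdivrMr// truncnS_gt.
have i2 : i%:R * h j <= s + h j.
  rewrite -natr1 mulrDl mul1r lerD2r -ler_pdivlMr//.
  by have /andP[] := truncn_itv sh0.
have i3 : (i <= 2 ^ j)%N.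
  rewrite -(ltr_nat R) -(ltr_pM2r (h0 j)) hN; apply: le_lt_trans st.
  rewrite -ler_pdivlMr//; by have /andP[] := truncn_itv sh0.
have := H (i%:R * h j); rewrite /ball_ /= => H1.
have {}H1 : `|f s - f (i%:R * h j)| <= e / 2.
  by apply: H1 => //; rewrite ltr_norml; apply/andP; split; lra.
have := G_ge i3; have := le_trans (ler_norm _) H1; lra.
Qed.

End cadlag_supremum.

Lemma ae_cintegral {R : realType} {d : measure_display} {T : measurableType d}
    (m : {measure set T -> \bar R}) (f g : T -> R[i]) :
  cmeasurable setT f -> cmeasurable setT g -> {ae m, forall x, f x = g x} ->
  cintegrable m setT g -> cintegrable m setT f /\ cintegral m setT f = cintegral m setT g.
Proof.
move=> [f1 f2] [g1 g2] fg [/integrableP[_ i1] /integrableP[_ i2]].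
have key (p : R[i] -> R) : measurable_fun setT (fun x => p (f x)) -> measurable_fun setT (fun x => p (g x)) ->
    (\int[m]_x `|(p (g x))%:E| < +oo)%E ->
    m.-integrable setT (fun x => (p (f x))%:E) /\ \int[m]_x p (f x) = \int[m]_x p (g x).
  move=> mf mg ig; split.
    apply/integrableP; split; first exact/measurable_EFinP.
    apply: le_lt_trans ig; rewrite le_eqVlt; apply/orP; left; apply/eqP.
    apply: ae_eq_integral => //.
    - by apply: measurableT_comp => //; exact/measurable_EFinP.
    - by apply: measurableT_comp => //; exact/measurable_EFinP.
    - by apply: filterS fg => x -> _.
  rewrite /Rintegral; congr fine; apply: ae_eq_integral => //; try exact/measurable_EFinP.
  by apply: filterS fg => x -> _.
have [k1 e1] := key (fun z => Re z) f1 g1 i1; have [k2 e2] := key (fun z => Im z) f2 g2 i2.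
by split; [split|rewrite /cintegral e1 e2].
Qed.

Section one_sided_process.
Context {R : realType} {d : measure_display} {Omega : measurableType d}.
Local Notation RR := (measurableTypeR R).
Variables (P : probability Omega R) (PL : R -> probability RR R) (M al : R).
Hypothesis M0 : 0 < M.
Hypothesis al0 : 0 <= al.
Hypothesis charf_PL : forall s r u : R, 0 < s -> 0 < r ->
  charf (PL (s + r)) u = charf (PL s) u * charf (PL r) u.
Hypothesis moment_PL : forall s : R, 0 < s ->
  (\int[PL s]_x (expR (M * x))%:E <= (expR (s * al))%:E)%E /\
  (\int[PL s]_x (expR (- M * x))%:E <= (expR (s * al))%:E)%E.
Variables (X : R -> Omega -> R) (t : R).
Hypothesis t0 : 0 < t.
Hypothesis mX : forall s, measurable_fun setT (X s : Omega -> RR).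
Hypothesis X_right : forall w s, 0 <= s -> s < t -> X r w @[r --> s^'+] --> X s w.
Hypothesis X_left : forall w s, 0 < s -> s <= t -> cvg (X r w @[r --> s^'-]).
Hypothesis X0 : {ae P, forall w, X 0 w = 0}.
Hypothesis law_X : forall (n : nat) (h : R) (B : nat -> set RR),
  0 < h -> n%:R * h <= t -> (forall i, measurable (B i)) ->
  P (\bigcap_(i in `I_n) [set w | B i (X (i.+1%:R * h) w - X (i%:R * h) w)]) =
  (\prod_(i < n) PL h (B i))%E.

Let h (j : nat) : R := t / 2 ^+ j.
Let h0 j : 0 < h j. Proof. by rewrite divr_gt0// exprn_gt0. Qed.
Let hN j : (2 ^ j)%:R * h j = t.
Proof. by rewrite /h natrX mulrC divfK// gt_eqF// exprn_gt0. Qed.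

Let inc j (i : nat) (w : Omega) : RR := X (i.+1%:R * h j) w - X (i%:R * h j) w.
Let minc j i : measurable_fun setT (inc j i).
Proof. exact: (measurable_funB (mX _) (mX _)). Qed.
Let G j (w : Omega) : RR := tail_max (2 ^ j) (inc j) (2 ^ j) w.
Let mG j : measurable_fun setT (G j). Proof. exact: measurable_tail_max. Qed.
Let top w := sup [set X s w | s in `[0, t]].
(** The grid maxima refer to the value at 0, which vanishes only almost surely; with the difference
    all comparisons hold on every path. *)
Let Z (w : Omega) : RR := top w - X 0 w.

Let G_ge w j i : (i <= 2 ^ j)%N -> X (i%:R * h j) w - X 0 w <= G j w.
Proof.
move=> ij; have := tail_max_ge (X := inc j) (w := w) (S := fun i => X (i%:R * h j) w) (fun=> erefl) ij.
by rewrite mul0r.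
Qed.

Let G_attained w j : exists2 i, (i <= 2 ^ j)%N & G j w = X (i%:R * h j) w - X 0 w.
Proof.
have := tail_max_attained (2 ^ j) (X := inc j) (w := w) (S := fun i => X (i%:R * h j) w) (fun=> erefl).
by rewrite mul0r.
Qed.

Let G_le w j : G j w <= Z w.
Proof.
have := grid_maximum_le (f := X ^~ w) (G := G ^~ w) t0 (@X_right w) (@X_left w) (@G_attained w) j.
exact.
Qed.

Let G_cvg w : G ^~ w @ \oo --> Z w.
Proof.
have := grid_maximum_cvg (f := X ^~ w) (G := G ^~ w) t0 (@X_right w) (@X_left w) (@G_ge w) (@G_attained w).
exact.
Qed.

Let G_ge0 w j : 0 <= G j w.
Proof. by have := G_ge w (leq0n (2 ^ j)); rewrite mul0r subrr. Qed.

Let Z_ge0 w : 0 <= Z w. Proof. exact: le_trans (G_ge0 w 0%N) (G_le w 0%N). Qed.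

Let mZ : measurable_fun setT Z.
Proof. exact: (measurable_fun_cvg (h := G) mG (fun w _ => @G_cvg w)). Qed.

Let G_law j (C : set RR) : measurable C -> P (G j @^-1` C) = lindley (PL (h j)) (2 ^ j) C.
Proof.
apply: lindley_law; first exact: minc.
by move=> B mB; have := law_X (n := 2 ^ j) (h0 j) _ mB; rewrite hN; exact.
Qed.

Let Gm j : {mfun Omega >-> RR} := mfun_Sub (mem_set (mG j)).

Let cintegral_G j (f : RR -> R[i]) : cmeasurable setT f -> cintegrable P setT (fun w => f (G j w)) ->
  cintegral P setT (fun w => f (G j w)) = cintegral (lindley (PL (h j)) (2 ^ j)) setT f.
Proof.
move=> mf iF; rewrite -(cintegral_distribution (X := Gm j) mf iF).
by apply: eq_measure_cintegral => A mA; exact: G_law.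
Qed.

Section integrals.
Variables th : R.
Hypothesis th0 : 0 <= th.
Hypothesis thM : th < M.

(** The grid maxima have uniformly bounded exponential moments, and Fatou's lemma transfers the
    bound. As [G j w <= Z w], this function then dominates the transforms for all grids. *)
Let iexpZ : P.-integrable setT (EFin \o (fun w => exp_pos th (Z w))).
Proof.
have mE (Y : Omega -> RR) : measurable_fun setT Y -> measurable_fun setT (fun w => (exp_pos th (Y w))%:E).
  by move=> mY; apply/measurable_EFinP; exact: (measurableT_comp (measurable_exp_pos th) mY).
apply/integrableP; split; first exact: mE.
have [C HC] := lindley_moment_bounded M0 al0 charf_PL moment_PL th0 thM t0.
apply: (@le_lt_trans _ _ C%:E); last exact: ltry.
have bd j : (\int[P]_w (exp_pos th (G j w))%:E <= C%:E)%E.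
  have -> : (\int[P]_w (exp_pos th (G j w))%:E = \int[lindley (PL (h j)) (2 ^ j)]_x (exp_pos th x)%:E)%E.
    transitivity (\int[distribution P (Gm j)]_x (exp_pos th x)%:E)%E; last first.
      by apply: eq_measure_integral => A mA _; exact: (G_law j mA).
    apply/esym/ge0_integral_distribution; last by move=> y; rewrite lee_fin exp_pos_ge0.
    by apply/measurable_EFinP; exact: measurable_exp_pos.
  have ih : exp_integrable th (PL (h j)) by exact: (exp_integrable_PL moment_PL thM (h0 j)).
  have il := exp_integrable_lindley th0 ih (2 ^ j).
  have := HC j.
  have -> : cintegral (lindley (PL (t / 2 ^+ j)) (2 ^ j)) setT (damped_exp (- th%:C) : RR -> R[i]) =
      cintegral (lindley (PL (h j)) (2 ^ j)) setT (fun x : RR => (exp_pos th x)%:C).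
    apply: eq_cintegral => x _; rewrite /damped_exp mulNr opprK /exp_pos -cexpR.
    by rewrite realCM.
  rewrite cintegral_real normcR => /(le_trans (ler_norm _)).
  by rewrite -lee_fin /Rintegral fineK//; exact: integrable_fin_num.
have -> : (\int[P]_w `|(EFin \o (fun w => exp_pos th (Z w))) w| =
    \int[P]_w limn_einf (fun j => (exp_pos th (G j w))%:E))%E.
  apply: eq_integral => w _; rewrite /comp gee0_abs ?lee_fin ?exp_pos_ge0//; apply/esym.
  have c : (exp_pos th (G j w))%:E @[j --> \oo] --> (exp_pos th (Z w))%:E.
    apply: cvg_EFin; first exact: nearW.
    have -> : (fine \o (fun j => (exp_pos th (G j w))%:E)) = fun j => expR (th * G j w).
      by apply/funext => j; rewrite /= /exp_pos pos_part_id.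
    rewrite /exp_pos pos_part_id//; apply: continuous_cvg; first exact: continuous_expR.
    by apply: cvgM; [exact: cvg_cst|exact: G_cvg].
  by have [-> _] := cvg_limn_einf_sup c.
apply: le_trans (fatou P measurableT (fun j => mE _ (mG j)) _) _.
  by move=> j w _; rewrite lee_fin exp_pos_ge0.
rewrite limn_einf_lim; apply: lime_le; first exact: is_cvg_einfs.
apply: nearW => j; apply: le_trans (bd j).
by apply: ereal_inf_lbound; exists j => //=.
Qed.

Variable beta : R[i].
Hypothesis bth : - Re beta <= th.

Let l : R[i] := cintegral P setT (fun w => damped_exp beta (Z w)).

Let cvg_l : cintegrable P setT (fun w => damped_exp beta (Z w)) /\
  ccvg (fun j => cintegral (lindley (PL (t / 2 ^+ j)) (2 ^ j)) setT (damped_exp beta : RR -> R[i])) l.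
Proof.
have md (Y : Omega -> RR) : measurable_fun setT Y -> cmeasurable setT (fun w => damped_exp beta (Y w)).
  by move=> mY; exact: (cmeasurable_comp (growth_damped_exp bth).1 mY).
have bd j w : setT w -> normc (damped_exp beta (G j w)) <= exp_pos th (Z w).
  move=> _; apply: le_trans (normc_damped_exp bth _) _.
  rewrite /exp_pos (pos_part_id (G_ge0 w j)) (pos_part_id (Z_ge0 w)) ler_expR.
  exact: (ler_wpM2l th0 (G_le w j)).
have dc w : setT w -> ccvg (fun j => damped_exp beta (G j w)) (damped_exp beta (Z w)).
  move=> _; rewrite /damped_exp; apply: ccvg_cexp; apply: ccvgN; apply: ccvgM; first exact: ccvg_cst.
  apply: ccvg_real; rewrite pos_part_id//.
  have -> : (fun n => pos_part (G n w)) = G ^~ w by apply/funext => j; rewrite pos_part_id.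
  exact: G_cvg.
have [i c] := cdominated measurableT (fun j => md _ (mG j)) dc iexpZ bd; split=> //.
have e j : cintegral P setT (fun w => damped_exp beta (G j w)) =
    cintegral (lindley (PL (t / 2 ^+ j)) (2 ^ j)) setT (damped_exp beta : RR -> R[i]).
  apply: cintegral_G; first exact: (growth_damped_exp bth).1.
  exact: (cintegrable_dom measurableT (md _ (mG j)) iexpZ (bd j)).
by apply: ccvg_eq c; apply: nearW.
Qed.

Lemma one_sided_laplace (k Y : R) : 0 < k -> al < Y ->
  let sup_exp w := cexp (- (beta * (sup [set X s w | s in `[0, t]])%:C)) in
  cintegrable P setT sup_exp /\
  forall eps : R, 0 < eps -> exists A0 : R, forall A : R, A0 <= A ->
    normc (inversion_integral (ladder_up k PL) t beta Y A - cintegral P setT sup_exp) <= eps.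
Proof.
move=> k0 alY sup_exp.
have [iZ cl] := cvg_l.
have [i e] : cintegrable P setT sup_exp /\ cintegral P setT sup_exp = l.
  apply: ae_cintegral iZ.
  - apply: cmeasurable_cexp; apply: cmeasurableN; apply: cmeasurableM; first exact: cmeasurable_cst.
    apply: cmeasurable_real.
    have -> : (fun w => sup [set X s w | s in `[0, t]]) = (fun w => Z w + X 0 w).
      by apply/funext => w; rewrite /Z subrK.
    exact: (measurable_funD mZ (mX 0)).
  - exact: (cmeasurable_comp (growth_damped_exp bth).1 mZ).
  - by apply: filterS X0 => w X0w; rewrite /sup_exp /damped_exp pos_part_id// /Z X0w subr0.
split=> // eps eps0; rewrite e.
have [A0 HA] := one_sided_inversion M0 al0 charf_PL moment_PL th0 thM t0 alY bth cl eps0.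
exists A0 => A /HA; rewrite /inversion_integral.
suff -> : cintegral (@lebesgue_measure R) `[- A, A] (fun v : R => let z := Y +i* v in
    cexp (t%:C * z) / z * (ladder_up k PL z 0 / ladder_up k PL z beta)) =
    cintegral (@lebesgue_measure R) `[- A, A] (resolvent_kernel t Y (damped_transform PL beta)) by [].
apply: eq_cintegral => v _; cbv zeta.
rewrite (ladder_up_ratio M0 al0 charf_PL moment_PL th0 thM v k0 alY bth) /resolvent_kernel.
by rewrite mulrAC.
Qed.

End integrals.

End one_sided_process.

Lemma cvg_complex_eps {R : realType} (f : R -> R[i]) (l : R[i]) :
  (forall eps : R, 0 < eps -> exists A0 : R, forall A : R, A0 <= A -> normc (f A - l) <= eps) ->
  (f A : R[i]^o) @[A --> +oo] --> (l : R[i]^o).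
Proof.
(* A positive element of [R[i]] has imaginary part 0, so its real part serves as tolerance. *)
move=> H; apply/cvgrPdist_le => e; rewrite ltcE => /andP[/eqP e1 e2].
have [A0 HA] := H _ e2; exists A0; split; first exact: num_real.
move=> A /ltW /HA h; rewrite distrC normrcE; rewrite lecE /=.
by rewrite e1 eqxx.
Qed.

(** * Reflection and the increments on a grid *)

Section reflection.
Context {R : realType}.
Local Notation RR := (measurableTypeR R).
Local Notation mu := (@lebesgue_measure R).

Definition negation (x : RR) : RR := - x.
Lemma measurable_negation : measurable_fun setT negation.
Proof. exact: measurable_funN. Qed.
HB.instance Definition _ := isMeasurableFun.Build _ _ _ _ negation measurable_negation.

Definition reflected (m : probability RR R) : probability RR R :=
  distribution m (negation : {mfun RR >-> RR}).

(** Positive and negative parts are transported separately, so that no integrability is involved. *)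
Lemma cintegral_reflected (m : probability RR R) (f : RR -> R[i]) : cmeasurable setT f ->
  cintegral (reflected m) setT f = cintegral m setT (fun x : RR => f (- x)).
Proof.
move=> [f1 f2].
have key (g : RR -> R) : measurable_fun setT g ->
    \int[reflected m]_x g x = \int[m]_x g (- x).
  move=> mg; have mg' : measurable_fun setT (EFin \o g) by exact/measurable_EFinP.
  have p1 := @ge0_integral_distribution _ _ _ _ _ m (negation : {mfun RR >-> RR}) _ (measurable_funepos mg') (funepos_ge0 (EFin \o g)).
  have p2 := @ge0_integral_distribution _ _ _ _ _ m (negation : {mfun RR >-> RR}) _ (measurable_funeneg mg') (funeneg_ge0 (EFin \o g)).
  rewrite /Rintegral [in LHS]integralE [in RHS]integralE p1 p2.
  have e1 : (\int[m]_x ((EFin \o g)^\+ \o negation) x = \int[m]_x ((fun x0 : RR => (g (- x0))%:E)^\+ x))%E.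
    apply: eq_integral => x _; by rewrite /= !funeposE.
  have e2 : (\int[m]_x ((EFin \o g)^\- \o negation) x = \int[m]_x ((fun x0 : RR => (g (- x0))%:E)^\- x))%E.
    apply: eq_integral => x _; by rewrite /= !funenegE.
  by rewrite e1 e2.
by rewrite /cintegral (key (fun x => Re (f x)))// (key (fun x => Im (f x))).
Qed.

Lemma charf_reflected m u : charf (reflected m) u = charf m (- u).
Proof.
rewrite /charf cintegral_reflected; last first.
  by apply: cmeasurable_expi_comp; exact: measurable_funM.
by apply: eq_cintegral => x _; rewrite mulrN mulNr.
Qed.

(** Reflection exchanges the two half-lines and the sign in front of [beta x]: descending ladder
    exponents are ascending ones of the reflected laws. *)
Lemma ladder_down_reflected (k : R) (PL : R -> probability RR R) (z beta : R[i]) :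
  ladder_down k PL z beta = ladder_up k (fun s => reflected (PL s)) z beta.
Proof.
rewrite /ladder_down /ladder_up; congr (_ * cexp _); apply: eq_cintegral => s _.
pose F (x : R) : R[i] := (cexp (- s%:C) - cexp (- (z * s%:C) - beta * x%:C)) * (s^-1)%:C.
pose G (x : RR) : R[i] := (if 0 < x then 1 else 0)%:C * F x.
have mG : cmeasurable setT G.
  have mid : cmeasurable setT (fun x : RR => x%:C) by exact: cmeasurable_real.
  apply: cmeasurableM.
    by apply: cmeasurable_real; apply: measurable_fun_ifT => //; exact: measurable_fun_ltr.
  apply: cmeasurableM; last exact: cmeasurable_cst.
  apply: cmeasurableB; first exact: cmeasurable_cst.
  apply: cmeasurable_cexp; apply: cmeasurableB; first exact: cmeasurable_cst.
  by apply: cmeasurableM => //; exact: cmeasurable_cst.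
transitivity (cintegral (PL s) setT (fun x : RR => G (- x))).
  apply: cintegral_extend => x.
    rewrite /= in_itv/= => x0; rewrite /G /F oppr_gt0 x0 mul1r; congr ((_ - cexp (_ + _)) * _).
    have -> : (- x)%:C = - x%:C :> R[i] by apply: complexP; rewrite ?ReN ?ImN/= ?oppr0.
    by rewrite mulrN opprK.
  by move/negP; rewrite /= in_itv/= /G oppr_gt0 => /negbTE ->; rewrite mul0r.
rewrite -cintegral_reflected//; apply/esym; apply: cintegral_extend => x.
  by rewrite /= in_itv/= andbT /G => ->; rewrite mul1r.
by move/negP; rewrite /= in_itv/= andbT /G => /negbTE ->; rewrite mul0r.
Qed.

End reflection.

Lemma ae_measure_eq {R : realType} {d : measure_display} {T : measurableType d}
    (m : {measure set T -> \bar R}) (A B : set T) :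
  measurable A -> measurable B -> {ae m, forall x, A x <-> B x} -> m A = m B.
Proof.
move=> mA mB AB; rewrite -[A]setIT -[B]setIT -!(integral_indic m measurableT)//.
apply: ae_eq_integral => //; try by apply/measurable_EFinP; exact: measurable_indic.
apply: filterS AB => x ABx _; congr (_%:E).
rewrite !indicE; congr ((_ : bool)%:R); apply/idP/idP => /set_mem h; apply/mem_set; exact/ABx.
Qed.

Section levy_grid.
Context {R : realType} {d : measure_display} {Omega : measurableType d}.
Local Notation RR := (measurableTypeR R).
Variables (P : probability Omega R) (T : \bar R) (L : R -> {RV P >-> R}).
Variables (b c : R) (lam : {measure set RR -> \bar R}) (PL : R -> probability RR R).
Hypothesis levy : levy_process T L.
Hypothesis local : local_characteristics b c lam T L.
Hypothesis laws : levy_laws b c lam PL.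

Lemma charf_levy_law (s u : R) : 0 < s -> charf (PL s) u = cexp (s%:C * cumulant b c lam (0 +i* u)).
Proof. exact: laws. Qed.

Lemma charf_levy_lawD (s r u : R) : 0 < s -> 0 < r ->
  charf (PL (s + r)) u = charf (PL s) u * charf (PL r) u.
Proof.
move=> s0 r0; rewrite (charf_levy_law u (addr_gt0 s0 r0)) (charf_levy_law u s0) (charf_levy_law u r0).
move: (cumulant _ _ _ _) => z; rewrite -cexpD; congr cexp.
by apply: complexP; rewrite ?ReD ?ImD (ReM _ z, ImM _ z) (ReM _ z, ImM _ z) (ReM _ z, ImM _ z) /=; ring.
Qed.

Let mL s : measurable_fun setT (L s : Omega -> RR).
Proof. exact: (@measurable_funPT _ _ _ _ (L s)). Qed.

(** [PL h] is linked to [L] only through characteristic functions, so [charf_inj] is needed;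
    subtracting [L 0] changes nothing almost surely. *)
Let increment_law (h : R) (B : set RR) : 0 < h -> (h%:E <= T)%E -> measurable B ->
  P [set w | B (L h w - L 0 w)] = PL h B.
Proof.
move=> h0 hT mB.
have [_ L0 _ _] := levy; have [_ _ lc] := local.
pose f : Omega -> RR := L h.
have mLh : measurable_fun setT f := mL h.
pose Lh : {mfun Omega >-> RR} := mfun_Sub (mem_set mLh).
have mD : measurable [set w | B (L h w - L 0 w)].
  by rewrite -[X in measurable X]setTI; exact: (measurable_funB (mL h) (mL 0)).
have mLB : measurable [set w | B (L h w)].
  by rewrite -[X in measurable X]setTI; exact: mL.
transitivity (distribution P Lh B).
  apply: ae_measure_eq => //; apply: filterS L0 => w /= L0w.
  by rewrite L0w subr0.
apply: charf_inj => // u; rewrite charf_levy_law// -(lc h u (ltW h0) hT) /charf.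
have me : cmeasurable setT (fun x : RR => expi (u * x)).
  by apply: cmeasurable_expi_comp; exact: measurable_funM.
have me' : cmeasurable setT (fun w => expi (u * L h w)).
  by apply: cmeasurable_expi_comp; exact: measurable_funM.
rewrite cintegral_distribution//.
apply: (cintegrable_dom measurableT me' (integrable_prob_cst P 1)) => w _.
by rewrite normc_cexp /= expR0.
Qed.

Lemma levy_grid_law (t : R) (n : nat) (h : R) (B : nat -> set RR) : (t%:E <= T)%E ->
  0 < h -> n%:R * h <= t -> (forall i, measurable (B i)) ->
  P (\bigcap_(i in `I_n) [set w | B i (L (i.+1%:R * h) w - L (i%:R * h) w)]) =
  (\prod_(i < n) PL h (B i))%E.
Proof.
move=> tT h0 nh mB; have [_ _ ind stat] := levy.
have leT (s : R) : s <= n%:R * h -> (s%:E <= T)%E.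
  by move=> sn; apply: le_trans tT; rewrite lee_fin (le_trans sn).
have := ind n (fun i => i%:R * h) B; rewrite /= mul0r lexx => -> //; last 2 first.
- by move=> i _; rewrite ler_wpM2r ?(ltW h0)// ler_nat.
- exact: leT.
apply: eq_bigr => i _; rewrite -natr1 mulrDl mul1r.
have inh : i%:R * h + h <= n%:R * h.
  by rewrite -[X in _ + X]mul1r -mulrDl natr1 ler_wpM2r ?(ltW h0)// ler_nat.
rewrite stat ?mulr_ge0 ?(ltW h0) ?leT//; last exact: mB.
apply: increment_law => //; apply: leT; apply: le_trans inh.
by rewrite lerDr mulr_ge0 ?(ltW h0).
Qed.

End levy_grid.

Theorem theorem3p6 (R : realType) (d : measure_display)
    (Omega : measurableType d) (P : probability Omega R)
    (T : \bar R) (L : R -> {RV P >-> R})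
    (b c : R) (lam : {measure set (measurableTypeR R) -> \bar R}) (M : R)
    (PL : R -> probability (measurableTypeR R) R) (kup kdown : R) :
  (0 < T)%E ->
  levy_process T L ->
  local_characteristics b c lam T L ->
  1 < M -> exp_moments M lam ->
  ~ compound_poisson b c lam ->
  levy_laws b c lam PL ->
  0 < kup -> 0 < kdown ->
  forall (t : R) (beta : R[i]) (Y Yt : R),
    0 < t -> (t%:E <= T)%E ->
    - M < complex.Re beta ->
    alpha_star b c lam M < Y -> alpha_star b c lam M < Yt ->
    (cintegrable P setT (fun w => cexp (- (beta * (running_sup L t w)%:C))) /\
     (inversion_integral (ladder_up kup PL) t beta Y A : R[i]^o)
       @[A --> +oo] -->
       (cintegral P setT (fun w => cexp (- (beta * (running_sup L t w)%:C)))
        : R[i]^o)) /\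
    (cintegrable P setT (fun w => cexp (beta * (running_inf L t w)%:C)) /\
     (inversion_integral (ladder_down kdown PL) t beta Yt A : R[i]^o)
       @[A --> +oo] -->
       (cintegral P setT (fun w => cexp (beta * (running_inf L t w)%:C))
        : R[i]^o)).
Proof.
move=> T0 levy local M1 hM _ laws kup0 kdown0 t beta Y Yt t0 tT Mbeta aY aYt.
have [c0 hlam _] := local; have [cadlag L0 _ _] := levy.
have M0 : 0 < M by exact: lt_trans M1.
have al0 := alpha_star_ge0 b lam M1 c0.
set al := alpha_star b c lam M in aY aYt al0.
have charf_PL := charf_levy_lawD laws.
have moment_PL s : 0 < s -> (\int[PL s]_x (expR (M * x))%:E <= (expR (s * al))%:E)%E /\
    (\int[PL s]_x (expR (- M * x))%:E <= (expR (s * al))%:E)%E.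
  by move=> s0; apply: (exp_moment_le_alpha M1 c0 hlam hM s0) => u; exact: charf_levy_law.
(* [th] is the rate of growth of [exp(- beta x)] on the half-line, cut off at 0; it stays below [M]
   by the hypothesis on [beta]. *)
pose th := Num.max 0 (- complex.Re beta).
have th0 : 0 <= th by rewrite le_max lexx.
have bth : - complex.Re beta <= th by rewrite le_max lexx orbT.
have thM : th < M by rewrite gt_max M0 ltrNl.
have mL s : measurable_fun setT (L s : Omega -> measurableTypeR R) by exact: (@measurable_funPT _ _ _ _ (L s)).
have right w s : 0 <= s -> s < t -> (L r w : R) @[r --> s^'+] --> (L s w : R).
  by move=> s0 st; apply: (cadlag w).1 => //; apply: lt_le_trans tT; rewrite lte_fin.
have left w s : 0 < s -> s <= t -> cvg ((L r w : R) @[r --> s^'-]).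
  by move=> s0 st; apply: (cadlag w).2 => //; apply: le_trans tT; rewrite lee_fin.
have grid n h B := @levy_grid_law _ _ _ P T L b c lam PL levy local laws t n h B tT.
split.
  have [i H] := one_sided_laplace M0 al0 charf_PL moment_PL (X := fun s w => L s w) t0 mL right left L0 grid
    th0 thM bth kup0 aY.
  by split=> //; exact: cvg_complex_eps.
(* The second formula is the first one for [- L]. Reflection exchanges the moment bounds at [M] and
   [- M], so the same [alpha_star] serves. *)
pose PL' s := reflected (PL s).
have charf_PL' s r u : 0 < s -> 0 < r -> charf (PL' (s + r)) u = charf (PL' s) u * charf (PL' r) u.
  by move=> s0 r0; rewrite !charf_reflected charf_PL.
have moment_PL' s : 0 < s -> (\int[PL' s]_x (expR (M * x))%:E <= (expR (s * al))%:E)%E /\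
    (\int[PL' s]_x (expR (- M * x))%:E <= (expR (s * al))%:E)%E.
  move=> s0; have [h1 h2] := moment_PL s s0.
  have e a : (\int[PL' s]_x (expR (a * x))%:E = \int[PL s]_x (expR (- a * x))%:E)%E.
    rewrite ge0_integral_distribution.
    - by apply: eq_integral => x _; rewrite /= /negation mulrN mulNr.
    - by apply/measurable_EFinP; apply: measurableT_comp => //; exact: measurable_funM.
    - by move=> y; rewrite lee_fin expR_ge0.
  by rewrite !e opprK.
have mL' s : measurable_fun setT ((fun w => - L s w) : Omega -> measurableTypeR R).
  exact: (measurable_funN (mL s)).
have right' w s : 0 <= s -> s < t -> (- L r w : R) @[r --> s^'+] --> (- L s w : R).
  by move=> s0 st; apply: cvgN; exact: right.
have left' w s : 0 < s -> s <= t -> cvg ((- L r w : R) @[r --> s^'-]).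
  by move=> s0 st; apply: is_cvgN; exact: left.
have L0' : {ae P, forall w, - L 0 w = 0}.
  by apply: filterS L0 => w ->; rewrite oppr0.
have grid' (n : nat) (h : R) (B : nat -> set (measurableTypeR R)) : 0 < h -> n%:R * h <= t ->
    (forall i, measurable (B i)) ->
    P (\bigcap_(i in `I_n) [set w | B i (- L (i.+1%:R * h) w - - L (i%:R * h) w)]) =
    (\prod_(i < n) PL' h (B i))%E.
  move=> h0 nh mB; have := grid n h (fun i => negation @^-1` B i) h0 nh.
  have mB' i : measurable (negation @^-1` B i : set (measurableTypeR R)).
    by rewrite -[X in measurable X]setTI; exact: measurable_negation.
  move=> /(_ mB') <-; congr (P _); apply: eq_bigcapr => i _.
  by apply/seteqP; split=> w /=; rewrite /negation opprB addrC opprK.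
have [i H] := one_sided_laplace M0 al0 charf_PL' moment_PL' (X := fun s w => - L s w) t0 mL' right' left' L0' grid'
  th0 thM bth kdown0 aYt.
have e w : cexp (beta * (running_inf L t w)%:C) = cexp (- (beta * (sup [set - (L s w : R) | s in `[0, t]])%:C)).
  congr cexp; rewrite -mulrN; congr (_ * _).
  have -> : running_inf L t w = - sup [set - (L s w : R) | s in `[0, t]].
    rewrite /running_inf /inf; congr (- sup _); apply/seteqP; split => x /=.
      by move=> [_ [s sI <-] <-]; exists s.
    by move=> [s sI <-]; exists (L s w : R) => //; exists s.
  by apply: complexP; rewrite ?ReN ?ImN/= ?oppr0.
have -> : (fun w => cexp (beta * (running_inf L t w)%:C)) =
    (fun w => cexp (- (beta * (sup [set - (L s w : R) | s in `[0, t]])%:C))) by exact/funext.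
have -> : inversion_integral (ladder_down kdown PL) = inversion_integral (ladder_up kdown PL').
  have E : ladder_down kdown PL = ladder_up kdown PL'.
    by apply/funext => z; apply/funext => b'; exact: ladder_down_reflected.
  by rewrite E.
by split=> //; exact: cvg_complex_eps.
Qed.
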